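(* Let $M$ be a connected closed manifold of dimension $d\ge2$, let $s>0$, and let $A\in\Psi^s$ be an elliptic self-adjoint $m\times m$ pseudodifferential operator acting on $m$-columns of half-densities on $M$, such that the eigenvalues of its principal symbol $A_{\mathrm{prin}}(x,\xi)$ are simple and $m^+\ge 2$ of them are positive. Let $P_l$ be the pseudodifferential projections associated with $A$, and put $A_j:=A-2\sum_{l=1,\dots,m^+,\ l\ne j}P_l^*AP_l$, $j=1,\dots,m^+$. Let $0<\lambda_1\le\lambda_2\le\dots$ be the positive eigenvalues of $A$ enumerated in increasing order with account of multiplicity, and let $\sigma^+(A_j)=\sigma(A_j)\cap(0,+\infty)$. Then $$\operatorname{dist}\Bigl(\lambda_k,\ \bigcup_{j=1}^{m^+}\sigma^+(A_j)\Bigr)=O(k^{-\infty})\quad\text{as}\quad k\to+\infty .$$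
   Context: $C^\infty(M)$ is the space of $m$-columns of smooth complex-valued half-densities on $M$; $L^2(M)$ is its closure with respect to $\langle v,w\rangle=\int_M v^*w\,dx$; $H^s(M)$ are the corresponding Sobolev spaces. $\Psi^s$ is the space of classical pseudodifferential operators of order $s$ acting on such $m$-columns, from $H^s(M)$ to $L^2(M)$; $\Psi^{-\infty}=\bigcap_s\Psi^s$ is the space of infinitely smoothing operators; ''$B=C \mod\Psi^{-\infty}$'' means $B-C\in\Psi^{-\infty}$. $B_{\mathrm{prin}}$ is the principal symbol of $B$. The symbol $*$ is Hermitian conjugation for matrices and adjunction for operators. Elliptic means $\det A_{\mathrm{prin}}(x,\xi)\ne0$ on $T^*M\setminus\{0\}$. $m^+$ (resp. $m^-$) is the number of positive (resp. negative) eigenvalues of $A_{\mathrm{prin}}(x,\xi)$. The eigenvalues are $h^{(j)}(x,\xi)$, with eigenprojections $P^{(j)}(x,\xi)$, enumerated in increasing order, with index $j=1,\dots,m^+$ for the positive and $j=-1,\dots,-m^-$ for the negative ones. Pseudodifferential projections associated with $A$: operators $P_j\in\Psi^0$, $j\in\{-m^-,\dots,-1,1,\dots,m^+\}$, such that $(P_j)_{\mathrm{prin}}=P^{(j)}$ and, modulo $\Psi^{-\infty}$: $P_j=P_j^*$, $P_jP_l=\delta_{jl}P_j$, $\sum_jP_j=\mathrm{Id}$, $[A,P_j]=0$. It is known that these exist and are unique modulo $\Psi^{-\infty}$; a choice is fixed. The operators $A_j$ are elliptic self-adjoint operators in $\Psi^s$ with discrete spectrum; $(A_j)_{\mathrm{prin}}$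 has exactly one positive eigenvalue, $h^{(j)}$. $O(k^{-\infty})$ means $O(k^{-N})$ for every $N$. *)

(* Defs.v *)
From mathcomp Require Import all_boot all_order all_algebra.
From mathcomp Require Import all_classical all_reals all_analysis.
From mathcomp Require Import complex.

Set Implicit Arguments.
Unset Strict Implicit.
Unset Printing Implicit Defensive.

Import Order.TTheory GRing.Theory Num.Theory.
Import numFieldNormedType.Exports.

Local Open Scope classical_set_scope.
Local Open Scope ring_scope.
Local Open Scope sesquilinear_scope.
Local Open Scope complex_scope.

Section Euclidean.
Variable R : realType.
Local Notation C := R[i].

Definition dot n (x y : 'rV[R]_n) : R := \sum_i x 0 i * y 0 i.

Definition enorm n (x : 'rV[R]_n) : R := Num.sqrt (dot x x).

Definition expi (t : R) : C := cos t +i* sin t.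

(* Iterated one-dimensional Lebesgue integrals.  All integrands below are
   continuous and either compactly supported or rapidly decreasing, so by
   Fubini this is the Lebesgue integral on R^n. *)
Fixpoint intRn (n : nat) : ('rV[R]_n -> R) -> R :=
  match n with
  | 0%N => fun f => f 0
  | n'.+1 => fun f =>
      \int[lebesgue_measure]_t
        intRn (fun y : 'rV[R]_n' => f (row_mx (t%:M : 'rV[R]_1) y))
  end.

Definition intC n (f : 'rV[R]_n -> C) : C :=
  intRn (fun x => complex.Re (f x)) +i* intRn (fun x => complex.Im (f x)).

Definition intcV n m (F : 'rV[R]_n -> 'cV[C]_m) : 'cV[C]_m :=
  \col_i intC (fun x => F x i 0).

Definition pderiv n (l : seq 'I_n) (f : 'rV[R]_n -> R) : 'rV[R]_n -> R :=
  foldr (fun i g x => 'D_('e_i) g x) f l.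

(* f is C^oo on the open set U: every iterated partial derivative exists and
   is continuous at the points of U. *)
Definition smooth_on n (U : set 'rV[R]_n) (f : 'rV[R]_n -> R) : Prop :=
  forall (l : seq 'I_n) (x : 'rV[R]_n), U x ->
    {for x, continuous (pderiv l f)} /\
    forall i, derivable (pderiv l f) x 'e_i.

Definition smooth_mx n p q (U : set 'rV[R]_n) (F : 'rV[R]_n -> 'M[C]_(p, q))
  : Prop :=
  forall i j, smooth_on U (fun x => complex.Re (F x i j)) /\
              smooth_on U (fun x => complex.Im (F x i j)).

Definition fourier d m (u : 'rV[R]_d -> 'cV[C]_m) (xi : 'rV[R]_d) : 'cV[C]_m :=
  intcV (fun y => expi (- dot y xi) *: u y).

(* A function of (x, xi) in R^d x R^d is encoded as a function on 'rV_(d + d),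
   evaluated at row_mx x xi. *)
Definition Op d m (a : 'rV[R]_(d + d) -> 'M[C]_m) (u : 'rV[R]_d -> 'cV[C]_m)
    (x : 'rV[R]_d) : 'cV[C]_m :=
  (((2 * pi)^-1 ^+ d)%:C) *:
    intcV (fun xi => expi (dot x xi) *: (a (row_mx x xi) *m fourier u xi)).

(* Number of derivatives with respect to xi in an iterated derivative. *)
Definition xi_order d (l : seq 'I_(d + d)) : nat :=
  count (fun i : 'I_(d + d) => (d <= i)%N) l.

(* a is a classical symbol of order s on U x R^d, with asymptotic expansion
   a ~ \sum_k ak k, where ak k is positively homogeneous of degree s - k.
   The case N = 0 of the last clause says that a belongs to S^s(U x R^d). *)
Definition classical_symbol d m (U : set 'rV[R]_d) (s : R)
    (a : 'rV[R]_(d + d) -> 'M[C]_m) (ak : nat -> 'rV[R]_(d + d) -> 'M[C]_m)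
  : Prop :=
  [/\ smooth_mx [set z | U (lsubmx z)] a,
      forall k, smooth_mx [set z | U (lsubmx z) /\ rsubmx z <> 0] (ak k),
      forall k x xi (t : R), U x -> xi <> 0 -> 0 < t ->
        ak k (row_mx x (t *: xi)) = (t `^ (s - k%:R))%:C *: ak k (row_mx x xi)
    & forall (N : nat) (K : set 'rV[R]_d) (l : seq 'I_(d + d)),
        compact K -> K `<=` U ->
        exists c : R, forall x xi, K x -> 1 <= enorm xi -> forall i j,
          let rem z := (a z - \sum_(k < N) ak k z) i j in
          let bound := c * enorm xi `^ (s - N%:R - (xi_order l)%:R) in
          `|pderiv l (fun z => complex.Re (rem z)) (row_mx x xi)| <= bound /\
          `|pderiv l (fun z => complex.Im (rem z)) (row_mx x xi)| <= bound].

(* Q is the orthogonal projection onto the eigenspace ker (X - x). *)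
Definition eigenprojection m (X : 'M[C]_m) (x : R) (Q : 'M[C]_m) : Prop :=
  [/\ Q ^t* = Q, Q *m Q = Q &
      forall u : 'cV[C]_m, Q *m u = u <-> X *m u = x%:C *: u].

End Euclidean.

Section Manifold.
Variables (R : realType) (d : nat) (M : topologicalType).

Record chart := Chart {
  cdom : set M;
  cmap : M -> 'rV[R]_d;
  cinv : 'rV[R]_d -> M }.

Definition cimg (c : chart) : set 'rV[R]_d := cmap c @` cdom c.

(* c restricts to a homeomorphism between the open sets cdom c and cimg c;
   the values of cmap c and cinv c elsewhere are irrelevant. *)
Definition is_chart (c : chart) : Prop :=
  [/\ open (cdom c), open (cimg c),
      {within cdom c, continuous (cmap c)},
      {within cimg c, continuous (cinv c)} &
      forall x, cdom c x -> cinv c (cmap c x) = x].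

Definition overlap (c c' : chart) : set 'rV[R]_d :=
  cmap c @` (cdom c `&` cdom c').

Definition transition (c c' : chart) : 'rV[R]_d -> 'rV[R]_d :=
  cmap c' \o cinv c.

Definition compatible (c c' : chart) : Prop :=
  forall i, smooth_on (overlap c c') (fun y => transition c c' y 0 i).

(* A maximal smooth atlas. *)
Record smooth_structure := SmoothStructure {
  atlas : set chart;
  atlas_chart : forall c, atlas c -> is_chart c;
  atlas_cover : forall x, exists2 c, atlas c & cdom c x;
  atlas_compatible : forall c c', atlas c -> atlas c' -> compatible c c';
  atlas_maximal : forall c, is_chart c ->
    (forall c', atlas c' -> compatible c c' /\ compatible c' c) -> atlas c }.

(* For locally Euclidean spaces, compactness implies second countability. *)
Definition closed_connected : Prop :=
  [/\ [set: M] !=set0, hausdorff_space M, compact [set: M]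
    & connected [set: M]].

End Manifold.

Section HalfDensities.
Variables (R : realType) (d : nat) (M : topologicalType).
Variable X : smooth_structure R d M.
Local Notation C := R[i].
Local Notation chart := (chart R d M).
Local Notation atlas := (atlas X).

(* A column of half-densities is given by its coordinate expressions: v c y is
   its value in the chart c at the point with coordinates y. *)
Definition hdens (m : nat) := chart -> 'rV[R]_d -> 'cV[C]_m.

(* The last clause normalises the irrelevant values to 0. *)
Definition Cinf m (v : hdens m) : Prop :=
  [/\ forall c, atlas c -> smooth_mx (cimg c) (v c),
      forall c c', atlas c -> atlas c' -> forall y, overlap c c' y ->
        v c y = (Num.sqrt `|\det ('J (transition c c') y)|)%:C *:
                v c' (transition c c' y)
    & forall c y, ~ (atlas c /\ cimg c y) -> v c y = 0].

Definition supp m (v : hdens m) : set M :=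
  closure [set x | exists2 c, cdom c x & v c (cmap c x) <> 0].

Definition cutoff (c : chart) (chi : M -> R) : Prop :=
  (forall c', atlas c' -> smooth_on (cimg c') (chi \o cinv c')) /\
  closure [set x | chi x <> 0] `<=` cdom c.

Definition partition_of_unity n (kappa : 'I_n -> chart) (chi : 'I_n -> M -> R)
  : Prop :=
  (forall i, atlas (kappa i) /\ cutoff (kappa i) (chi i)) /\
  forall x, \sum_i chi i x = 1.

(* Integral over M of the density with coordinate expressions rho c; the value
   does not depend on the partition of unity. *)
Definition integralM (rho : chart -> 'rV[R]_d -> C) : C :=
  xget 0 [set z | exists n (kappa : 'I_n -> chart) (chi : 'I_n -> M -> R),
    partition_of_unity kappa chi /\
    z = \sum_i intC (fun y =>
          (chi i (cinv (kappa i) y))%:C * rho (kappa i) y)].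

Definition inner m (v w : hdens m) : C :=
  integralM (fun c y => ((v c y) ^t* *m w c y) 0 0).

Definition L2norm m (v : hdens m) : R := Num.sqrt (complex.Re (inner v v)).

(* The Sobolev norm of order s of the localisation chi v in the chart c.  The
   topology of H^s(M) is defined by all these seminorms. *)
Definition Hsnorm m (s : R) (c : chart) (chi : M -> R) (v : hdens m) : R :=
  Num.sqrt (intRn (fun xi => (1 + dot xi xi) `^ s *
    \sum_i complex.Re
      `|fourier (fun y => (chi (cinv c y))%:C *: v c y) xi i 0| ^+ 2)).

(* L^2(M) and H^s(M) are the completions of C^oo(M): their elements are
   represented by Cauchy sequences of smooth columns of half-densities, modulo
   null sequences. *)
Definition L2 m (v : nat -> hdens m) : Prop :=
  (forall n, Cinf (v n)) /\
  forall e : R, 0 < e -> exists N, forall n k, (N <= n)%N -> (N <= k)%N ->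
    L2norm (v n - v k) < e.

Definition L2null m (v : nat -> hdens m) : Prop :=
  L2norm (v n) @[n --> \oo] --> (0 : R).

Definition Hs m (s : R) (v : nat -> hdens m) : Prop :=
  (forall n, Cinf (v n)) /\
  forall c chi, atlas c -> cutoff c chi ->
  forall e : R, 0 < e -> exists N, forall n k, (N <= n)%N -> (N <= k)%N ->
    Hsnorm s c chi (v n - v k) < e.

Definition Hsnull m (s : R) (v : nat -> hdens m) : Prop :=
  forall c chi, atlas c -> cutoff c chi ->
    Hsnorm s c chi (v n) @[n --> \oo] --> (0 : R).

(* Operators on C^oo(M); their values outside C^oo(M) are irrelevant. *)
Definition op (m : nat) := hdens m -> hdens m.

Definition symb (m : nat) := chart -> 'rV[R]_d -> 'rV[R]_d -> 'M[C]_m.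

(* B belongs to Psi^s and B_prin(x, xi) is the matrix p c y eta, where y and
   eta are the coordinates of x and xi in the chart c.  In each chart, B is the
   sum of the quantisation of a classical symbol and of an integral operator
   with smooth kernel K.  Since the atlas is maximal it contains charts with
   disconnected domains, in particular charts around any given pair of points,
   so that this also covers the behaviour of B off the diagonal. *)
Definition psido_prin m (s : R) (B : op m) (p : symb m) : Prop :=
  [/\ forall v, Cinf v -> Cinf (B v),
      forall (z : C) v w, Cinf v -> Cinf w -> B (z *: v + w) = z *: B v + B w
    & forall c, atlas c ->
      exists (a : 'rV[R]_(d + d) -> 'M[C]_m)
             (ak : nat -> 'rV[R]_(d + d) -> 'M[C]_m)
             (K : 'rV[R]_(d + d) -> 'M[C]_m),
      [/\ classical_symbol (cimg c) s a ak,
          forall y eta, cimg c y -> eta <> 0 ->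
            ak 0%N (row_mx y eta) = p c y eta,
          smooth_mx [set z | cimg c (lsubmx z) /\ cimg c (rsubmx z)] K
        & forall v, Cinf v -> supp v `<=` cdom c -> forall y, cimg c y ->
            B v c y = Op a (v c) y +
                      intcV (fun z => K (row_mx y z) *m v c z)]].

Definition Psi m (s : R) (B : op m) : Prop := exists p, psido_prin s B p.

(* B = B' mod Psi^{-oo}, where Psi^{-oo} is the intersection of all Psi^s. *)
Definition eqmod m (B B' : op m) : Prop :=
  forall s : R, Psi s (fun v => B v - B' v).

Definition is_adjoint m (B B' : op m) : Prop :=
  (forall v, Cinf v -> Cinf (B' v)) /\
  forall v w, Cinf v -> Cinf w -> inner (B v) w = inner v (B' w).

(* The adjoint B^*, which is unique as an operator on C^oo(M). *)
Definition adj m (B : op m) : op m := xget (id : op m) [set B' | is_adjoint B B'].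

Definition self_adjoint m (A : op m) : Prop := is_adjoint A A.

Definition elliptic m (p : symb m) : Prop :=
  forall c y eta, atlas c -> cimg c y -> eta <> 0 -> \det (p c y eta) != 0.

(* At each point of T^*M \ {0}, the values of h are the eigenvalues of p with
   multiplicities; they are simple and enumerated in increasing order, the
   first mneg of them being negative and the last mpos positive.  The indices
   j = -mneg, ..., -1 correspond to lshift mpos i with i = j + mneg, and
   j = 1, ..., mpos to rshift mneg i with i = j - 1. *)
Definition simple_eigenvalues (mneg mpos : nat) (p : symb (mneg + mpos))
    (h : 'I_(mneg + mpos) -> chart -> 'rV[R]_d -> 'rV[R]_d -> R) : Prop :=
  forall c y eta, atlas c -> cimg c y -> eta <> 0 ->
  [/\ char_poly (p c y eta) = \prod_l ('X - ((h l c y eta)%:C)%:P),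
      forall l l' : 'I_(mneg + mpos), (l < l')%N -> h l c y eta < h l' c y eta,
      forall i : 'I_mneg, h (lshift mpos i) c y eta < 0
    & forall i : 'I_mpos, 0 < h (rshift mneg i) c y eta].

(* The family P consists of the pseudodifferential projections associated with
   A, where p = A_prin has the eigenvalues h. *)
Definition psido_projections m (A : op m) (p : symb m)
    (h : 'I_m -> chart -> 'rV[R]_d -> 'rV[R]_d -> R) (P : 'I_m -> op m)
  : Prop :=
  [/\ forall j, exists2 Q : symb m, psido_prin 0 (P j) Q &
        forall c y eta, atlas c -> cimg c y -> eta <> 0 ->
          eigenprojection (p c y eta) (h j c y eta) (Q c y eta),
      forall j, eqmod (P j) (adj (P j)),
      forall j l, eqmod (P j \o P l) (if j == l then P j else fun=> 0),
      eqmod (fun v => \sum_j P j v) id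
    & forall j, eqmod (A \o P j) (P j \o A)].

Definition Aj (mneg mpos : nat) (A : op (mneg + mpos))
    (P : 'I_(mneg + mpos) -> op (mneg + mpos)) (j : 'I_mpos)
  : op (mneg + mpos) :=
  fun v => A v - 2 *: \sum_(l < mpos | l != j)
    adj (P (rshift mneg l)) (A (P (rshift mneg l) v)).

(* For A in Psi^s, the operator A - z : H^s(M) -> L^2(M), extended by
   continuity from C^oo(M), is bijective (hence boundedly invertible). *)
Definition resolvent m (s : R) (A : op m) (z : C) : Prop :=
  (forall f : nat -> hdens m, L2 f ->
     exists2 u, Hs s u & L2null (fun n => A (u n) - z *: u n - f n)) /\
  (forall u : nat -> hdens m, Hs s u ->
     L2null (fun n => A (u n) - z *: u n) -> Hsnull s u).

Definition spectrum m (s : R) (A : op m) : set C :=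
  [set z | ~ resolvent s A z].

Definition spectrum_pos m (s : R) (A : op m) : set R :=
  [set x | 0 < x /\ spectrum s A x%:C].

(* The kernel of A - x : H^s(M) -> L^2(M) has dimension at least N. *)
Definition multiplicity_ge m (s : R) (A : op m) (x : R) (N : nat) : Prop :=
  exists u : 'I_N -> nat -> hdens m,
    (forall i, Hs s (u i) /\ L2null (fun n => A (u i n) - x%:C *: u i n)) /\
    (forall z : 'I_N -> C,
       Hsnull s (fun n => \sum_i z i *: u i n) -> forall i, z i = 0).

(* lam enumerates the positive eigenvalues of A in increasing order, with
   account of multiplicity. *)
Definition positive_eigenvalues m (s : R) (A : op m) (lam : nat -> R) : Prop :=
  [/\ forall k, 0 < lam k,
      {homo lam : k l / (k <= l)%N >-> k <= l}
    & forall (x : R) (N : nat), 0 < x ->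
        multiplicity_ge s A x N <->
        exists2 f : 'I_N -> nat, injective f & forall i, lam (f i) = x].

End HalfDensities.

(* Main.v *)
(* Modulo smoothing operators A_j P_l = P_l A whenever l = j or l < 0, and v is the sum of the
   P_l v.  A smoothing operator applied to an approximate eigenvector w of A with eigenvalue
   lambda is O(lambda^-oo), since it remains bounded after composition with every power of A.
   Hence some P_l w is not small and is an O(lambda^-oo)-approximate eigenvector of some A_j,
   so that the symmetric operator A_j has spectrum within O(lambda^-oo) of lambda.

   Powers of lambda_k are converted into powers of k by a crude Weyl bound k <= C lambda_k^q.
   If some A_j has a positive point x in its resolvent set, a gliding hump argument bounds the
   H^s norm of v by that of (A_j - x) v, hence by those of A v and v, and the eigenvectors
   are counted in Fourier space.  If there is no such x, then sigma^+(A_j) is the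
   whole half-line and the distance is zero. *)
From HB Require Import structures.
Require Import Defs.
From mathcomp Require Import all_boot all_order all_algebra.
From mathcomp Require Import all_classical all_reals all_analysis.
From mathcomp Require Import complex.
From mathcomp Require Import measurable_realfun ring lra.

Set Implicit Arguments.
Unset Strict Implicit.
Unset Printing Implicit Defensive.

Import Order.TTheory GRing.Theory Num.Theory.
Import numFieldNormedType.Exports.

Local Open Scope classical_set_scope.
Local Open Scope ring_scope.

(** No composition, adjoint or mapping theorem for pseudodifferential operators is used, although
    operators such as S A^i with S smoothing have to be bounded. The substitute is symmetry: a
    symmetric operator B on C^oo(M) is continuous from test functions with a C^k norm to L^2, by a
    uniform boundedness argument of Hellinger-Toeplitz type. By duality the Fourier transform of a
    localisation of B v grows at most polynomially, with a factor linear in the L^2 norm of v, and a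
    symbol of sufficiently negative order absorbs this growth; hence S B is bounded on L^2. Since
    elements of L^2(M) are Cauchy sequences, operators stay on C^oo(M), with the real part of the
    inner product; an elementary gap estimate replaces the spectral theorem. The operation [adj] has
    the default value [id] where no adjoint exists, so that a projection may lack its adjoint; this
    happens for at most one of them, which is then the identity modulo smoothing. The L^2
    boundedness of the projections comes from their being self-adjoint idempotents modulo smoothing
    operators. *)

Section Topology.
Variable R : realType.

(** * Convergence and continuity of row vectors and matrices *)

Lemma cvg_mx (T : Type) (F : set_system T) {FF : Filter F} m n
    (f : T -> 'M[R]_(m, n)) (l : 'M[R]_(m, n)) :
  (forall i j, f x i j @[x --> F] --> l i j) -> f @ F --> l.
Proof.
move=> fl; apply/cvg_ballP => e e0.
have H : \forall x \near F, forall ij : 'I_m * 'I_n,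
    ball (l ij.1 ij.2) e (f x ij.1 ij.2).
  apply: filter_forall => ij.
  by have /cvg_ballP := fl ij.1 ij.2; apply.
near=> x.
suff: forall ij : 'I_m * 'I_n, ball (l ij.1 ij.2) e (f x ij.1 ij.2).
  by move=> h; split=> // i j; apply: (h (i, j)).
by near: x.
Unshelve. all: end_near. Qed.

Lemma cvg_coord (T : Type) (F : set_system T) {FF : Filter F} m n
    (f : T -> 'M[R]_(m, n)) (l : 'M[R]_(m, n)) i j :
  f @ F --> l -> f x i j @[x --> F] --> l i j.
Proof.
move=> fl; apply: (@cvg_comp _ _ _ f (fun M : 'M[R]_(m, n) => M i j) _ _ _ fl).
exact: coord_continuous.
Qed.

(** Dominated convergence speaks of sequences; this transfers its conclusion to continuity of
    integrals in a parameter. *)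
Lemma continuous_seq (T : pseudoMetricType R) (U : topologicalType) (f : T -> U)
    (p : T) :
  (forall u : nat -> T, u n @[n --> \oo] --> p -> f (u n) @[n --> \oo] --> f p) ->
  {for p, continuous f}.
Proof.
move=> h; apply: contrapT => nf.
have [A nA hA] : exists2 A, nbhs (f p) A & ~ nbhs p (f @^-1` A).
  apply: contrapT => /forall2NP H; apply: nf => A nA.
  by have [//|/contrapT] := H A.
have {}hA : forall n : nat, exists x, ball p (n.+1%:R^-1) x /\ ~ A (f x).
  move=> n; apply: contrapT => /forallNP H; apply: hA.
  apply/nbhs_ballP; exists n.+1%:R^-1 => /=; first by rewrite invr_gt0.
  by move=> x bx; have /not_andP[//|/contrapT] := H x.
have [u hu] := choice hA.
have up : u n @[n --> \oo] --> p.
  apply/cvg_ballP => e e0; near=> n.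
  have [+ _] := hu n; apply: le_ball.
  near: n; exists (Num.truncn e^-1) => // k /= ke.
  rewrite -[leRHS]invrK lef_pV2 ?posrE ?invr_gt0//.
  by apply/ltW; rewrite -truncn_le_nat.
have := h u up _ nA; move=> -[N _ HN].
by have [_] := hu N; apply; apply: HN => /=.
Unshelve. all: end_near. Qed.

Lemma cvg_pair_nbhs (T : Type) (U V : topologicalType) (F : set_system T)
    {FF : Filter F} (f : T -> U) (g : T -> V) (l : U) (k : V) :
  f @ F --> l -> g @ F --> k -> (f x, g x) @[x --> F] --> (l, k).
Proof. by move=> fl gk; exact: (cvg_pair fl gk). Qed.

Lemma continuousC (T U V : topologicalType) (f : T -> U) (g : U -> V) :
  continuous f -> continuous g -> continuous (fun x => g (f x)).
Proof. by move=> cf cg x; apply: (@continuous_comp _ _ _ f g); [exact: cf|exact: cg]. Qed.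

Lemma cvg_row_mx n1 n2 (T : Type) (F : set_system T) {FF : Filter F}
    (f : T -> 'rV[R]_n1) (g : T -> 'rV[R]_n2) (l : 'rV[R]_n1) (k : 'rV[R]_n2) :
  f @ F --> l -> g @ F --> k -> row_mx (f x) (g x) @[x --> F] --> row_mx l k.
Proof.
move=> fl gk; apply: cvg_mx => i j; rewrite mxE.
rewrite (_ : (fun x => _) = (fun x => match fintype.split j with
   | inl j1 => f x i j1 | inr j2 => g x i j2 end)); last first.
  by apply/funext => x; rewrite mxE.
by case: (fintype.split j) => j'; apply: cvg_coord.
Qed.

Lemma cvg_scalar_mx1 (T : Type) (F : set_system T) {FF : Filter F}
    (f : T -> R) (l : R) :
  f @ F --> l -> ((f x)%:M : 'rV[R]_1) @[x --> F] --> (l%:M : 'rV[R]_1).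
Proof.
move=> fl; apply: cvg_mx => i j; rewrite mxE.
rewrite (_ : (fun x => _) = (fun x => f x *+ (i == j))).
  rewrite !ord1 eqxx /=.
  by [].
by apply/funext => x; rewrite mxE.
Qed.

(** Written exactly as the argument in the recursive clause of [intRn], so that [intRnS] holds by
    conversion. *)
Definition cons_row n (t : R) (y : 'rV[R]_n) : 'rV[R]_n.+1 :=
  row_mx (t%:M : 'rV[R]_1) y.

Lemma cons_row0 n t (y : 'rV[R]_n) : cons_row t y 0 0 = t.
Proof. by rewrite /cons_row mxE split1 unlift_none /= mxE eqxx. Qed.

Lemma cons_rowS n t (y : 'rV[R]_n) j : cons_row t y 0 (lift ord0 j) = y 0 j.
Proof. by rewrite /cons_row mxE split1 liftK. Qed.

Lemma cons_rowE n (x : 'rV[R]_n.+1) : cons_row (x 0 0) (\row_j x 0 (lift ord0 j)) = x.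
Proof.
apply/rowP => j; have [->|[k ->]] : j = ord0 \/ exists k, j = lift ord0 k.
- by case: (unliftP ord0 j) => [k|] ->; [right; exists k|left].
- by rewrite cons_row0.
- by rewrite cons_rowS mxE.
Qed.

Lemma cvg_cons_row n (T : Type) (F : set_system T) {FF : Filter F}
    (f : T -> R) (g : T -> 'rV[R]_n) (l : R) (k : 'rV[R]_n) :
  f @ F --> l -> g @ F --> k -> cons_row (f x) (g x) @[x --> F] --> cons_row l k.
Proof. move=> fl gk; exact: (cvg_row_mx (cvg_scalar_mx1 fl) gk). Qed.

End Topology.

(** * Integrals on the line of functions dominated by the Cauchy weight *)

Section Weight.
Variable R : realType.
Local Notation mu := (@lebesgue_measure R).

(** The Cauchy weight, of integral pi. Products of it over the coordinates dominate the integrands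
    on R^n, so that one explicit majorant serves both dominated convergence and Fubini. *)
Definition wt1 (t : R) : R := (1 + t ^+ 2)^-1.

Lemma wt1_gt0 t : 0 < wt1 t.
Proof. by rewrite invr_gt0 ltr_wpDr ?sqr_ge0. Qed.

Lemma wt1_ge0 t : 0 <= wt1 t. Proof. exact: ltW (wt1_gt0 t). Qed.

Lemma wt1_le1 t : wt1 t <= 1.
Proof. by rewrite invf_le1 ?ltr_wpDr ?sqr_ge0// lerDl sqr_ge0. Qed.

Lemma continuous_wt1 : continuous wt1.
Proof. exact: continuous_oneDsqrV. Qed.

Lemma wt1N t : wt1 (- t) = wt1 t. Proof. by rewrite /wt1 sqrrN. Qed.

Lemma integralT_wt1 : (\int[mu]_x (wt1 x)%:E = (pi : R)%:E)%E.
Proof.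
rewrite ge0_symfun_integralT; [|exact: wt1_ge0|exact: continuous_wt1|]; last first.
  by move=> x /=; rewrite wt1N.
rewrite -set_itvcy integral0y_oneDsqr -EFinM mulrC divfK// pnatr_eq0.
Qed.

Lemma integrable_wt1 : mu.-integrable setT (EFin \o wt1).
Proof.
apply/integrableP; split.
  by apply/measurable_EFinP; apply: continuous_measurable_fun; exact: continuous_wt1.
under eq_integral do rewrite /= ger0_norm ?wt1_ge0//.
by rewrite integralT_wt1 ltry.
Qed.

Lemma Rintegral_wt1 : \int[mu]_x wt1 x = pi.
Proof. by rewrite /Rintegral integralT_wt1. Qed.

Lemma integrable_dec1 (f : R -> R) C : continuous f ->
  (forall x, `|f x| <= C * wt1 x) -> mu.-integrable setT (EFin \o f).
Proof.
move=> cf fC.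
apply: (@le_integrable _ _ _ mu _ measurableT _ (fun x => C%:E * (wt1 x)%:E)%E).
- by apply/measurable_EFinP; exact: continuous_measurable_fun.
- move=> x _ /=; rewrite lee_fin (le_trans (fC x))//.
  by rewrite ler_norm.
- exact: (integrableZl measurableT C integrable_wt1).
Qed.

Lemma Rintegral_dec1_le (f : R -> R) C : continuous f ->
  (forall x, `|f x| <= C * wt1 x) -> `|\int[mu]_x f x| <= C * pi.
Proof.
move=> cf fC; have iF := integrable_dec1 cf fC.
apply: le_trans (le_normr_Rintegral measurableT iF) _.
rewrite -Rintegral_wt1 -RintegralZl//; last exact: integrable_wt1.
apply: le_Rintegral => //.
- by apply: (@integrable_dec1 _ C) => [x|x]; [exact: cvg_norm (cf x)|rewrite normr_id].
- have := integrableZl measurableT C integrable_wt1.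
  by [].
Qed.

Lemma cvg_Rintegral_dec1 (fk : nat -> R -> R) (f : R -> R) C :
  (forall k, continuous (fk k)) -> continuous f ->
  (forall k x, `|fk k x| <= C * wt1 x) ->
  (forall x, fk k x @[k --> \oo] --> f x) ->
  \int[mu]_x fk k x @[k --> \oo] --> \int[mu]_x f x.
Proof.
move=> cfk cf fC fkf.
have fC' x : `|f x| <= C * wt1 x.
  have cN : (fun k => `|fk k x|) @ \oo --> `|f x| by apply: cvg_norm (fkf x).
  rewrite -(cvg_lim _ cN)//; apply: limr_le; first by apply/cvg_ex; eexists; exact: cN.
  by apply: nearW => k.
rewrite /Rintegral; apply: fine_cvg.
rewrite fineK; last by apply: integrable_fin_num => //; exact: integrable_dec1 fC'.
apply: (@dominated_cvg _ _ _ mu _ measurableT (fun k x => (fk k x)%:E)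
  (fun x => (f x)%:E) (fun x => C%:E * (wt1 x)%:E)%E).
- by move=> k; apply/measurable_EFinP; exact: continuous_measurable_fun.
- by move=> x _; apply: cvg_EFin; [exact: nearW|exact: fkf].
- by move=> x _.
- exact: (integrableZl measurableT C integrable_wt1).
- by move=> n x _; rewrite lee_fin.
Qed.

(** An open subset of the plane is the union of the countably many rational squares that it
    contains, and a square is a product of intervals; this links continuity to the product
    sigma-algebra. *)
Lemma measurable_continuous2 (H : R * R -> R) : continuous H ->
  measurable_fun setT H.
Proof.
move=> cH; apply: (measurability _ (RGenOInfty.measurableE R)) => //.
move=> _ [_ [a ->] <-]; rewrite setTI.
set O := H @^-1` _.
have oO : open O.
  apply: open_comp => [x _|]; first exact: cH.
  rewrite (_ : [set` _] = [set x | a < x]); last first.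
    by apply/seteqP; split => x /=; rewrite in_itv/= andbT.
  exact: open_gt.
pose rect (q : rat * rat * rat) : set (R * R) :=
  ball (ratr q.1.1 : R) (ratr q.2 : R) `*` ball (ratr q.1.2 : R) (ratr q.2 : R).
have -> : O = \bigcup_(q in [set q | rect q `<=` O]) rect q.
  apply/seteqP; split => [[x y] Oxy|z [q /= qO rz]]; last exact: qO.
  have /nbhs_ballP[e /= e0 he] : nbhs (x, y) O by apply: open_nbhs_nbhs.
  have [r] : exists q, ratr q \in `]0, e / 2[ by apply: rat_in_itvoo; rewrite divr_gt0.
  rewrite in_itv/= => /andP[r0 re].
  have [p] : exists q, ratr q \in `]x - ratr r, x + ratr r[ by apply: rat_in_itvoo; lra.
  rewrite in_itv/= => /andP[p1 p2].
  have [q] : exists q, ratr q \in `]y - ratr r, y + ratr r[ by apply: rat_in_itvoo; lra.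
  rewrite in_itv/= => /andP[q1 q2].
  exists (p, q, r) => /=.
    move=> [u v] [/=]; rewrite /ball/= => hu hv; apply: he.
    split; rewrite /= /ball/=; move: hu hv;
      rewrite !ltr_norml => /andP[? ?] /andP[? ?]; apply/andP; split; lra.
  by split => /=; rewrite /ball/= ltr_norml; apply/andP; split; lra.
rewrite bigcup_mkcond; apply: countable_bigcupT_measurable => // q.
case: ifP => // _; apply: measurableX; rewrite ball_itv; exact: measurable_itv.
Qed.

Lemma Fubini_dec (H : R * R -> R) (C : R) : continuous H ->
  (forall z, `|H z| <= C * (wt1 z.1 * wt1 z.2)) ->
  \int[mu]_t \int[mu]_u H (t, u) = \int[mu]_u \int[mu]_t H (t, u).
Proof.
move=> cH HC.
have cH1 t : continuous (fun u => H (t, u)).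
  by move=> u; apply: (@continuous_comp _ _ _ (pair t) H); [exact: (cvg_pair_nbhs (cvg_cst _) cvg_id)|exact: cH].
have cH2 u : continuous (fun t => H (t, u)).
  by move=> t; apply: (@continuous_comp _ _ _ (pair^~ u) H); [exact: (cvg_pair_nbhs cvg_id (cvg_cst _))|exact: cH].
have H1C t u : `|H (t, u)| <= (C * wt1 t) * wt1 u by rewrite -mulrA (HC (t, u)).
have H2C u t : `|H (t, u)| <= (C * wt1 u) * wt1 t.
  by rewrite -mulrA [X in C * X]mulrC (HC (t, u)).
have C0 : 0 <= C.
  have := le_trans (normr_ge0 _) (HC (0, 0)).
  by rewrite pmulr_lge0// mulr_gt0 ?wt1_gt0.
have mH : measurable_fun setT (EFin \o H).
  by apply/measurable_EFinP; exact: measurable_continuous2.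
have iH : (mu \x mu)%E.-integrable setT (EFin \o H).
  apply/integrable12ltyP => //=.
  apply: (@le_lt_trans _ _ (\int[mu]_x ((C * pi)%:E * (wt1 x)%:E))%E).
    apply: ge0_le_integral => //=.
    - by move=> x _; apply: integral_ge0 => y _; rewrite lee_fin.
    - apply: (@measurable_fun_fubini_tonelli_F _ _ _ _ _ mu (fun z => `|H z|%:E)%E).
        by apply/measurable_EFinP; apply: measurableT_comp => //; exact: measurable_continuous2.
      by move=> z; rewrite lee_fin.
    - exact: (measurable_int _ (integrableZl measurableT _ integrable_wt1)).
    move=> x _.
    apply: (@le_trans _ _ (\int[mu]_y ((C * wt1 x)%:E * (wt1 y)%:E))%E).
      apply: ge0_le_integral => //=.
      - apply/measurable_EFinP; apply: continuous_measurable_fun.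
        by move=> y; apply: cvg_norm; exact: cH1.
      - exact: (measurable_int _ (integrableZl measurableT _ integrable_wt1)).
      - by move=> y _; rewrite lee_fin.
    rewrite integralZl//; last exact: integrable_wt1.
    by rewrite integralT_wt1 -!EFinM lee_fin mulrAC.
  rewrite integralZl//; last exact: integrable_wt1.
  by rewrite integralT_wt1 -EFinM ltry.
have := Fubini iH; rewrite /= => E.
rewrite /Rintegral; congr fine.
under eq_integral => t _.
  rewrite fineK; last by apply: integrable_fin_num => //; exact: integrable_dec1 (H1C t).
  over.
under [RHS]eq_integral => u _.
  rewrite fineK; last by apply: integrable_fin_num => //; exact: integrable_dec1 (H2C u).
  over.
exact: E.
Qed.

End Weight.

(** * Iterated integrals on R^n: convergence, linearity, monotonicity *)

Section IntRn.
Variable R : realType.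
Local Notation mu := (@lebesgue_measure R).

Definition wt n (x : 'rV[R]_n) : R := \prod_i wt1 (x 0 i).

Lemma wt_gt0 n (x : 'rV[R]_n) : 0 < wt x.
Proof. by apply: prodr_gt0 => i _; exact: wt1_gt0. Qed.

Lemma wt_ge0 n (x : 'rV[R]_n) : 0 <= wt x. Proof. exact/ltW/wt_gt0. Qed.

Lemma wt_le1 n (x : 'rV[R]_n) : wt x <= 1.
Proof.
by rewrite -[leRHS](@big1_eq _ 1 *%R _ (index_enum 'I_n) predT); apply: ler_prod => i _;
  rewrite wt1_ge0 wt1_le1.
Qed.

Lemma wt_cons n t (y : 'rV[R]_n) : wt (cons_row t y) = wt1 t * wt y.
Proof.
by rewrite /wt big_ord_recl cons_row0; congr (_ * _); apply: eq_bigr => i _; rewrite cons_rowS.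
Qed.

(** The working notion of integrability. It passes to slices because [wt] is a product over the
    coordinates. *)
Definition dec n (f : 'rV[R]_n -> R) :=
  continuous f /\ exists C, forall x, `|f x| <= C * wt x.

Lemma intRnS n (f : 'rV[R]_n.+1 -> R) :
  intRn f = \int[mu]_t intRn (fun y => f (cons_row t y)).
Proof. by []. Qed.

Lemma continuous_cons_row n t : continuous (@cons_row R n t).
Proof. by move=> y; apply: (@cvg_cons_row R n _ (nbhs y) _ (fun=> t) id t y); [exact: cvg_cst|exact: cvg_id]. Qed.

Lemma continuous_cons_row1 n (y : 'rV[R]_n) : continuous ((@cons_row R n)^~ y).
Proof. by move=> t; apply: (@cvg_cons_row R n _ (nbhs t) _ id (fun=> y) t y); [exact: cvg_id|exact: cvg_cst]. Qed.

Lemma continuous_slice n t (f : 'rV[R]_n.+1 -> R) : continuous f ->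
  continuous (fun y => f (cons_row t y)).
Proof. by move=> cf y; apply: (@continuous_comp _ _ _ (@cons_row R n t) f); [exact: continuous_cons_row|exact: cf]. Qed.

Lemma slice_le n t (f : 'rV[R]_n.+1 -> R) C : (forall x, `|f x| <= C * wt x) ->
  forall y, `|f (cons_row t y)| <= (C * wt1 t) * wt y.
Proof. by move=> fC y; rewrite -mulrA -wt_cons. Qed.

Lemma le_wt_ge0 n (f : 'rV[R]_n -> R) C : (forall x, `|f x| <= C * wt x) -> 0 <= C.
Proof. by move=> /(_ 0) /(le_trans (normr_ge0 _)); rewrite pmulr_lge0// wt_gt0. Qed.

(** The two claims need each other in the induction: in dimension n + 1 the inner integral must be a
    continuous and dominated function of the first coordinate, and its continuity comes from the
    convergence statement in dimension n, its domination from the bound. *)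
Lemma intRn_main n :
  (forall (f : 'rV[R]_n -> R) C, continuous f -> (forall x, `|f x| <= C * wt x) ->
     `|intRn f| <= C * pi ^+ n) /\
  (forall (fk : nat -> 'rV[R]_n -> R) f C, (forall k, continuous (fk k)) ->
     (forall k x, `|fk k x| <= C * wt x) -> continuous f ->
     (forall x, fk k x @[k --> \oo] --> f x) ->
     intRn (fk k) @[k --> \oo] --> intRn f).
Proof.
elim: n => [|n [IHb IHc]].
  split=> [f C cf fC|fk f C cfk fkC cf fkf] /=; last exact: fkf.
  by rewrite expr0 (le_trans (fC 0))// /wt big_ord0.
have sliceb (f : 'rV[R]_n.+1 -> R) C : continuous f -> (forall x, `|f x| <= C * wt x) ->
    continuous (fun t => intRn (fun y => f (cons_row t y))) /\
    forall t, `|intRn (fun y => f (cons_row t y))| <= (C * pi ^+ n) * wt1 t.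
  move=> cf fC; split=> t.
    apply: (@continuous_seq _ R) => u ut.
    apply: (IHc _ _ C).
    - by move=> k; exact: continuous_slice.
    - move=> k y; apply: (le_trans (slice_le _ fC y)).
      apply: ler_wpM2r; first exact: wt_ge0.
      by rewrite ler_piMr ?wt1_le1// (le_wt_ge0 fC).
    - exact: continuous_slice.
    - move=> y; apply: (@continuous_cvg _ _ _ \oo _ (fun k => cons_row (u k) y) f); first exact: cf.
      by apply: (@cvg_cons_row R n _ \oo _ u (fun=> y) t y) => //; exact: cvg_cst.
  rewrite mulrAC; apply: IHb; first exact: continuous_slice.
  exact: slice_le.
split=> [f C cf fC|fk f C cfk fkC cf fkf].
  have [cF FC] := sliceb f C cf fC.
  by rewrite exprSr mulrA; exact: Rintegral_dec1_le.
have fC x : `|f x| <= C * wt x.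
  have cN : (fun k => `|fk k x|) @ \oo --> `|f x| by apply: cvg_norm (fkf x).
  rewrite -(cvg_lim _ cN)//; apply: limr_le; first by apply/cvg_ex; eexists; exact: cN.
  by apply: nearW => k.
apply: (@cvg_Rintegral_dec1 _ (fun k t => intRn (fun y => fk k (cons_row t y))) _ (C * pi ^+ n)).
- by move=> k; have [] := sliceb (fk k) C (cfk k) (fkC k).
- by have [] := sliceb f C cf fC.
- by move=> k; have [_] := sliceb (fk k) C (cfk k) (fkC k).
- move=> t; apply: (IHc _ _ (C * wt1 t)).
  + by move=> k; exact: continuous_slice.
  + by move=> k y; exact: slice_le.
  + exact: continuous_slice.
  + by move=> y; exact: fkf.
Qed.

Lemma intRn_norm_le n (f : 'rV[R]_n -> R) C : continuous f ->
  (forall x, `|f x| <= C * wt x) -> `|intRn f| <= C * pi ^+ n.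
Proof. by have [h _] := intRn_main n; exact: h. Qed.

Lemma cvg_intRn n (fk : nat -> 'rV[R]_n -> R) f C : (forall k, continuous (fk k)) ->
  (forall k x, `|fk k x| <= C * wt x) -> continuous f ->
  (forall x, fk k x @[k --> \oo] --> f x) ->
  intRn (fk k) @[k --> \oo] --> intRn f.
Proof. by have [_ h] := intRn_main n; exact: h. Qed.

Lemma continuous_intRn (T : pseudoMetricType R) n (f : T -> 'rV[R]_n -> R) p C :
  (forall q, continuous (f q)) -> (forall x, {for p, continuous (f^~ x)}) ->
  (\forall q \near p, forall x, `|f q x| <= C * wt x) ->
  {for p, continuous (fun q => intRn (f q))}.
Proof.
move=> cf cp bd; apply: continuous_seq => u up.
have [N _ HN] := up _ bd.
rewrite -(cvg_shiftn N); apply: (@cvg_intRn _ (fun k => f (u (k + N)%N)) _ C) => //.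
- by move=> k x; apply: HN; rewrite /= leq_addl.
- move=> x; apply: (@continuous_cvg _ _ _ \oo _ (fun k => u (k + N)%N) (f^~ x)); first exact: cp.
  exact: (cvg_comp _ _ (cvg_addnr N) up).
Qed.

Lemma dec_slice n (f : 'rV[R]_n.+1 -> R) t : dec f -> dec (fun y => f (cons_row t y)).
Proof.
move=> [cf [C fC]]; split; first exact: continuous_slice.
by exists (C * wt1 t); exact: slice_le.
Qed.

Lemma continuous_intRn_slice n (f : 'rV[R]_n.+1 -> R) : dec f ->
  continuous (fun t => intRn (fun y => f (cons_row t y))).
Proof.
move=> [cf [C fC]] t.
apply: (@continuous_intRn _ n (fun t y => f (cons_row t y)) t C).
- by move=> q; exact: continuous_slice.
- by move=> x; apply: (@continuous_comp _ _ _ ((@cons_row R n)^~ x) f); [exact: continuous_cons_row1|exact: cf].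
- near=> q; move=> x; apply: (le_trans (slice_le _ fC x)).
  apply: ler_wpM2r; first exact: wt_ge0.
  by rewrite ler_piMr ?wt1_le1// (le_wt_ge0 fC).
Unshelve. all: end_near. Qed.

Lemma dec_integrable n (f : 'rV[R]_n.+1 -> R) : dec f ->
  mu.-integrable setT (EFin \o (fun t => intRn (fun y => f (cons_row t y)))).
Proof.
move=> df; have [cf [C fC]] := df; apply: (@integrable_dec1 _ _ (C * pi ^+ n)).
  exact: continuous_intRn_slice.
move=> t; rewrite mulrAC; apply: intRn_norm_le; first exact: continuous_slice.
exact: slice_le.
Qed.

Lemma decD n (f g : 'rV[R]_n -> R) : dec f -> dec g -> dec (fun x => f x + g x).
Proof.
move=> [cf [C fC]] [cg [D gD]]; split; first by move=> x; exact: (continuousD (cf x) (cg x)).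
by exists (C + D) => x; rewrite mulrDl (le_trans (ler_normD _ _))// lerD.
Qed.

Lemma decM n (f g : 'rV[R]_n -> R) C : dec f -> continuous g ->
  (forall x, `|g x| <= C) -> dec (fun x => g x * f x).
Proof.
move=> [cf [D fD]] cg gC; split; first by move=> x; exact: (continuousM (cg x) (cf x)).
exists (C * D) => x; rewrite normrM -mulrA; apply: ler_pM => //.
Qed.

Lemma decZ n a (f : 'rV[R]_n -> R) : dec f -> dec (fun x => a * f x).
Proof.
move=> df; apply: (@decM _ f (fun=> a) `|a| df); [exact: cst_continuous|by []].
Qed.

Lemma decN n (f : 'rV[R]_n -> R) : dec f -> dec (fun x => - f x).
Proof.
by move=> /(decZ (-1)); rewrite (_ : (fun x => -1 * f x) = (fun x => - f x))//;
  apply/funext => x; rewrite mulN1r.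
Qed.

Lemma decB n (f g : 'rV[R]_n -> R) : dec f -> dec g -> dec (fun x => f x - g x).
Proof. by move=> df dg; apply: decD => //; exact: decN. Qed.

Lemma dec_norm n (f : 'rV[R]_n -> R) : dec f -> dec (fun x => `|f x|).
Proof.
move=> [cf [C fC]]; split.
  by move=> x; apply: (@continuous_comp _ _ _ f Num.norm); [exact: cf|exact: norm_continuous].
by exists C => x; rewrite normr_id.
Qed.

Lemma dec0 n : dec (fun _ : 'rV[R]_n => 0 : R).
Proof. by split; [exact: cst_continuous|exists 0 => x; rewrite normr0 mul0r]. Qed.

Lemma dec_sum n I (r : seq I) (P : pred I) (f : I -> 'rV[R]_n -> R) :
  (forall i, P i -> dec (f i)) -> dec (fun x => \sum_(i <- r | P i) f i x).
Proof.
move=> df; elim: r => [|i r IH].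
  have -> : (fun x => \sum_(i <- [::] | P i) f i x) = (fun=> 0).
    by apply/funext => x; rewrite big_nil.
  exact: dec0.
have -> : (fun x => \sum_(j <- i :: r | P j) f j x) =
    (fun x => (if P i then f i x else 0) + \sum_(i <- r | P i) f i x).
  by apply/funext => x; rewrite [LHS]big_cons; case: ifP => // _; rewrite add0r.
by apply: decD => //; case Pi: (P i); [exact: df|exact: dec0].
Qed.

Lemma eq_intRn n (f g : 'rV[R]_n -> R) : f =1 g -> intRn f = intRn g.
Proof. by move=> /funext ->. Qed.

Lemma intRnD n (f g : 'rV[R]_n -> R) : dec f -> dec g ->
  intRn (fun x => f x + g x) = intRn f + intRn g.
Proof.
elim: n f g => [//|n IH] f g df dg; rewrite !intRnS -RintegralD//;
  [|exact: dec_integrable|exact: dec_integrable].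
by apply: eq_Rintegral => t _; rewrite IH//; exact: dec_slice.
Qed.

Lemma intRnZ n a (f : 'rV[R]_n -> R) : dec f ->
  intRn (fun x => a * f x) = a * intRn f.
Proof.
elim: n f => [//|n IH] f df; rewrite !intRnS -RintegralZl//; last exact: dec_integrable.
by apply: eq_Rintegral => t _; rewrite IH//; exact: dec_slice.
Qed.

Lemma intRnN n (f : 'rV[R]_n -> R) : dec f -> intRn (fun x => - f x) = - intRn f.
Proof.
by move=> df; rewrite -mulN1r -intRnZ//; apply: eq_intRn => x; rewrite mulN1r.
Qed.

Lemma intRnB n (f g : 'rV[R]_n -> R) : dec f -> dec g ->
  intRn (fun x => f x - g x) = intRn f - intRn g.
Proof. by move=> df dg; rewrite intRnD ?intRnN//; exact: decN. Qed.

Lemma intRn0 n : intRn (fun _ : 'rV[R]_n => 0 : R) = 0.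
Proof. by rewrite -[RHS](mul0r (intRn (fun _ : 'rV[R]_n => 0 : R))) -intRnZ; [apply: eq_intRn => x; rewrite mul0r|exact: dec0]. Qed.

Lemma intRn_sum n I (r : seq I) (P : pred I) (f : I -> 'rV[R]_n -> R) :
  (forall i, P i -> dec (f i)) ->
  intRn (fun x => \sum_(i <- r | P i) f i x) = \sum_(i <- r | P i) intRn (f i).
Proof.
move=> df; elim: r => [|i r IH].
  by rewrite big_nil -[RHS](intRn0 n); apply: eq_intRn => x; rewrite big_nil.
rewrite big_cons; case: ifP => Pi; last first.
  by rewrite -IH; apply: eq_intRn => x; rewrite big_cons Pi.
rewrite -IH -intRnD; [|exact: df|exact: dec_sum].
by apply: eq_intRn => x; rewrite big_cons Pi.
Qed.

Lemma le_intRn n (f g : 'rV[R]_n -> R) : dec f -> dec g ->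
  (forall x, f x <= g x) -> intRn f <= intRn g.
Proof.
elim: n f g => [f g _ _|n IH f g df dg] fg; first exact: fg.
rewrite !intRnS; apply: le_Rintegral; [by []|exact: dec_integrable|exact: dec_integrable|].
by move=> t _; apply: IH => //; exact: dec_slice.
Qed.

Lemma intRn_ge0 n (f : 'rV[R]_n -> R) : (forall x, 0 <= f x) -> 0 <= intRn f.
Proof.
by elim: n f => [f|n IH f] f0; [exact: f0|apply: Rintegral_ge0 => t _; apply: IH].
Qed.

Lemma le_norm_intRn n (f : 'rV[R]_n -> R) : dec f ->
  `|intRn f| <= intRn (fun x => `|f x|).
Proof.
move=> df; rewrite ler_norml -intRnN; last exact: dec_norm.
apply/andP; split; apply: le_intRn => //; try exact: dec_norm.
- exact/decN/dec_norm.
- by move=> x; rewrite lerNl -normrN ler_norm.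
- by move=> x; exact: ler_norm.
Qed.

End IntRn.

(** * Exchange of iterated integrals *)

Section Swap.
Variable R : realType.
Local Notation mu := (@lebesgue_measure R).

Lemma continuous2 (T U V : topologicalType) (W : topologicalType)
    (F : U -> V -> W) (a : T -> U) (b : T -> V) :
  continuous (fun q : U * V => F q.1 q.2) -> continuous a -> continuous b ->
  continuous (fun p => F (a p) (b p)).
Proof.
move=> cF ca cb p.
apply: (@continuous_comp _ _ _ (fun p => (a p, b p)) (fun q : U * V => F q.1 q.2)).
  exact: (cvg_pair_nbhs (ca p) (cb p)).
exact: cF.
Qed.

Lemma continuous_cons2 n : continuous (fun q : R * 'rV[R]_n => cons_row q.1 q.2).
Proof.
by move=> q; apply: (@cvg_cons_row R n _ (nbhs q) _ fst snd q.1 q.2); [exact: cvg_fst|exact: cvg_snd].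
Qed.

Lemma continuous_fst (U V : topologicalType) : continuous (@fst U V).
Proof. by move=> x; exact: cvg_fst. Qed.

Lemma continuous_snd (U V : topologicalType) : continuous (@snd U V).
Proof. by move=> x; exact: cvg_snd. Qed.

Lemma continuous_fun1 (T U V W : topologicalType) (F : U -> V -> W) x :
  continuous (fun q : U * V => F q.1 q.2) -> continuous (F x).
Proof. by move=> cF; apply: (continuous2 cF); [exact: cst_continuous|move=> y; exact: cvg_id]. Qed.

Lemma continuous_fun2 (T U V W : topologicalType) (F : U -> V -> W) y :
  continuous (fun q : U * V => F q.1 q.2) -> continuous (F^~ y).
Proof. by move=> cF; apply: (continuous2 cF); [move=> x; exact: cvg_id|exact: cst_continuous]. Qed.

(** The variable t is exchanged with the first coordinate by the plane Fubini theorem, applied to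
    the integral over the remaining coordinates, and then carried through these by induction. *)
Lemma intRn_swap1 n (G : R -> 'rV[R]_n -> R) C :
  continuous (fun q : R * 'rV[R]_n => G q.1 q.2) ->
  (forall t y, `|G t y| <= C * (wt1 t * wt y)) ->
  \int[mu]_t intRn (G t) = intRn (fun y => \int[mu]_t G t y).
Proof.
elim: n G C => [//|n IH] G C cG GC.
have C0 : 0 <= C.
  have := le_trans (normr_ge0 _) (GC 0 0).
  by rewrite pmulr_lge0// mulr_gt0 ?wt1_gt0 ?wt_gt0.
have cG3 z : continuous (fun q : R * R => G q.1 (cons_row q.2 z)).
  apply: (continuous2 cG); first exact: continuous_fst.
  by apply: (continuous2 (@continuous_cons2 n)); [exact: continuous_snd|exact: cst_continuous].
have cGs s : continuous (fun q : R * 'rV[R]_n => G q.1 (cons_row s q.2)).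
  apply: (continuous2 cG); first exact: continuous_fst.
  by apply: (continuous2 (@continuous_cons2 n)); [exact: cst_continuous|exact: continuous_snd].
pose H (q : R * R) := intRn (fun z => G q.1 (cons_row q.2 z)).
have bH (q : R * R) (x : 'rV[R]_n) : `|G q.1 (cons_row q.2 x)| <= (C * (wt1 q.1 * wt1 q.2)) * wt x.
  by apply: (le_trans (GC _ _)); rewrite wt_cons !mulrA.
have cH : continuous H.
  move=> p; apply: (@continuous_intRn _ _ n (fun (q : R * R) z => G q.1 (cons_row q.2 z)) p C).
  - by move=> q; exact: (@continuous_fun1 R _ _ _ (fun t z => G t (cons_row q.2 z)) q.1 (cGs q.2)).
  - by move=> x; exact: cG3.
  - near=> q; move=> x; apply: (le_trans (bH _ _)); apply: ler_wpM2r; first exact: wt_ge0.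
    by rewrite ler_piMr// mulr_ile1 ?wt1_ge0 ?wt1_le1.
transitivity (\int[mu]_t \int[mu]_s H (t, s)); first by [].
rewrite (@Fubini_dec _ H (C * pi ^+ n))//; last first.
  move=> q; rewrite mulrAC; apply: intRn_norm_le; last exact: bH.
  exact: (@continuous_fun1 R _ _ _ (fun t z => G t (cons_row q.2 z)) q.1 (cGs q.2)).
apply: eq_Rintegral => s _; rewrite /H /=.
apply: (IH (fun t z => G t (cons_row s z)) (C * wt1 s)) => // t y.
by apply: (le_trans (GC _ _)); rewrite wt_cons -!mulrA [wt1 t * _]mulrCA.
Unshelve. all: end_near. Qed.

(** Induction on the number of outer variables: for a fixed first coordinate the others are carried
    through by the induction hypothesis, then [intRn_swap1] carries the first one. *)
Lemma intRn_swap n m (F : 'rV[R]_n -> 'rV[R]_m -> R) C :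
  continuous (fun q : 'rV[R]_n * 'rV[R]_m => F q.1 q.2) ->
  (forall x y, `|F x y| <= C * (wt x * wt y)) ->
  intRn (fun x => intRn (F x)) = intRn (fun y => intRn (F^~ y)).
Proof.
elim: n F C => [//|n IH] F C cF FC.
have C0 : 0 <= C.
  have := le_trans (normr_ge0 _) (FC 0 0).
  by rewrite pmulr_lge0// mulr_gt0 ?wt_gt0.
have cF1 t : continuous (fun q : 'rV[R]_n * 'rV[R]_m => F (cons_row t q.1) q.2).
  apply: (continuous2 cF); last exact: continuous_snd.
  by apply: (continuous2 (@continuous_cons2 n)); [exact: cst_continuous|exact: continuous_fst].
have cF2 z : continuous (fun q : R * 'rV[R]_m => F (cons_row q.1 z) q.2).
  apply: (continuous2 cF); last exact: continuous_snd.
  by apply: (continuous2 (@continuous_cons2 n)); [exact: continuous_fst|exact: cst_continuous].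
have bF t x y : `|F (cons_row t x) y| <= (C * (wt1 t * wt y)) * wt x.
  by apply: (le_trans (FC _ _)); rewrite wt_cons mulrAC -!mulrA [wt y * wt x]mulrC.
rewrite intRnS.
transitivity (\int[mu]_t intRn (fun y => intRn (fun x => F (cons_row t x) y))).
  apply: eq_Rintegral => t _; apply: (IH (fun x y => F (cons_row t x) y) (C * wt1 t)) => // x y.
  by apply: (le_trans (FC _ _)); rewrite wt_cons !mulrA.
apply: (@intRn_swap1 m (fun t y => intRn (fun x => F (cons_row t x) y)) (C * pi ^+ n)).
  move=> p.
  apply: (@continuous_intRn _ _ n (fun (q : R * 'rV[R]_m) x => F (cons_row q.1 x) q.2) p C).
  - by move=> q; exact: (@continuous_fun2 R _ _ _ (fun x y => F (cons_row q.1 x) y) q.2 (cF1 q.1)).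
  - by move=> x; exact: cF2.
  - near=> q; move=> x; apply: (le_trans (bF _ _ _)); apply: ler_wpM2r; first exact: wt_ge0.
    by rewrite ler_piMr// mulr_ile1 ?wt1_ge0 ?wt1_le1 ?wt_ge0 ?wt_le1.
move=> t y; rewrite mulrAC; apply: intRn_norm_le; last by move=> x; exact: bF.
exact: (@continuous_fun2 R _ _ _ (fun x y => F (cons_row t x) y) y (cF1 t)).
Unshelve. all: end_near. Qed.

End Swap.

(** * Compactly supported functions and affine substitutions on the line *)

Section CompactSupport.
Variable R : realType.
Local Notation mu := (@lebesgue_measure R).

(** Domination by the product weight [wt] does not survive a rotation of the coordinates, whereas
    compact support does. Hence changes of variables are formulated for this class. *)
Definition cs n (f : 'rV[R]_n -> R) :=
  continuous f /\ exists r, forall x, r < `|x| -> f x = 0.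

Lemma rV_coord_le n (x : 'rV[R]_n) i : `|x 0 i| <= `|x|.
Proof.
rewrite /Num.norm/= mx_normrE; apply: (le_bigmax _ (fun k : 'I_1 * 'I_n => `|x k.1 k.2|) (0, i)).
Qed.

Lemma rV_norm_le n (x : 'rV[R]_n) r : 0 <= r -> (forall i, `|x 0 i| <= r) -> `|x| <= r.
Proof.
move=> r0 h; rewrite /Num.norm/= mx_normrE; apply/bigmax_leP; split=> // -[i j] _ /=.
by rewrite ord1.
Qed.

Lemma compact_norm_le n r : compact [set x : 'rV[R]_n | `|x| <= r].
Proof.
apply: bounded_closed_compact.
  exists r; split; first exact: num_real.
  by move=> M rM x /= xr; apply: (le_trans xr); exact: ltW.
by apply: (@closed_comp _ _ (@Num.norm _ 'rV[R]_n) [set x | x <= r]);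
  [move=> x _; exact: norm_continuous|exact: closed_le].
Qed.

Lemma continuous_bounded_compact (T : topologicalType) (f : T -> R) (A : set T) :
  compact A -> (forall x, A x -> {for x, continuous f}) ->
  exists C, 0 <= C /\ forall x, A x -> `|f x| <= C.
Proof.
move=> cA cf.
have : compact (f @` A).
  by apply: continuous_compact => //; apply: continuous_in_subspaceT => x /set_mem; exact: cf.
move=> /compact_bounded [M [_ HM]].
exists (Num.max 0 (M + 1)); split; first by rewrite le_max lexx.
move=> x Ax; rewrite le_max; apply/orP; right; apply: (HM (M + 1)); first by rewrite ltrDl.
by exists x.
Qed.

Lemma wt_ge_of_norm n (x : 'rV[R]_n) r : `|x| <= r -> (1 + r ^+ 2) ^- n <= wt x.
Proof.
move=> xr; have r0 : 0 <= r by exact: le_trans xr.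
rewrite -[n in X in X <= _]card_ord -exprVn -prodr_const; apply: ler_prod => i _.
rewrite invr_ge0 addr_ge0 ?sqr_ge0//= lef_pV2 ?posrE ?ltr_wpDr ?sqr_ge0//.
by rewrite lerD2l -[x 0 i ^+ 2]real_normK ?num_real// lerXn2r ?nnegrE// (le_trans (rV_coord_le _ _)).
Qed.

(** On the ball of radius r, which is a cube, the weight is at least [(1 + r ^+ 2) ^- n]; this is
    the origin of the constant. *)
Lemma cs_bound n (f : 'rV[R]_n -> R) B r : (forall x, `|f x| <= B) -> (forall x, r < `|x| -> f x = 0) ->
  forall x, `|f x| <= (B * (1 + r ^+ 2) ^+ n) * wt x.
Proof.
move=> fB fr x; have [/fr ->|xr] := ltP r `|x|.
  rewrite normr0 !mulr_ge0 ?wt_ge0 ?exprn_ge0 ?addr_ge0 ?sqr_ge0//.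
  exact: le_trans (fB 0).
apply: (le_trans (fB x)); rewrite -mulrA ler_peMr//; first exact: le_trans (fB 0).
have p0 : 0 < (1 + r ^+ 2) ^+ n by rewrite exprn_gt0// ltr_wpDr ?sqr_ge0.
by rewrite -ler_pdivrMl// mulr1 wt_ge_of_norm.
Qed.

Lemma cs_bounded n (f : 'rV[R]_n -> R) : cs f -> exists C, 0 <= C /\ forall x, `|f x| <= C.
Proof.
move=> [cf [r fr]].
have [C [C0 HC]] := continuous_bounded_compact (@compact_norm_le n r) (fun x _ => cf x).
exists C; split => // x; have [/fr ->|] := ltP r `|x|; first by rewrite normr0.
exact: HC.
Qed.

Lemma cs_dec n (f : 'rV[R]_n -> R) : cs f -> dec f.
Proof.
move=> csf; have [C [C0 fC]] := cs_bounded csf; have [cf [r fr]] := csf.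
by split => //; exists (C * (1 + r ^+ 2) ^+ n); exact: cs_bound.
Qed.

Lemma csP1 n (f : 'rV[R]_n.+1 -> R) : cs f ->
  exists r, forall t y, r < `|t| \/ r < `|y| -> f (cons_row t y) = 0.
Proof.
move=> [cf [r fr]]; exists (Num.max 0 r) => t y [h|h]; apply: fr.
  rewrite (lt_le_trans (le_lt_trans _ h))//; first by rewrite le_max lexx orbT.
  by rewrite -[X in `|X|](cons_row0 t y); exact: rV_coord_le.
apply: (le_lt_trans _ (lt_le_trans h _)); first by rewrite le_max lexx orbT.
apply: rV_norm_le => // i; rewrite -(cons_rowS t y i); exact: rV_coord_le.
Qed.

Definition cs1 (f : R -> R) := continuous f /\ exists r, forall x, r < `|x| -> f x = 0.

Lemma cs1_integrable f : cs1 f -> mu.-integrable setT (EFin \o f).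
Proof.
move=> [cf [r fr]].
have [C [C0 HC]] : exists C, 0 <= C /\ forall x, `[-r, r]%classic x -> `|f x| <= C.
  by apply: (continuous_bounded_compact (@segment_compact R (- r) r)) => x _; exact: cf.
have fC x : `|f x| <= C.
  have [/fr ->|xr] := ltP r `|x|; first by rewrite normr0.
  by apply: HC; rewrite /= in_itv/= -ler_norml.
apply: (@integrable_dec1 _ f (C * (1 + r ^+ 2))) => // x.
have [/fr ->|xr] := ltP r `|x|.
  by rewrite normr0 !mulr_ge0 ?wt1_ge0 ?addr_ge0 ?sqr_ge0.
apply: (le_trans (fC x)); rewrite -mulrA ler_peMr// ler_pdivlMr ?ltr_wpDr ?sqr_ge0//.
by rewrite mul1r lerD2l -[x ^+ 2]real_normK ?num_real// lerXn2r ?nnegrE// (le_trans _ xr).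
Qed.

Lemma cs1_affine f a b : a != 0 -> cs1 f -> cs1 (fun t => f (a * t + b)).
Proof.
move=> a0 [cf [r fr]]; split.
  move=> t; apply: (@continuous_comp _ _ _ (fun t => a * t + b) f); last exact: cf.
  apply: cvgD; last exact: cvg_cst.
  by apply: cvgM; [exact: cvg_cst|exact: cvg_id].
exists ((r + `|b|) / `|a|) => t; rewrite ltr_pdivrMr ?normr_gt0// => h; apply: fr.
rewrite -ltrBrDr in h; apply: (lt_le_trans h); rewrite -normrM mulrC.
exact: lerB_normD.
Qed.

Lemma ge0_Rintegral_affine_pos (G : R -> R) a b : 0 < a -> continuous G ->
  (forall x, 0 <= G x) -> (\int[mu]_x (G x)%:E = \int[mu]_x (G (a * x + b) * a)%:E)%E.
Proof.
move=> a0 cG G0.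
have dF x : is_derive x (1 : R) (fun t : R => a * t + b) a.
  have h : is_derive x (1 : R) (a \*: (@id R) + cst b) (a *: 1 + 0).
    exact: is_deriveD.
  by rewrite addr0 /GRing.scale/= mulr1 in h.
have dFE : derive1 (fun t : R => a * t + b) = cst a.
  by apply/funext => x; rewrite derive1E; exact: derive_val.
rewrite (@increasing_ge0_integration_by_substitutionT _ (fun t => a * t + b)) => //.
- by rewrite dFE.
- by move=> x y xy; rewrite ltrD2r ltr_pM2l.
- by rewrite dFE; exact: cst_continuous.
- by rewrite dFE; apply: is_cvg_cst.
- by rewrite dFE; apply: is_cvg_cst.
- apply/cvgrNyPle => A; near=> x.
  rewrite -lerBrDr mulrC -ler_pdivlMr//; near: x; exact: nbhs_ninfty_le.
- apply/cvgryPge => A; near=> x.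
  rewrite -lerBlDr mulrC -ler_pdivrMr//; near: x; exact: nbhs_pinfty_ge.
Unshelve. all: end_near. Qed.

Lemma ge0_Rintegral_opp (G : R -> R) : continuous G ->
  (forall x, 0 <= G x) -> (\int[mu]_x (G x)%:E = \int[mu]_x (G (- x))%:E)%E.
Proof.
move=> cG G0.
have cG' : continuous (fun x => G (- x)).
  by move=> x; apply: (@continuous_comp _ _ _ -%R G); [exact: opp_continuous|exact: cG].
have cGG : continuous (fun x => G x + G (- x)) by move=> x; exact: (continuousD (cG x) (cG' x)).
have split0 (H : R -> R) : continuous H -> (forall x, 0 <= H x) ->
  (\int[mu]_x (H x)%:E = \int[mu]_(x in `[0%R, +oo[) (H x)%:E
    + \int[mu]_(x in `[0%R, +oo[) (H (- x))%:E)%E.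
  move=> cH H0.
  have mH : measurable_fun setT H by exact: continuous_measurable_fun.
  rewrite -(setUv `[0%R, +oo[%classic) ge0_integral_setU//=; last 4 first.
  - exact: measurableC.
  - by apply/measurable_EFinP; rewrite setUv.
  - by move=> x _; rewrite lee_fin.
  - exact/disj_setPCl.
  congr +%E; rewrite setCitvr.
  rewrite integral_itv_bndo_bndc; last exact/measurable_EFinP/measurable_funTS.
  rewrite -{1}oppr0 ge0_integration_by_substitutionNy//.
  exact: continuous_subspaceT.
rewrite split0// (split0 (fun x => G (- x)))// addeC; congr +%E.
by apply: eq_integral => x _; rewrite opprK.
Qed.

Lemma cs1_split f : cs1 f -> exists f1 f2 : R -> R,
  [/\ cs1 f1, cs1 f2, forall x, 0 <= f1 x, forall x, 0 <= f2 x & forall x, f x = f1 x - f2 x].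
Proof.
move=> [cf [r fr]]; exists (fun x => Num.max (f x) 0), (fun x => Num.max (- f x) 0).
have cN : continuous (fun x => - f x).
  by move=> x; apply: (@continuous_comp _ _ _ f -%R); [exact: cf|exact: opp_continuous].
split.
- split; last by exists r => x /fr ->; rewrite maxxx.
  by move=> x; apply: (@continuous_max _ _ f (cst 0)); [exact: cf|exact: cst_continuous].
- split; last by exists r => x /fr ->; rewrite oppr0 maxxx.
  by move=> x; apply: (@continuous_max _ _ (fun x => - f x) (cst 0)); [exact: cN|exact: cst_continuous].
- by move=> x; rewrite le_max lexx orbT.
- by move=> x; rewrite le_max lexx orbT.
- move=> x /=; have [h|h] := leP 0 (f x).
    by rewrite (@max_r _ _ (- f x)) ?subr0// oppr_le0.
  by rewrite (@max_l _ _ (- f x)) ?sub0r ?opprK// oppr_ge0 ltW.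
Qed.

(** The substitution rules at hand are for nonnegative integrands, hence the splitting into positive
    and negative parts. A negative slope is handled as a reflection combined with a positive
    slope. *)
Lemma Rintegral_cs1_affine f a b : a != 0 -> cs1 f ->
  `|a| * \int[mu]_x f (a * x + b) = \int[mu]_x f x.
Proof.
move=> a0 csf; have [f1 [f2 [c1 c2 f10 f20 fE]]] := cs1_split csf.
have key g : cs1 g -> (forall x, 0 <= g x) -> `|a| * \int[mu]_x g (a * x + b) = \int[mu]_x g x.
  move=> csg g0; have [cg _] := csg.
  have csga := cs1_affine b a0 csg; have [cga _] := csga.
  rewrite mulrC -RintegralZr//; last exact: cs1_integrable.
  rewrite /Rintegral; congr fine.
  move: a0; rewrite neq_lt => /orP[a0|a0]; last first.
    by rewrite [RHS](ge0_Rintegral_affine_pos b a0)//; apply: eq_integral => x _; rewrite gtr0_norm.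
  have oa : 0 < - a by rewrite oppr_gt0.
  rewrite ge0_Rintegral_opp//; last by move=> x; rewrite mulr_ge0.
    rewrite [RHS](ge0_Rintegral_affine_pos b oa)//.
    by apply: eq_integral => x _; rewrite ltr0_norm// [a * - x]mulrN [- a * x]mulNr.
  move=> x; apply: (@continuousM _ _ (fun t => g (a * t + b)) (cst `|a|)); first exact: cga.
  exact: cst_continuous.
transitivity (`|a| * (\int[mu]_x f1 (a * x + b) - \int[mu]_x f2 (a * x + b))).
  congr (_ * _); rewrite -RintegralB//; try exact/cs1_integrable/cs1_affine.
  by apply: eq_Rintegral => x _; rewrite fE.
rewrite mulrBr !key// -RintegralB//; try exact/cs1_integrable.
by apply: eq_Rintegral => x _; rewrite fE.
Qed.

End CompactSupport.

(** * Linear changes of variables *)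

Section LinearChange.
Variable R : realType.
Local Notation mu := (@lebesgue_measure R).

Lemma mulmx_norm_le n k (M : 'M[R]_(n, k)) (x : 'rV[R]_n) :
  `|x *m M| <= (\sum_i \sum_j `|M i j|) * `|x|.
Proof.
apply: rV_norm_le.
  by rewrite mulr_ge0// sumr_ge0// => i _; rewrite sumr_ge0.
move=> j; rewrite mxE (le_trans (ler_norm_sum _ _ _))// mulr_suml; apply: ler_sum => i _.
rewrite normrM mulrC; apply: ler_pM => //; last exact: rV_coord_le.
by rewrite (bigD1 j)//= lerDl sumr_ge0.
Qed.

Lemma continuous_mulmxr n k (M : 'M[R]_(n, k)) : continuous (fun x : 'rV[R]_n => x *m M).
Proof.
move=> x; apply/(@cvgrPdist_lt _ _ _ (nbhs x)) => e e0.
set K := \sum_i \sum_j `|M i j|.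
have K0 : 0 <= K by rewrite sumr_ge0// => i _; rewrite sumr_ge0.
have K1 : 0 < K + 1 by rewrite ltr_wpDl.
apply/nbhs_ballP; exists (e / (K + 1)); first by rewrite /= divr_gt0.
move=> y; rewrite -ball_normE /= => xy.
rewrite -mulmxBl (le_lt_trans (mulmx_norm_le _ _))//.
apply: (@le_lt_trans _ _ ((K + 1) * `|x - y|)); first by rewrite ler_wpM2r// lerDl.
by rewrite mulrC -ltr_pdivlMr.
Qed.

Lemma continuous_addr n (a : 'rV[R]_n) : continuous (fun x : 'rV[R]_n => x + a).
Proof.
by move=> x; apply: (@continuousD _ _ _ id (cst a)); [exact: cvg_id|exact: cst_continuous].
Qed.

Lemma cs_affine n (f : 'rV[R]_n -> R) (L : 'M[R]_n) (a : 'rV[R]_n) : L \in unitmx ->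
  cs f -> cs (fun x => f (x *m L + a)).
Proof.
move=> uL [cf [r fr]]; split.
  have c1 := @continuousC _ _ _ (fun x : 'rV[R]_n => x *m L) (fun x => x + a)
    (@continuous_mulmxr _ _ L) (@continuous_addr _ a).
  exact: (continuousC c1 cf).
set K := \sum_i \sum_j `|(invmx L) i j|.
have K0 : 0 <= K by rewrite sumr_ge0// => i _; rewrite sumr_ge0.
exists ((K + 1) * (r + `|a|)) => x h; apply: fr.
have K1 : 0 < K + 1 by rewrite ltr_wpDl.
have : `|x| <= (K + 1) * `|x *m L|.
  rewrite -{1}[x](mulmxK uL) (le_trans (mulmx_norm_le _ _))//.
  by rewrite ler_wpM2r// lerDl.
move=> /(lt_le_trans h); rewrite ltr_pM2l// -ltrBrDr => /lt_le_trans; apply.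
exact: lerB_normD.
Qed.

Lemma cs_linear n (f : 'rV[R]_n -> R) (L : 'M[R]_n) : L \in unitmx ->
  cs f -> cs (fun x => f (x *m L)).
Proof.
move=> uL /(cs_affine 0 uL); rewrite (_ : (fun x => _) = (fun x => f (x *m L)))//.
by apply/funext => x; rewrite addr0.
Qed.

Lemma cs_translate n (f : 'rV[R]_n -> R) (a : 'rV[R]_n) : cs f -> cs (fun x => f (x + a)).
Proof.
move=> /(cs_affine a (unitmx1 R n)); rewrite (_ : (fun x => _) = (fun x => f (x + a)))//.
by apply/funext => x; rewrite mulmx1.
Qed.

Lemma cs_slice n (f : 'rV[R]_n.+1 -> R) t : cs f -> cs (fun y => f (cons_row t y)).
Proof.
move=> csf; have [r hr] := csP1 csf; have [cf _] := csf; split; first exact: continuous_slice.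
by exists r => y ry; apply: hr; right.
Qed.

Lemma cs1_slice n (f : 'rV[R]_n.+1 -> R) y : cs f -> cs1 (fun t => f (cons_row t y)).
Proof.
move=> csf; have [r hr] := csP1 csf; have [cf _] := csf; split.
  by move=> x; apply: (@continuous_comp _ _ _ ((@cons_row R n)^~ y) f); [exact: continuous_cons_row1|exact: cf].
by exists r => t rt; apply: hr; left.
Qed.

Lemma cs1_intRn n (f : 'rV[R]_n.+1 -> R) : cs f -> cs1 (fun t => intRn (fun y => f (cons_row t y))).
Proof.
move=> csf; split; first exact/continuous_intRn_slice/cs_dec.
have [r hr] := csP1 csf; exists r => t rt.
by rewrite -[RHS](intRn0 R n); apply: eq_intRn => y; apply: hr; left.
Qed.

Lemma cons_rowD n t u (x y : 'rV[R]_n) : cons_row t x + cons_row u y = cons_row (t + u) (x + y).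
Proof.
rewrite -[LHS]cons_rowE; congr cons_row; first by rewrite mxE !cons_row0.
by apply/rowP => j; rewrite mxE mxE !cons_rowS mxE.
Qed.

Lemma cons_row_mul_ublock n (t a : R) (y b : 'rV[R]_n) (D : 'M[R]_n) :
  cons_row t y *m (block_mx (a%:M : 'M[R]_1) b 0 D : 'M[R]_(1 + n)) = cons_row (a * t) (y *m D + t *: b).
Proof.
transitivity (row_mx ((t%:M : 'M[R]_1) *m a%:M + y *m 0) (t%:M *m b + y *m D)).
  exact: (@mul_row_block R 1 1 n 1 n t%:M y a%:M b 0 D).
rewrite mulmx0 addr0 -scalar_mxM mulrC; congr row_mx.
by rewrite mul_scalar_mx addrC.
Qed.

Lemma cons_row_mul_lblock n (t : R) (y : 'rV[R]_n) (c : 'M[R]_(n, 1)) :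
  cons_row t y *m (block_mx (1%:M : 'M[R]_1) 0 c 1%:M : 'M[R]_(1 + n)) = cons_row (t + (y *m c) 0 0) y.
Proof.
transitivity (row_mx ((t%:M : 'M[R]_1) *m 1%:M + y *m c) (t%:M *m 0 + y *m 1%:M)).
  exact: (@mul_row_block R 1 1 n 1 n t%:M y 1%:M 0 c 1%:M).
rewrite !mulmx1 mulmx0 add0r; congr row_mx.
by apply/matrixP => i j; rewrite !ord1 !mxE eqxx/=.
Qed.

Lemma intRn_translate n (f : 'rV[R]_n -> R) a : cs f -> intRn (fun x => f (x + a)) = intRn f.
Proof.
elim: n f a => [|n IH] f a csf; first by congr f; apply/rowP => -[].
rewrite !intRnS -[a]cons_rowE; set a0 := a 0 0; set a' := (\row_j _).
rewrite -[RHS](Rintegral_cs1_affine a0 (oner_neq0 R))//; last exact: cs1_intRn.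
rewrite normr1 mul1r; apply: eq_Rintegral => t _.
under eq_intRn do rewrite cons_rowD.
by rewrite (IH (fun y => f (cons_row (t + a0) y)))// ?mul1r//; exact: cs_slice.
Qed.

(** For a fixed first coordinate t the matrix acts on the others by D followed by the translation by
    [t *: b], which the inner integral does not see; what remains is the dilation by a on the
    line. *)
Lemma linear_change_ublock n (a : R) (b : 'rV[R]_n) (D : 'M[R]_n) (f : 'rV[R]_(1 + n) -> R) :
  (forall g : 'rV[R]_n -> R, cs g -> `|\det D| * intRn (fun x => g (x *m D)) = intRn g) ->
  a != 0 -> D \in unitmx -> cs f ->
  `|a * \det D| * intRn (fun x => f (x *m (block_mx (a%:M : 'M[R]_1) b 0 D : 'M[R]_(1 + n)))) = intRn f.
Proof.
move=> IH a0 uD csf; rewrite normrM -mulrA !intRnS.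
rewrite -[RHS](Rintegral_cs1_affine 0 a0)//; last exact: cs1_intRn.
congr (_ * _); rewrite -RintegralZl//; last first.
  apply: (@dec_integrable _ _ (fun x => f (x *m (block_mx (a%:M : 'M[R]_1) b 0 D : 'M[R]_(1 + n))))).
  apply/cs_dec/cs_linear => //.
  by rewrite unitmxE (@det_ublock R 1 n) det_scalar1 unitfE mulf_neq0// -unitfE -unitmxE.
apply: eq_Rintegral => t _.
under eq_intRn do rewrite cons_row_mul_ublock.
rewrite (IH (fun z => f (cons_row (a * t) (z + t *: b)))); last first.
  exact: (@cs_translate _ (fun z => f (cons_row (a * t) z)) _ (cs_slice _ csf)).
rewrite (@intRn_translate _ (fun z => f (cons_row (a * t) z)) _ (cs_slice _ csf)).
by rewrite addr0.
Qed.

(** The shear translates the first coordinate by an amount depending on the others, so the integral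
    over the first coordinate has to be made the inner one: hence the two exchanges. *)
Lemma linear_change_lblock n (c : 'M[R]_(n, 1)) (f : 'rV[R]_(1 + n) -> R) : cs f ->
  intRn (fun x => f (x *m (block_mx (1%:M : 'M[R]_1) 0 c 1%:M : 'M[R]_(1 + n)))) = intRn f.
Proof.
move=> csf; rewrite !intRnS; set L := block_mx _ _ _ _.
have uL : L \in unitmx by rewrite unitmxE (@det_lblock R 1 n) !det1 mulr1 unitr1.
have [cL [C fC]] := cs_dec (cs_linear uL csf).
have [cf [C' fC']] := cs_dec csf.
rewrite (@intRn_swap1 _ n (fun t y => f (cons_row t y *m L)) C); first last.
- by move=> t y; rewrite -wt_cons.
- move=> q; apply: (@continuous_comp _ _ _ (fun q : R * 'rV[R]_n => cons_row q.1 q.2) (fun x => f (x *m L))).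
    exact: continuous_cons2.
  exact: cL.
rewrite (@intRn_swap1 _ n (fun t y => f (cons_row t y)) C'); first last.
- by move=> t y; rewrite -wt_cons.
- move=> q; apply: (@continuous_comp _ _ _ (fun q : R * 'rV[R]_n => cons_row q.1 q.2) f).
    exact: continuous_cons2.
  exact: cf.
apply: eq_intRn => y.
rewrite -[RHS](Rintegral_cs1_affine ((y *m c) 0 0) (oner_neq0 R)); last exact: cs1_slice.
rewrite normr1 mul1r; apply: eq_Rintegral => t _.
by rewrite cons_row_mul_lblock mul1r.
Qed.

(** Gaussian elimination: an invertible matrix is a product of shears and block triangular matrices,
    for which the formula is known by induction on the dimension. *)
Lemma intRn_linear n (L : 'M[R]_n) (f : 'rV[R]_n -> R) : L \in unitmx -> cs f ->
  `|\det L| * intRn (fun x => f (x *m L)) = intRn f.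
Proof.
elim: n L f => [|n IH] L f uL csf.
  by rewrite det_mx00 normr1 mul1r /=; congr f; apply/rowP => -[].
(* With a nonzero pivot M is a lower shear times an upper block matrix whose lower right block is
   the Schur complement D. *)
have pivot (M : 'M[R]_(1 + n)) : M \in unitmx -> ulsubmx M 0 0 != 0 ->
  forall g, cs g -> `|\det M| * intRn (fun x => g (x *m M)) = intRn g.
  move=> uM a0 g csg; set a := ulsubmx M 0 0 in a0.
  pose c := a^-1 *: dlsubmx M.
  pose D := drsubmx M - c *m ursubmx M.
  have EM : M = block_mx 1%:M 0 c 1%:M *m block_mx a%:M (ursubmx M) 0 D.
    rewrite mulmx_block !mul1mx !mul0mx !addr0 [_ + D]addrC subrK -[LHS]submxK.
    congr block_mx; first by apply/matrixP => i j; rewrite !ord1 [RHS]mxE eqxx.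
    by rewrite mul_mx_scalar /c scalerA divff// scale1r.
  have dM : \det M = a * \det D by rewrite EM det_mulmx (@det_lblock R 1 n) (@det_ublock R 1 n) !det1 !mul1r det_scalar1.
  have uD : D \in unitmx.
    by move: uM; rewrite !unitmxE !unitfE dM mulf_eq0 negb_or => /andP[].
  rewrite dM -[RHS](@linear_change_ublock n a (ursubmx M) D g)//; last first.
    by move=> h csh; exact: IH.
  congr (_ * _); set U := block_mx a%:M _ _ _.
  have uU : U \in unitmx.
    by rewrite unitmxE (@det_ublock R 1 n) det_scalar1 unitfE mulf_neq0// -unitfE -unitmxE.
  rewrite -[RHS](@linear_change_lblock n c (fun x => g (x *m U))); last exact: cs_linear.
  by apply: eq_intRn => x; rewrite EM mulmxA.
have [a0|] := eqVneq (ulsubmx (L : 'M[R]_(1 + n)) 0 0) 0; last by move=> ?; exact: pivot.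
have [i Li] : exists i, dlsubmx (L : 'M[R]_(1 + n)) i 0 != 0.
  apply/existsP; rewrite -negb_forall; apply/negP => /forallP H.
  move: uL; rewrite unitmxE unitfE => /negP; apply.
  have -> : L = (block_mx (0 : 'M[R]_1) (ursubmx (L : 'M[R]_(1 + n))) 0 (drsubmx (L : 'M[R]_(1 + n))) : 'M[R]_(1 + n)).
    have E1 : ulsubmx (L : 'M[R]_(1 + n)) = 0.
      by apply/matrixP => k j; rewrite !ord1 a0 mxE.
    have E2 : dlsubmx (L : 'M[R]_(1 + n)) = 0.
      by apply/matrixP => k j; rewrite !ord1 (eqP (H k)) mxE.
    by rewrite -[LHS](@submxK R 1 n 1 n) E1 E2.
  by rewrite (@det_ublock R 1 n) det_mx11 mxE mul0r.
(* If the pivot vanishes, some entry below it does not; multiplying by [T (delta_mx 0 i)] adds that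
   row to the first one and leaves the determinant unchanged. *)
pose T e := block_mx (1%:M : 'M[R]_1) e 0 1%:M : 'M[R]_(1 + n).
have dT e : \det (T e) = 1 by rewrite (@det_ublock R 1 n) !det1 mulr1.
have uT e : T e \in unitmx by rewrite unitmxE dT unitr1.
have EL : L = T (- delta_mx 0 i) *m (T (delta_mx 0 i) *m L).
  rewrite mulmxA /T mulmx_block !mul1mx !mulmx1 !mul0mx !mulmx0 !addr0 add0r subrr -scalar_mx_block.
  by rewrite mul1mx.
have uTL : T (delta_mx 0 i) *m L \in unitmx by rewrite unitmx_mul uT uL.
transitivity (`|\det (T (delta_mx 0 i) *m L)| * intRn (fun x => f (x *m (T (delta_mx 0 i) *m L)))).
  rewrite det_mulmx dT mul1r; congr (_ * _).
  rewrite -[RHS](@linear_change_ublock n 1 (- delta_mx 0 i) 1%:M (fun x => f (x *m (T (delta_mx 0 i) *m L)))).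
  - rewrite det1 mulr1 normr1 mul1r; apply: eq_intRn => x.
    by rewrite {1}EL !mulmxA.
  - by move=> h _; rewrite det1 normr1 mul1r; apply: eq_intRn => x; rewrite mulmx1.
  - exact: oner_neq0.
  - exact: unitmx1.
  - exact: cs_linear.
apply: pivot => //.
rewrite -[L](@submxK R 1 n 1 n) /T (@mulmx_block R 1 n 1 n 1 n) block_mxKul !mul1mx.
rewrite mxE a0 add0r mxE (bigD1 i)//= mxE !eqxx mul1r big1 ?addr0// => j ji.
by rewrite mxE eqxx (negbTE ji) mul0r.
Qed.

End LinearChange.

(** * Mean value theorem on boxes and differentiability from continuous partial derivatives *)

Section Calculus.
Variable R : realType.

Lemma line_quotient n (f : 'rV[R]_n -> R) p v t :
  (fun h : R => h^-1 *: (((fun t => f (p + t *: v)) \o shift t) (h *: 1) - f (p + t *: v))) =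
  (fun h => h^-1 *: ((f \o shift (p + t *: v)) (h *: v) - f (p + t *: v))).
Proof.
apply/funext => h /=; congr (_ *: (f _ - _)).
have -> : h *: (1 : R) = h by exact: mulr1.
by rewrite scalerDl addrCA.
Qed.

Lemma is_derive_line n (f : 'rV[R]_n -> R) p v t : derivable f (p + t *: v) v ->
  is_derive t (1 : R) (fun t => f (p + t *: v)) ('D_v f (p + t *: v)).
Proof.
move=> df; have E := line_quotient f p v t.
by split; [rewrite /derivable E|rewrite /derive E].
Qed.

Lemma MVT_line n (f : 'rV[R]_n -> R) p v s :
  (forall t, Num.min 0 s <= t <= Num.max 0 s -> derivable f (p + t *: v) v) ->
  exists2 t, Num.min 0 s <= t <= Num.max 0 s & f (p + s *: v) - f p = s * 'D_v f (p + t *: v).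
Proof.
move=> df.
have dg t : Num.min 0 s <= t <= Num.max 0 s ->
    is_derive t (1 : R) (fun t => f (p + t *: v)) ('D_v f (p + t *: v)).
  by move=> /df; exact: is_derive_line.
have cg a b : Num.min 0 s <= a -> b <= Num.max 0 s ->
    {within `[a, b], continuous (fun t => f (p + t *: v))}.
  move=> ha hb; apply: derivable_within_continuous => t; rewrite in_itv/= => /andP[h1 h2].
  by have [] := dg t; first by rewrite (le_trans ha) ?(le_trans _ hb).
have [s0|s0|->] := ltgtP s 0.
- have mE : Num.min 0 s = s by rewrite min_r ?ltW.
  have ME : Num.max 0 s = 0 by rewrite max_l ?ltW.
  rewrite mE ME in dg cg *.
  have [t|t ht] := @MVT R (fun t => f (p + t *: v)) (fun t => 'D_v f (p + t *: v)) s 0 s0 _ (cg s 0 (lexx _) (lexx _)).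
    by rewrite in_itv/= => /andP[h1 h2]; apply: dg; rewrite !ltW.
  move: ht; rewrite in_itv/= => /andP[h1 h2] E; exists t; first by rewrite !ltW.
  by apply: oppr_inj; rewrite opprB -mulNr -[- s]sub0r mulrC -E scale0r addr0.
- have mE : Num.min 0 s = 0 by rewrite min_l ?ltW.
  have ME : Num.max 0 s = s by rewrite max_r ?ltW.
  rewrite mE ME in dg cg *.
  have [t|t ht] := @MVT R (fun t => f (p + t *: v)) (fun t => 'D_v f (p + t *: v)) 0 s s0 _ (cg 0 s (lexx _) (lexx _)).
    by rewrite in_itv/= => /andP[h1 h2]; apply: dg; rewrite !ltW.
  move: ht; rewrite in_itv/= => /andP[h1 h2] E; exists t; first by rewrite !ltW.
  by move: E; rewrite subr0 scale0r addr0 mulrC.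
- by exists 0; rewrite ?minxx ?maxxx ?lexx// scale0r addr0 subrr mul0r.
Qed.

Lemma ball_rVP n (x y : 'rV[R]_n) r : 0 < r ->
  ball x r y <-> forall i, `|x 0 i - y 0 i| < r.
Proof.
move=> r0; split=> [[_ h] i|h]; first exact: (h 0 i).
by split=> // i j; rewrite ord1; exact: h.
Qed.

Lemma deltaE n (i j : 'I_n) (R' : nzRingType) : (delta_mx 0 i : 'rV[R']_n) 0 j = (j == i)%:R.
Proof. by rewrite mxE eqxx. Qed.

(** The coordinates of a are replaced by those of b one at a time. Balls of row vectors are cubes,
    so that all intermediate points stay in the ball. *)
Lemma MVT_box n (f : 'rV[R]_n -> R) x r a b : 0 < r ->
  (forall z, ball x r z -> forall i, derivable f z 'e_i) ->
  ball x r a -> ball x r b ->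
  exists xi : 'I_n -> 'rV[R]_n,
    (forall i, ball x r (xi i)) /\
    f b - f a = \sum_i (b 0 i - a 0 i) * 'D_('e_i) f (xi i).
Proof.
move=> r0 df ba bb.
pose mix (k : nat) : 'rV[R]_n := \row_j if (j < k)%N then b 0 j else a 0 j.
have key (i : 'I_n) : exists xi, ball x r xi /\
    f (mix i.+1) - f (mix i) = (b 0 i - a 0 i) * 'D_('e_i) f xi.
  have E : mix i.+1 = mix i + (b 0 i - a 0 i) *: 'e_i.
    apply/rowP => j; rewrite !mxE eqxx /= ltnS; have [->|ji] := eqVneq j i.
      by rewrite leqnn ltnn mulr1 addrC subrK.
    by rewrite mulr0 addr0 leq_eqVlt -(inj_eq val_inj) in ji *; rewrite (negbTE ji).
  have inb t : Num.min 0 (b 0 i - a 0 i) <= t <= Num.max 0 (b 0 i - a 0 i) ->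
      ball x r (mix i + t *: 'e_i).
    move=> ht; apply/ball_rVP => // j; rewrite !mxE eqxx /=.
    move/(ball_rVP _ _ r0) : ba => /(_ j); move/(ball_rVP _ _ r0) : bb => /(_ j).
    have [->|ji] := eqVneq j i; last by rewrite mulr0 addr0; case: ifP.
    rewrite ltnn mulr1; move: ht; rewrite ge_min le_max !ltr_norml.
    by case/andP => /orP[?|?] /orP[?|?] /andP[? ?] /andP[? ?]; apply/andP; split; lra.
  rewrite E; have [t ht ->] := @MVT_line _ f (mix i) 'e_i (b 0 i - a 0 i) (fun t ht => df _ (inb t ht) i).
  by exists (mix i + t *: 'e_i); split => //; exact: inb.
have [xi hxi] := choice key; exists xi; split; first by move=> i; have [] := hxi i.
have -> : f b - f a = \sum_(0 <= k < n) (f (mix k.+1) - f (mix k)).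
  rewrite telescope_sumr//; congr (f _ - f _); apply/rowP => j; rewrite mxE//.
  by rewrite ltn_ord.
by rewrite big_mkord; apply: eq_bigr => i _; have [_ ->] := hxi i.
Qed.

Definition lform n (c : 'I_n -> R) (x : 'rV[R]_n) : R := \sum_i x 0 i * c i.

Lemma lform_is_linear n c : linear (@lform n c).
Proof.
move=> a x y; rewrite /lform /GRing.scale/= mulr_sumr -big_split/=; apply: eq_bigr => i _.
by rewrite !mxE mulrDl mulrA.
Qed.

HB.instance Definition _ n c := GRing.isLinear.Build R 'rV[R]_n R _ (@lform n c) (@lform_is_linear n c).

Lemma continuous_lform n c : continuous (@lform n c).
Proof.
have cM := @continuous_mulmxr R n 1 (\col_i c i).
have -> : @lform n c = (fun x => (x *m (\col_i c i)) 0 0).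
  by apply/funext => x; rewrite mxE; apply: eq_bigr => i _; rewrite mxE.
exact: (continuousC cM (@coord_continuous R 1 1 0 0)).
Qed.

Lemma C1_diff n (f : 'rV[R]_n -> R) x :
  (\forall z \near x, forall i, derivable f z 'e_i) ->
  (forall i, {for x, continuous ('D_('e_i) f)}) ->
  differentiable f x /\ 'd f x = lform (fun i => 'D_('e_i) f x) :> ('rV[R]_n -> R).
Proof.
move=> df cdf; set c := fun i => _.
have E : f \o shift x = cst (f x) + lform c +o_ (0 : 'rV[R]_n) id.
  apply/eqaddoP => e e0.
  (* Each of the n coordinates contributes at most [e / (n + 1)] times the norm of h; the
     denominator n + 1 instead of n covers dimension 0. *)
  have n0 : 0 < n%:R + 1 :> R by rewrite ltr_wpDl.
  have : \forall z \near x, forall i, `|c i - 'D_('e_i) f z| < e / (n%:R + 1).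
    apply: (@filter_forall _ _ (fun i z => `|c i - 'D_('e_i) f z| < e / (n%:R + 1)) (nbhs x)) => i.
    have /(@cvgrPdist_lt _ _ _ (nbhs x)) := cdf i; apply.
    by rewrite divr_gt0.
  move=> H.
  have /nbhs_ballP[r /= r0 hr] : nbhs x [set z | (forall i, derivable f z 'e_i) /\
      forall i, `|c i - 'D_('e_i) f z| < e / (n%:R + 1)] by exact: filterI df H.
  apply/nbhs_ballP; exists r => // h; rewrite -ball_normE /= sub0r normrN => hr0.
  have bh : ball x r (h + x).
    by rewrite -ball_normE /= opprD addrCA subrr addr0 normrN.
  have bx : ball x r x by exact: ballxx.
  have [xi [hxi Exi]] := @MVT_box n f x r x (h + x) r0 (fun z hz => (hr z hz).1) bx bh.
  rewrite -[X in `|X|]/(f (h + x) - (f x + lform c h)) opprD addrA Exi.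
  rewrite /lform -sumrB (le_trans (ler_norm_sum _ _ _))//.
  apply: (@le_trans _ _ (\sum_(i < n) (e / (n%:R + 1)) * `|h|)).
    apply: ler_sum => i _; rewrite mxE addrK -mulrBr normrM mulrC.
    apply: ler_pM => //; last exact: rV_coord_le.
    by rewrite distrC ltW//; have [_] := hr _ (hxi i); apply.
  rewrite -mulr_suml sumr_const card_ord; apply: ler_wpM2r => //.
  by rewrite -[(e / _) *+ n]mulr_natr mulrAC ler_pdivrMr// ler_pM2l// lerDl.
have dE := diff_unique (@continuous_lform n c) E.
by split => //; apply/diff_locallyP; rewrite dE; split => //; exact: continuous_lform.
Qed.

End Calculus.

(** * Functions of class C^k and smooth functions *)

Section Smooth.
Variable R : realType.

(** [smooth_on] quantifies over lists of partial derivatives; grading by the order of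
    differentiation lets products and compositions be treated by induction on k. *)
Fixpoint Ck (k : nat) n (U : set 'rV[R]_n) (f : 'rV[R]_n -> R) : Prop :=
  (forall x, U x -> {for x, continuous f}) /\
  match k with
  | 0 => True
  | k'.+1 => forall i, (forall x, U x -> derivable f x 'e_i) /\ Ck k' U ('D_('e_i) f)
  end.

Lemma Ck_cont k n (U : set 'rV[R]_n) f x : Ck k U f -> U x -> {for x, continuous f}.
Proof. by case: k => [|k] [+ _]; apply. Qed.

Lemma CkS k n (U : set 'rV[R]_n) f : Ck k.+1 U f -> Ck k U f.
Proof.
elim: k f => [|k IH] f [cf df]; first by [].
by split => // i; have [d1 d2] := df i; split => //; exact: IH.
Qed.

Lemma Ck_derive k n (U : set 'rV[R]_n) f i : Ck k.+1 U f -> Ck k U ('D_('e_i) f).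
Proof. by move=> [_ /(_ i)[]]. Qed.

Lemma pderiv_rcons n l (i : 'I_n) (f : 'rV[R]_n -> R) :
  pderiv (rcons l i) f = pderiv l ('D_('e_i) f).
Proof. by rewrite /pderiv foldr_rcons. Qed.

Lemma smooth_onP n (U : set 'rV[R]_n) f : smooth_on U f <-> forall k, Ck k U f.
Proof.
split=> [sf k|Cf l].
  elim: k f sf => [|k IH] f sf; first by split => // x /(sf [::])[].
  split=> [x /(sf [::])[]//|i]; split; first by move=> x /(sf [::])[].
  by apply: IH => l x Ux; have := sf (rcons l i) x Ux; rewrite pderiv_rcons.
elim/last_ind: l f Cf => [|l i IH] f Cf x Ux.
  by split=> [|i]; [exact: (Ck_cont (Cf 0%N))|have [_ /(_ i)[+ _]] := Cf 1%N; apply].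
rewrite pderiv_rcons; apply: IH => // k; exact: Ck_derive (Cf k.+1).
Qed.

Lemma smooth_on_sub n (U V : set 'rV[R]_n) f : U `<=` V -> smooth_on V f -> smooth_on U f.
Proof. by move=> UV sf l x /UV; exact: sf. Qed.

Section Open.
Variables (n : nat) (U : set 'rV[R]_n).
Hypothesis oU : open U.
Implicit Types f g : 'rV[R]_n -> R.

Lemma near_open x : U x -> \forall z \near x, U z.
Proof. by move=> Ux; exact: open_nbhs_nbhs. Qed.

Lemma eq_on_near f g x : (forall z, U z -> f z = g z) -> U x -> \forall z \near x, f z = g z.
Proof. by move=> fg Ux; apply: (filterS _ (near_open Ux)) => z; exact: fg. Qed.

Lemma eq_on_derive f g x (i : 'I_n) : (forall z, U z -> f z = g z) -> U x ->
  derivable f x 'e_i -> derivable g x 'e_i /\ 'D_('e_i) g x = 'D_('e_i) f x.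
Proof.
move=> fg Ux df.
have H := near_eq_is_derive (eq_on_near fg Ux) (derivableP df).
by split; [exact: (@ex_derive _ _ _ _ _ _ _ H)|exact: (@derive_val _ _ _ _ _ _ _ H)].
Qed.

Lemma eq_on_cont f g x : (forall z, U z -> f z = g z) -> U x ->
  {for x, continuous f} -> {for x, continuous g}.
Proof.
move=> fg Ux cf; rewrite /prop_for /continuous_at -(fg x Ux); apply: cvg_trans cf.
apply: (@near_eq_cvg _ _ (nbhs x)); near=> z; rewrite fg//; near: z; exact: near_open.
Unshelve. all: end_near. Qed.

Lemma Ck_congr k f g : (forall z, U z -> f z = g z) -> Ck k U f -> Ck k U g.
Proof.
elim: k f g => [|k IH] f g fg [cf df].
  by split=> // x Ux; exact: eq_on_cont (cf x Ux).
split; first by move=> x Ux; exact: eq_on_cont (cf x Ux).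
move=> i; have [d1 d2] := df i; split.
  by move=> x Ux; have [] := eq_on_derive fg Ux (d1 x Ux).
by apply: IH d2 => z Uz; have [_ ->] := eq_on_derive fg Uz (d1 z Uz).
Qed.

Lemma Ck_cst k (c : R) : Ck k U (fun=> c).
Proof.
elim: k c => [|k IH] c; split => //; try by move=> x _; exact: cst_continuous.
move=> i; split; first by move=> x _; exact: derivable_cst.
by apply: (@Ck_congr _ (fun=> 0)) => // z _; rewrite derive_cst.
Qed.

Lemma CkD k f g : Ck k U f -> Ck k U g -> Ck k U (fun x => f x + g x).
Proof.
elim: k f g => [|k IH] f g [cf df] [cg dg]; split => //.
- by move=> x Ux; exact: (continuousD (cf x Ux) (cg x Ux)).
- by move=> x Ux; exact: (continuousD (cf x Ux) (cg x Ux)).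
move=> i; have [f1 f2] := df i; have [g1 g2] := dg i; split.
  by move=> x Ux; exact: (derivableD (f1 x Ux) (g1 x Ux)).
apply: Ck_congr (IH _ _ f2 g2) => z Uz.
by rewrite (deriveD (f1 z Uz) (g1 z Uz)).
Qed.

Lemma CkM k f g : Ck k U f -> Ck k U g -> Ck k U (fun x => f x * g x).
Proof.
elim: k f g => [|k IH] f g Cf Cg; have [cf df] := Cf; have [cg dg] := Cg; split => //.
- by move=> x Ux; exact: (continuousM (cf x Ux) (cg x Ux)).
- by move=> x Ux; exact: (continuousM (cf x Ux) (cg x Ux)).
move=> i; have [f1 f2] := df i; have [g1 g2] := dg i; split.
  by move=> x Ux; exact: (derivableM (f1 x Ux) (g1 x Ux)).
apply: Ck_congr (CkD (IH _ _ (CkS Cf) g2) (IH _ _ (CkS Cg) f2)) => z Uz.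
by rewrite (deriveM (f1 z Uz) (g1 z Uz)).
Qed.

Lemma Ck_sum k I (r : seq I) (P : pred I) (F : I -> 'rV[R]_n -> R) :
  (forall i, P i -> Ck k U (F i)) -> Ck k U (fun x => \sum_(i <- r | P i) F i x).
Proof.
move=> CF; elim: r => [|i r IH].
  by apply: Ck_congr (Ck_cst k 0) => z _; rewrite big_nil.
case Pi: (P i); last by apply: Ck_congr IH => z _; rewrite big_cons Pi.
by apply: Ck_congr (CkD (CF i Pi) IH) => z _; rewrite big_cons Pi.
Qed.

Lemma Ck_prod k I (r : seq I) (P : pred I) (F : I -> 'rV[R]_n -> R) :
  (forall i, P i -> Ck k U (F i)) -> Ck k U (fun x => \prod_(i <- r | P i) F i x).
Proof.
move=> CF; elim: r => [|i r IH].
  by apply: Ck_congr (Ck_cst k 1) => z _; rewrite big_nil.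
case Pi: (P i); last by apply: Ck_congr IH => z _; rewrite big_cons Pi.
by apply: Ck_congr (CkM (CF i Pi) IH) => z _; rewrite big_cons Pi.
Qed.

Lemma is_derive_coord (x : 'rV[R]_n) i j :
  is_derive x ('e_i : 'rV[R]_n) (fun z : 'rV[R]_n => z 0 j) ((j == i)%:R).
Proof.
have E : (fun h : R => h^-1 *: (((fun z : 'rV[R]_n => z 0 j) \o shift x) (h *: 'e_i) - x 0 j)) @ 0^' --> ((j == i)%:R : R).
  apply: (@cvg_trans _ ((fun=> (j == i)%:R : R) @ 0^')); last exact: cvg_cst.
  apply: near_eq_cvg; near=> h => /=.
  rewrite !mxE eqxx/= addrK /GRing.scale/= mulrA mulVf ?mul1r//.
  by near: h; exact: nbhs_dnbhs_neq.
by split; [apply/cvg_ex; eexists; exact: E|exact: cvg_lim E].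
Unshelve. all: end_near. Qed.

Lemma Ck_coord k j : Ck k U (fun z => z 0 j).
Proof.
case: k => [|k]; split => //; try by move=> x _; exact: coord_continuous.
move=> i; split; first by move=> x _; exact: (@ex_derive _ _ _ _ _ _ _ (is_derive_coord x i j)).
apply: Ck_congr (Ck_cst k (j == i)%:R) => z _.
by rewrite (@derive_val _ _ _ _ _ _ _ (is_derive_coord z i j)).
Qed.

Lemma Ck_diff k f x : Ck k.+1 U f -> U x ->
  differentiable f x /\ 'd f x = lform (fun i => 'D_('e_i) f x) :> ('rV[R]_n -> R).
Proof.
move=> [cf df] Ux; apply: C1_diff.
  by apply: (filterS _ (near_open Ux)) => z Uz i; have [+ _] := df i; apply.
by move=> i; have [_ h] := df i; exact: Ck_cont h Ux.
Qed.

(** The family [G] lists a function of one variable together with all its derivatives, so that the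
    induction on k can pass from [G] to its shift. *)
Lemma Ck_comp1 k (G : nat -> R -> R) (I : set R) f :
  (forall j t, I t -> is_derive t (1 : R) (G j) (G j.+1 t)) ->
  (forall x, U x -> I (f x)) -> Ck k U f -> Ck k U (fun x => G 0%N (f x)).
Proof.
move=> dG UI; elim: k G dG => [|k IH] G dG Cf.
  split=> // x Ux; apply: (@continuous_comp _ _ _ f (G 0%N)); first exact: Ck_cont Cf Ux.
  apply: differentiable_continuous; apply/derivable1_diffP.
  exact: (@ex_derive _ _ _ _ _ _ _ (dG 0%N _ (UI _ Ux))).
have dGf x : U x -> differentiable (G 0%N) (f x).
  move=> Ux; apply/derivable1_diffP.
  exact: (@ex_derive _ _ _ _ _ _ _ (dG 0%N _ (UI _ Ux))).
have dff x : U x -> differentiable f x by move=> /(Ck_diff Cf)[].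
have dc x : U x -> differentiable (G 0%N \o f) x.
  by move=> Ux; apply: differentiable_comp; [exact: dff|exact: dGf].
split=> [x Ux|i]; first exact/differentiable_continuous/dc.
split=> [x Ux|]; first exact/diff_derivable/dc.
apply: Ck_congr (CkM (IH (fun j => G j.+1) (fun j => dG j.+1) (CkS Cf)) (Ck_derive i Cf)) => z Uz.
rewrite -[RHS]/('D_('e_i) (G 0%N \o f) z) (deriveE _ (dc z Uz)) (diff_comp (dff z Uz) (dGf z Uz)) /=.
rewrite (deriveE _ (dff z Uz)) [in RHS]diff1E; last exact: dGf.
rewrite /GRing.scale/= mulrC; congr (_ * _).
by rewrite derive1E (@derive_val _ _ _ _ _ _ _ (dG 0%N _ (UI _ Uz))).
Qed.

End Open.

Lemma differentiable_rV n m (phi : 'rV[R]_n -> 'rV[R]_m) x :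
  (forall j, differentiable (fun z => phi z 0 j) x) -> differentiable phi x.
Proof.
move=> dphi; have -> : phi = (fun z => \sum_j phi z 0 j *: 'e_j).
  by apply/funext => z; exact: row_sum_delta.
rewrite (_ : (fun z => _) = \sum_j (fun z => phi z 0 j *: 'e_j)); last first.
  by apply/funext => z; rewrite fct_sumE.
apply: differentiable_sum => j; exact: differentiableZl.
Qed.

Lemma differentiable_entry n m (phi : 'rV[R]_n -> 'rV[R]_m) x j : differentiable phi x ->
  differentiable (fun z => phi z 0 j) x.
Proof.
move=> dphi; apply: (@differentiable_comp _ _ _ _ phi (fun M : 'rV[R]_m => M 0 j)) => //.
exact: differentiable_coord.
Qed.

Lemma derive_coord n m (phi : 'rV[R]_n -> 'rV[R]_m) x v j : differentiable phi x ->
  ('d phi x v) 0 j = 'd (fun z => phi z 0 j) x v.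
Proof.
move=> dphi.
rewrite -deriveE// derive_mx ?mxE; last exact: diff_derivable.
by rewrite deriveE//; exact: differentiable_entry.
Qed.

Lemma jacobianE n m (phi : 'rV[R]_n -> 'rV[R]_m) x i j : differentiable phi x ->
  ('J phi x) i j = 'D_('e_i) (fun z => phi z 0 j) x.
Proof.
move=> dphi; rewrite mxE derive_coord// deriveE//; exact: differentiable_entry.
Qed.

Lemma Ck_comp k n m (U : set 'rV[R]_n) (V : set 'rV[R]_m) (phi : 'rV[R]_n -> 'rV[R]_m) f :
  open U -> open V -> (forall x, U x -> V (phi x)) ->
  (forall j, Ck k U (fun z => phi z 0 j)) -> Ck k V f -> Ck k U (fun x => f (phi x)).
Proof.
move=> oU oV UV; elim: k f => [|k IH] f Cphi Cf.
  split=> // x Ux; apply: (@continuous_comp _ _ _ phi f); last exact: Ck_cont Cf (UV _ Ux).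
  apply: (@cvg_mx R _ (nbhs x) _ 1 m phi (phi x)) => i j; rewrite ord1.
  exact: (Ck_cont (Cphi j) Ux).
have dphi x : U x -> differentiable phi x.
  by move=> Ux; apply: differentiable_rV => j; have [] := Ck_diff oU (Cphi j) Ux.
have df x : U x -> differentiable f (phi x) by move=> /UV /(Ck_diff oV Cf)[].
have dc x : U x -> differentiable (f \o phi) x.
  by move=> Ux; apply: differentiable_comp; [exact: dphi|exact: df].
split=> [x Ux|i]; first exact/differentiable_continuous/dc.
split=> [x Ux|]; first exact/diff_derivable/dc.
have C' j : Ck k U (fun z => phi z 0 j) by exact: CkS.
have H j : Ck k U (fun x => 'D_('e_i) (fun z => phi z 0 j) x * 'D_('e_j) f (phi x)).
  apply: CkM => //; first exact: Ck_derive (Cphi j).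
  exact: IH C' (Ck_derive j Cf).
have Hs := @Ck_sum _ U oU k _ (index_enum 'I_m) predT _ (fun j _ => H j).
apply: (Ck_congr oU _ Hs) => z Uz.
rewrite -[RHS]/('D_('e_i) (f \o phi) z) (deriveE _ (dc z Uz)) (diff_comp (dphi z Uz) (df z Uz)) /=.
have [_ ->] := Ck_diff oV Cf (UV _ Uz).
apply: eq_bigr => j _; congr (_ * _).
rewrite derive_coord; last exact: dphi.
by rewrite deriveE//; have [] := Ck_diff oU (Cphi j) Uz.
Qed.

End Smooth.

(** * Uniform Lipschitz bounds and the tent function *)

Section ChangeOfVariables.
Variable R : realType.

Lemma lipschitz_near n m (V : set 'rV[R]_n) (psi : 'rV[R]_n -> 'rV[R]_m) y :
  open V -> (forall j, Ck 1 V (fun z => psi z 0 j)) -> V y ->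
  exists r L, [/\ 0 < r, 0 <= L & forall z z', ball y r z -> ball y r z' ->
    `|psi z - psi z'| <= L * `|z - z'|].
Proof.
move=> oV Cp Vy.
have H : \forall z \near y, V z /\ forall ij : 'I_n * 'I_m,
    `|'D_('e_ij.1) (fun z => psi z 0 ij.2) y - 'D_('e_ij.1) (fun z => psi z 0 ij.2) z| < 1.
  apply: (@filterI _ (nbhs y)); first exact: near_open.
  apply: (@filter_forall _ _ (fun ij : 'I_n * 'I_m => fun z =>
    `|'D_('e_ij.1) (fun z => psi z 0 ij.2) y - 'D_('e_ij.1) (fun z => psi z 0 ij.2) z| < 1) (nbhs y)) => ij.
  have c := Ck_cont (Ck_derive ij.1 (Cp ij.2)) Vy.
  by have /(@cvgrPdist_lt _ _ _ (nbhs y)) := c; apply.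
have /nbhs_ballP[r /= r0 hr] := H.
pose B j i := `|'D_('e_i) (fun z => psi z 0 j) y| + 1.
have B0 j i : 0 <= B j i by rewrite addr_ge0.
exists r, (\sum_j \sum_i B j i); split => //.
  by rewrite sumr_ge0// => j _; rewrite sumr_ge0.
move=> z z' bz bz'; apply: rV_norm_le.
  by rewrite mulr_ge0// sumr_ge0// => j _; rewrite sumr_ge0.
move=> j; rewrite !mxE.
have [xi [hxi ->]] := @MVT_box R n (fun z => psi z 0 j) y r z' z r0
  (fun w hw i => ((Cp j).2 i).1 w (hr w hw).1) bz' bz.
rewrite (le_trans (ler_norm_sum _ _ _))// (bigD1 j)//= mulrDl.
apply: (@le_trans _ _ ((\sum_i B j i) * `|z - z'|)); last first.
  by rewrite lerDl mulr_ge0// sumr_ge0// => k _; rewrite sumr_ge0.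
rewrite mulr_suml; apply: ler_sum => i _; rewrite normrM mulrC; apply: ler_pM => //.
  have [_ /(_ (i, j))/=] := hr _ (hxi i); rewrite distrC => h.
  rewrite -lerBlDl (le_trans _ (ltW h))//.
  exact: lerB_dist.
by have := rV_coord_le (z - z') i; rewrite !mxE.
Qed.

(** A single number A serves as Lipschitz constant and as inverse of a radius: near each point all
    large A have both properties, and compactness, in its near covering form along A tending to
    infinity, makes the choice uniform. *)
Lemma lipschitz_compact n m (V F : set 'rV[R]_n) (psi : 'rV[R]_n -> 'rV[R]_m) :
  open V -> (forall j, Ck 1 V (fun z => psi z 0 j)) -> compact F -> F `<=` V ->
  exists A : R, 0 < A /\ forall z y, F z -> `|z - y| <= A^-1 ->
    V y /\ `|psi z - psi y| <= A * `|z - y|.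
Proof.
move=> oV Cp cF FV.
pose P (A : R) (z : 'rV[R]_n) := 0 < A /\ forall y, `|z - y| <= A^-1 ->
    V y /\ `|psi z - psi y| <= A * `|z - y|.
suff : \forall A \near +oo, F `<=` P A.
  move=> H; have [A [hA A0]] : exists A, F `<=` P A /\ 0 < A.
    near (pinfty_nbhs R) => A; exists A; split; first by near: A.
    by near: A; apply: nbhs_pinfty_gt; rewrite num_real.
  by exists A; split => // z y /hA [_]; apply.
have /compact_near_coveringP := cF; apply => x Fx.
have [r [L [r0 L0 hL]]] := lipschitz_near oV Cp (FV _ Fx).
have /nbhs_ballP[r' /= r'0 hr'] : nbhs x V by exact: near_open (FV _ Fx).
pose d := Num.min r r' / 2.
have d0 : 0 < d by rewrite divr_gt0// lt_min r0.
exists (ball x d, [set A | d^-1 < A /\ L < A]).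
  split; first exact: nbhsx_ballx.
  by apply: filterI; apply: nbhs_pinfty_gt; rewrite num_real.
move=> [z A] [/= bz [hA LA]].
have A0 : 0 < A by rewrite (lt_trans _ hA)// invr_gt0.
split=> // y zy.
have dd : d + d = Num.min r r' by rewrite /d -splitr.
have by' : ball x (Num.min r r') y.
  rewrite -dd; apply: (ball_triangle bz); rewrite -ball_normE /=.
  by rewrite (le_lt_trans zy)// -[ltRHS]invrK ltf_pV2 ?posrE ?invr_gt0.
have bz' : ball x (Num.min r r') z by apply: le_ball bz; rewrite -dd lerDl ltW.
split; first by apply: hr'; apply: le_ball by'; rewrite ge_min lexx orbT.
apply: (@le_trans _ _ (L * `|z - y|)); last by rewrite ler_wpM2r// ltW.
by apply: hL; [apply: le_ball bz'|apply: le_ball by']; rewrite ge_min lexx.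
Unshelve. all: end_near. Qed.

Lemma continuous_zero_ext (T : topologicalType) (W K : set T) (g : T -> R) :
  open W -> closed K -> K `<=` W -> (forall x, W x -> {for x, continuous g}) ->
  (forall x, ~ K x -> g x = 0) -> continuous g.
Proof.
move=> oW cK KW cg g0 x; have [/KW|nK] := pselect (K x); first exact: cg.
have oK : open (~` K) by rewrite openC.
have nx : nbhs x (~` K) by exact: open_nbhs_nbhs.
rewrite /continuous_at (g0 _ nK).
apply: (@cvg_trans _ ((fun=> 0 : R) @ x)); last exact: cvg_cst.
apply: (@near_eq_cvg _ _ (nbhs x)); near=> z; rewrite g0//; near: z; exact: nx.
Unshelve. all: end_near. Qed.

Lemma cs_of_compact n (K : set 'rV[R]_n) (f : 'rV[R]_n -> R) : compact K -> continuous f ->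
  (forall x, ~ K x -> f x = 0) -> cs f.
Proof.
move=> cK cf f0; split => //; have [M [_ HM]] := compact_bounded cK.
exists (M + 1) => x h; apply: f0 => Kx.
by have := HM (M + 1); rewrite ltrDl => /(_ ltr01 x Kx) /=; rewrite leNgt h.
Qed.

(** The mollifier in the proof of the change of variables formula, where continuity of the bump is
    enough. *)
Definition bmp n (x : 'rV[R]_n) : R := Num.max 0 (1 - `|x|).

Lemma bmp_ge0 n (x : 'rV[R]_n) : 0 <= bmp x. Proof. by rewrite le_max lexx. Qed.

Lemma bmp_le1 n (x : 'rV[R]_n) : bmp x <= 1.
Proof. by rewrite /bmp ge_max ler01 /= gerBl. Qed.

Lemma bmp_eq0 n (x : 'rV[R]_n) : 1 <= `|x| -> bmp x = 0.
Proof. by move=> h; rewrite /bmp max_l// subr_le0. Qed.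

Lemma continuous_bmp n : continuous (@bmp n).
Proof.
move=> x; apply: (@continuous_max _ _ (cst 0) (fun x : 'rV[R]_n => 1 - `|x|)).
  exact: cst_continuous.
have c1 : {for x, continuous (fun _ : 'rV[R]_n => 1 : R)} by exact: cst_continuous.
have c2 : {for x, continuous (fun x : 'rV[R]_n => `|x|)} by exact: norm_continuous.
exact: (continuousB c1 c2).
Qed.

Lemma cs_bmp n : cs (@bmp n).
Proof. by split; [exact: continuous_bmp|exists 1 => x /ltW; exact: bmp_eq0]. Qed.

Lemma Rintegral_gt0 (f : R -> R) t0 : lebesgue_measure.-integrable setT (EFin \o f) ->
  continuous f -> (forall t, 0 <= f t) -> 0 < f t0 -> 0 < \int[lebesgue_measure]_t f t.
Proof.
move=> intf cf f0 ft0.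
have h0 : 0 < f t0 / 2 by rewrite divr_gt0.
have /cvgrPdist_lt/(_ _ h0)/nbhs_ballP[r /= r0 hr] := cf t0.
have hI t : t \in `[t0 - r / 2, t0 + r / 2] -> f t0 / 2 <= f t.
  rewrite in_itv/= => /andP[h1 h2].
  have : ball t0 r t by rewrite /ball/= ltr_norml; apply/andP; split; lra.
  by move=> /hr; rewrite ltr_norml => /andP[h3 h4]; lra.
pose I : set R := `[t0 - r / 2, t0 + r / 2]%classic.
have m1 : measurable I by exact: measurable_itv.
have E : (\int[lebesgue_measure]_(t in I) (f t0 / 2)%:E <= \int[lebesgue_measure]_t (f t)%:E)%E.
  apply: (@le_trans _ _ (\int[lebesgue_measure]_(t in I) (f t)%:E)%E).
    apply: ge0_le_integral => //.
    - by move=> x _; rewrite lee_fin ltW.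
    - apply/measurable_EFinP/measurable_funTS; exact: continuous_measurable_fun.
  apply: ge0_subset_integral => //.
  - apply/measurable_EFinP; exact: continuous_measurable_fun.
  - by move=> x _; rewrite lee_fin.
move: E; rewrite integral_cst//= /I lebesgue_measure_itv/= lte_fin.
have -> : t0 - r / 2 < t0 + r / 2 by lra.
rewrite -EFinB -EFinM => E.
have fi : (\int[lebesgue_measure]_t (f t)%:E)%E \is a fin_num by exact: integrable_fin_num.
rewrite /Rintegral; move: E; rewrite -(fineK fi) lee_fin; apply: lt_le_trans.
by rewrite mulr_gt0//; lra.
Qed.

Lemma intRn_gt0 n (f : 'rV[R]_n -> R) x0 : dec f -> (forall x, 0 <= f x) -> 0 < f x0 ->
  0 < intRn f.
Proof.
elim: n f x0 => [|n IH] f x0 df f0 fx.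
  by rewrite /=; rewrite (_ : 0 = x0)//; apply/rowP => -[].
rewrite intRnS; apply: (@Rintegral_gt0 _ (x0 0 0)).
- exact: dec_integrable.
- exact: continuous_intRn_slice.
- by move=> t; apply: intRn_ge0.
- by apply: (IH _ (\row_j x0 0 (lift ord0 j))) => //; [exact: dec_slice|rewrite cons_rowE].
Qed.

Lemma intRn_bmp_gt0 n : 0 < intRn (@bmp n).
Proof.
apply: (@intRn_gt0 _ _ 0); [exact/cs_dec/cs_bmp|exact: bmp_ge0|].
by rewrite /bmp normr0 subr0 max_r.
Qed.

End ChangeOfVariables.

(** * Change of variables under diffeomorphisms *)

Section ChangeOfVariables.
Variable R : realType.

Lemma Ck_det k n m (U : set 'rV[R]_n) (M : 'rV[R]_n -> 'M[R]_m) : open U ->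
  (forall i j, Ck k U (fun x => M x i j)) -> Ck k U (fun x => \det (M x)).
Proof.
move=> oU CM; rewrite /determinant; apply: (Ck_sum oU) => s _; apply: (CkM oU).
  exact: Ck_cst.
by apply: (Ck_prod oU) => i _; exact: CM.
Qed.

Lemma Ck_det_jacobian k n (U : set 'rV[R]_n) (phi : 'rV[R]_n -> 'rV[R]_n) : open U ->
  (forall j, Ck k.+1 U (fun z => phi z 0 j)) -> Ck k U (fun x => \det ('J phi x)).
Proof.
move=> oU Cphi; apply: Ck_det => // i j.
apply: (Ck_congr oU _ (Ck_derive i (Cphi j))) => z Uz; rewrite jacobianE//.
by apply: differentiable_rV => l; have [] := Ck_diff oU (Cphi l) Uz.
Qed.

Lemma intRn_rescale n (g : 'rV[R]_n -> R) (a : 'rV[R]_n) (N : R) : 0 < N -> cs g ->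
  N ^+ n * intRn g = intRn (fun u => g (N^-1 *: u + a)).
Proof.
move=> N0 csg.
have uL : ((N^-1)%:M : 'M[R]_n) \in unitmx.
  by rewrite unitmxE det_scalar unitfE expf_neq0// invr_neq0// gt_eqF.
have := @intRn_linear R n (N^-1)%:M (fun z => g (z + a)) uL (cs_translate a csg).
rewrite intRn_translate// det_scalar => <-.
rewrite ger0_norm ?exprn_ge0 ?invr_ge0 ?ltW// exprVn mulrA divff ?mul1r ?expf_neq0 ?gt_eqF//.
by apply: eq_intRn => u; rewrite mul_mx_scalar.
Qed.

Lemma diff_compE (U V W : normedModType R) (f : U -> V) (g : V -> W) x v :
  differentiable f x -> differentiable g (f x) ->
  'd (g \o f) x v = 'd g (f x) ('d f x v).
Proof. by move=> df dg; rewrite diff_comp. Qed.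

Lemma invn_cvg0 (N : nat -> R) : (forall k, 0 < N k) -> N k @[k --> \oo] --> +oo ->
  (N k)^-1 @[k --> \oo] --> (0 : R).
Proof. by move=> N0 Noo; apply/gtr0_cvgV0; [exact: nearW|exact: Noo]. Qed.

Lemma quotient_cvg n m (phi : 'rV[R]_n -> 'rV[R]_m) x u (N : nat -> R) :
  differentiable phi x -> (forall k, 0 < N k) -> N k @[k --> \oo] --> +oo ->
  N k *: (phi ((N k)^-1 *: u + x) - phi x) @[k --> \oo] --> u *m 'J phi x.
Proof.
move=> dphi N0 Noo; rewrite -deriveEjacobian//.
have /cvg_ex [l Hl] := @diff_derivable _ _ _ phi x u dphi.
have <- : l = 'D_u phi x by apply/esym/cvg_lim.
have H0 : (N k)^-1 @[k --> \oo] --> (0 : R)^'.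
  move=> B /= nB; have [M _ HM] := invn_cvg0 N0 Noo nB.
  exists M => // k Mk; apply: (HM k Mk).
  have h : (N k)^-1 != 0 by rewrite invr_neq0// gt_eqF.
  by first [exact: h|exact/eqP].
have := cvg_comp _ _ H0 Hl; rewrite (_ : _ \o _ = fun k => N k *: (phi ((N k)^-1 *: u + x) - phi x))//.
by apply/funext => k /=; rewrite invrK.
Qed.

(* The mass of [G x * b (N (phi x - y))] is computed in both orders, where b is a bump:
   integrating in y first gives the left-hand side; integrating in x first, phi is
   replaced by its differential as N grows, and the linear case applies. *)
Lemma change_of_variables n (U V F : set 'rV[R]_n) (phi psi : 'rV[R]_n -> 'rV[R]_n)
    (f : 'rV[R]_n -> R) :
  open U -> open V ->
  (forall j, Ck 2 U (fun z => phi z 0 j)) -> (forall j, Ck 2 V (fun z => psi z 0 j)) ->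
  (forall x, U x -> V (phi x) /\ psi (phi x) = x) ->
  (forall y, V y -> U (psi y) /\ phi (psi y) = y) ->
  compact F -> F `<=` V -> continuous f -> (forall y, ~ F y -> f y = 0) ->
  intRn (fun x => if `[< U x >] then f (phi x) * `|\det ('J phi x)| else 0) = intRn f.
Proof.
move=> oU oV Cphi Cpsi phiK psiK cF FV cf f0.
set G := fun x => _.
have dphi x : U x -> differentiable phi x.
  by move=> Ux; apply: differentiable_rV => j; have [] := Ck_diff oU (Cphi j) Ux.
have dpsi y : V y -> differentiable psi y.
  by move=> Vy; apply: differentiable_rV => j; have [] := Ck_diff oV (Cpsi j) Vy.
pose K := psi @` F.
have GK x : ~ K x -> G x = 0.
  move=> nK; rewrite /G; case: asboolP => // Ux; rewrite f0 ?mul0r// => Fx.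
  by apply: nK; exists (phi x) => //; have [] := phiK _ Ux.
have cpsi y : V y -> {for y, continuous psi} by move=> /dpsi /differentiable_continuous.
have cphi x : U x -> {for x, continuous phi} by move=> /dphi /differentiable_continuous.
have cK : compact K.
  apply: continuous_compact => //; apply: continuous_in_subspaceT => y /set_mem /FV; exact: cpsi.
have KU : K `<=` U by move=> _ [y /FV /psiK[+ _] <-].
have clK : closed K by apply: compact_closed.
have cG0 x : U x -> {for x, continuous G}.
  move=> Ux; apply: (@eq_on_cont _ _ U oU (fun x => f (phi x) * `|\det ('J phi x)|)) => //.
    by move=> z Uz; rewrite /G; case: asboolP.
  have c1 : {for x, continuous (fun x => f (phi x))}.
    by apply: (@continuous_comp _ _ _ phi f); [exact: cphi|exact: cf].
  have CJ : Ck 1 U (fun x => \det ('J phi x)).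
    exact: Ck_det_jacobian oU Cphi.
  have c2 : {for x, continuous (fun x => `|\det ('J phi x)|)}.
    by apply: (@continuous_comp 'rV[R]_n R R (fun x => \det ('J phi x)) Num.norm); [exact: Ck_cont CJ Ux|exact: norm_continuous].
  exact: (continuousM c1 c2).
have cG : continuous G by exact: (continuous_zero_ext oU clK KU cG0 GK).
have csG : cs G by exact: cs_of_compact cK cG GK.
have csf : cs f by exact: cs_of_compact cF cf f0.
have [CG [CG0 HG]] := cs_bounded csG.
pose b := @bmp R n.
have csb : cs b by exact: cs_bmp.
pose Kf (N : R) (x y : 'rV[R]_n) := G x * b (N *: (phi x - y)).
have b1 z : `|b z| <= 1 by rewrite ger0_norm ?bmp_ge0// bmp_le1.
have KfG N x y : `|Kf N x y| <= `|G x| by rewrite /Kf normrM ler_piMr.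
have cKf N : continuous (fun q : 'rV[R]_n * 'rV[R]_n => Kf N q.1 q.2).
  apply: (@continuous_zero_ext _ _ (fst @^-1` U) (fst @^-1` K)).
  - by apply: open_comp => // q _; exact: continuous_fst.
  - by apply: closed_comp => // q _; exact: continuous_fst.
  - by move=> q; exact: KU.
  - move=> q Uq.
    have c1 : {for q, continuous (fun q : 'rV[R]_n * 'rV[R]_n => G q.1)}.
      by apply: (@continuous_comp _ _ _ fst G); [exact: continuous_fst|exact: cG].
    have c2 : {for q, continuous (fun q : 'rV[R]_n * 'rV[R]_n => phi q.1)}.
      by apply: (@continuous_comp _ _ _ fst phi); [exact: continuous_fst|exact: cphi].
    have c3 : {for q, continuous (fun q : 'rV[R]_n * 'rV[R]_n => phi q.1 - q.2)}.
      exact: (continuousB c2 (@continuous_snd _ _ q)).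
    have c4 : {for q, continuous (fun q : 'rV[R]_n * 'rV[R]_n => N *: (phi q.1 - q.2))}.
      by apply: (@continuous_comp _ _ _ (fun q : 'rV[R]_n * 'rV[R]_n => phi q.1 - q.2) (fun z : 'rV[R]_n => N *: z)); [exact: c3|exact: scaler_continuous].
    have c5 : {for q, continuous (fun q : 'rV[R]_n * 'rV[R]_n => b (N *: (phi q.1 - q.2)))}.
      by apply: (@continuous_comp _ _ _ (fun q : 'rV[R]_n * 'rV[R]_n => N *: (phi q.1 - q.2)) b); [exact: c4|exact: continuous_bmp].
    exact: (continuousM c1 c5).
  - by move=> q nK; rewrite /Kf GK// mul0r.
have csKf1 N y : cs (Kf N ^~ y).
  apply: (@cs_of_compact _ _ K) => //; last by move=> x nK; rewrite /Kf GK// mul0r.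
  exact: (@continuous_fun2 R _ _ _ (Kf N) y (cKf N)).
have intY N x : 0 < N -> N ^+ n * intRn (Kf N x) = G x * intRn b.
  move=> N0; rewrite /Kf.
  have uL : ((- N)%:M : 'M[R]_n) \in unitmx.
    by rewrite unitmxE det_scalar unitfE expf_neq0// oppr_eq0 gt_eqF.
  have csbl := cs_affine (N *: phi x) uL csb.
  have E : (fun y => b (N *: (phi x - y))) = (fun y => b (y *m (- N)%:M + N *: phi x)).
    by apply/funext => y; rewrite mul_mx_scalar scaleNr scalerBr addrC.
  rewrite intRnZ ?E; last exact: cs_dec.
  rewrite mulrCA; congr (_ * _).
  have := @intRn_linear R n (- N)%:M (fun z => b (z + N *: phi x)) uL (cs_translate _ csb).
  by rewrite intRn_translate// det_scalar => <-; rewrite normrX normrN gtr0_norm.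
have [A [A0 HA]] := lipschitz_compact oV (fun j => CkS (Cpsi j)) cF FV.
have KfP N x y : A <= N -> Kf N x y != 0 ->
    [/\ V y, `|x - psi y| <= A * N^-1 & exists2 z, F z & `|z - y| <= A^-1].
  move=> AN; have N0 : 0 < N by exact: lt_le_trans AN.
  move=> nz; have Kx : K x by apply: contrapT => /GK Gx; move: nz; rewrite /Kf Gx mul0r eqxx.
  case: Kx => z Fz zx; rewrite -zx.
  have [_ pz] := psiK _ (FV _ Fz).
  have zy : `|z - y| <= N^-1.
    rewrite leNgt; apply/negP => h; move: nz; rewrite /Kf -zx pz /b bmp_eq0 ?mulr0 ?eqxx//.
    by rewrite normrZ gtr0_norm// -ler_pdivrMl// mulr1 ltW.
  have zA : `|z - y| <= A^-1 by rewrite (le_trans zy)// lef_pV2 ?posrE.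
  have [Vy hy] := HA _ _ Fz zA; split => //; last by exists z.
  by rewrite (le_trans hy)// ler_wpM2l// ltW.
(* The shift of the index makes [N k] at least A for every k, so that the support estimates [KfP]
   hold for all members of the sequence. *)
pose k0 := (Num.truncn A).+1.
pose N (k : nat) : R := (k + k0)%N%:R.
have AN k : A <= N k.
  by rewrite ltW// (lt_le_trans (truncnS_gt A))// ler_nat leq_addl.
have N0 k : 0 < N k by exact: lt_le_trans (AN k).
have NV k : (N k)^-1 <= A^-1 by rewrite lef_pV2 ?posrE.
have Noo : N k @[k --> \oo] --> +oo.
  exact: (cvg_comp _ _ (cvg_addnr k0) (@cvgr_idn R)).
(* The mass that the bump of width [1 / N k] around y collects. Rescaled around [psi y] it becomes
   an integral over a fixed bounded region, which is where the limit is taken. *)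
pose m k y := N k ^+ n * intRn (Kf (N k) ^~ y).
have mE k y : m k y = intRn (fun u => Kf (N k) ((N k)^-1 *: u + psi y) y).
  exact: intRn_rescale.
have csint k y : cs (fun u => Kf (N k) ((N k)^-1 *: u + psi y) y).
  have uL : (((N k)^-1)%:M : 'M[R]_n) \in unitmx.
    by rewrite unitmxE det_scalar unitfE expf_neq0// invr_neq0// gt_eqF.
  have := cs_affine (psi y) uL (csKf1 (N k) y).
  rewrite (_ : (fun x => _) = (fun u => Kf (N k) ((N k)^-1 *: u + psi y) y))//.
  by apply/funext => u; rewrite mul_mx_scalar.
have intb k y u : `|Kf (N k) ((N k)^-1 *: u + psi y) y| <= (CG * (1 + A ^+ 2) ^+ n) * wt u.
  move: u; apply: cs_bound => u; first by rewrite (le_trans (KfG _ _ _)).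
  move=> Au; apply/eqP; apply: contraTT Au => /(KfP _ _ _ (AN k))[_ + _].
  rewrite addrK normrZ gtr0_norm ?invr_gt0// mulrC ler_pM2r ?invr_gt0//.
  by rewrite leNgt.
pose C1 := CG * (1 + A ^+ 2) ^+ n * pi ^+ n.
have mb k y : `|m k y| <= C1.
  rewrite mE; apply: intRn_norm_le; last exact: intb.
  by have [] := csint k y.
have m0 k y : ~ V y \/ (forall z, F z -> A^-1 < `|z - y|) -> m k y = 0.
  move=> H; rewrite /m (_ : intRn _ = 0) ?mulr0// -[RHS](intRn0 R n).
  apply: eq_intRn => x; apply/eqP; apply: contrapT => /negP /(KfP _ _ _ (AN k))[Vy _ [z Fz zy]].
  case: H => [//|/(_ z Fz)]; by rewrite ltNge zy.
have [B [_ HB]] := compact_bounded cF.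
have mwt k y : `|m k y| <= (C1 * (1 + (B + 1 + A^-1) ^+ 2) ^+ n) * wt y.
  move: y; apply: cs_bound => y; first exact: mb.
  move=> hy; apply: m0; right => z Fz.
  have zB : `|z| <= B + 1 by apply: (HB (B + 1)); rewrite ?ltrDl.
  rewrite distrC (lt_le_trans _ (lerB_dist _ _))// ltrBrDr addrC.
  by rewrite (le_lt_trans _ hy)// lerD2r.
have cm k : continuous (m k).
  move=> y; have c1 : {for y, continuous (fun y => intRn (Kf (N k) ^~ y))}.
    have [CK HCK] := (cs_dec csG).2.
    apply: (@continuous_intRn _ _ n (fun y x => Kf (N k) x y) y CK).
    - by move=> q; have [] := csKf1 (N k) q.
    - by move=> x; exact: (@continuous_fun1 R _ _ _ (Kf (N k)) x (cKf (N k))).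
    - by near=> q; move=> x; exact: le_trans (KfG _ _ _) (HCK x).
  exact: (continuousM (@cst_continuous _ _ (N k ^+ n) y) c1).
have mlim y : m k y @[k --> \oo] --> f y * intRn b.
  have [Vy|nVy] := pselect (V y); last first.
    rewrite (_ : m ^~ y = fun=> 0); last by apply/funext => k; apply: m0; left.
    by rewrite f0 ?mul0r; [exact: cvg_cst|move=> /FV].
  have [Ux px] := psiK _ Vy.
  set J := 'J phi (psi y).
  have uJ : J \in unitmx.
    have E : 'J psi y *m J = 1%:M.
      apply/row_matrixP => i; rewrite row_mul.
      have -> : row i ('J psi y) = 'd psi y 'e_i by rewrite rowE /jacobian mul_rV_lin1.
      rewrite /J /jacobian mul_rV_lin1 row1.
      have dp : differentiable phi (psi y) by exact: dphi.
      transitivity ('d (phi \o psi) y 'e_i).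
        exact: esym (diff_compE _ (dpsi _ Vy) dp).
      rewrite -deriveE; last exact: differentiable_comp (dpsi _ Vy) dp.
      have H : \forall z \near y, id z = (phi \o psi) z.
        by apply: (filterS _ (near_open oV Vy)) => z /psiK[_ /= ->].
      by rewrite -(near_eq_derive 'e_i H) derive_id.
    by have [] := mulmx1_unit E.
  have csL := cs_linear uJ csb.
  have -> : f y * intRn b = intRn (fun u => G (psi y) * b (u *m J)).
    rewrite intRnZ; last exact: cs_dec.
    rewrite -(intRn_linear uJ csb) mulrA; congr (_ * _).
    by rewrite /G; case: asboolP => // _; rewrite px.
  rewrite (_ : m ^~ y = fun k => intRn (fun u => Kf (N k) ((N k)^-1 *: u + psi y) y)); last first.
    by apply/funext => k; exact: mE.
  apply: (@cvg_intRn _ _ _ _ (CG * (1 + A ^+ 2) ^+ n)).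
  - by move=> k; have [] := csint k y.
  - by move=> k u; exact: intb.
  - have [cbL _] := csL; move=> u; exact: (continuousM (@cst_continuous _ _ (G (psi y)) u) (cbL u)).
  move=> u.
  have q := @quotient_cvg n n phi (psi y) u N (dphi _ Ux) N0 Noo.
  rewrite /Kf; apply: cvgM.
    apply: (@continuous_cvg _ _ _ \oo _ (fun k => (N k)^-1 *: u + psi y) G); first exact: cG.
    rewrite -[X in _ --> X]add0r; apply: cvgD; last exact: cvg_cst.
    rewrite -[X in _ --> X](scale0r u); apply: cvgZr_tmp; exact: invn_cvg0.
  apply: (@continuous_cvg _ _ _ \oo _ (fun k => N k *: (phi ((N k)^-1 *: u + psi y) - y)) b).
    exact: continuous_bmp.
  by move: q; rewrite px.
have mint k : intRn (m k) = intRn b * intRn G.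
  have Nn0 : N k ^+ n != 0 by rewrite expf_neq0// gt_eqF.
  have dm : dec (m k) by split => //; eexists; exact: mwt.
  rewrite (_ : intRn (m k) = N k ^+ n * intRn (fun y => intRn (Kf (N k) ^~ y))); last first.
    rewrite -intRnZ// (_ : (fun y => _) = (fun y => (N k ^+ n)^-1 * m k y)); first exact: decZ.
    by apply/funext => y; rewrite /m mulKf.
  have [CK HCK] := (cs_dec csG).2.
  rewrite -(@intRn_swap _ n n (Kf (N k)) (CK * (1 + (B + 1 + A^-1) ^+ 2) ^+ n))//; last first.
    move=> x y; rewrite mulrA [_ * wt x]mulrAC; move: y.
    apply: cs_bound => y; first exact: le_trans (KfG _ _ _) (HCK x).
    move=> hy; apply/eqP; apply: contraTT hy => /(KfP _ _ _ (AN k))[_ _ [z Fz zy]].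
    have zB : `|z| <= B + 1 by apply: (HB (B + 1)); rewrite ?ltrDl.
    rewrite -leNgt -(subrK z y) (le_trans (ler_normD _ _))// distrC [leRHS]addrC lerD//.
  rewrite (_ : (fun x => intRn (Kf (N k) x)) = (fun x => ((N k ^+ n)^-1 * intRn b) * G x)); last first.
    by apply/funext => x; apply: (mulfI Nn0); rewrite intY// !mulrA divff// mul1r mulrC.
  by rewrite intRnZ ?mulrA ?divff ?mul1r//; exact: cs_dec.
have lim1 : intRn (m k) @[k --> \oo] --> intRn b * intRn f.
  rewrite -intRnZ; last exact: cs_dec.
  apply: (@cvg_intRn _ _ _ _ (C1 * (1 + (B + 1 + A^-1) ^+ 2) ^+ n)) => //.
  - move=> y; exact: (continuousM (@cst_continuous _ _ (intRn b) y) (cf y)).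
  - by move=> y; rewrite mulrC; exact: mlim.
have b0 : intRn b != 0 by rewrite gt_eqF// intRn_bmp_gt0.
apply: (mulfI b0).
have lim2 : intRn (m k) @[k --> \oo] --> intRn b * intRn G.
  by rewrite (_ : (fun k => intRn (m k)) = fun=> intRn b * intRn G); [exact: cvg_cst|apply/funext => k].
by have := cvg_unique _ lim2 lim1; apply.
Unshelve. all: end_near. Qed.

End ChangeOfVariables.

(** * A smooth flat function and derivatives of elementary functions *)

Section FlatBump.
Variable R : realType.

(** Each factor X of the polynomial is paid for with half of the exponential rate, which is why the
    rate a is arbitrary in the statement. *)
Lemma horner_expR_bound (q : {poly R}) (a : R) : 0 < a ->
  exists2 K, 0 <= K & forall u, 0 <= u -> `|q.[u]| <= K * expR (a * u).
Proof.
elim/poly_ind: q a => [|q c IH] a a0.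
  by exists 0 => // u _; rewrite horner0 normr0 mul0r.
have a2 : 0 < a / 2 by rewrite divr_gt0.
have [K K0 HK] := IH _ a2.
exists (K * (a / 2)^-1 + `|c|); first by rewrite addr_ge0// mulr_ge0// invr_ge0 ltW.
move=> u u0; rewrite hornerMXaddC (le_trans (ler_normD _ _))// mulrDl; apply: lerD; last first.
  by rewrite ler_peMr// -expR0 ler_expR mulr_ge0// ltW.
rewrite normrM (ger0_norm u0).
have -> : expR (a * u) = expR (a / 2 * u) * expR (a / 2 * u).
  by rewrite -expRD -mulrDl -splitr.
have hu : u <= (a / 2)^-1 * expR (a / 2 * u).
  rewrite -ler_pdivrMl ?invr_gt0// invrK.
  by rewrite (le_trans _ (expR_ge1Dx _))// lerDr.
apply: le_trans (ler_pM (normr_ge0 _) u0 (HK _ u0) hu) _.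
by rewrite mulrACA.
Qed.

(** Polynomials in 1/t times exp(-1/t), extended by zero: a class stable under differentiation,
    which replaces p by X^2 (p - p'). The case p = 1 is the classical flat function. *)
Definition flat (p : {poly R}) (t : R) : R := if 0 < t then p.[t^-1] * expR (- t^-1) else 0.

Lemma flat_le0 p t : t <= 0 -> flat p t = 0.
Proof. by rewrite /flat leNgt => /negbTE ->. Qed.

Lemma flat1_gt0 t : 0 < t -> 0 < flat 1 t.
Proof. by move=> t0; rewrite /flat t0 hornerC mul1r expR_gt0. Qed.

Lemma flat1_ge0 t : 0 <= flat 1 t.
Proof. by have [/flat_le0 ->//|/flat1_gt0/ltW] := leP t 0. Qed.

(** The quadratic bound makes the difference quotient at 0 tend to 0. It is the exponential bound
    for X^2 p at 1/t. *)
Lemma flat_bound p : exists2 K, 0 <= K & forall t, `|flat p t| <= K * t ^+ 2.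
Proof.
have [K K0 HK] := horner_expR_bound ('X^2 * p) (@ltr01 R).
exists K => // t; have [t0|t0] := leP t 0.
  by rewrite flat_le0// normr0 mulr_ge0// sqr_ge0.
rewrite /flat t0 normrM (gtr0_norm (expR_gt0 _)).
have := HK t^-1; rewrite invr_ge0 ltW// => /(_ isT).
rewrite hornerM hornerXn mul1r normrM ger0_norm ?exprn_ge0 ?invr_ge0 ?(ltW t0)//.
rewrite exprVn -ler_pdivlMl ?exprn_gt0 ?invr_gt0 ?exprn_gt0// invrK => h.
rewrite expRN ler_pdivrMr ?expR_gt0// (le_trans h)//.
by rewrite mulrCA mulrA.
Qed.

Lemma is_derive_inv (t : R) : t != 0 -> is_derive t (1 : R) (fun s => s^-1) (- t ^- 2).
Proof.
move=> t0; split; first exact: (@derivableV _ _ id).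
have di : derivable (@id R) t 1 by exact: derivable_id.
have E := @deriveV _ _ (@id R) t 1 t0 di.
by rewrite E derive_id /GRing.scale/= mulr1.
Qed.

Lemma is_derive_flat p t : is_derive t (1 : R) (flat p) (flat ('X^2 * (p - p^`())) t).
Proof.
have [t0|t0|->] := ltgtP t 0.
- rewrite flat_le0 ?ltW//.
  have d0 : is_derive t (1 : R) (fun _ : R => 0 : R) 0 by exact: is_derive_cst.
  have n0 : \forall s \near t, (fun _ : R => 0 : R) s = flat p s.
    by apply: filterS (lt_nbhsl t0) => s s0; rewrite flat_le0// ltW.
  exact: near_eq_is_derive n0 d0.
- have di := is_derive_inv (lt0r_neq0 t0).
  have dh : is_derive t^-1 (1 : R) (horner p) (p^`()).[t^-1].
    by split; [exact: derivable_horner|rewrite -derive1E -derivE].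
  have d1 : is_derive t (1 : R) (horner p \o (fun s => s^-1)) ((p^`()).[t^-1] * - t ^- 2).
    exact: is_derive1_comp.
  have d2 : is_derive t (1 : R) (expR \o (fun s => - s^-1)) (expR (- t^-1) * - - t ^- 2).
    exact: is_derive1_comp.
  have d3 := is_deriveM d1 d2.
  have n0 : \forall s \near t, ((horner p \o (fun s => s^-1)) * (expR \o (fun s => - s^-1))) s = flat p s.
    by apply: filterS (lt_nbhsr t0) => s s0; rewrite /flat s0.
  apply: is_derive_eq (near_eq_is_derive n0 d3) _.
  rewrite /flat t0 /= hornerM hornerXn hornerD hornerN /GRing.scale/= exprVn; ring.
- rewrite flat_le0//.
  have [K K0 HK] := flat_bound p.
  have H : (fun h : R => h^-1 *: ((flat p \o shift 0) (h *: 1) - flat p 0)) @ 0^' --> (0 : R).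
    apply/cvgrPdist_lt => e e0; near=> h.
    have h0 : h != 0 by near: h; exact: nbhs_dnbhs_neq.
    rewrite sub0r normrN /= addr0 (flat_le0 p (lexx 0)) subr0.
    have -> : h *: (1 : R) = h by exact: mulr1.
    rewrite normrZ normfV ltr_pdivrMl ?normr_gt0// (le_lt_trans (HK _))//.
    have hK : `|h| < e / (K + 1).
      near: h; apply: dnbhs0_lt; by rewrite divr_gt0// ltr_wpDl.
    rewrite -real_normK ?num_real// expr2 mulrCA ltr_pM2l ?normr_gt0//.
    apply: (@le_lt_trans _ _ ((K + 1) * `|h|)); first by rewrite ler_wpM2r// lerDl.
    by rewrite mulrC -ltr_pdivlMr// ltr_wpDl.
  by split; [apply/cvg_ex; exists 0; exact: H|exact: cvg_lim H].
Unshelve. all: end_near. Qed.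

Definition flatn (j : nat) : R -> R := flat (iter j (fun p => 'X^2 * (p - p^`())) 1).

Lemma is_derive_flatn j t : is_derive t (1 : R) (flatn j) (flatn j.+1 t).
Proof. exact: is_derive_flat. Qed.

(** This and the next two families list the successive derivatives of 1/t, of t^a and of the cosine
    in the form that [Ck_comp1] requires. *)
Definition invn (j : nat) (t : R) : R := (-1) ^+ j * j`!%:R * t ^- j.+1.

Lemma is_derive_invn j (t : R) : t != 0 -> is_derive t (1 : R) (invn j) (invn j.+1 t).
Proof.
move=> t0; have di := is_derive_inv t0.
have d1 := is_deriveX j.+1 di.
have d2 := is_deriveZ ((-1) ^+ j * j`!%:R) d1.
rewrite /invn.
have E : (fun t : R => (-1) ^+ j * j`!%:R * t ^- j.+1) = ((-1) ^+ j * j`!%:R) \*: (fun s : R => s^-1) ^+ j.+1.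
  by apply/funext => s; rewrite /= !fctE exprVn.
rewrite E; apply: is_derive_eq d2 _.
rewrite /GRing.scale/= factS natrM /= exprVn !exprS expr0; field.
by rewrite t0 expf_neq0.
Qed.

Definition pown (a : R) (j : nat) (t : R) : R := (\prod_(i < j) (a - i%:R)) * t `^ (a - j%:R).

Lemma is_derive_pown (a : R) j (t : R) : 0 < t -> is_derive t (1 : R) (pown a j) (pown a j.+1 t).
Proof.
move=> t0; have d1 := is_derive1_powR (a - j%:R) t0.
have d2 := is_deriveZ (\prod_(i < j) (a - i%:R)) d1.
apply: is_derive_eq d2 _.
by rewrite /pown big_ord_recr/= /GRing.scale/= mulrA -(natr1 j) opprD addrA.
Qed.

Definition cosn (j : nat) (t : R) : R := cos (t + j%:R * (pi / 2)).

Lemma is_derive_cosn j (t : R) : is_derive t (1 : R) (cosn j) (cosn j.+1 t).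
Proof.
have d1 : is_derive t (1 : R) (cos \o (fun t => t + j%:R * (pi / 2))) (- sin (t + j%:R * (pi / 2)) * (1 + 0)).
  apply: is_derive1_comp; exact: is_deriveD.
apply: is_derive_eq d1 _.
have E : j.+1%:R * (pi / 2) = j%:R * (pi / 2) + pi / 2 :> R.
  by rewrite [j.+1%:R]mulrSr mulrDl mul1r.
by rewrite /cosn E addrA cosD cos_pihalf sin_pihalf mulr0 mulr1 sub0r addr0 mulr1.
Qed.

End FlatBump.

(** * Closure properties of smooth functions *)

Section SmoothOn.
Variables (R : realType) (n : nat) (U : set 'rV[R]_n).
Hypothesis oU : open U.
Implicit Types f g : 'rV[R]_n -> R.

Lemma smooth_congr f g : (forall z, U z -> f z = g z) -> smooth_on U f -> smooth_on U g.
Proof. by move=> fg /smooth_onP H; apply/smooth_onP => k; exact: Ck_congr (H k). Qed.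

Lemma smooth_cst (c : R) : smooth_on U (fun=> c).
Proof. by apply/smooth_onP => k; exact: Ck_cst. Qed.

Lemma smoothD f g : smooth_on U f -> smooth_on U g -> smooth_on U (fun x => f x + g x).
Proof. by move=> /smooth_onP F /smooth_onP G; apply/smooth_onP => k; exact: CkD. Qed.

Lemma smoothM f g : smooth_on U f -> smooth_on U g -> smooth_on U (fun x => f x * g x).
Proof. by move=> /smooth_onP F /smooth_onP G; apply/smooth_onP => k; exact: CkM. Qed.

Lemma smoothZ a f : smooth_on U f -> smooth_on U (fun x => a * f x).
Proof. exact/smoothM/smooth_cst. Qed.

Lemma smoothN f : smooth_on U f -> smooth_on U (fun x => - f x).
Proof. by move/(smoothZ (-1)); apply: smooth_congr => z _; rewrite mulN1r. Qed.

Lemma smoothB f g : smooth_on U f -> smooth_on U g -> smooth_on U (fun x => f x - g x).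
Proof. by move=> F G; apply: smoothD; [exact: F|exact: smoothN]. Qed.

Lemma smooth_sum I (r : seq I) (P : pred I) (F : I -> 'rV[R]_n -> R) :
  (forall i, P i -> smooth_on U (F i)) -> smooth_on U (fun x => \sum_(i <- r | P i) F i x).
Proof. by move=> H; apply/smooth_onP => k; apply: Ck_sum => // i Pi; have /smooth_onP := H i Pi; apply. Qed.

Lemma smooth_prod I (r : seq I) (P : pred I) (F : I -> 'rV[R]_n -> R) :
  (forall i, P i -> smooth_on U (F i)) -> smooth_on U (fun x => \prod_(i <- r | P i) F i x).
Proof. by move=> H; apply/smooth_onP => k; apply: Ck_prod => // i Pi; have /smooth_onP := H i Pi; apply. Qed.

Lemma smooth_coord j : smooth_on U (fun z => z 0 j).
Proof. by apply/smooth_onP => k; exact: Ck_coord. Qed.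

Lemma smooth_comp1 (G : nat -> R -> R) (I : set R) f :
  (forall j t, I t -> is_derive t (1 : R) (G j) (G j.+1 t)) ->
  (forall x, U x -> I (f x)) -> smooth_on U f -> smooth_on U (fun x => G 0%N (f x)).
Proof. by move=> dG fI /smooth_onP F; apply/smooth_onP => k; exact: Ck_comp1 dG fI (F k). Qed.

Lemma smooth_comp m (V : set 'rV[R]_m) (phi : 'rV[R]_n -> 'rV[R]_m) (f : 'rV[R]_m -> R) :
  open V -> (forall x, U x -> V (phi x)) ->
  (forall j, smooth_on U (fun z => phi z 0 j)) -> smooth_on V f -> smooth_on U (fun x => f (phi x)).
Proof.
move=> oV UV Sphi /smooth_onP F; apply/smooth_onP => k; apply: Ck_comp oU oV UV _ (F k).
by move=> j; have /smooth_onP := Sphi j; apply.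
Qed.

Lemma smooth_derive f i : smooth_on U f -> smooth_on U ('D_('e_i) f).
Proof. by move=> /smooth_onP F; apply/smooth_onP => k; exact: Ck_derive (F k.+1). Qed.

Lemma smooth_cont f x : smooth_on U f -> U x -> {for x, continuous f}.
Proof. by move=> /(_ [::] x) h /h[]. Qed.

Lemma smooth_diff_rV m (phi : 'rV[R]_n -> 'rV[R]_m) x :
  (forall j, smooth_on U (fun z => phi z 0 j)) -> U x -> differentiable phi x.
Proof.
move=> Sphi Ux; apply: differentiable_rV => j; have /smooth_onP/(_ 1%N) C := Sphi j.
by have [] := Ck_diff oU C Ux.
Qed.

Lemma smooth_inv f : (forall x, U x -> f x != 0) -> smooth_on U f -> smooth_on U (fun x => (f x)^-1).
Proof.
move=> f0 /(@smooth_comp1 (@invn R) [set t | t != 0] f (fun j t => @is_derive_invn R j t) f0).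
by apply: smooth_congr => z _; rewrite /invn expr0 fact0 !mul1r expr1.
Qed.

(** The function is the fourth root of f^2, a smooth function of a positive quantity whatever the
    sign of f. *)
Lemma smooth_sqrt_norm f : (forall x, U x -> f x != 0) -> smooth_on U f ->
  smooth_on U (fun x => Num.sqrt `|f x|).
Proof.
move=> f0 Sf.
have S2 := smoothM Sf Sf.
have pos x : U x -> 0 < f x * f x by move=> /f0 h; rewrite -expr2 exprn_even_gt0.
have := @smooth_comp1 (@pown R 4^-1) [set t | 0 < t] _ (fun j t => @is_derive_pown R 4^-1 j t) pos S2.
apply: smooth_congr => z Uz; rewrite /pown big_ord0 mul1r subr0.
rewrite -expr2 -real_normK ?num_real// -powR_mulrn// -powRrM.
have -> : 2%:R * 4^-1 = 2^-1 :> R by field.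
by rewrite powR12_sqrt.
Qed.

Lemma smooth_flat f : smooth_on U f -> smooth_on U (fun x => flat 1 (f x)).
Proof. exact: (@smooth_comp1 (@flatn R) setT f (fun j t _ => is_derive_flatn j t) (fun _ _ => I)). Qed.

Lemma smooth_cos f : smooth_on U f -> smooth_on U (fun x => cos (f x)).
Proof.
move=> /(@smooth_comp1 (@cosn R) setT f (fun j t _ => is_derive_cosn j t) (fun _ _ => I)).
by apply: smooth_congr => z _; rewrite /cosn mul0r addr0.
Qed.

Lemma smooth_det_jacobian (phi : 'rV[R]_n -> 'rV[R]_n) :
  (forall j, smooth_on U (fun z => phi z 0 j)) -> smooth_on U (fun x => \det ('J phi x)).
Proof.
move=> S; apply/smooth_onP => k; apply: Ck_det_jacobian => // j.
by have /smooth_onP := S j; apply.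
Qed.

End SmoothOn.

(** * Local smoothness, smooth bumps and Jacobians *)

Section SmoothLocal.
Variable R : realType.

Lemma smooth_local n (W : set 'rV[R]_n) (f : 'rV[R]_n -> R) :
  (forall x, W x -> exists O, [/\ O x & smooth_on O f]) -> smooth_on W f.
Proof. by move=> h l x Wx; have [Op [Ox S]] := h x Wx; exact: S. Qed.

Lemma smooth_zero_ext n (U W K : set 'rV[R]_n) (f : 'rV[R]_n -> R) : open W -> closed K ->
  (forall x, W x -> K x -> U x) -> smooth_on U f ->
  (forall x, W x -> ~ K x -> f x = 0) -> smooth_on W f.
Proof.
move=> oW cK KU Sf f0; apply: smooth_local => x Wx.
have [Kx|nK] := pselect (K x); first by exists U; split => //; apply: KU.
exists (W `&` ~` K); split; first by split.
apply: (@smooth_congr _ _ _ _ (fun=> 0)); first by apply: openI => //; rewrite openC.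
  by move=> z [Wz nKz]; rewrite f0.
by apply: smooth_cst; apply: openI => //; rewrite openC.
Qed.

(** A product over the coordinates, because the balls in which these bumps are supported are
    cubes. *)
Definition bumpn n (x0 : 'rV[R]_n) (r : R) (x : 'rV[R]_n) : R :=
  \prod_i flat 1 (r ^+ 2 - (x 0 i - x0 0 i) * (x 0 i - x0 0 i)).

Lemma smooth_bumpn n (x0 : 'rV[R]_n) r : smooth_on setT (bumpn x0 r).
Proof.
have oT : open [set: 'rV[R]_n] by exact: openT.
apply: smooth_prod => // i _; apply: smooth_flat => //; apply: smoothB => //.
  exact: smooth_cst.
have S : smooth_on setT (fun x : 'rV[R]_n => x 0 i - x0 0 i).
  by apply: smoothB => //; [exact: smooth_coord|exact: smooth_cst].
exact: smoothM.
Qed.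

Lemma bumpn_ge0 n (x0 : 'rV[R]_n) r x : 0 <= bumpn x0 r x.
Proof. by apply: prodr_ge0 => i _; exact: flat1_ge0. Qed.

Lemma bumpn_gt0 n (x0 : 'rV[R]_n) r : 0 < r -> 0 < bumpn x0 r x0.
Proof.
by move=> r0; apply: prodr_gt0 => i _; rewrite subrr mul0r subr0 flat1_gt0// exprn_gt0.
Qed.

Lemma bumpn_eq0 n (x0 : 'rV[R]_n) r x : 0 < r -> ~ ball x0 r x -> bumpn x0 r x = 0.
Proof.
move=> r0 /(ball_rVP _ _ r0)/existsNP[i /negP]; rewrite -leNgt => h.
apply/eqP; rewrite prodf_seq_eq0; apply/hasP; exists i; first by rewrite mem_index_enum.
rewrite flat_le0 ?eqxx// subr_le0 -expr2 -[leRHS]real_normK ?num_real// distrC.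
by rewrite lerXn2r ?nnegrE// ltW.
Qed.

Lemma mul_jacobian n m (f : 'rV[R]_n -> 'rV[R]_m) x (v : 'rV[R]_n) : v *m 'J f x = 'd f x v.
Proof. by rewrite /jacobian mul_rV_lin1. Qed.

Lemma row_jacobian n m (f : 'rV[R]_n -> 'rV[R]_m) x i : row i ('J f x) = 'd f x 'e_i.
Proof. by rewrite rowE; exact: mul_jacobian. Qed.

Lemma jacobian_comp n (f g : 'rV[R]_n -> 'rV[R]_n) x : differentiable f x ->
  differentiable g (f x) -> 'J (g \o f) x = 'J f x *m 'J g (f x).
Proof.
move=> df dg; apply/row_matrixP => i.
rewrite [LHS]row_jacobian [RHS]row_mul [row i _]row_jacobian [RHS]mul_jacobian.
exact: (diff_compE 'e_i df dg).
Qed.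

Lemma jacobian_id n (f : 'rV[R]_n -> 'rV[R]_n) x : differentiable f x ->
  (\forall z \near x, f z = z) -> 'J f x = 1%:M.
Proof.
move=> df H; apply/row_matrixP => i; rewrite row1 row_jacobian.
have H' : \forall z \near x, id z = f z by apply: filterS H => z ->.
rewrite -deriveE// -(near_eq_derive 'e_i H'); exact: derive_id.
Qed.

Lemma jacobian_near n (f g : 'rV[R]_n -> 'rV[R]_n) x : differentiable f x -> differentiable g x ->
  (\forall z \near x, f z = g z) -> 'J f x = 'J g x.
Proof.
move=> df dg H; apply/row_matrixP => i.
have E1 := row_jacobian f x i; have E2 := row_jacobian g x i.
have E3 := deriveE 'e_i df; have E4 := deriveE 'e_i dg.
have E5 := near_eq_derive 'e_i H.
exact: (etrans E1 (etrans (esym E3) (etrans E5 (etrans E4 (esym E2))))).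
Qed.

End SmoothLocal.

Lemma near_eq_continuous (T U : topologicalType) (W : set T) (f g : T -> U) x :
  open W -> W x -> (forall z, W z -> f z = g z) -> {for x, continuous f} -> {for x, continuous g}.
Proof.
move=> oW Wx fg cf; rewrite /prop_for /continuous_at -(fg x Wx); apply: cvg_trans cf.
have nW : nbhs x W by exact: open_nbhs_nbhs.
apply: (@near_eq_cvg _ _ (nbhs x)); near=> z; rewrite fg//; near: z; exact: nW.
Unshelve. all: end_near. Qed.

(** * Charts, transition maps and cutoff functions *)

Section Charts.
Variables (R : realType) (d : nat) (M : topologicalType).
Variable X : smooth_structure R d M.
Local Notation chart := (chart R d M).
Local Notation C := R[i].

Lemma cdom_open (c : chart) : atlas X c -> open (cdom c).
Proof. by move=> /atlas_chart[]. Qed.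

Lemma cimg_open (c : chart) : atlas X c -> open (cimg c).
Proof. by move=> /atlas_chart[]. Qed.

Lemma cmapK (c : chart) x : atlas X c -> cdom c x -> cinv c (cmap c x) = x.
Proof. by move=> /atlas_chart[_ _ _ _]; apply. Qed.

Lemma cimg_cmap (c : chart) x : cdom c x -> cimg c (cmap c x).
Proof. by move=> Dx; exists x. Qed.

Lemma cinv_dom (c : chart) y : atlas X c -> cimg c y -> cdom c (cinv c y).
Proof. by move=> Ac [x Dx <-]; rewrite cmapK. Qed.

Lemma cinvK (c : chart) y : atlas X c -> cimg c y -> cmap c (cinv c y) = y.
Proof. by move=> Ac [x Dx <-]; rewrite cmapK. Qed.

Lemma cmap_cont (c : chart) x : atlas X c -> cdom c x -> {for x, continuous (cmap c)}.
Proof.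
move=> /atlas_chart[oD _ cc _ _] Dx.
by move: cc; rewrite continuous_open_subspace// => /(_ x); rewrite inE; apply.
Qed.

Lemma cinv_cont (c : chart) y : atlas X c -> cimg c y -> {for y, continuous (cinv c)}.
Proof.
move=> /atlas_chart[_ oI _ cc _] Iy.
by move: cc; rewrite continuous_open_subspace// => /(_ y); rewrite inE; apply.
Qed.

Lemma open_pre_cinv (c : chart) (O : set M) : atlas X c -> open O ->
  open [set y | cimg c y /\ O (cinv c y)].
Proof.
move=> Ac oO; rewrite openE => y [Iy Oy]; rewrite /interior.
have H1 := near_open (cimg_open Ac) Iy.
have H2 : \forall z \near y, O (cinv c z).
  by apply: (cinv_cont Ac Iy); exact: open_nbhs_nbhs.
exact: filterI H1 H2.
Qed.

Lemma open_pre_cmap (c : chart) (W : set 'rV[R]_d) : atlas X c -> open W ->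
  open [set x | cdom c x /\ W (cmap c x)].
Proof.
move=> Ac oW; rewrite openE => x [Dx Wx]; rewrite /interior.
have H1 : \forall z \near x, cdom c z by apply: open_nbhs_nbhs; split => //; exact: cdom_open.
have H2 : \forall z \near x, W (cmap c z).
  by apply: (cmap_cont Ac Dx); exact: open_nbhs_nbhs.
exact: filterI H1 H2.
Qed.

Lemma overlapE (c c' : chart) y : atlas X c ->
  overlap c c' y <-> cimg c y /\ cdom c' (cinv c y).
Proof.
move=> Ac; split=> [[x [Dx Dx'] <-]|[Iy Dy]].
  by rewrite cmapK//; split => //; exact: cimg_cmap.
by exists (cinv c y); [split => //; exact: cinv_dom|rewrite cinvK].
Qed.

Lemma overlap_refl (c : chart) y : atlas X c -> cimg c y -> overlap c c y.
Proof. by move=> Ac Iy; apply/overlapE => //; split => //; exact: cinv_dom. Qed.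

Lemma overlap_cimg (c c' : chart) y : atlas X c -> overlap c c' y -> cimg c y.
Proof. by move=> Ac /(overlapE _ _ Ac)[]. Qed.

Lemma open_overlap (c c' : chart) : atlas X c -> atlas X c' -> open (overlap c c').
Proof.
move=> Ac Ac'; have -> : overlap c c' = [set y | cimg c y /\ cdom c' (cinv c y)].
  by apply/seteqP; split=> y /(overlapE _ _ Ac).
exact/open_pre_cinv/cdom_open.
Qed.

Lemma trans_overlap (c c' : chart) y : atlas X c -> atlas X c' ->
  overlap c c' y -> overlap c' c (transition c c' y).
Proof.
move=> Ac Ac' /(overlapE _ _ Ac)[Iy Dy]; apply/overlapE => //; split; first exact: cimg_cmap.
by rewrite /transition /= cmapK//; exact: cinv_dom.
Qed.

Lemma trans_cimg (c c' : chart) y : atlas X c -> atlas X c' ->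
  overlap c c' y -> cimg c' (transition c c' y).
Proof. by move=> Ac Ac' /(trans_overlap Ac Ac') /(overlap_cimg Ac'). Qed.

Lemma trans_cinv (c c' : chart) y : atlas X c -> atlas X c' ->
  overlap c c' y -> cinv c' (transition c c' y) = cinv c y.
Proof. by move=> Ac Ac' /(overlapE _ _ Ac)[Iy Dy]; rewrite /transition /= cmapK. Qed.

Lemma trans_trans (c c1 c2 : chart) y : atlas X c -> atlas X c1 ->
  overlap c c1 y -> transition c1 c2 (transition c c1 y) = transition c c2 y.
Proof. by move=> Ac Ac1 o; rewrite {1}/transition /= trans_cinv. Qed.

Lemma trans_refl (c : chart) y : atlas X c -> cimg c y -> transition c c y = y.
Proof. by move=> Ac Iy; rewrite /transition /= cinvK. Qed.

Lemma transK (c c' : chart) y : atlas X c -> atlas X c' ->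
  overlap c c' y -> transition c' c (transition c c' y) = y.
Proof. by move=> Ac Ac' o; rewrite trans_trans// trans_refl//; exact: overlap_cimg o. Qed.

Lemma overlap_trans (c c1 c2 : chart) y : atlas X c -> atlas X c1 ->
  overlap c c1 y -> overlap c c2 y -> overlap c1 c2 (transition c c1 y).
Proof.
move=> Ac Ac1 o1 /(overlapE _ _ Ac)[Iy Dy]; apply/overlapE => //; split; first exact: trans_cimg.
by rewrite trans_cinv.
Qed.

Lemma trans_smooth (c c' : chart) : atlas X c -> atlas X c' ->
  forall i, smooth_on (overlap c c') (fun y => transition c c' y 0 i).
Proof. by move=> Ac Ac'; have := atlas_compatible Ac Ac'. Qed.

Lemma trans_diff (c c' : chart) y : atlas X c -> atlas X c' -> overlap c c' y ->
  differentiable (transition c c') y.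
Proof.
by move=> Ac Ac'; apply: smooth_diff_rV; [exact: open_overlap|exact: trans_smooth].
Qed.

Definition jac (c c' : chart) (y : 'rV[R]_d) : R := \det ('J (transition c c') y).

Lemma jac_refl (c : chart) y : atlas X c -> cimg c y -> jac c c y = 1.
Proof.
move=> Ac Iy; rewrite /jac jacobian_id ?det1//; first exact/trans_diff/overlap_refl.
by apply: filterS (near_open (cimg_open Ac) Iy) => z Iz; rewrite trans_refl.
Qed.

Lemma jac_trans (c c1 c2 : chart) y : atlas X c -> atlas X c1 -> atlas X c2 ->
  overlap c c1 y -> overlap c c2 y ->
  jac c c2 y = jac c c1 y * jac c1 c2 (transition c c1 y).
Proof.
move=> Ac Ac1 Ac2 o1 o2; rewrite /jac -det_mulmx; congr (\det _).
have o12 := overlap_trans Ac Ac1 o1 o2.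
have d1 := trans_diff Ac Ac1 o1.
have d12 := trans_diff Ac1 Ac2 o12.
have d2 := trans_diff Ac Ac2 o2.
have E := jacobian_comp d1 d12.
have H : \forall z \near y, transition c c2 z = (transition c1 c2 \o transition c c1) z.
  by apply: filterS (near_open (open_overlap Ac Ac1) o1) => z oz; rewrite -(trans_trans c2 Ac Ac1 oz).
have d3 := differentiable_comp d1 d12.
exact: (etrans (jacobian_near d2 d3 H) E).
Qed.

Lemma jac_neq0 (c c' : chart) y : atlas X c -> atlas X c' -> overlap c c' y -> jac c c' y != 0.
Proof.
move=> Ac Ac' o; apply/negP => /eqP E.
have oc := overlap_refl Ac (overlap_cimg Ac o).
have := jac_trans Ac Ac' Ac o oc; rewrite E mul0r (jac_refl Ac (overlap_cimg Ac o)).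
by move=> /eqP; rewrite oner_eq0.
Qed.

Lemma smooth_jac (c c' : chart) : atlas X c -> atlas X c' -> smooth_on (overlap c c') (jac c c').
Proof.
by move=> Ac Ac'; apply: smooth_det_jacobian; [exact: open_overlap|exact: trans_smooth].
Qed.

Definition hfac (c c' : chart) (y : 'rV[R]_d) : R := Num.sqrt `|jac c c' y|.

Lemma smooth_hfac (c c' : chart) : atlas X c -> atlas X c' -> smooth_on (overlap c c') (hfac c c').
Proof.
move=> Ac Ac'; apply: smooth_sqrt_norm; first exact: open_overlap.
  by move=> y; exact: jac_neq0.
exact: smooth_jac.
Qed.

Lemma hfac_trans (c c1 c2 : chart) y : atlas X c -> atlas X c1 -> atlas X c2 ->
  overlap c c1 y -> overlap c c2 y ->
  hfac c c2 y = hfac c c1 y * hfac c1 c2 (transition c c1 y).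
Proof.
by move=> Ac Ac1 Ac2 o1 o2; rewrite /hfac (jac_trans Ac Ac1 Ac2 o1 o2) normrM sqrtrM.
Qed.

Lemma hfac_refl (c : chart) y : atlas X c -> cimg c y -> hfac c c y = 1.
Proof. by move=> Ac Iy; rewrite /hfac jac_refl// normr1 sqrtr1. Qed.

Lemma hfac_sqr (c c' : chart) y : hfac c c' y * hfac c c' y = `|jac c c' y|.
Proof. by rewrite -expr2 sqr_sqrtr. Qed.

Hypothesis hM : hausdorff_space M.

Lemma compact_cinv (c : chart) (L : set 'rV[R]_d) : atlas X c -> compact L -> L `<=` cimg c ->
  compact (cinv c @` L).
Proof.
move=> Ac cL LI; apply: continuous_compact => //; apply: continuous_in_subspaceT => y /set_mem /LI.
exact: cinv_cont.
Qed.

Lemma closed_cinv (c : chart) (L : set 'rV[R]_d) : atlas X c -> compact L -> L `<=` cimg c ->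
  closed (cinv c @` L).
Proof. by move=> Ac cL LI; apply: compact_closed => //; exact: compact_cinv. Qed.

Definition pull (c : chart) (f : 'rV[R]_d -> R) (x : M) : R :=
  if `[< cdom c x >] then f (cmap c x) else 0.

Lemma pull_eq0 (c : chart) (L : set 'rV[R]_d) f x : atlas X c ->
  (forall y, ~ L y -> f y = 0) -> ~ (cinv c @` L) x -> pull c f x = 0.
Proof.
move=> Ac f0 nx; rewrite /pull; case: asboolP => // Dx; apply: f0 => Lx.
by apply: nx; exists (cmap c x) => //; rewrite cmapK.
Qed.

(** Since M is Hausdorff, the image of the compact set L is closed in M; away from it the extension
    by zero vanishes near each point, also at the boundary of the chart domain. *)
Lemma smooth_pull (c : chart) (L : set 'rV[R]_d) f : atlas X c -> compact L -> L `<=` cimg c ->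
  smooth_on (cimg c) f -> (forall y, ~ L y -> f y = 0) ->
  forall c', atlas X c' -> smooth_on (cimg c') (pull c f \o cinv c').
Proof.
move=> Ac cL LI Sf f0 c' Ac'; have cl := closed_cinv Ac cL LI.
apply: smooth_local => y Iy.
have [[z Lz zE]|nL] := pselect ((cinv c @` L) (cinv c' y)).
  exists (overlap c' c); split.
    by apply/overlapE => //; split => //; rewrite -zE; apply: cinv_dom => //; exact: LI.
  have oo := open_overlap Ac' Ac.
  apply: (@smooth_congr _ _ _ oo (fun y => f (transition c' c y))).
    by move=> w /(overlapE _ _ Ac')[Iw Dw]; rewrite /= /pull asboolT.
  apply: (@smooth_comp _ _ _ oo _ (cimg c)) => //; first exact: cimg_open.
    by move=> w; exact: trans_cimg.
  exact: trans_smooth.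
have oo : open [set y | cimg c' y /\ (~` (cinv c @` L)) (cinv c' y)].
  by apply: open_pre_cinv => //; rewrite openC.
exists [set y | cimg c' y /\ (~` (cinv c @` L)) (cinv c' y)]; split => //.
apply: (@smooth_congr _ _ _ oo (fun=> 0)); last exact: smooth_cst.
by move=> w [Iw nw] /=; rewrite (pull_eq0 Ac f0).
Qed.

Lemma supp_pull (c : chart) (L : set 'rV[R]_d) f : atlas X c -> compact L -> L `<=` cimg c ->
  (forall y, ~ L y -> f y = 0) -> closure [set x | pull c f x <> 0] `<=` cinv c @` L.
Proof.
move=> Ac cL LI f0; have cl := closed_cinv Ac cL LI.
rewrite [X in _ `<=` X]((closure_id _).1 cl); apply: closureS => x /= nz.
by apply: contrapT => /(pull_eq0 Ac f0).
Qed.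

Lemma cutoff_pull (c : chart) (L : set 'rV[R]_d) f : atlas X c -> compact L -> L `<=` cimg c ->
  smooth_on (cimg c) f -> (forall y, ~ L y -> f y = 0) -> cutoff X c (pull c f).
Proof.
move=> Ac cL LI Sf f0; split; first exact: smooth_pull Sf f0.
by apply: subset_trans (supp_pull Ac cL LI f0) _ => _ [y /LI Iy <-]; exact: cinv_dom.
Qed.

Lemma cutoff_at (c : chart) x (O : set M) : atlas X c -> cdom c x -> open O -> O x ->
  exists chi : M -> R, [/\ cutoff X c chi, forall z, 0 <= chi z, 0 < chi x &
    closure [set z | chi z <> 0] `<=` O].
Proof.
move=> Ac Dx oO Ox.
have oW := open_pre_cinv Ac oO.
have Wx : [set y | cimg c y /\ O (cinv c y)] (cmap c x).
  by split; [exact: cimg_cmap|rewrite /= cmapK].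
have /nbhs_ballP[r /= r0 hr] := near_open oW Wx.
have r2 : 0 < r / 2 by rewrite divr_gt0.
set L := [set y : 'rV[R]_d | `|y - cmap c x| <= r / 2].
have cL : compact L.
  have -> : L = (fun y => y + cmap c x) @` [set y | `|y| <= r / 2].
    apply/seteqP; split=> [y Ly|_ [y Ly <-]]; last by rewrite /L /= addrK.
    by exists (y - cmap c x); rewrite ?subrK.
  apply: continuous_compact; last exact: compact_norm_le.
  by apply: continuous_subspaceT; exact: continuous_addr.
have LW y : L y -> cimg c y /\ O (cinv c y).
  move=> Ly; apply: hr; rewrite -ball_normE /= distrC (le_lt_trans Ly)//.
  by rewrite ltr_pdivrMr// ltr_pMr// ltr1n.
have LI : L `<=` cimg c by move=> y /LW[].
have f0 y : ~ L y -> bumpn (cmap c x) (r / 2) y = 0.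
  move=> nL; apply: bumpn_eq0 => // b; apply: nL.
  by move: b; rewrite -ball_normE /= distrC => /ltW.
exists (pull c (bumpn (cmap c x) (r / 2))); split.
- apply: cutoff_pull cL LI _ f0 => //.
  exact: smooth_on_sub (@smooth_bumpn R d (cmap c x) (r / 2)).
- by move=> z; rewrite /pull; case: asboolP => // _; exact: bumpn_ge0.
- by rewrite /pull asboolT// bumpn_gt0.
- by apply: subset_trans (supp_pull Ac cL LI f0) _ => _ [y /LW[_ Oy] <-].
Qed.

Section PairChart.
Variables (a b : chart) (O O' : set M) (pa pb : 'rV[R]_d) (i0 : 'I_d).
Hypotheses (Aa : atlas X a) (Ab : atlas X b) (oO : open O) (oO' : open O').
Hypothesis OO' : forall z, O z -> O' z -> False.

Let B (p : 'rV[R]_d) : set 'rV[R]_d := ball p 1.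
Let s : 'rV[R]_d := pa - pb + const_mx 3.
Let D1 : set M := [set z | cdom a z /\ (O z /\ B pa (cmap a z))].
Let D2 : set M := [set z | cdom b z /\ (O' z /\ B pb (cmap b z))].
Let cm (z : M) := if `[< O z >] then cmap a z else cmap b z + s.
Let ci (y : 'rV[R]_d) := if `[< B pa y >] then cinv a y else cinv b (y - s).

(** The two pieces lie in disjoint open sets, and their images in unit balls; the translation by s
    moves the second centre to distance 3 from the first, so that the images are disjoint as well.
    By maximality of the atlas the union of the pieces is one of its charts. *)
Definition glue : chart := Chart (D1 `|` D2) cm ci.

Let oD1 : open D1.
Proof.
have -> : D1 = O `&` [set z | cdom a z /\ B pa (cmap a z)].
  by apply/seteqP; split=> z [h1 [h2 h3]]; split => //; split.
by apply: openI => //; apply: open_pre_cmap => //; exact: ball_open.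
Qed.

Let oD2 : open D2.
Proof.
have -> : D2 = O' `&` [set z | cdom b z /\ B pb (cmap b z)].
  by apply/seteqP; split=> z [h1 [h2 h3]]; split => //; split.
by apply: openI => //; apply: open_pre_cmap => //; exact: ball_open.
Qed.

Let cm1 z : D1 z -> cm z = cmap a z.
Proof. by move=> [_ [hz _]]; rewrite /cm asboolT. Qed.

Let cm2 z : D2 z -> cm z = cmap b z + s.
Proof. by move=> [_ [hz _]]; rewrite /cm asboolF// => Oz; exact: OO' hz. Qed.

Let nB y : B pb (y - s) -> ~ B pa y.
Proof.
move=> /(ball_rVP _ _ ltr01)/(_ i0) h /(ball_rVP _ _ ltr01)/(_ i0); move: h.
rewrite !mxE !ltr_norml => /andP[? ?] /andP[? ?]; lra.
Qed.

Let I1 : set 'rV[R]_d := [set y | cimg a y /\ D1 (cinv a y)].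
Let I2 : set 'rV[R]_d := [set y | cimg b (y - s) /\ D2 (cinv b (y - s))].

Let ciI1 y : I1 y -> ci y = cinv a y.
Proof. by move=> [Iy [_ [_]]]; rewrite cinvK// => By; rewrite /ci asboolT. Qed.

Let ciI2 y : I2 y -> ci y = cinv b (y - s).
Proof. by move=> [Iy [_ [_]]]; rewrite cinvK// => /nB nBy; rewrite /ci asboolF. Qed.

Let open_shift (W : set 'rV[R]_d) : open W -> open [set y | W (y - s)].
Proof. by move=> oW; apply: (@open_comp _ _ (fun y : 'rV[R]_d => y - s)) => // y _; exact: continuous_addr. Qed.

Let oI1 : open I1. Proof. exact: open_pre_cinv. Qed.
Let oI2 : open I2. Proof. exact: (@open_shift [set y | cimg b y /\ D2 (cinv b y)] (open_pre_cinv Ab oD2)). Qed.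

Let img1 z : D1 z -> I1 (cmap a z).
Proof. by move=> Dz; have [Da _] := Dz; split; [exact: cimg_cmap|rewrite cmapK]. Qed.

Let img2 z : D2 z -> I2 (cmap b z + s).
Proof.
by move=> Dz; have [Db _] := Dz; split; rewrite addrK; [exact: cimg_cmap|rewrite cmapK].
Qed.

Let cimg_glue : cimg glue = I1 `|` I2.
Proof.
apply/seteqP; split=> [_ [z [Dz|Dz] <-]|y [Iy|Iy]] /=.
- by left; rewrite cm1//; exact: img1.
- by right; rewrite cm2//; exact: img2.
- have [Ia Da] := Iy; exists (cinv a y); first by left.
  by rewrite /= cm1// cinvK.
- have [Ib Db] := Iy; exists (cinv b (y - s)); first by right.
  by rewrite /= cm2// cinvK// subrK.
Qed.

Let glue_is_chart : is_chart glue.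
Proof.
have oD : open (D1 `|` D2) by exact: openU.
have oI : open (I1 `|` I2) by exact: openU.
split.
- exact: oD.
- by rewrite cimg_glue.
- rewrite continuous_open_subspace// => z; rewrite inE => -[Dz|Dz].
    apply: (near_eq_continuous oD1 Dz) (cmap_cont Aa Dz.1) => w Dw.
    by rewrite /= cm1.
  have c1 : {for z, continuous (fun z => cmap b z + s)}.
    apply: (@continuous_comp _ _ _ (cmap b) (fun y : 'rV[R]_d => y + s)).
      exact: cmap_cont Dz.1.
    exact: continuous_addr.
  by apply: (near_eq_continuous oD2 Dz) c1 => w Dw; rewrite /= cm2.
- rewrite cimg_glue continuous_open_subspace// => y; rewrite inE => -[Iy|Iy].
    by apply: (near_eq_continuous oI1 Iy) (cinv_cont Aa Iy.1) => w Iw; rewrite /= ciI1.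
  have c1 : {for y, continuous (fun y : 'rV[R]_d => cinv b (y - s))}.
    apply: (@continuous_comp _ _ _ (fun y : 'rV[R]_d => y - s) (cinv b)).
      exact: (@continuous_addr R d (- s)).
    exact: cinv_cont Iy.1.
  by apply: (near_eq_continuous oI2 Iy) c1 => w Iw; rewrite /= ciI2.
- move=> z [Dz|Dz] /=; first by rewrite cm1// ciI1 ?cmapK//; [exact: Dz.1|exact: img1].
  by rewrite cm2// ciI2 ?addrK ?cmapK//; [exact: Dz.1|exact: img2].
Qed.

Let glue_compat c' : atlas X c' -> compatible glue c' /\ compatible c' glue.
Proof.
move=> Ac'; split=> i; apply: smooth_local => y; [move=> [z [ [Dz|Dz] Dz'] <-] /=|move=> [z [Dz' [Dz|Dz] ] <-] /=].
- have oQ : open (I1 `&` overlap a c') by apply: openI => //; exact: open_overlap.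
  exists (I1 `&` overlap a c'); split.
    by rewrite cm1//; split; [exact: img1|exists z => //; split => //; exact: Dz.1].
  apply: (@smooth_congr _ _ _ oQ (fun y => transition a c' y 0 i)).
    by move=> w [Iw _]; rewrite /transition /= ciI1.
  by apply: smooth_on_sub (trans_smooth Aa Ac' i) => w [].
- have oQ : open (I2 `&` [set y | overlap b c' (y - s)]).
    by apply: openI => //; apply: open_shift; exact: open_overlap.
  exists (I2 `&` [set y | overlap b c' (y - s)]); split.
    rewrite cm2//; split; first exact: img2.
    by rewrite /= addrK; exists z => //; split => //; exact: Dz.1.
  apply: (@smooth_congr _ _ _ oQ (fun y => transition b c' (y - s) 0 i)).
    by move=> w [Iw _]; rewrite /transition /= ciI2.
  apply: (@smooth_comp _ _ _ oQ _ (overlap b c') (fun y => y - s) (fun y => transition b c' y 0 i)) => //.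
  + exact: open_overlap.
  + by move=> w [].
  + move=> j; apply: (@smooth_congr _ _ _ oQ (fun y => y 0 j - s 0 j)); first by move=> w _; rewrite !mxE.
    by apply: smoothB => //; [exact: smooth_coord|exact: smooth_cst].
  + exact: trans_smooth.
- have oQ := open_pre_cinv Ac' oD1.
  exists [set y | cimg c' y /\ D1 (cinv c' y)]; split.
    by split; [exact: cimg_cmap|rewrite /= (cmapK Ac' Dz')].
  apply: (@smooth_congr _ _ _ oQ (fun y => transition c' a y 0 i)).
    by move=> w [_ Dw]; rewrite /transition /= cm1.
  apply: smooth_on_sub (trans_smooth Ac' Aa i) => w [Iw [Dw _]].
  exact/overlapE.
- have oQ := open_pre_cinv Ac' oD2.
  exists [set y | cimg c' y /\ D2 (cinv c' y)]; split.
    by split; [exact: cimg_cmap|rewrite /= (cmapK Ac' Dz')].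
  apply: (@smooth_congr _ _ _ oQ (fun y => transition c' b y 0 i + s 0 i)).
    by move=> w [_ Dw]; rewrite /transition /= (cm2 Dw) [RHS]mxE.
  apply: smoothD => //; last exact: smooth_cst.
  apply: smooth_on_sub (trans_smooth Ac' Ab i) => w [Iw [Dw _]].
  exact/overlapE.
Qed.

Lemma glue_atlas : atlas X glue.
Proof. exact: atlas_maximal glue_is_chart glue_compat. Qed.

End PairChart.

(** [psido_prin] describes an operator only inside one chart at a time. The influence of a column
    supported near x' on the value at x is therefore read off in a chart that contains both
    points. *)
Lemma pair_chart x x' : (0 < d)%N -> exists c : chart, [/\ atlas X c, cdom c x & cdom c x'].
Proof.
move=> d0; have [->|xx'] := pselect (x = x').
  by have [c Ac Dx] := atlas_cover X x'; exists c.
have [a Aa Dx] := atlas_cover X x; have [b Ab Dx'] := atlas_cover X x'.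
have := hM; rewrite open_hausdorff => /(_ x x' (introN eqP xx')) [ [W W'] /= [Wx Wx'] [oW oW' WW']].
rewrite !inE in Wx Wx'.
have dis z : W z -> W' z -> False.
  by move=> Wz W'z; have : (W `&` W') z by []; rewrite (eqP WW').
exists (glue a b W W' (cmap a x) (cmap b x') ); split.
- by apply: (@glue_atlas a b W W' (cmap a x) (cmap b x') (Ordinal d0)).
- by left; split => //; split => //; exact: ballxx.
- by right; split => //; split => //; exact: ballxx.
Qed.

End Charts.

(** * Partitions of unity and integration of densities *)

Section Integration.
Variables (R : realType) (d : nat) (M : topologicalType).
Variable X : smooth_structure R d M.
Local Notation chart := (chart R d M).
Local Notation C := R[i].
Hypotheses (hM : hausdorff_space M) (cM : compact [set: M]) (d0 : (0 < d)%N).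

Definition msmooth (chi : M -> R) :=
  forall c, atlas X c -> smooth_on (cimg c) (chi \o cinv c).

Lemma msmooth_cont chi : msmooth chi -> continuous chi.
Proof.
move=> S x; have [c Ac Dx] := atlas_cover X x.
have c1 : {for x, continuous ((chi \o cinv c) \o cmap c)}.
  apply: (@continuous_comp _ _ _ (cmap c) (chi \o cinv c)); first exact: (cmap_cont Ac).
  by apply: (smooth_cont (S c Ac)); exact: cimg_cmap.
apply: (near_eq_continuous (cdom_open Ac) Dx) c1 => z Dz /=.
by rewrite (cmapK Ac Dz).
Qed.

Lemma msmoothM f g : msmooth f -> msmooth g -> msmooth (fun x => f x * g x).
Proof.
move=> F G c Ac; exact: (smoothM (cimg_open Ac) (F c Ac) (G c Ac)).
Qed.

Lemma msmooth_sum n (f : 'I_n -> M -> R) : (forall i, msmooth (f i)) ->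
  msmooth (fun x => \sum_i f i x).
Proof.
move=> F c Ac; apply: (@smooth_sum _ _ _ (cimg_open Ac) _ _ _ (fun i => f i \o cinv c)) => i _.
exact: (F i c Ac).
Qed.

Lemma msmooth_inv f : (forall x, f x != 0) -> msmooth f -> msmooth (fun x => (f x)^-1).
Proof.
move=> f0 F c Ac; apply: (@smooth_inv _ _ _ (cimg_open Ac) (f \o cinv c)); last exact: (F c Ac).
by move=> x _; exact: f0.
Qed.

Lemma cutoffM c f g : cutoff X c f -> msmooth g -> cutoff X c (fun x => f x * g x).
Proof.
move=> [F cF] G; split; first exact: (msmoothM F G).
apply: subset_trans cF; apply: closureS => x /= nz fx0.
by apply: nz; rewrite fx0 mul0r.
Qed.

(** A local-to-global principle. The property P is successively support in a chart, support in a
    chart through a given point, and boundedness of a localised operator. *)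
Lemma finite_bumps (P : (M -> R) -> Prop) :
  (forall x, exists f, [/\ msmooth f, forall z, 0 <= f z, 0 < f x & P f]) ->
  exists n (f : 'I_n -> M -> R),
    (forall i, [/\ msmooth (f i), forall z, 0 <= f i z & P (f i)]) /\
    forall z, 0 < \sum_i f i z.
Proof.
move=> /choice[F HF].
(* The filter of all sets containing every list that extends some fixed list: with it the near
   covering form of compactness produces a finite subcover. *)
pose FF : set_system (seq M) := [set Q : set (seq M) | exists s0 : seq M, forall s : seq M, {subset s0 <= s} -> Q s].
have fF : Filter FF.
  split.
  - by exists [::].
  - move=> P1 P2 [s1 h1] [s2 h2]; exists (s1 ++ s2) => s hs; split.
      by apply: h1 => x xs; apply: hs; rewrite mem_cat xs.
    by apply: h2 => x xs; apply: hs; rewrite mem_cat xs orbT.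
  - by move=> P1 P2 P12 [s1 h1]; exists s1 => s /h1 /P12.
have /compact_near_coveringP := cM.
move=> /(_ _ FF (fun (s : seq M) x => exists2 y, y \in s & 0 < F y x) fF) [].
  move=> x _; have [S _ Fx _] := HF x.
  have nx : \forall z \near x, 0 < F x z.
    have oF : open (F x @^-1` [set t | 0 < t]).
      by apply: open_comp; [move=> z _; exact: msmooth_cont S z|exact: open_gt].
    by apply: (@open_nbhs_nbhs _ x (F x @^-1` [set t | 0 < t])).
  exists ([set z | 0 < F x z], [set s : seq M | x \in s]) => /=.
    by split => //; exists [:: x] => s hs; apply: hs; rewrite inE.
  by move=> [z s] [/= zF xs]; exists x.
move=> s0 /(_ s0 (fun x h => h)) cov; pose s := in_tuple s0.
exists _, (fun i => F (tnth s i)); split; first by move=> i; have [] := HF (tnth s i).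
move=> z; have [x xs /= Fx] := cov z I.
have /tnthP[i xi] : x \in s by [].
rewrite (bigD1 i)//= -xi ltr_pwDl// sumr_ge0// => j _.
by have [_ + _ _] := HF (tnth s j); apply.
Qed.

Lemma partition_exists : exists n (kappa : 'I_n -> chart) (chi : 'I_n -> M -> R),
  partition_of_unity X kappa chi /\ forall i z, 0 <= chi i z.
Proof.
have [n [f [Hf fpos]]] : exists n (f : 'I_n -> M -> R),
    (forall i, [/\ msmooth (f i), forall z, 0 <= f i z & exists c, atlas X c /\ cutoff X c (f i)]) /\
    forall z, 0 < \sum_i f i z.
  apply: (finite_bumps (P := fun f => exists c, atlas X c /\ cutoff X c f)) => x.
  have [c Ac Dx] := atlas_cover X x.
  have [chi [h1 h2 h3 _]] := cutoff_at hM Ac Dx openT I.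
  by exists chi; split => //; [exact: h1.1|exists c].
have /choice[kappa Hk] : forall i, exists c, atlas X c /\ cutoff X c (f i).
  by move=> i; have [] := Hf i.
pose S z := \sum_i f i z.
have SS : msmooth S by apply: msmooth_sum => i; have [] := Hf i.
have S0 z : S z != 0 by rewrite gt_eqF// fpos.
exists n, kappa, (fun i z => f i z * (S z)^-1); split.
  split=> [i|x]; last by rewrite -mulr_suml (mulfV (S0 x)).
  have [Ak ck] := Hk i; split; [exact: Ak|apply: cutoffM; [exact: ck|exact: msmooth_inv]].
by move=> i z; rewrite mulr_ge0// ?invr_ge0 ?(ltW (fpos z))//; have [_ /(_ z)] := Hf i.
Qed.

Definition csup (c : chart) (chi : M -> R) : set 'rV[R]_d := cmap c @` closure [set x | chi x <> 0].

Lemma csup_compact c chi : atlas X c -> cutoff X c chi -> compact (csup c chi).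
Proof.
move=> Ac [_ sD]; apply: continuous_compact.
  by apply: continuous_in_subspaceT => x /set_mem /sD Dx; exact: (cmap_cont Ac Dx).
exact: (subclosed_compact (@closed_closure _ _) cM).
Qed.

Lemma csup_cimg c chi : cutoff X c chi -> csup c chi `<=` cimg c.
Proof. by move=> [_ sD] _ [x /sD Dx <-]; exact: cimg_cmap. Qed.

Lemma csup_eq0 c chi y : atlas X c -> cimg c y -> ~ csup c chi y -> chi (cinv c y) = 0.
Proof.
move=> Ac Iy ny; apply: contrapT => nz; apply: ny; exists (cinv c y); last by rewrite (cinvK Ac).
exact: subset_closure.
Qed.

Definition rdensity (r : chart -> 'rV[R]_d -> R) :=
  [/\ forall c y, atlas X c -> cimg c y -> {for y, continuous (r c)},
      forall c c' y, atlas X c -> atlas X c' -> overlap c c' y ->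
        r c y = `|jac c c' y| * r c' (transition c c' y)
    & forall c y, atlas X c -> ~ cimg c y -> r c y = 0].

Lemma rdensityM r chi : rdensity r -> msmooth chi -> rdensity (fun c y => chi (cinv c y) * r c y).
Proof.
move=> [r1 r2 r3] S; split.
- move=> c y Ac Iy; exact: (continuousM (smooth_cont (S c Ac) Iy) (r1 c y Ac Iy)).
- by move=> c c' y Ac Ac' o; rewrite (r2 _ _ _ Ac Ac' o) (trans_cinv Ac Ac' o) mulrCA.
- by move=> c y Ac nI; rewrite r3 ?mulr0.
Qed.

Definition vanish_off (F0 : set M) (r : chart -> 'rV[R]_d -> R) :=
  forall c y, atlas X c -> cimg c y -> ~ F0 (cinv c y) -> r c y = 0.

Lemma vanish_offM chi r F0 : vanish_off F0 r ->
  vanish_off (closure [set x | chi x <> 0] `&` F0) (fun c y => chi (cinv c y) * r c y).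
Proof.
move=> v c y Ac Iy n; have [->|c0] := eqVneq (chi (cinv c y)) 0; first by rewrite mul0r.
rewrite (v c y Ac Iy) ?mulr0// => h; apply: n; split => //.
by apply: subset_closure; exact/eqP.
Qed.

Lemma cs_density c F0 r : atlas X c -> closed F0 -> F0 `<=` cdom c -> rdensity r ->
  vanish_off F0 r -> cs (r c).
Proof.
move=> Ac cF FD [r1 r2 r3] v.
have cK : compact (cmap c @` F0).
  apply: continuous_compact; last exact: subclosed_compact cF cM _.
  by apply: continuous_in_subspaceT => x /set_mem /FD Dx; exact: (cmap_cont Ac Dx).
have z0 y : ~ (cmap c @` F0) y -> r c y = 0.
  move=> ny; have [Iy|nI] := pselect (cimg c y); last exact: r3.
  by apply: v => // Fy; apply: ny; exists (cinv c y) => //; exact: (cinvK Ac Iy).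
apply: (cs_of_compact cK) => //.
apply: (continuous_zero_ext (cimg_open Ac) (compact_closed _ cK)) => //.
  by move=> _ [x /FD Dx <-]; exact: cimg_cmap.
by move=> y Iy; exact: r1.
Qed.

Lemma change_chart c c' F0 r : atlas X c -> atlas X c' ->
  closed F0 -> F0 `<=` cdom c -> F0 `<=` cdom c' -> rdensity r -> vanish_off F0 r ->
  intRn (r c) = intRn (r c').
Proof.
move=> Ac Ac' cF0 FD FD' Hr v; have [r1 r2 r3] := Hr.
pose F := cmap c' @` F0.
have cF : compact F.
  apply: continuous_compact; last exact: subclosed_compact cF0 cM _.
  by apply: continuous_in_subspaceT => x /set_mem /FD' Dx; exact: (cmap_cont Ac' Dx).
have FV : F `<=` overlap c' c.
  by move=> _ [x Fx <-]; exists x => //; split; [exact: FD'|exact: FD].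
have [cfs _] := cs_density Ac' cF0 FD' Hr v.
have f0 y : ~ F y -> r c' y = 0.
  move=> nF; have [Iy|nI] := pselect (cimg c' y); last by rewrite r3.
  by apply: v => // Fy; apply: nF; exists (cinv c' y) => //; exact: (cinvK Ac' Iy).
have smC (a b : chart) j : atlas X a -> atlas X b ->
    Ck 2 (overlap a b) (fun z => transition a b z 0 j).
  by move=> Aa Ab; have /smooth_onP := trans_smooth Aa Ab j; apply.
rewrite -[RHS](@change_of_variables R d (overlap c c') (overlap c' c) F (transition c c')
   (transition c' c) (r c') (open_overlap Ac Ac') (open_overlap Ac' Ac)
   (fun j => smC c c' j Ac Ac') (fun j => smC c' c j Ac' Ac)) //.
- apply: eq_intRn => y; case: asboolP => [ho|no].
    by rewrite (r2 _ _ _ Ac Ac' ho) /jac mulrC.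
  have [Iy|nI] := pselect (cimg c y); last by rewrite r3.
  apply: v => // Fy; apply: no; apply/(overlapE _ _ Ac); split => //; exact: FD'.
- by move=> x o; split; [exact: (trans_overlap Ac Ac' o)|exact: (transK Ac Ac' o)].
- by move=> x o; split; [exact: (trans_overlap Ac' Ac o)|exact: (transK Ac' Ac o)].
Qed.

Definition psum n (kappa : 'I_n -> chart) (chi : 'I_n -> M -> R) (r : chart -> 'rV[R]_d -> R) : R :=
  \sum_i intRn (fun y => chi i (cinv (kappa i) y) * r (kappa i) y).

Lemma vanish_offT r : vanish_off setT r.
Proof. by move=> c y _ _ []. Qed.

Lemma dec_cutoff c chi r : atlas X c -> cutoff X c chi -> rdensity r ->
  dec (fun y => chi (cinv c y) * r c y).
Proof.
move=> Ac cc Hr; apply/cs_dec.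
apply: (cs_density Ac _ _ (rdensityM Hr cc.1) (vanish_offM (vanish_offT _))).
  by rewrite setIT; exact: closed_closure.
by rewrite setIT; exact: cc.2.
Qed.

Lemma psum_supp n kappa chi c F0 r : partition_of_unity X (n := n) kappa chi -> atlas X c ->
  closed F0 -> F0 `<=` cdom c -> rdensity r -> vanish_off F0 r -> psum kappa chi r = intRn (r c).
Proof.
move=> [P1 P2] Ac cF0 FD Hr v; rewrite /psum.
transitivity (\sum_i intRn (fun y => chi i (cinv c y) * r c y)).
  apply: eq_bigr => i _; have [Ak ck] := P1 i.
  apply: (change_chart Ak Ac _ _ _ (rdensityM Hr ck.1) (vanish_offM v)).
  - by apply: closedI => //; exact: closed_closure.
  - by move=> x [/ck.2].
  - by move=> x [_ /FD].
rewrite -intRn_sum; first by apply: eq_intRn => y; rewrite -mulr_suml P2 mul1r.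
move=> i _; apply/cs_dec; have [Ak ck] := P1 i.
apply: (cs_density Ac _ _ (rdensityM Hr ck.1) (vanish_offM v)).
  by apply: closedI => //; exact: closed_closure.
by move=> x [_ /FD].
Qed.

Lemma psum_sum n kappa chi I (s : seq I) r : partition_of_unity X (n := n) kappa chi ->
  (forall j, rdensity (r j)) ->
  psum kappa chi (fun c y => \sum_(j <- s) r j c y) = \sum_(j <- s) psum kappa chi (r j).
Proof.
move=> [P1 P2] Hr; rewrite /psum exchange_big /=; apply: eq_bigr => i _.
have [Ak ck] := P1 i; rewrite -intRn_sum; last by move=> j _; exact: dec_cutoff.
by apply: eq_intRn => y; rewrite mulr_sumr.
Qed.

(** Inserting the second partition makes every term supported in a single chart, where [psum_supp]
    evaluates it. Hence the value chosen by [xget] in [integralM] is well determined. *)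
Lemma psum_unique n kappa chi n' kappa' chi' r :
  partition_of_unity X (n := n) kappa chi -> partition_of_unity X (n := n') kappa' chi' ->
  rdensity r -> psum kappa chi r = psum kappa' chi' r.
Proof.
move=> P Q Hr.
transitivity (psum kappa chi (fun c y => \sum_j chi' j (cinv c y) * r c y)).
  by apply: eq_bigr => i _; apply: eq_intRn => y; rewrite -mulr_suml Q.2 mul1r.
rewrite psum_sum//; last by move=> j; apply: rdensityM => //; have [_ []] := Q.1 j.
apply: eq_bigr => j _; have [Ak ck] := Q.1 j.
apply: (psum_supp P Ak _ _ (rdensityM Hr ck.1) (vanish_offM (vanish_offT _))).
  by rewrite setIT; exact: closed_closure.
by rewrite setIT; exact: ck.2.
Qed.

End Integration.

Local Open Scope sesquilinear_scope.

(** * Semi-inner products on real subspaces *)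

Section SemiInner.
Variables (R : realType) (V : lmodType R[i]).
Local Notation "t %:K" := ((t : R)%:C)%C (at level 1, format "t %:K").

(** The carrier type contains all coordinate families, smooth or not, hence the domain D. Scalars
    are real because real parts of inner products are used; definiteness is left out so that one
    theory serves columns, Sobolev forms and Cauchy sequences. *)
Record real_subspace (D : set V) : Prop := RealSubspace {
  rs0 : D 0;
  rsD : forall v w, D v -> D w -> D (v + w);
  rsZ : forall t v, D v -> D (t%:K *: v) }.

Record semi_inner (D : set V) (b : V -> V -> R) : Prop := SemiInner {
  siC : forall v w, D v -> D w -> b v w = b w v;
  siD : forall u v w, D u -> D v -> D w -> b (u + v) w = b u w + b v w;
  siZ : forall t v w, D v -> D w -> b (t%:K *: v) w = t * b v w;
  si_ge0 : forall v, D v -> 0 <= b v v }.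

Definition snorm (b : V -> V -> R) v := Num.sqrt (b v v).

Section Theory.
Variables (D : set V) (b : V -> V -> R).
Hypotheses (rs : real_subspace D) (si : semi_inner D b).

Lemma rcN1 (v : V) : (-1)%:K *: v = - v.
Proof. by rewrite (_ : (-1)%:K = -1) ?scaleN1r//; apply/eqP; rewrite eq_complex /= oppr0 !eqxx. Qed.

Lemma rsN v : D v -> D (- v).
Proof. by rewrite -rcN1; exact: rsZ. Qed.

Lemma rsB v w : D v -> D w -> D (v - w).
Proof. by move=> Dv /rsN; exact: rsD. Qed.

Lemma rs_sum I (s : seq I) (P : pred I) (F : I -> V) :
  (forall i, P i -> D (F i)) -> D (\sum_(i <- s | P i) F i).
Proof. by move=> H; elim/big_rec: _ => [|i v /H]; [exact: rs0|exact: rsD]. Qed.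

Lemma siDr u v w : D u -> D v -> D w -> b w (u + v) = b w u + b w v.
Proof.
by move=> Du Dv Dw; rewrite (siC si) ?(siD si)// ?(siC si Du Dw) ?(siC si Dv Dw)//; exact: rsD.
Qed.

Lemma siZr t v w : D v -> D w -> b w (t%:K *: v) = t * b w v.
Proof. by move=> Dv Dw; rewrite (siC si) ?(siZ si) ?(siC si Dv Dw)//; exact: rsZ. Qed.

Lemma siN v w : D v -> D w -> b (- v) w = - b v w.
Proof. by move=> Dv Dw; rewrite -rcN1 (siZ si)// mulN1r. Qed.

Lemma siNr v w : D v -> D w -> b w (- v) = - b w v.
Proof. by move=> Dv Dw; rewrite -rcN1 siZr// mulN1r. Qed.

Lemma siB u v w : D u -> D v -> D w -> b (u - v) w = b u w - b v w.
Proof. by move=> Du Dv Dw; rewrite (siD si)// ?siN//; exact: rsN. Qed.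

Lemma siBr u v w : D u -> D v -> D w -> b w (u - v) = b w u - b w v.
Proof. by move=> Du Dv Dw; rewrite siDr// ?siNr//; exact: rsN. Qed.

Lemma si0 w : D w -> b 0 w = 0.
Proof. by move=> Dw; rewrite -(subrr w) siB// subrr. Qed.

Lemma si_suml I (s : seq I) (F : I -> V) w : (forall i, D (F i)) -> D w ->
  b (\sum_(i <- s) F i) w = \sum_(i <- s) b (F i) w.
Proof.
move=> DF Dw; elim: s => [|i s IH]; first by rewrite !big_nil si0.
by rewrite !big_cons (siD si) ?IH//; exact: rs_sum.
Qed.

Lemma si_sumr I (s : seq I) (F : I -> V) w : (forall i, D (F i)) -> D w ->
  b w (\sum_(i <- s) F i) = \sum_(i <- s) b w (F i).
Proof.
move=> DF Dw; elim: s => [|i s IH]; first by rewrite !big_nil (siC si) ?si0//; exact: rs0.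
by rewrite !big_cons siDr ?IH//; exact: rs_sum.
Qed.

Lemma snorm_ge0 v : 0 <= snorm b v.
Proof. exact: sqrtr_ge0. Qed.

Lemma sqr_snorm v : D v -> snorm b v ^+ 2 = b v v.
Proof. by move=> Dv; rewrite sqr_sqrtr// (si_ge0 si). Qed.

Lemma si_CS v w : D v -> D w -> `|b v w| <= snorm b v * snorm b w.
Proof.
move=> Dv Dw; have h2 : b v w ^+ 2 <= b v v * b w w.
  have q t : 0 <= b v v - 2 * t * b v w + t ^+ 2 * b w w.
    have Dt := rsZ rs t Dw.
    have := si_ge0 si (rsB Dv Dt).
    rewrite siB ?siBr// ?siZr// ?(siZ si)// ?siZr// ?(siC si Dw Dv); last exact: rsB.
    by congr (0 <= _); ring.
  have [z|nz] := eqVneq (b w w) 0.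
    rewrite z mulr0; have [->|n1] := eqVneq (b v w) 0; first by rewrite expr0n.
    (* With this t and [b w w = 0] the quadratic takes the value -1, a contradiction. *)
    have := q ((b v v + 1) / (2 * b v w)); rewrite z mulr0 addr0.
    have -> : 2 * ((b v v + 1) / (2 * b v w)) * b v w = b v v + 1 by field.
    by move=> h; lra.
  have p : 0 < b w w by rewrite lt_neqAle eq_sym nz (si_ge0 si).
  have := q (b v w / b w w).
  have -> : b v v - 2 * (b v w / b w w) * b v w + (b v w / b w w) ^+ 2 * b w w =
     (b v v * b w w - b v w ^+ 2) / b w w by field.
  by rewrite pmulr_lge0 ?invr_gt0// subr_ge0.
rewrite -sqrtrM; last exact: (si_ge0 si).
by rewrite -sqrtr_sqr ler_wsqrtr.
Qed.

Lemma snormD v w : D v -> D w -> snorm b (v + w) <= snorm b v + snorm b w.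
Proof.
move=> Dv Dw; rewrite -(@ler_pXn2r _ 2)// ?nnegrE ?addr_ge0 ?snorm_ge0//.
rewrite sqr_snorm; last exact: rsD.
rewrite (siD si) ?siDr//; last exact: rsD.
rewrite sqrrD -(sqr_snorm Dv) -(sqr_snorm Dw) !sqr_snorm// (siC si Dw Dv).
have h := si_CS Dv Dw.
have := le_trans (ler_norm _) h; rewrite mulr2n => h'; lra.
Qed.

Lemma snormZ t v : D v -> snorm b (t%:K *: v) = `|t| * snorm b v.
Proof.
move=> Dv; rewrite /snorm (siZ si) ?siZr// ?mulrA; last exact: rsZ.
by rewrite -expr2 sqrtrM ?sqr_ge0// sqrtr_sqr.
Qed.

Lemma snormN v : D v -> snorm b (- v) = snorm b v.
Proof. by move=> Dv; rewrite -rcN1 snormZ// normrN1 mul1r. Qed.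

Lemma snormB v w : D v -> D w -> snorm b (v - w) <= snorm b v + snorm b w.
Proof. by move=> Dv Dw; rewrite -(snormN Dw); apply: snormD => //; exact: rsN. Qed.

Lemma snorm_le_dist v w : D v -> D w -> snorm b v <= snorm b (v - w) + snorm b w.
Proof. by move=> Dv Dw; rewrite -{1}(subrK w v); apply: snormD => //; exact: rsB. Qed.

Lemma snorm0 : snorm b 0 = 0.
Proof. by rewrite /snorm si0 ?sqrtr0//; exact: rs0. Qed.

Lemma snorm_sum I (s : seq I) (F : I -> V) : (forall i, D (F i)) ->
  snorm b (\sum_(i <- s) F i) <= \sum_(i <- s) snorm b (F i).
Proof.
move=> DF; elim: s => [|i s IH]; first by rewrite !big_nil snorm0.
rewrite !big_cons; apply: le_trans (snormD _ _) _ => //; first exact: rs_sum.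
by rewrite lerD2l.
Qed.

End Theory.
End SemiInner.

(** * Real coordinates of complex columns *)

Section Columns.
Variables (R : realType) (m : nat).
Local Notation C := R[i].
Local Notation "t %:K" := ((t : R)%:C)%C (at level 1, format "t %:K").
Local Notation J := ('I_m * bool)%type.

(* real coordinates of a complex column: real parts (false) and imaginary parts (true) *)
Definition co (z : 'cV[C]_m) (j : J) : R :=
  if j.2 then complex.Im (z j.1 0) else complex.Re (z j.1 0).

Lemma coD z w j : co (z + w) j = co z j + co w j.
Proof. by rewrite /co mxE; case: j.2; case: (z _ _) => ? ?; case: (w _ _). Qed.

Lemma coN z j : co (- z) j = - co z j.
Proof. by rewrite /co mxE; case: j.2; case: (z _ _) => ? ?. Qed.

Lemma co0 j : co 0 j = 0.
Proof. by rewrite /co mxE; case: j.2. Qed.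

Lemma coZ t z j : co (t%:K *: z) j = t * co z j.
Proof. by rewrite /co mxE; case: j.2; case: (z _ _) => a b /=; rewrite mul0r ?subr0 ?addr0. Qed.

Definition ej (j : J) : 'cV[C]_m := \col_i (if i == j.1 then if j.2 then 'i%C else 1 else 0).

Lemma co_ej j k : co (ej j) k = (k == j)%:R.
Proof.
by rewrite /co mxE; case: j k => [i b] [i' b'] /=; rewrite xpair_eqE; case: eqVneq => _; case: b; case: b'.
Qed.

Definition rdot (z w : 'cV[C]_m) : R := \sum_j co z j * co w j.

Lemma rdotC z w : rdot z w = rdot w z.
Proof. by apply: eq_bigr => j _; rewrite mulrC. Qed.

Lemma rdotD z w u : rdot (z + w) u = rdot z u + rdot w u.
Proof. by rewrite /rdot -big_split; apply: eq_bigr => j _; rewrite coD mulrDl. Qed.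

Lemma rdotZ t z u : rdot (t%:K *: z) u = t * rdot z u.
Proof. by rewrite /rdot mulr_sumr; apply: eq_bigr => j _; rewrite coZ mulrA. Qed.

Lemma rdot0 u : rdot u 0 = 0.
Proof. by rewrite /rdot big1// => j _; rewrite co0 mulr0. Qed.

Lemma rdot_ej j u : rdot (ej j) u = co u j.
Proof.
rewrite /rdot (bigD1 j)//= co_ej eqxx mul1r big1 ?addr0// => k /negPf kj.
by rewrite co_ej kj mul0r.
Qed.

Lemma rdot_ge0 u : 0 <= rdot u u.
Proof. by apply: sumr_ge0 => j _; rewrite -expr2 sqr_ge0. Qed.

Lemma rdotE z w : complex.Re ((z ^t* *m w) 0 0) = rdot z w.
Proof.
rewrite mxE (big_morph (@complex.Re R) (id1 := 0) (op1 := +%R))//; last by move=> [? ?] [? ?].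
rewrite /rdot -(pair_bigA _ (fun i b => co z (i, b) * co w (i, b))) /=.
apply: eq_bigr => i _; rewrite big_bool /co /= !mxE.
by case: (z i 0) => a b; case: (w i 0) => a' b' /=; rewrite mulNr opprK addrC.
Qed.

End Columns.

(** * The real inner product on smooth half-densities *)

Section Inner.
Variables (R : realType) (d : nat) (M : topologicalType).
Variable X : smooth_structure R d M.
Variable m : nat.
Local Notation chart := (chart R d M).
Local Notation C := R[i].
Local Notation hd := (hdens R d M m).
Local Notation "t %:K" := ((t : R)%:C)%C (at level 1, format "t %:K").
Hypotheses (hM : hausdorff_space M) (cM : compact [set: M]) (d0 : (0 < d)%N).

Lemma CinfP (v : hd) : Cinf X v <->
  [/\ forall c j, atlas X c -> smooth_on (cimg c) (fun y => co (v c y) j),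
      forall c c', atlas X c -> atlas X c' -> forall y, overlap c c' y ->
        v c y = (hfac c c' y)%:K *: v c' (transition c c' y)
    & forall c y, ~ (atlas X c /\ cimg c y) -> v c y = 0].
Proof.
split=> [[v1 v2 v3]|[v1 v2 v3]]; split => //.
  by move=> c [i b] Ac; have [h1 h2] := v1 c Ac i 0; rewrite /co /=; case: b.
by move=> c Ac i j; rewrite ord1; split; [exact: (v1 c (i, false))|exact: (v1 c (i, true))].
Qed.

Lemma Cinf_smooth (v : hd) c j : Cinf X v -> atlas X c -> smooth_on (cimg c) (fun y => co (v c y) j).
Proof. by move=> /CinfP[+ _ _]; exact. Qed.

Lemma Cinf_out (v : hd) c y : Cinf X v -> ~ cimg c y -> v c y = 0.
Proof. by move=> [_ _ v3] nI; apply: v3 => -[]. Qed.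

Lemma hdD (v w : hd) c y : (v + w) c y = v c y + w c y.
Proof. by []. Qed.

Lemma hdZ z (v : hd) c y : (z *: v) c y = z *: v c y.
Proof. by []. Qed.

Lemma Cinf_subspace : real_subspace [set v : hd | Cinf X v].
Proof.
split.
- apply/CinfP; split => //= [c j Ac|c c' _ _ y _]; last by rewrite scaler0.
  apply: (@smooth_congr _ _ _ (cimg_open Ac) (fun=> 0)); last exact: smooth_cst (cimg_open Ac) _.
  by move=> y _; rewrite co0.
- move=> v w /CinfP[v1 v2 v3] /CinfP[w1 w2 w3]; apply/CinfP; split.
  + move=> c j Ac; have oI := cimg_open Ac.
    apply: (smooth_congr oI _ (smoothD oI (v1 c j Ac) (w1 c j Ac))).
    by move=> y _ /=; rewrite -coD.
  + by move=> c c' Ac Ac' y o; rewrite !hdD (v2 c c')// (w2 c c')// -scalerDr.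
  + by move=> c y n; rewrite hdD v3// w3// addr0.
- move=> t v /CinfP[v1 v2 v3]; apply/CinfP; split.
  + move=> c j Ac; have oI := cimg_open Ac.
    by apply: (smooth_congr oI _ (smoothZ oI t (v1 c j Ac))) => y _ /=; rewrite -coZ.
  + by move=> c c' Ac Ac' y o; rewrite !hdZ (v2 c c' Ac Ac' y o) !scalerA mulrC.
  + by move=> c y n; rewrite hdZ v3// scaler0.
Qed.

Lemma Cinf_sum I (r : seq I) (Q : pred I) (F : I -> hd) :
  (forall i, Q i -> Cinf X (F i)) -> Cinf X (\sum_(i <- r | Q i) F i).
Proof. exact: (rs_sum Cinf_subspace r). Qed.

Lemma rdensity_rdot (v w : hd) : Cinf X v -> Cinf X w -> rdensity X (fun c y => rdot (v c y) (w c y)).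
Proof.
move=> Cv Cw; have [v1 v2 v3] := (CinfP v).1 Cv; have [w1 w2 w3] := (CinfP w).1 Cw; split.
- move=> c y Ac Iy; have oI := cimg_open Ac.
  apply: (@smooth_cont _ _ _ (fun y => \sum_j co (v c y) j * co (w c y) j) y _ Iy).
  by apply: smooth_sum => // j _; apply: smoothM => //; [exact: v1|exact: w1].
- move=> c c' y Ac Ac' o; rewrite (v2 c c')// (w2 c c')// rdotZ rdotC rdotZ mulrA hfac_sqr.
  by rewrite rdotC.
- by move=> c y Ac nI; rewrite (w3 c y) ?rdot0// => -[].
Qed.

Lemma Re_integralM n kappa chi rho : partition_of_unity X (n := n) kappa chi ->
  rdensity X (fun c y => complex.Re (rho c y)) ->
  complex.Re (integralM X rho) = psum kappa chi (fun c y => complex.Re (rho c y)).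
Proof.
move=> P Hr; rewrite /integralM; set S := [set z | _].
have [n' [kappa' [chi' [P' ->]]]] : S (xget 0 S).
  by apply: xgetPex; exists (\sum_i intC (fun y => (chi i (cinv (kappa i) y))%:C%C * rho (kappa i) y)), n, kappa, chi.
rewrite (psum_unique cM P P' Hr) (big_morph (@complex.Re R) (id1 := 0) (op1 := +%R))//; last by move=> [? ?] [? ?].
apply: eq_bigr => i _; apply: eq_intRn => y.
by case: (rho _ _) => a b /=; rewrite mul0r subr0.
Qed.

(** The real part determines the L^2 norm, and an adjoint for [inner] is an adjoint for it
    ([rin_adjoint]). *)
Definition rin (v w : hd) : R := complex.Re (inner X v w).

Lemma rinE n kappa chi v w : partition_of_unity X (n := n) kappa chi -> Cinf X v -> Cinf X w ->
  rin v w = psum kappa chi (fun c y => rdot (v c y) (w c y)).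
Proof.
move=> P Cv Cw; rewrite /rin /inner.
have E : (fun c y => complex.Re (((v c y) ^t* *m w c y) 0 0)) = (fun c y => rdot (v c y) (w c y)).
  by apply/funext => c; apply/funext => y; rewrite rdotE.
rewrite (Re_integralM P) ?E//; exact: rdensity_rdot.
Qed.

Lemma rin_semi_inner : semi_inner [set v : hd | Cinf X v] rin.
Proof.
have [n [kappa [chi [P chi0]]]] := partition_exists X hM cM.
have rs := Cinf_subspace.
split.
- move=> v w Cv Cw; rewrite !(rinE P)//; apply: eq_bigr => i _; apply: eq_intRn => y.
  by rewrite rdotC.
- move=> u v w Cu Cv Cw; have Cuv := rsD rs Cu Cv; rewrite !(rinE P)// /psum -big_split /=.
  apply: eq_bigr => i _; have [Ak ck] := P.1 i.
  rewrite -intRnD; last 2 first.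
    exact: (dec_cutoff cM Ak ck (rdensity_rdot Cu Cw)).
    exact: (dec_cutoff cM Ak ck (rdensity_rdot Cv Cw)).
  by apply: eq_intRn => y; rewrite rdotD mulrDr.
- move=> t v w Cv Cw; have Ct := rsZ rs t Cv; rewrite !(rinE P)// /psum mulr_sumr.
  apply: eq_bigr => i _; have [Ak ck] := P.1 i.
  rewrite -intRnZ; last exact: (dec_cutoff cM Ak ck (rdensity_rdot Cv Cw)).
  by apply: eq_intRn => y; rewrite rdotZ; ring.
- move=> v Cv; rewrite (rinE P)//; apply: sumr_ge0 => i _; apply: intRn_ge0 => y.
  by rewrite mulr_ge0// rdot_ge0.
Qed.

Lemma rin_adjoint (B B' : op R d M m) v w : is_adjoint X B B' -> Cinf X v -> Cinf X w ->
  rin (B v) w = rin v (B' w).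
Proof. by move=> [_ h] Cv Cw; rewrite /rin h. Qed.

Lemma rin_supp c F0 v w : atlas X c -> closed F0 -> F0 `<=` cdom c -> Cinf X v -> Cinf X w ->
  (forall c y, atlas X c -> cimg c y -> ~ F0 (cinv c y) -> v c y = 0) ->
  rin v w = intRn (fun y => rdot (v c y) (w c y)).
Proof.
move=> Ac cF FD Cv Cw v0; have [n [kappa [chi [P chi0]]]] := partition_exists X hM cM.
rewrite (rinE P)// (psum_supp cM P Ac cF FD (rdensity_rdot Cv Cw))// => c' y Ac' Iy nF.
by rewrite (v0 c')// rdotC rdot0.
Qed.

Definition cutv (chi : M -> R) (v : hd) : hd := fun c y => (chi (cinv c y))%:K *: v c y.

Lemma Cinf_cutv chi v : msmooth X chi -> Cinf X v -> Cinf X (cutv chi v).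
Proof.
move=> S /CinfP[v1 v2 v3]; apply/CinfP; split.
- move=> c j Ac; have oI := cimg_open Ac.
  by apply: (smooth_congr oI _ (smoothM oI (S c Ac) (v1 c j Ac))) => y _ /=; rewrite -coZ.
- move=> c c' Ac Ac' y o; rewrite /cutv (v2 c c' Ac Ac' y o) !scalerA (trans_cinv Ac Ac' o).
  by rewrite mulrC.
- by move=> c y n; rewrite /cutv v3// scaler0.
Qed.

Lemma rin_cutv c chi v w : atlas X c -> cutoff X c chi -> Cinf X v -> Cinf X w ->
  rin (cutv chi v) w = intRn (fun y => chi (cinv c y) * rdot (v c y) (w c y)).
Proof.
move=> Ac cc Cv Cw.
rewrite (rin_supp Ac (@closed_closure _ [set x | chi x <> 0]) cc.2 (Cinf_cutv cc.1 Cv) Cw).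
  by apply: eq_intRn => y; rewrite /cutv rdotZ.
move=> c' y Ac' Iy n; rewrite /cutv.
have -> : chi (cinv c' y) = 0.
  by apply: contrapT => nz; apply: n; exact: subset_closure.
by rewrite scale0r.
Qed.

(** The expressions in the other charts are forced by the transformation law of half-densities. *)
Definition ext (c : chart) (f : 'rV[R]_d -> R) (e : 'cV[C]_m) : hd := fun c' y =>
  if `[< atlas X c' /\ overlap c' c y >]
  then (hfac c' c y * f (transition c' c y))%:K *: e else 0.

Section Ext.
Variables (c : chart) (L : set 'rV[R]_d).
Hypotheses (Ac : atlas X c) (cL : compact L) (LI : L `<=` cimg c).

Definition test (f : 'rV[R]_d -> R) := smooth_on setT f /\ forall y, ~ L y -> f y = 0.

Lemma ext_vanish f e c' y : test f -> ~ (cinv c @` L) (cinv c' y) -> ext c f e c' y = 0.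
Proof.
move=> [_ f0] n; rewrite /ext; case: asboolP => // -[Ac' o].
rewrite f0 ?mulr0 ?scale0r// => Lt; apply: n; exists (transition c' c y) => //.
exact: (trans_cinv Ac' Ac o).
Qed.

Lemma Cinf_ext f e : test f -> Cinf X (ext c f e).
Proof.
move=> Tf; have [Sf f0] := Tf; apply/CinfP; split.
- move=> c' j Ac'; have cl := closed_cinv hM Ac cL LI.
  apply: smooth_local => y Iy.
  have [[z Lz zE]|nL] := pselect ((cinv c @` L) (cinv c' y)).
    exists (overlap c' c); split.
      by apply/(overlapE _ _ Ac'); split => //; rewrite -zE; apply: (cinv_dom Ac); exact: LI.
    have oo := open_overlap Ac' Ac.
    apply: (@smooth_congr _ _ _ oo (fun y => hfac c' c y * f (transition c' c y) * co e j)).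
      by move=> w o; rewrite /ext asboolT// coZ.
    apply: smoothM => //; last exact: smooth_cst.
    apply: smoothM => //; first exact: (smooth_hfac Ac' Ac).
    apply: (@smooth_comp _ _ _ oo _ (cimg c)) => //; first exact: (cimg_open Ac).
    - by move=> w o; exact: (trans_cimg Ac' Ac o).
    - exact: (trans_smooth Ac' Ac).
    - exact: smooth_on_sub Sf.
  have oo : open [set y | cimg c' y /\ (~` (cinv c @` L)) (cinv c' y)].
    by apply: (open_pre_cinv Ac'); rewrite openC.
  exists [set y | cimg c' y /\ (~` (cinv c @` L)) (cinv c' y)]; split => //.
  apply: (@smooth_congr _ _ _ oo (fun=> 0)); last exact: smooth_cst.
  by move=> w [Iw nw] /=; rewrite ext_vanish ?co0.
- move=> c1 c2 A1 A2 y o12; rewrite /ext; case: asboolP => [[_ o1]|n1].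
    have o2 := overlap_trans A1 A2 o12 o1.
    rewrite asboolT// (hfac_trans A1 A2 Ac o12 o1) (trans_trans c A1 A2 o12) scalerA.
    by congr (_ *: _); rewrite -mulrA rmorphM.
  case: asboolP => [[_ o2]|]; last by rewrite scaler0.
  exfalso; apply: n1; split => //.
  have /(trans_overlap A1 A2) o21 := o12.
  have := overlap_trans A2 A1 o21 o2; by rewrite (transK A1 A2 o12).
- move=> c' y n; rewrite /ext; case: asboolP => // -[Ac' o]; exfalso; apply: n; split => //.
  exact: (overlap_cimg Ac' o).
Qed.

Lemma extE f e y : cimg c y -> ext c f e c y = (f y)%:K *: e.
Proof.
move=> Iy; rewrite /ext asboolT; last by split => //; exact: (overlap_refl Ac Iy).
by rewrite (hfac_refl Ac Iy) (trans_refl Ac Iy) mul1r.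
Qed.

Lemma rin_ext f e w : test f -> Cinf X w ->
  rin (ext c f e) w = intRn (fun y => f y * rdot e (w c y)).
Proof.
move=> Tf Cw; rewrite (rin_supp Ac (closed_cinv hM Ac cL LI) _ (Cinf_ext e Tf) Cw).
- apply: eq_intRn => y; have [Iy|nI] := pselect (cimg c y); first by rewrite extE// rdotZ.
  by rewrite (Cinf_out Cw nI) !rdot0 mulr0.
- by move=> _ [y /LI Iy <-]; exact: (cinv_dom Ac Iy).
- by move=> c' y _ _; exact: ext_vanish.
Qed.

Lemma ext_lin t f g e : ext c (fun y => t * f y + g y) e = t%:K *: ext c f e + ext c g e.
Proof.
apply/funext => c'; apply/funext => y; rewrite hdD hdZ /ext.
case: asboolP => _; last by rewrite scaler0 addr0.
rewrite scalerA -scalerDl; congr (_ *: _).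
by rewrite -rmorphM -rmorphD; congr (_%:K); ring.
Qed.

Lemma snorm_ext f e : test f -> snorm rin (ext c f e) ^+ 2 = rdot e e * intRn (fun y => f y * f y).
Proof.
move=> Tf; have CE := Cinf_ext e Tf; have [Sf f0] := Tf.
rewrite (sqr_snorm rin_semi_inner)// (rin_ext e Tf CE) -intRnZ.
  apply: eq_intRn => y; have [Iy|nI] := pselect (cimg c y).
    by rewrite (extE _ _ Iy) rdotC rdotZ; ring.
  by rewrite (f0 y) ?mul0r ?mulr0// => /LI.
have cf : continuous f by move=> y; exact: (smooth_cont Sf I).
apply/cs_dec/(cs_of_compact cL); last by move=> y ny; rewrite f0 ?mul0r.
by move=> y; exact: (continuousM (cf y) (cf y)).
Qed.

End Ext.
End Inner.

(** * Fourier transform of test functions *)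

Section Fourier.
Variable R : realType.

Lemma dotC n (x y : 'rV[R]_n) : dot x y = dot y x.
Proof. by apply: eq_bigr => i _; rewrite mulrC. Qed.

Lemma dotDl n (x y z : 'rV[R]_n) : dot (x + y) z = dot x z + dot y z.
Proof. by rewrite /dot -big_split; apply: eq_bigr => i _; rewrite mxE mulrDl. Qed.

Lemma dotZl n t (x y : 'rV[R]_n) : dot (t *: x) y = t * dot x y.
Proof. by rewrite /dot mulr_sumr; apply: eq_bigr => i _; rewrite mxE mulrA. Qed.

Lemma dotNl n (x y : 'rV[R]_n) : dot (- x) y = - dot x y.
Proof. by rewrite -scaleN1r dotZl mulN1r. Qed.

Lemma dotNr n (x y : 'rV[R]_n) : dot x (- y) = - dot x y.
Proof. by rewrite dotC dotNl dotC. Qed.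

Lemma dot_e n i (y : 'rV[R]_n) : dot 'e_i y = y 0 i.
Proof.
rewrite /dot (bigD1 i)//= deltaE eqxx mul1r big1 ?addr0// => j /negPf ji.
by rewrite deltaE ji mul0r.
Qed.

Lemma continuous_dot n : continuous (fun q : 'rV[R]_n * 'rV[R]_n => dot q.1 q.2).
Proof.
rewrite /dot; elim: (index_enum _) => [|i s IH].
  rewrite (_ : (fun q => _) = fun=> 0); first exact: cst_continuous.
  by apply/funext => q; rewrite big_nil.
rewrite (_ : (fun q => _) = fun q : 'rV[R]_n * 'rV[R]_n =>
    q.1 0 i * q.2 0 i + \sum_(j <- s) q.1 0 j * q.2 0 j); last by apply/funext => q; rewrite big_cons.
have c1 : continuous (fun q : 'rV[R]_n * 'rV[R]_n => q.1 0 i).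
  by apply: (@continuousC _ _ _ fst (fun x : 'rV[R]_n => x 0 i)); [exact: continuous_fst|exact: coord_continuous].
have c2 : continuous (fun q : 'rV[R]_n * 'rV[R]_n => q.2 0 i).
  by apply: (@continuousC _ _ _ snd (fun x : 'rV[R]_n => x 0 i)); [exact: continuous_snd|exact: coord_continuous].
move=> q; exact: (continuousD (continuousM (c1 q) (c2 q)) (IH q)).
Qed.

Lemma continuous_dot2 (T : topologicalType) n (a b : T -> 'rV[R]_n) :
  continuous a -> continuous b -> continuous (fun t => dot (a t) (b t)).
Proof. by move=> ca cb; apply: (continuous2 (F := @dot R n)) => //; exact: continuous_dot. Qed.

Lemma continuous_cosC (T : topologicalType) (a : T -> R) : continuous a -> continuous (fun t => cos (a t)).
Proof. by move=> ca; apply: continuousC => //; exact: continuous_cos. Qed.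

Lemma continuousDT (T : topologicalType) (a b : T -> R) : continuous a -> continuous b ->
  continuous (fun t => a t + b t).
Proof. by move=> ca cb t; exact: (continuousD (ca t) (cb t)). Qed.

Lemma continuousMT (T : topologicalType) (a b : T -> R) : continuous a -> continuous b ->
  continuous (fun t => a t * b t).
Proof. by move=> ca cb t; exact: (continuousM (ca t) (cb t)). Qed.

Lemma continuousZT (T : topologicalType) n (a : R) (b : T -> 'rV[R]_n) : continuous b ->
  continuous (fun t => a *: b t).
Proof. by move=> cb; apply: (continuousC cb); exact: scaler_continuous. Qed.

Lemma continuousDrV (T : topologicalType) n (a b : T -> 'rV[R]_n) : continuous a -> continuous b ->
  continuous (fun t => a t + b t).
Proof. by move=> ca cb t; exact: (continuousD (ca t) (cb t)). Qed.

Lemma continuous_idT (T : topologicalType) : continuous (fun x : T => x).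
Proof. by move=> x. Qed.

(* the Fourier transform of a real function f is [cf 0 f - i cf (- pi / 2) f] *)
Definition cf n (th : R) (f : 'rV[R]_n -> R) (xi : 'rV[R]_n) : R :=
  intRn (fun y => cos (dot y xi + th) * f y).

Lemma dec_cosM n th xi (f : 'rV[R]_n -> R) : dec f -> dec (fun y => cos (dot y xi + th) * f y).
Proof.
move=> df; apply: (decM (C := 1) df); last by move=> y; exact: cos_max.
apply: continuous_cosC; apply: continuousDT; last exact: cst_continuous.
by apply: continuous_dot2; [exact: continuous_idT|exact: cst_continuous].
Qed.

Lemma cf_le n th (f : 'rV[R]_n -> R) xi : dec f -> `|cf th f xi| <= intRn (fun y => `|f y|).
Proof.
move=> df; have dc := dec_cosM th xi df; apply: le_trans (le_norm_intRn dc) _.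
apply: le_intRn; [exact: dec_norm|exact: dec_norm|move=> y].
by rewrite normrM ler_piMl// cos_max.
Qed.

Lemma cfB n th (f g : 'rV[R]_n -> R) xi : dec f -> dec g ->
  cf th (fun y => f y - g y) xi = cf th f xi - cf th g xi.
Proof.
move=> df dg; rewrite /cf -intRnB; [|exact: dec_cosM|exact: dec_cosM].
by apply: eq_intRn => y; rewrite mulrBr.
Qed.

Lemma continuous_cf n th (f : 'rV[R]_n -> R) : dec f -> continuous (cf th f).
Proof.
move=> df xi; have [cdf [C fC]] := df.
apply: (@continuous_intRn _ _ _ (fun xi y => cos (dot y xi + th) * f y) xi C).
- by move=> q; have [] := dec_cosM th q df.
- move=> y; apply: (@continuousMT _ (fun q : 'rV[R]_n => cos (dot y q + th)) (fun=> f y)); last exact: cst_continuous.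
  apply: continuous_cosC; apply: continuousDT; last exact: cst_continuous.
  by apply: continuous_dot2; [exact: cst_continuous|exact: continuous_idT].
- apply: (@nearW _ (nbhs xi)) => q y; apply: le_trans (fC y).
  by rewrite normrM ler_piMl// cos_max.
Qed.

Lemma is_derive_phase n th (xi x : 'rV[R]_n) i :
  is_derive x ('e_i : 'rV[R]_n) (fun y : 'rV[R]_n => cos (dot y xi + th))
    (xi 0 i * cos (dot x xi + (th + pi / 2))).
Proof.
pose g (h : R) := cos (xi 0 i *: h + (dot x xi + th)).
have dg : is_derive (0 : R) (1 : R) g (xi 0 i * cos (dot x xi + (th + pi / 2))).
  have d1 : is_derive (0 : R) (1 : R) (cos \o (fun h : R => xi 0 i *: h + (dot x xi + th)))
     (- sin (xi 0 i *: (0 : R) + (dot x xi + th)) * (xi 0 i)).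
    apply: is_derive1_comp.
    have d0 : is_derive (0 : R) (1 : R) (fun h : R => xi 0 i *: h + (dot x xi + th))
        (xi 0 i *: (1 : R) + 0).
      apply: is_deriveD; exact: is_deriveZ.
    by move: d0; rewrite addr0 [_ *: 1]mulr1.
  move: d1; rewrite scaler0 add0r addrA cosDpihalf mulNr mulrN mulrC.
  by [].
have E : (fun h : R => h^-1 *: (((fun y : 'rV[R]_n => cos (dot y xi + th)) \o shift x) (h *: 'e_i) - cos (dot x xi + th))) =
   (fun h : R => h^-1 *: ((g \o shift 0) (h *: 1) - g 0)).
  apply/funext => h; rewrite /g /= scaler0 add0r addr0; congr (_ *: (cos _ - _)).
  by rewrite dotDl dotZl dot_e addrA [h *: 1]mulr1 [_ *: h]mulrC.
by have [h1 h2] := dg; split; [rewrite /derivable E|rewrite -h2 /derive E].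
Qed.

Lemma test_cs n (L : set 'rV[R]_n) f : compact L -> test L f -> cs f.
Proof.
by move=> cL [Sf f0]; apply: (cs_of_compact cL) => // x; exact: (smooth_cont Sf I).
Qed.

Lemma test_dec n (L : set 'rV[R]_n) f : compact L -> test L f -> dec f.
Proof. by move=> cL Tf; apply/cs_dec/test_cs/Tf. Qed.

Lemma rV_hausdorff n : hausdorff_space 'rV[R]_n.
Proof. exact: norm_hausdorff. Qed.

Lemma test_derive n (L : set 'rV[R]_n) f i : compact L -> test L f -> test L ('D_('e_i) f).
Proof.
move=> cL [Sf f0]; split; first exact: smooth_derive.
move=> y ny; have oL : open (~` L) by rewrite openC; exact: compact_closed (@rV_hausdorff n) cL.
have E z : (~` L) z -> 0 = f z by move=> nz; rewrite f0.
have [_ ->] := eq_on_derive (f := fun=> 0) oL (i := i) E ny (derivable_cst _ _ _).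
exact: derive_cst.
Qed.

Lemma testB n (L : set 'rV[R]_n) f g : test L f -> test L g -> test L (fun y => f y - g y).
Proof.
move=> [Sf f0] [Sg g0]; split; first exact: (smoothB openT Sf Sg).
by move=> y ny; rewrite f0// g0// subr0.
Qed.

(** Difference quotients have integral zero by translation invariance, and they converge to the
    derivative under a common majorant supplied by the mean value theorem. *)
Lemma intRn_derive0 n (F : 'rV[R]_n -> R) i : (forall x, derivable F x 'e_i) ->
  cs F -> cs ('D_('e_i) F) -> intRn ('D_('e_i) F) = 0.
Proof.
move=> dF csF csD; have [cF [r hr]] := csF; have [B [B0 HB]] := cs_bounded csD.
pose a (k : nat) : 'rV[R]_n := k.+1%:R^-1 *: 'e_i.
pose Q k x := k.+1%:R * (F (x + a k) - F x).
have csT k : cs (fun x => F (x + a k)) by exact: cs_translate.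
have int0 k : intRn (Q k) = 0.
  rewrite /Q intRnZ; last by apply: decB; exact: cs_dec.
  by rewrite intRnB ?intRn_translate ?subrr ?mulr0//; exact: cs_dec.
have QB k x : `|Q k x| <= B.
  rewrite /Q; have [t _ E] := @MVT_line R n F x 'e_i k.+1%:R^-1 (fun t _ => dF _).
  by rewrite E mulrA divff ?mul1r ?pnatr_eq0.
have e1 : `|'e_i : 'rV[R]_n| <= 1.
  apply: rV_norm_le => // j; rewrite deltaE; case: (j == i) => /=; rewrite ?normr1 ?normr0//.
have Q0 k x : r + 1 < `|x| -> Q k x = 0.
  move=> rx; have a1 : `|a k| <= 1.
    by rewrite normrZ ger0_norm ?invr_ge0// mulr_ile1 ?invr_ge0// invf_le1 ?ler1n.
  rewrite /Q !hr ?subrr ?mulr0//; first by lra.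
  have := ler_normB (x + a k) (a k); rewrite addrK => h; lra.
have cv x : Q k x @[k --> \oo] --> 'D_('e_i) F x.
  have /cvg_ex [l Hl] := dF x.
  have <- : l = 'D_('e_i) F x by apply/esym/cvg_lim.
  have h0 : (k.+1%:R^-1 : R) @[k --> \oo] --> 0^'.
    move=> B' /= nB; have [K _ HK] := @cvg_harmonic R _ nB.
    exists K => // k Kk; apply: (HK k Kk).
    have h : (k.+1%:R^-1 : R) != 0 by rewrite invr_neq0.
    by first [exact: h|exact/eqP].
  have := cvg_comp _ _ h0 Hl; rewrite (_ : _ \o _ = Q ^~ x)//.
  by apply/funext => k /=; rewrite invrK /Q /a [x + _]addrC.
have cQ k : continuous (Q k).
  apply: continuousMT; first exact: cst_continuous.
  apply: continuousDT; first by have [] := csT k.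
  by move=> x; exact: (continuousN (cF x)).
have := @cvg_intRn R n Q ('D_('e_i) F) (B * (1 + (r + 1) ^+ 2) ^+ n) cQ
  (fun k => cs_bound (QB k) (Q0 k)) csD.1 cv.
rewrite (_ : (fun k => intRn (Q k)) = fun=> 0); last by apply/funext.
by move=> /cvg_lim <-//; rewrite lim_cst.
Qed.

Lemma cf_laplace n (L : set 'rV[R]_n) th f xi i : compact L -> test L f ->
  cf th (fun y => f y - 'D_('e_i) ('D_('e_i) f) y) xi = (1 + xi 0 i ^+ 2) * cf th f xi.
Proof.
move=> cL Tf; have T1 := test_derive i cL Tf; have T2 := test_derive i cL T1.
rewrite cfB; [|exact: test_dec Tf|exact: test_dec T2].
rewrite mulrDl mul1r; congr (_ + _); apply/eqP; rewrite eqr_oppLR; apply/eqP.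
pose k (t : R) (y : 'rV[R]_n) := cos (dot y xi + t).
(* Two integrations by parts at once: [DF] is the derivative of F, since shifting the phase twice by
   pi/2 changes the sign of the cosine, and its integral vanishes. *)
pose F y := k th y * 'D_('e_i) f y - xi 0 i * (k (th + pi / 2) y * f y).
pose DF y := k th y * 'D_('e_i) ('D_('e_i) f) y + xi 0 i ^+ 2 * (k th y * f y).
have dF y : is_derive y ('e_i : 'rV[R]_n) F (DF y).
  have d0 t := is_derive_phase t xi y i.
  have df := derivableP ((Tf.1 [::] y I).2 i).
  have ddf := derivableP ((T1.1 [::] y I).2 i).
  have e1 := is_deriveM (d0 th) ddf.
  have e2 := is_deriveZ (xi 0 i) (is_deriveM (d0 (th + pi / 2)) df).
  refine (@is_derive_eq _ _ _ _ _ _ _ _ (is_deriveB e1 e2) _).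
  have -> : th + pi / 2 + pi / 2 = th + pi by field.
  rewrite /DF /k [dot y xi + (th + pi)]addrA cosDpi /GRing.scale /=; ring.
have kc t : continuous (k t).
  apply: continuous_cosC; apply: continuousDT; last exact: cst_continuous.
  by apply: continuous_dot2; [exact: continuous_idT|exact: cst_continuous].
have fc g : test L g -> continuous g by move=> [Sg _] y; exact: (smooth_cont Sg I).
have DFE : 'D_('e_i) F = DF by apply/funext => y; exact: derive_val.
have csk t g : test L g -> cs (fun y => k t y * g y).
  move=> Tg; apply: (cs_of_compact cL); first by apply: continuousMT => //; exact: fc.
  by move=> y ny; rewrite Tg.2 ?mulr0.
have csF : cs F.
  apply: (cs_of_compact cL).
    apply: continuousDT; first by have [] := csk th _ T1.
    have c0 : continuous (fun y => xi 0 i * (k (th + pi / 2) y * f y)).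
      by apply: continuousMT; [exact: cst_continuous|have [] := csk (th + pi / 2) _ Tf].
    by move=> y; exact: (continuousN (c0 y)).
  by move=> y ny; rewrite /F Tf.2// T1.2// !mulr0 subrr.
have csDF : cs DF.
  apply: (cs_of_compact cL).
    apply: continuousDT; first by have [] := csk th _ T2.
    apply: continuousMT; first exact: cst_continuous.
    by have [] := csk th _ Tf.
  by move=> y ny; rewrite /DF Tf.2// T2.2// !mulr0 addr0.
have := @intRn_derive0 _ F i (fun y => @ex_derive _ _ _ _ _ _ _ (dF y)) csF.
rewrite DFE => /(_ csDF).
rewrite /DF intRnD; last 2 first.
  exact/cs_dec/csk.
  by apply/decZ/cs_dec/csk.
rewrite intRnZ; last exact/cs_dec/csk.
by move=> /eqP; rewrite addr_eq0 => /eqP.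
Qed.

(** Applying 1 - D_i^2 once in every coordinate divides the transform by [wt]; each round therefore
    gains one factor [wt]. *)
Lemma cf_decay n (L : set 'rV[R]_n) f N : compact L -> test L f ->
  exists C, 0 <= C /\ forall th xi, `|cf th f xi| <= C * wt xi ^+ N.
Proof.
move=> cL; elim: N f => [|N IH] f Tf.
  exists (intRn (fun y => `|f y|)); split; first by apply: intRn_ge0.
  by move=> th xi; rewrite expr0 mulr1; apply: cf_le; exact: test_dec Tf.
pose g := foldr (fun i (h : 'rV[R]_n -> R) y => h y - 'D_('e_i) ('D_('e_i) h) y) f (index_enum 'I_n).
have Hg s : test L (foldr (fun i (h : 'rV[R]_n -> R) y => h y - 'D_('e_i) ('D_('e_i) h) y) f s) /\
    forall th xi, cf th (foldr (fun i (h : 'rV[R]_n -> R) y => h y - 'D_('e_i) ('D_('e_i) h) y) f s) xi =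
      (\prod_(i <- s) (1 + xi 0 i ^+ 2)) * cf th f xi.
  elim: s => [|i s [Ts Hs]] /=; first by split => // th xi; rewrite big_nil mul1r.
  split; first by apply: testB => //; do 2 apply: test_derive => //.
  by move=> th xi; rewrite big_cons (cf_laplace _ _ _ cL Ts) Hs mulrA.
have [Tg Eg] := Hg (index_enum 'I_n).
have [C [C0 HC]] := IH _ Tg; exists C; split => // th xi.
have := HC th xi; rewrite Eg normrM exprSr mulrA => h.
have wE : \prod_(i <- index_enum 'I_n) (1 + xi 0 i ^+ 2) = (wt xi)^-1.
  by rewrite /wt prodfV invrK.
move: h; rewrite wE gtr0_norm ?invr_gt0 ?wt_gt0// mulrC -/(_ / _) ler_pdivrMr ?wt_gt0//.
Qed.

Definition pw n (f : 'rV[R]_n -> R) xi := cf 0 f xi ^+ 2 + cf (- (pi / 2)) f xi ^+ 2.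

Lemma pw_ge0 n (f : 'rV[R]_n -> R) xi : 0 <= pw f xi.
Proof. by rewrite addr_ge0 ?sqr_ge0. Qed.

Lemma continuous_pw n (f : 'rV[R]_n -> R) : dec f -> continuous (pw f).
Proof.
move=> df; rewrite /pw; apply: continuousDT.
  by apply: continuousMT; exact: continuous_cf.
by apply: continuousMT; exact: continuous_cf.
Qed.

Lemma dec_cfM n (L : set 'rV[R]_n) f g t t' : compact L -> test L f -> test L g ->
  dec (fun xi => cf t f xi * cf t' g xi).
Proof.
move=> cL Tf Tg; split.
  by apply: continuousMT; apply: continuous_cf; [exact: test_dec Tf|exact: test_dec Tg].
have [C [C0 HC]] := cf_decay 1 cL Tf; have [D [D0 HD]] := cf_decay 0 cL Tg.
exists (D * C) => xi; rewrite normrM mulrC -mulrA ler_pM//.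
  by have := HD t' xi; rewrite expr0 mulr1.
Qed.

Lemma dec_pw n (L : set 'rV[R]_n) f : compact L -> test L f -> dec (pw f).
Proof. by move=> cL Tf; rewrite /pw; apply: decD; exact: (dec_cfM _ _ cL Tf Tf). Qed.

Lemma cs_swap n m (F : 'rV[R]_n -> 'rV[R]_m -> R) r :
  continuous (fun q : 'rV[R]_n * 'rV[R]_m => F q.1 q.2) ->
  (forall x y, r < `|x| \/ r < `|y| -> F x y = 0) ->
  intRn (fun x => intRn (F x)) = intRn (fun y => intRn (F^~ y)).
Proof.
move=> cF F0.
have cK := compact_setX (@compact_norm_le R n r) (@compact_norm_le R m r).
have [C [C0 HC]] := @continuous_bounded_compact R _ _ _ cK (fun q _ => cF q).
apply: (@intRn_swap _ _ _ F (C * (1 + r ^+ 2) ^+ n * (1 + r ^+ 2) ^+ m)) => // x y.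
have [xr|xr] := ltP r `|x|; first by rewrite F0 ?normr0; [rewrite !mulr_ge0 ?exprn_ge0 ?addr_ge0 ?sqr_ge0// ltW// wt_gt0|left].
have [yr|yr] := ltP r `|y|; first by rewrite F0 ?normr0; [rewrite !mulr_ge0 ?exprn_ge0 ?addr_ge0 ?sqr_ge0// ltW// wt_gt0|right].
apply: le_trans (HC (x, y) _) _; first by split.
have p k : 0 < (1 + r ^+ 2) ^+ k by rewrite exprn_gt0// ltr_pwDl// sqr_ge0.
have w1 := wt_ge_of_norm xr; have w2 := wt_ge_of_norm yr.
rewrite -[leLHS]mulr1 -!mulrA ler_wpM2l//.
have -> : (1 + r ^+ 2) ^+ n * ((1 + r ^+ 2) ^+ m * (wt x * wt y)) =
  ((1 + r ^+ 2) ^+ n * wt x) * ((1 + r ^+ 2) ^+ m * wt y) by ring.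
rewrite -[leLHS]mulr1 ler_pM//.
  by rewrite mulrC -ler_pdivrMr ?div1r.
by rewrite mulrC -ler_pdivrMr ?div1r.
Qed.

End Fourier.

(** * A Plancherel inequality *)

Section Plancherel.
Variables (R : realType) (n : nat).
Local Notation rV := 'rV[R]_n.

Definition bb : rV -> R := bumpn 0 1.
Definition kap (z : rV) : R := pw bb z.
(** The autocorrelation of the bump: compactly supported, with cosine transform [kap] ([kapE]). *)
Definition acor (z : rV) : R := intRn (fun y => bb (y + z) * bb y).

Lemma bb_eq0 x : 1 < `|x| -> bb x = 0.
Proof.
move=> h; apply: bumpn_eq0 => //; move=> /ball_rVP -/(_ ltr01) H.
have : `|x| <= 1.
  by apply: rV_norm_le => // i; have := H i; rewrite mxE sub0r normrN => /ltW.
by move=> h'; lra.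
Qed.

Lemma test_bb : test [set x : rV | `|x| <= 1] bb.
Proof.
split; first exact: smooth_bumpn.
by move=> y /= ny; apply: bb_eq0; rewrite ltNge; apply/negP.
Qed.

Lemma cs_bb : cs bb.
Proof. exact: test_cs (@compact_norm_le R n 1) test_bb. Qed.

Lemma bb_ge0 x : 0 <= bb x.
Proof. exact: bumpn_ge0. Qed.

Lemma dec_kap : dec kap.
Proof. exact: dec_pw (@compact_norm_le R n 1) test_bb. Qed.

Lemma intRn_kap_gt0 : 0 < intRn kap.
Proof.
apply: (@intRn_gt0 _ _ _ 0) => //; [exact: dec_kap|by move=> x; exact: pw_ge0|].
rewrite /kap /pw ltr_pwDl ?sqr_ge0// exprn_gt0//.
have -> : cf 0 bb 0 = intRn bb.
  apply: eq_intRn => y; have -> : dot y (0 : rV) = 0 by rewrite /dot big1// => i _; rewrite mxE mulr0.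
  by rewrite addr0 cos0 mul1r.
apply: (@intRn_gt0 _ _ _ 0); [exact/cs_dec/cs_bb|exact: bb_ge0|exact: bumpn_gt0].
Qed.

Lemma bb2_eq0 (y z : rV) : 2 < `|y| \/ 2 < `|z| -> bb (y + z) * bb y = 0.
Proof.
have [y1|y1] := ltP 1 `|y|; first by rewrite (bb_eq0 y1) mulr0.
move=> [h|h]; first by lra.
rewrite bb_eq0 ?mul0r//; have := ler_normB (y + z) y; rewrite addrAC subrr add0r => h'; lra.
Qed.

Lemma continuous_bb2 : continuous (fun q : rV * rV => bb (q.2 + q.1) * bb q.2).
Proof.
have [cb _] := cs_bb.
apply: continuousMT; last by apply: continuousC => //; exact: continuous_snd.
apply: continuousC => //; apply: continuousDrV; [exact: continuous_snd|exact: continuous_fst].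
Qed.

Lemma continuous_bbl (q : rV) : continuous (fun y : rV => bb (y + q) * bb y).
Proof.
have [cb _] := cs_bb; apply: continuousMT => //; apply: continuousC cb.
by apply: continuousDrV; [exact: continuous_idT|exact: cst_continuous].
Qed.

Lemma continuous_bbr (y : rV) : continuous (fun q : rV => bb (y + q) * bb y).
Proof.
have [cb _] := cs_bb; apply: continuousMT; last exact: cst_continuous.
apply: continuousC cb.
by apply: continuousDrV; [exact: cst_continuous|exact: continuous_idT].
Qed.

Lemma cs_acor : cs acor.
Proof.
split; last first.
  exists 2 => z hz; rewrite /acor (_ : (fun y => _) = fun=> 0) ?intRn0//.
  by apply/funext => y; apply: bb2_eq0; right.
have [cb _] := cs_bb; have [B [B0 HB]] := cs_bounded cs_bb.
move=> z; apply: (@continuous_intRn _ _ _ (fun z y => bb (y + z) * bb y) z (B * B * (1 + 2 ^+ 2) ^+ n)).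
- by move=> q; exact: continuous_bbl.
- by move=> y; exact: continuous_bbr.
- apply: (@nearW _ (nbhs z)) => q y; apply: (@cs_bound R n (fun y => bb (y + q) * bb y) (B * B) 2).
    by move=> x; rewrite normrM ler_pM.
  by move=> x hx; apply: bb2_eq0; left.
Qed.

Lemma cosBdot t (x y z : rV) : cos (t * dot z (y - x)) =
  cos (dot y (t *: z) + 0) * cos (dot x (t *: z) + 0) +
  cos (dot y (t *: z) + - (pi / 2)) * cos (dot x (t *: z) + - (pi / 2)).
Proof.
rewrite !addr0 !cosB cos_pihalf sin_pihalf !mulr0 !mulr1 !add0r -cosB.
by congr cos; rewrite dotC dotDl dotNl !(dotC _ (t *: z)) !dotZl !(dotC z); ring.
Qed.

Lemma continuous_cosdot (T : topologicalType) t (a b : T -> rV) : continuous a -> continuous b ->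
  continuous (fun q => cos (t * dot (a q) (b q))).
Proof.
move=> ca cb; apply: continuous_cosC; apply: continuousMT; first exact: cst_continuous.
exact: continuous_dot2.
Qed.

Lemma kapE z : kap z = intRn (fun w => acor w * cos (1 * dot w z)).
Proof.
have db := cs_dec cs_bb; have [cb _] := cs_bb.
have -> : kap z = intRn (fun x => intRn (fun y => bb y * bb x * cos (1 * dot z (y - x)))).
  rewrite /kap /pw !expr2 /cf.
  have E th : cf th bb z * cf th bb z = intRn (fun x => cf th bb z * (cos (dot x z + th) * bb x)).
    by rewrite intRnZ//; exact: dec_cosM.
  rewrite !E -intRnD; [|by apply: decZ; exact: dec_cosM..].
  apply: eq_intRn => x.
  rewrite -[X in X + _]mulrC -[X in _ + X]mulrC /cf -!intRnZ; [|exact: dec_cosM..].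
  rewrite -intRnD; [|by apply: decZ; exact: dec_cosM..].
  by apply: eq_intRn => y; rewrite cosBdot scale1r; ring.
rewrite /acor.
transitivity (intRn (fun x => intRn (fun w => bb (x + w) * bb x * cos (1 * dot w z)))).
  apply: eq_intRn => x; rewrite -(@intRn_translate R n _ x).
    by apply: eq_intRn => w; rewrite addrK dotC (addrC w).
  have [r hr] := cs_bb.2; split.
    apply: continuousMT; first by apply: continuousMT => //; exact: cst_continuous.
    apply: continuous_cosdot; first exact: cst_continuous.
    by apply: continuousDrV; [exact: continuous_idT|exact: cst_continuous].
  by exists r => y ry; rewrite hr// !mul0r.
rewrite (@cs_swap _ _ _ (fun x w => bb (x + w) * bb x * cos (1 * dot w z)) 2); last 2 first.
- apply: continuousMT.
    have := @continuousC _ _ _ (fun q : rV * rV => (q.2, q.1)) _ _ continuous_bb2; apply.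
    by move=> q; apply: cvg_pair_nbhs; [exact: continuous_snd|exact: continuous_fst].
  by apply: continuous_cosdot; [exact: continuous_snd|exact: cst_continuous].
- by move=> x w h; rewrite bb2_eq0// mul0r.
apply: eq_intRn => w.
transitivity (intRn (fun x => cos (1 * dot w z) * (bb (x + w) * bb x))).
  by apply: eq_intRn => x; rewrite mulrC.
rewrite intRnZ; first exact: mulrC.
apply: cs_dec; split.
  exact: continuous_bbl.
by exists 2 => x hx; apply: bb2_eq0; left.
Qed.

Section One.
Variables (L : set rV) (f : rV -> R).
Hypotheses (cL : compact L) (Tf : test L f).

Let csf : cs f. Proof. exact: test_cs cL Tf. Qed.
Let cf_ : continuous f. Proof. by have [] := csf. Qed.

(** A quadratic form evaluated twice. In frequency space it is an integral of |f^|^2 against the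
    rescaled [acor] ([JN_freq]); in space the kernel concentrates on the diagonal, and N^n [JN N]
    tends to a multiple of the integral of f^2 ([JN_lim]). The comparison yields a Plancherel
    inequality without Fourier inversion. *)
Definition JN (N : R) := intRn (fun x => f x * intRn (fun y => f y * kap (N *: (y - x)))).

Lemma JN_freq N : JN N = intRn (fun w => acor w * pw f (N *: w)).
Proof.
have df := cs_dec csf; have [cG [rG hG]] := cs_acor; have [r hr] := csf.2.
have inner x : intRn (fun y => f y * kap (N *: (y - x))) =
  intRn (fun w => acor w * (cos (dot x (N *: w) + 0) * cf 0 f (N *: w) +
     cos (dot x (N *: w) + - (pi / 2)) * cf (- (pi / 2)) f (N *: w))).
  transitivity (intRn (fun y => intRn (fun w => f y * acor w * cos (N * dot w (y - x))))).
    apply: eq_intRn => y; rewrite kapE -intRnZ.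
      by apply: eq_intRn => w; rewrite mul1r dotC dotZl dotC; ring.
    apply: cs_dec; split.
      apply: continuousMT => //; apply: continuous_cosdot; [exact: continuous_idT|exact: cst_continuous].
    by exists rG => w hw; rewrite hG ?mul0r.
  rewrite (@cs_swap _ _ _ (fun y w => f y * acor w * cos (N * dot w (y - x))) (Num.max r rG)); last 2 first.
  - apply: continuousMT.
      apply: continuousMT; first exact: (continuousC (@continuous_fst _ _) cf_).
      exact: (continuousC (@continuous_snd _ _) cG).
    apply: continuous_cosdot; first exact: continuous_snd.
    apply: continuousDrV; [exact: continuous_fst|exact: cst_continuous].
  - by move=> y w [h|h]; [rewrite hr ?mul0r//|rewrite hG ?mulr0 ?mul0r//]; apply: le_lt_trans h; rewrite le_max lexx ?orbT.
  apply: eq_intRn => w; rewrite /cf -!intRnZ; [|exact: dec_cosM..].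
  rewrite -intRnD; [|by apply: decZ; exact: dec_cosM..].
  rewrite -intRnZ; last by apply: decD; apply: decZ; exact: dec_cosM.
  by apply: eq_intRn => y; rewrite cosBdot; ring.
have cN : continuous (fun w : rV => N *: w) by exact: scaler_continuous.
have ccf th : continuous (fun w : rV => cf th f (N *: w)) by apply: (continuousC cN); exact: continuous_cf.
pose F x w := f x * acor w * (cos (dot x (N *: w) + 0) * cf 0 f (N *: w) +
     cos (dot x (N *: w) + - (pi / 2)) * cf (- (pi / 2)) f (N *: w)).
have cph (T : topologicalType) th (a b : T -> rV) : continuous a -> continuous b ->
    continuous (fun q => cos (dot (a q) (N *: b q) + th)).
  move=> ca cb; apply: continuous_cosC; apply: continuousDT; last exact: cst_continuous.
  by apply: continuous_dot2 => //; exact: continuousZT.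
have cF : continuous (fun q : rV * rV => F q.1 q.2).
  apply: continuousMT.
    apply: continuousMT; first exact: (continuousC (@continuous_fst _ _) cf_).
    exact: (continuousC (@continuous_snd _ _) cG).
  by apply: continuousDT; apply: continuousMT; do ?[apply: cph; [exact: continuous_fst|exact: continuous_snd]|exact: (continuousC (@continuous_snd _ _) (ccf _))].
rewrite /JN; transitivity (intRn (fun x => intRn (F x))).
  apply: eq_intRn => x; rewrite inner -intRnZ.
    by apply: eq_intRn => w; rewrite mulrA.
  apply: cs_dec; split; last by exists rG => w hw; rewrite hG ?mul0r.
  apply: continuousMT => //; apply: continuousDT; apply: continuousMT => //.
    by apply: cph; [exact: cst_continuous|exact: continuous_idT].
  by apply: cph; [exact: cst_continuous|exact: continuous_idT].
rewrite (@cs_swap _ _ _ F (Num.max r rG)) //; last first.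
  by move=> y w [h|h]; rewrite /F; [rewrite hr ?mul0r//|rewrite hG ?mulr0 ?mul0r//]; apply: le_lt_trans h; rewrite le_max lexx ?orbT.
apply: eq_intRn => w; rewrite /F /pw.
transitivity (intRn (fun x => (acor w * cf 0 f (N *: w)) * (cos (dot x (N *: w) + 0) * f x) +
   (acor w * cf (- (pi / 2)) f (N *: w)) * (cos (dot x (N *: w) + - (pi / 2)) * f x))).
  by apply: eq_intRn => x; ring.
rewrite intRnD; [|by apply: decZ; exact: dec_cosM..].
by rewrite !intRnZ; [rewrite /cf; ring|exact: dec_cosM..].
Qed.

Lemma JN_freq_rescale N : 0 < N -> N ^+ n * JN N = intRn (fun u => acor (N^-1 *: u) * pw f u).
Proof.
move=> N0; have [cG [rG hG]] := cs_acor; rewrite JN_freq (intRn_rescale 0)//.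
  apply: eq_intRn => u; rewrite addr0 scalerA divff ?scale1r// gt_eqF//.
split; last by exists rG => w hw; rewrite hG ?mul0r.
have cN : continuous (fun w : rV => N *: w) by exact: scaler_continuous.
apply: continuousMT => //; exact: (continuousC cN (continuous_pw (cs_dec csf))).
Qed.

Lemma JN_space N : 0 < N -> N ^+ n * JN N =
  intRn (fun x => f x * intRn (fun u => f (N^-1 *: u + x) * kap u)).
Proof.
move=> N0; have [ck [Ck hk]] := dec_kap; have [B [B0 HB]] := cs_bounded csf; have [r hr] := csf.2.
have inner x : N ^+ n * intRn (fun y => f y * kap (N *: (y - x))) = intRn (fun u => f (N^-1 *: u + x) * kap u).
  rewrite (intRn_rescale x)//.
    by apply: eq_intRn => u; rewrite addrK scalerA divff ?scale1r// gt_eqF.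
  split; last by exists r => y hy; rewrite hr ?mul0r.
  apply: continuousMT => //; apply: continuousC ck; apply: continuousZT.
  by apply: continuousDrV; [exact: continuous_idT|exact: cst_continuous].
have cin : continuous (fun x => intRn (fun u => f (N^-1 *: u + x) * kap u)).
  move=> x; apply: (@continuous_intRn R rV n (fun x u => f (N^-1 *: u + x) * kap u) x (B * Ck)).
  - move=> q; apply: continuousMT => //; apply: continuousC cf_.
    by apply: continuousDrV; [exact: scaler_continuous|exact: cst_continuous].
  - move=> u; have c : continuous (fun q : rV => f (N^-1 *: u + q) * kap u).
      apply: continuousMT; last exact: cst_continuous.
      by apply: continuousC cf_; apply: continuousDrV; [exact: cst_continuous|exact: continuous_idT].
    exact: (c x).
  - by apply: (@nearW _ (nbhs x)) => q u; rewrite normrM -mulrA ler_pM.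
rewrite /JN -intRnZ.
  by apply: eq_intRn => x; rewrite -inner; ring.
apply: cs_dec; split; last by exists r => y hy; rewrite hr ?mul0r.
apply: continuousMT => //.
have -> : (fun x => intRn (fun y => f y * kap (N *: (y - x)))) =
   (fun x => N ^- n * intRn (fun u => f (N^-1 *: u + x) * kap u)).
  by apply/funext => x; rewrite -inner mulKf// expf_neq0// gt_eqF.
by apply: continuousMT => //; exact: cst_continuous.
Qed.

Lemma JN_lim : k.+1%:R ^+ n * JN k.+1%:R @[k --> \oo] --> intRn kap * intRn (fun x => f x * f x).
Proof.
have [ck [Ck hk]] := dec_kap; have [B [B0 HB]] := cs_bounded csf.
have [cdf [Cf hf]] := cs_dec csf.
pose G (k : nat) (x : rV) := intRn (fun u : rV => f (k.+1%:R^-1 *: u + x) * kap u).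
have -> : (fun k => k.+1%:R ^+ n * JN k.+1%:R) = fun k => intRn (fun x => f x * G k x).
  by apply/funext => k; rewrite JN_space.
have -> : intRn kap * intRn (fun x => f x * f x) = intRn (fun x => f x * (f x * intRn kap)).
  rewrite -intRnZ; first by apply: eq_intRn => x; ring.
  apply: (decM (C := B)) => //; exact: cs_dec.
have cq (k : nat) (x : rV) : continuous (fun u : rV => f (k.+1%:R^-1 *: u + x) * kap u).
  apply: continuousMT => //; apply: continuousC cf_.
  by apply: continuousDrV; [exact: scaler_continuous|exact: cst_continuous].
have bq (k : nat) (x u : rV) : `|f (k.+1%:R^-1 *: u + x) * kap u| <= B * Ck * wt u.
  by rewrite normrM -mulrA ler_pM.
have GB k x : `|G k x| <= B * Ck * pi ^+ n by apply: intRn_norm_le.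
have cG k : continuous (G k).
  move=> x; apply: (@continuous_intRn R rV n (fun x u => f (k.+1%:R^-1 *: u + x) * kap u) x (B * Ck)) => //.
    move=> u; have c : continuous (fun q : rV => f (k.+1%:R^-1 *: u + q) * kap u).
      apply: continuousMT; last exact: cst_continuous.
      by apply: continuousC cf_; apply: continuousDrV; [exact: cst_continuous|exact: continuous_idT].
    exact: (c x).
  by apply: (@nearW _ (nbhs x)) => q u.
apply: (@cvg_intRn _ _ _ _ (Cf * (B * Ck * pi ^+ n))).
- by move=> k; apply: continuousMT.
- move=> k x; rewrite normrM mulrAC ler_pM//.
- by do 2 apply: continuousMT => //; exact: cst_continuous.
- move=> x; apply: cvgM; first exact: cvg_cst.
  have -> : f x * intRn kap = intRn (fun u => f x * kap u) by rewrite intRnZ//; exact: dec_kap.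
  apply: (@cvg_intRn _ _ _ _ (B * Ck)) => //.
    by apply: continuousMT => //; exact: cst_continuous.
  move=> u; apply: cvgM; last exact: cvg_cst.
  apply: (@cvg_comp _ _ _ (fun k => k.+1%:R^-1 *: u + x) f); last exact: cf_.
  have h1 : k.+1%:R^-1 *: u @[k --> \oo] --> (0 : R) *: u.
    by apply: cvgZr_tmp; exact: cvg_harmonic.
  have h2 : k.+1%:R^-1 *: u + x @[k --> \oo] --> (0 : R) *: u + x.
    by apply: cvgD => //; exact: cvg_cst.
  by move: h2; rewrite scale0r add0r.
Qed.

End One.

(* squared modulus of the Fourier transform of a + i b *)
Definition pw2 (a b : rV -> R) xi :=
  (cf 0 a xi + cf (- (pi / 2)) b xi) ^+ 2 + (cf 0 b xi - cf (- (pi / 2)) a xi) ^+ 2.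

(** The cosine transform is even and the sine transform odd in xi, so the cross terms cancel between
    xi and -xi. *)
Lemma pw2_opp a b xi : dec a -> dec b -> pw2 a b xi + pw2 a b (- xi) = 2 * (pw a xi + pw b xi).
Proof.
move=> da db; rewrite /pw2 /pw.
have E1 f : cf 0 f (- xi) = cf 0 f xi by apply: eq_intRn => y; rewrite dotNr !addr0 cosN.
have E2 f : dec f -> cf (- (pi / 2)) f (- xi) = - cf (- (pi / 2)) f xi.
  move=> df; rewrite /cf -intRnN; last exact: dec_cosM.
  apply: eq_intRn => y; rewrite dotNr !cosB cos_pihalf sin_pihalf cosN sinN; ring.
by rewrite !E1 !E2//; ring.
Qed.

Lemma pw2_ge0 a b xi : 0 <= pw2 a b xi.
Proof. by rewrite addr_ge0 ?sqr_ge0. Qed.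

Lemma dec_pw2 (L : set rV) a b : compact L -> test L a -> test L b -> dec (pw2 a b).
Proof.
move=> cL Ta Tb; rewrite (_ : pw2 a b = fun xi => ((cf 0 a xi * cf 0 a xi + cf 0 a xi * cf (- (pi / 2)) b xi) +
   (cf 0 a xi * cf (- (pi / 2)) b xi + cf (- (pi / 2)) b xi * cf (- (pi / 2)) b xi)) +
   ((cf 0 b xi * cf 0 b xi - cf 0 b xi * cf (- (pi / 2)) a xi) -
   (cf 0 b xi * cf (- (pi / 2)) a xi - cf (- (pi / 2)) a xi * cf (- (pi / 2)) a xi))).
  by apply: decD; [apply: decD; apply: decD|apply: decB; apply: decB]; apply: (dec_cfM _ _ cL).
by apply/funext => xi; rewrite /pw2; ring.
Qed.

Lemma intRn_opp (g : rV -> R) : cs g -> intRn (fun x => g (- x)) = intRn g.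
Proof.
move=> csg; have uL : ((-1)%:M : 'M[R]_n) \in unitmx.
  by rewrite unitmxE det_scalar unitfE expf_neq0// oppr_eq0 oner_eq0.
rewrite -[RHS](intRn_linear uL csg) det_scalar normrX normrN1 expr1n mul1r.
by apply: eq_intRn => x; rewrite mul_mx_scalar scaleN1r.
Qed.

Lemma plancherel_le : exists C, 0 <= C /\ forall (L : set rV) a b, compact L ->
  test L a -> test L b ->
  intRn (fun x => a x * a x + b x * b x) <= C * intRn (pw2 a b).
Proof.
have [S [S0 HS]] := cs_bounded cs_acor.
have k0 := intRn_kap_gt0.
exists ((intRn kap)^-1 * (2 * S)); split.
  by rewrite mulr_ge0 ?invr_ge0 ?(ltW k0)// mulr_ge0.
move=> L a b cL Ta Tb.
have csa := test_cs cL Ta; have csb := test_cs cL Tb.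
have da := cs_dec csa; have db := cs_dec csb.
have dpa := dec_pw cL Ta; have dpb := dec_pw cL Tb; have dp2 := dec_pw2 cL Ta Tb.
have dsq f : cs f -> dec (fun x => f x * f x).
  move=> [c [r hr]]; apply: cs_dec; split; first exact: continuousMT.
  by exists r => x hx; rewrite hr// mul0r.
rewrite intRnD; [|exact: dsq..].
rewrite -[_^-1 * _ * _]mulrA ler_pdivlMl// mulrDr.
have lm : k.+1%:R ^+ n * JN a k.+1%:R + k.+1%:R ^+ n * JN b k.+1%:R @[k --> \oo] -->
    intRn kap * intRn (fun x => a x * a x) + intRn kap * intRn (fun x => b x * b x).
  by apply: cvgD; [exact: JN_lim cL Ta|exact: JN_lim cL Tb].
apply: (cvgr_to_le lm); apply: nearW => k.
set N : R := k.+1%:R; have N0 : 0 < N by rewrite ltr0n.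
rewrite (JN_freq_rescale cL Ta N0) (JN_freq_rescale cL Tb N0).
have [cG _] := cs_acor.
have cGN : continuous (fun u : rV => acor (N^-1 *: u)).
  have cN : continuous (fun u : rV => N^-1 *: u) by exact: scaler_continuous.
  exact: (continuousC cN cG).
have bG u : `|acor (N^-1 *: u)| <= S by [].
(* An even, compactly supported majorant of [acor (N^-1 *: u)]: where the latter is nonzero the tent
   is at least 1/2, hence the factor 2 S. Evenness allows u and -u to be paired, so that [pw2_opp]
   applies. *)
pose E (u : rV) : R := 2 * S * bmp ((4^-1 * N^-1) *: u).
have [cbm [rb hb]] := cs_bmp R n.
have cE : continuous E.
  apply: continuousMT; first exact: cst_continuous.
  have cN : continuous (fun u : rV => (4^-1 * N^-1) *: u) by exact: scaler_continuous.
  exact: (continuousC cN cbm).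
have E_le u : `|E u| <= 2 * S.
  by rewrite /E normrM !ger0_norm ?bmp_ge0 ?mulr_ge0// ler_piMr ?bmp_le1 ?mulr_ge0.
have E0 u : 4 * N < `|u| -> E u = 0.
  move=> h; rewrite /E bmp_eq0 ?mulr0// normrZ gtr0_norm ?mulr_gt0 ?invr_gt0//.
  by rewrite -invfM mulrC ler_pdivlMr ?mulr_gt0// mul1r ltW.
have GE u : acor (N^-1 *: u) <= E u.
  have [h|h] := ltP 2 `|N^-1 *: u|.
    rewrite /acor (_ : (fun y => _) = fun=> 0) ?intRn0 ?mulr_ge0 ?bmp_ge0//.
    by apply/funext => y; apply: bb2_eq0; right.
  apply: le_trans (ler_norm _) _; apply: le_trans (bG u) _.
  have h4 : 4^-1 * `|N^-1 *: u| <= 2^-1 by rewrite ler_pdivrMl//; lra.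
  have hm : 2^-1 <= bmp ((4^-1 * N^-1) *: u).
    by rewrite /bmp -scalerA normrZ gtr0_norm ?invr_gt0// le_max; apply/orP; right; lra.
  by apply: (@le_trans _ _ (2 * S * 2^-1)); [lra|rewrite /E ler_wpM2l ?mulr_ge0].
have dE f : dec f -> dec (fun u => E u * f u) by move=> df; exact: decM E_le.
have dG f : dec f -> dec (fun u => acor (N^-1 *: u) * f u) by move=> df; exact: decM bG.
rewrite -intRnD; [|exact: dG..].
apply: (@le_trans _ _ (intRn (fun u => E u * (pw a u + pw b u)))).
  apply: le_intRn; [by apply: decD; exact: dG|by apply: dE; exact: decD|move=> u].
  by rewrite -mulrDr ler_wpM2r// addr_ge0 ?pw_ge0.
have csE : cs (fun u => E u * pw2 a b u).
  split; first by apply: continuousMT => //; have [] := dp2.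
  by exists (4 * N) => x hx; rewrite E0// mul0r.
have -> : intRn (fun u => E u * (pw a u + pw b u)) = intRn (fun u => E u * pw2 a b u).
  have h2 : 2 * intRn (fun u => E u * (pw a u + pw b u)) = 2 * intRn (fun u => E u * pw2 a b u).
    rewrite -intRnZ; last by apply: dE; exact: decD.
    rewrite mulrDl mul1r -[X in _ = _ + X](intRn_opp csE) -intRnD; last 2 first.
    - exact: cs_dec.
    - have := cs_linear (L := (-1)%:M) _ csE.
      rewrite unitmxE det_scalar unitfE expf_neq0 ?oppr_eq0 ?oner_eq0// => /(_ isT) h.
      apply: cs_dec; move: h; rewrite (_ : (fun x : rV => _) = (fun u => E (- u) * pw2 a b (- u)))//.
      by apply/funext => x; rewrite mul_mx_scalar scaleN1r.
    apply: eq_intRn => u; have -> : E (- u) = E u by rewrite /E scalerN /bmp normrN.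
    by rewrite -mulrDr pw2_opp//; ring.
  by apply: (mulfI _ h2).
rewrite -intRnZ//; apply: le_intRn; [exact: cs_dec|exact: decZ|move=> u].
by rewrite ler_wpM2r ?pw2_ge0//; apply: le_trans (ler_norm _) _.
Qed.

End Plancherel.

(* Gliding hump: if no uniform bound held, one could choose v_0, v_1, ... small, with signs
   such that the n-th seminorm is large on the partial sum and almost unaffected by later terms. *)
Lemma hump (R : realType) (V : zmodType) (I : Type) (D : set V) (P : nat -> set V) (q : I -> V -> R) :
  D 0 -> (forall u v, D u -> D v -> D (u + v)) -> (forall v, D v -> D (- v)) ->
  (forall k, P k `<=` D) -> (forall k l, (k <= l)%N -> P l `<=` P k) ->
  (forall k v, P k v -> P k (- v)) ->
  (forall r u v, D u -> D v -> q r (u + v) <= q r u + q r v) ->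
  (forall r v, D v -> q r (- v) = q r v) ->
  (forall r v, D v -> 2 * q r v <= q r (v + v)) ->
  (forall r e, 0 < e -> exists k, forall v, P k v -> q r v <= e) ->
  (forall v : nat -> V, (forall k, P k (v k)) ->
     exists T, forall r n0, exists n, (n0 <= n)%N /\ q r (\sum_(i < n) v i) <= T) ->
  exists k T, forall r v, P k v -> q r v <= T.
Proof.
move=> D0 DD DN PD PS PN qD qN q2 qP lim; apply: contrapT => H.
have H1 k T : exists rv : I * V, P k rv.2 /\ T < q rv.1 rv.2.
  apply: contrapT => n1; apply: H; exists k, T => r v Pv; rewrite leNgt; apply/negP => h.
  by apply: n1; exists (r, v).
have /choice[kr Hkr] : forall rn : I * nat, exists k, forall v, P k v -> q rn.1 v <= 2^-1 ^+ rn.2.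
  by move=> rn; apply: qP; rewrite exprn_gt0.
(* A state consists of the stage n, the partial sum so far and, for every stage n', the smallness
   index demanded there by the seminorms selected so far. *)
have /choice[F HF] : forall st : nat * V * (nat -> nat), exists rv : I * V, D st.1.2 ->
    P (maxn st.1.1 (st.2 st.1.1)) rv.2 /\ st.1.1%:R < q rv.1 (st.1.2 + rv.2).
  move=> [ [n sg] kk] /=.
  have [[r v] /= [Pv qv]] := H1 (maxn n (kk n)) n%:R.
  have [h|h] := ltP n%:R (q r (sg + v)); first by exists (r, v).
  (* If v does not make the seminorm of the new partial sum large, then -v does: the difference of
     the two candidates is 2 v. *)
  exists (r, - v) => /= Dsg; split; first exact: PN.
  have Dv := PD _ _ Pv.
  have := qD r (sg + v) (- (sg - v)) (DD _ _ Dsg Dv) (DN _ (DD _ _ Dsg (DN _ Dv))).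
  rewrite qN; last by apply: DD => //; exact: DN.
  have -> : sg + v - (sg - v) = v + v by rewrite opprB [sg + v]addrC -addrA (addrC sg) subrK.
  have := q2 r v Dv => h1 h2; lra.
pose nx (st : nat * V * (nat -> nat)) := (st.1.1.+1, st.1.2 + (F st).2,
  fun n' => maxn (st.2 n') (kr ((F st).1, n'))).
pose st n := iter n nx (0%N, 0, fun=> 0%N).
pose vv n := (F (st n)).2; pose rr n := (F (st n)).1.
have st1 n : (st n).1.1 = n by elim: n => //= n ->.
have stS n : (st n).1.2 = \sum_(i < n) vv i.
  by elim: n => [|n IH]; rewrite ?big_ord0// big_ord_recr /= -IH.
have stD n : D (st n).1.2.
  elim: n => //= n IH; apply: DD => //; have [+ _] := HF _ IH; exact: PD.
have stK n m j : (n <= m)%N -> ((st n).2 j <= (st m).2 j)%N.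
  by move=> nm; rewrite -(subnK nm); elim: (m - n)%N => //= k IH; apply: leq_trans IH _; rewrite leq_maxl.
have vP n : P n (vv n).
  have [+ _] := HF _ (stD n); rewrite st1; apply: PS; exact: leq_maxl.
have qr n : n%:R < q (rr n) (\sum_(i < n.+1) vv i).
  by have [_] := HF _ (stD n); rewrite st1 stS big_ord_recr.
have later n m : (n < m)%N -> q (rr n) (vv m) <= 2^-1 ^+ m.
  move=> nm; apply: (Hkr (rr n, m)); have [+ _] := HF _ (stD m); rewrite st1; apply: PS.
  apply: leq_trans (leq_maxr _ _); apply: leq_trans (stK n.+1 m m nm).
  by rewrite /= leq_maxr.
have [T HT] := lim vv vP.
have [N HN] : exists N : nat, T + 1 <= N%:R.
  by exists (Num.bound `|T + 1|); apply: le_trans (ler_norm _) (ltW (archi_boundP _)).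
have [n [Nn qn]] := HT (rr N) N.+1.
have key m : q (rr N) (\sum_(i < N.+1) vv i) <= q (rr N) (\sum_(i < N.+1 + m) vv i) + (1 - 2^-1 ^+ m).
  elim: m => [|m IH]; first by rewrite addn0 expr0 subrr addr0.
  apply: le_trans IH _.
  have -> : \sum_(i < N.+1 + m.+1) vv i = \sum_(i < N.+1 + m) vv i + vv (N.+1 + m)%N.
    by rewrite addnS big_ord_recr.
  have Ds : D (\sum_(i < N.+1 + m) vv i) by rewrite -stS.
  have Dv := PD _ _ (vP (N.+1 + m)%N).
  have := qD (rr N) _ _ (DD _ _ Ds Dv) (DN _ Dv); rewrite addrK qN// => h1.
  have h2 := later N (N.+1 + m)%N (leq_addr _ _).
  have h3 : (2^-1 : R) ^+ (N.+1 + m) <= 2^-1 ^+ m.+1.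
    by rewrite ler_wiXn2l ?invr_ge0// ?invf_le1 ?ler1n// addSn ltnS leq_addl.
  have h4 : (2^-1 : R) ^+ m = 2 * 2^-1 ^+ m.+1 by rewrite exprS mulrA divff// mul1r.
  set a := _ ^+ m.+1 in h3 h4 *; set S := \sum_(i < _) _ in h1 *; lra.
have := key (n - N.+1)%N; rewrite subnKC// => k1.
have : 0 <= (2^-1 : R) ^+ (n - N.+1) by rewrite exprn_ge0.
have := qr N; lra.
Qed.

(** * Polynomial weights in frequency space *)

Section Weights.
Variables (R : realType) (n : nat).
Local Notation rV := 'rV[R]_n.

Lemma wtV (x : rV) : (wt x)^-1 = \prod_i (1 + x 0 i ^+ 2).
Proof. by rewrite /wt prodfV invrK. Qed.

Lemma dot_ge0 (x : rV) : 0 <= dot x x.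
Proof. by apply: sumr_ge0 => i _; rewrite -expr2 sqr_ge0. Qed.

Lemma dot1_gt0 (x : rV) : 0 < 1 + dot x x.
Proof. by rewrite ltr_pwDl// dot_ge0. Qed.

Lemma dot1_le_wt (x : rV) : 1 + dot x x <= (wt x)^-1.
Proof.
rewrite wtV /dot; suff [_ //] : 1 <= \prod_i (1 + x 0 i ^+ 2) /\ 1 + \sum_i x 0 i * x 0 i <= \prod_i (1 + x 0 i ^+ 2).
elim/big_rec2: _ => [|i y z _ [h1 h2]]; first by rewrite addr0.
have := sqr_ge0 (x 0 i); rewrite -expr2; set t := x 0 i ^+ 2 => t0; split; nra.
Qed.

Lemma wt_le_dot1 (x : rV) : (wt x)^-1 <= (1 + dot x x) ^+ n.
Proof.
rewrite wtV -[X in _ ^+ X](card_ord n) -prodr_const; apply: ler_prod => i _.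
rewrite addr_ge0 ?sqr_ge0//= lerD2l /dot (bigD1 i)//= -expr2 lerDl.
by apply: sumr_ge0 => j _; rewrite -expr2 sqr_ge0.
Qed.

Definition weight (w : rV -> R) := [/\ continuous w, forall x, 0 <= w x &
  exists N C, 0 <= C /\ forall x, w x <= C * (wt x) ^- N].

Definition sobw (s : R) (x : rV) : R := (1 + dot x x) `^ s.

Lemma sobw_ge0 s x : 0 <= sobw s x.
Proof. exact: powR_ge0. Qed.

Lemma sobw_ge1 s x : 0 <= s -> 1 <= sobw s x.
Proof.
move=> s0; have p1 : 1 `^ s = 1 :> R by rewrite powR1.
by rewrite -p1 ge0_ler_powR ?nnegrE ?(ltW (dot1_gt0 x))// lerDl dot_ge0.
Qed.

Lemma continuous_sobw s : continuous (sobw s).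
Proof.
have E x : sobw s x = expR (s * ln (1 + dot x x)) by rewrite /sobw /powR ?gt_eqF ?dot1_gt0.
rewrite (_ : sobw s = fun x => expR (s * ln (1 + dot x x))); last exact/funext.
have c1 : continuous (fun x : rV => 1 + dot x x).
  by apply: continuousDT; [exact: cst_continuous|apply: continuous_dot2; exact: continuous_idT].
move=> x; have c2 : {for x, continuous (fun x : rV => ln (1 + dot x x))}.
  apply: (@continuous_comp _ _ _ (fun x : rV => 1 + dot x x) (@ln R)); first exact: c1.
  by apply: continuous_ln; exact: dot1_gt0.
have c3 : {for x, continuous (fun x : rV => s * ln (1 + dot x x))}.
  have c0 : {for x, continuous (fun _ : rV => s)} by exact: cst_continuous.
  exact: (continuousM c0 c2).
apply: (@continuous_comp _ _ _ (fun x : rV => s * ln (1 + dot x x)) (@expR R)) => //.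
exact: continuous_expR.
Qed.

Lemma weight_sobw s : weight (sobw s).
Proof.
split; [exact: continuous_sobw|exact: sobw_ge0|].
exists (Num.bound `|s|), 1; split => // x; rewrite mul1r.
have s1 : s <= (Num.bound `|s|)%:R by apply: le_trans (ler_norm _) (ltW (archi_boundP _)).
apply: (@le_trans _ _ ((1 + dot x x) `^ (Num.bound `|s|)%:R)).
  by rewrite ler_powR// lerDl dot_ge0.
by rewrite (powR_mulrn _ (ltW (dot1_gt0 x))) -exprVn lerXn2r ?nnegrE ?invr_ge0 ?(ltW (wt_gt0 _)) ?(ltW (dot1_gt0 _)) ?dot1_le_wt.
Qed.

Lemma continuous_min (f g : rV -> R) : continuous f -> continuous g -> continuous (fun x => Num.min (f x) (g x)).
Proof.
move=> cf cg x; have E y : Num.min (f y) (g y) = 2^-1 * (f y + g y - `|f y - g y|).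
  have [h|h] := leP (f y) (g y).
    by rewrite ler0_norm ?subr_le0//; field.
  by rewrite ger0_norm ?subr_ge0 ?ltW//; field.
rewrite (_ : (fun x => _) = fun y => 2^-1 * (f y + g y - `|f y - g y|)); last exact/funext.
have c1 := continuousB (cf x) (cg x).
have c2 : {for x, continuous (fun y => `|f y - g y|)}.
  by apply: (@continuous_comp _ _ _ (fun y => f y - g y) Num.norm) => //; exact: norm_continuous.
have c3 : {for x, continuous (fun y => f y + g y - `|f y - g y|)}.
  exact: (continuousB (continuousD (cf x) (cg x)) c2).
have c0 : {for x, continuous (fun _ : rV => 2^-1 : R)} by exact: cst_continuous.
exact: (continuousM c0 c3).
Qed.

(** Integrable weights that increase to the Sobolev weight. Each truncated form is bounded by the
    L^2 norm, and the supremum over k is the Sobolev norm: this makes the Sobolev norm accessible to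
    uniform boundedness. *)
Definition truncw (s : R) (k : nat) (x : rV) : R := Num.min (sobw s x) (k%:R * wt x).

Lemma truncw_ge0 s k x : 0 <= truncw s k x.
Proof. by rewrite le_min sobw_ge0 mulr_ge0// ltW// wt_gt0. Qed.

Lemma continuous_wt : continuous (@wt R n).
Proof.
have E : @wt R n = fun x => (\prod_i (1 + x 0 i ^+ 2))^-1 by apply/funext => x; rewrite -wtV invrK.
have C : forall s : seq 'I_n, continuous (fun x : rV => \prod_(i <- s) wt1 (x 0 i)).
  elim=> [|i s IH].
    by rewrite (_ : (fun x => _) = fun=> 1); [exact: cst_continuous|apply/funext => x; rewrite big_nil].
  rewrite (_ : (fun x => _) = fun x : rV => wt1 (x 0 i) * \prod_(i <- s) wt1 (x 0 i)); last first.
    by apply/funext => x; rewrite big_cons.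
  apply: continuousMT => //.
  have c : continuous (fun x : rV => x 0 i) by exact: coord_continuous.
  exact: (continuousC c (@continuous_wt1 R)).
exact: C.
Qed.

Lemma weight_truncw s k : weight (truncw s k).
Proof.
split; [|exact: truncw_ge0|].
  apply: continuous_min; first exact: continuous_sobw.
  by apply: continuousMT; [exact: cst_continuous|exact: continuous_wt].
exists 0%N, k%:R; split => // x; rewrite expr0 invr1 mulr1.
by rewrite /truncw ge_min; apply/orP; right; rewrite ler_piMr// wt_le1.
Qed.

Lemma weight1 : weight (fun=> 1).
Proof. by split => // [|]; [exact: cst_continuous|exists 0%N, 1; split => // x; rewrite expr0 invr1 mulr1]. Qed.

End Weights.

(** * Localised Sobolev norms *)

Section Sobolev.
Variables (R : realType) (d : nat) (M : topologicalType).
Variable X : smooth_structure R d M.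
Variable m : nat.
Local Notation chart := (chart R d M).
Local Notation C := R[i].
Local Notation hd := (hdens R d M m).
Local Notation J := ('I_m * bool)%type.
Local Notation rV := 'rV[R]_d.
Local Notation "t %:K" := ((t : R)%:C)%C (at level 1, format "t %:K").
Local Notation CI := [set v : hd | Cinf X v].
Local Notation rin := (@rin R d M X m).
Local Notation nrm := (snorm rin).
Hypotheses (hM : hausdorff_space M) (cM : compact [set: M]) (d0 : (0 < d)%N).

Let rs := Cinf_subspace X m.
Let si : semi_inner CI rin := @rin_semi_inner R d M X m hM cM.

(* cinv c takes arbitrary values off cimg c *)
Definition cutc (c : chart) (chi : M -> R) (y : rV) : R :=
  if `[< cimg c y >] then chi (cinv c y) else 0.

Section Loc.
Variables (c : chart) (chi : M -> R).
Hypotheses (Ac : atlas X c) (cc : cutoff X c chi).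

Let cL : compact (csup c chi) := csup_compact cM Ac cc.
Let LI : csup c chi `<=` cimg c := @csup_cimg _ _ _ _ _ _ cc.

Lemma test_ext_zero (g : rV -> R) : smooth_on (cimg c) g -> (forall y, ~ csup c chi y -> g y = 0) ->
  test (csup c chi) g.
Proof.
move=> Sg g0; split => //.
apply: (smooth_zero_ext openT (compact_closed (@rV_hausdorff R d) cL) _ Sg) => y _; [exact: LI|exact: g0].
Qed.

Lemma cutc_eq0 y : ~ csup c chi y -> cutc c chi y = 0.
Proof.
move=> n; rewrite /cutc; case: asboolP => // Iy; exact: (csup_eq0 Ac Iy n).
Qed.

Lemma test_cutcM g : smooth_on (cimg c) g -> test (csup c chi) (fun y => cutc c chi y * g y).
Proof.
move=> Sg; apply: test_ext_zero; last by move=> y n; rewrite cutc_eq0// mul0r.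
have oI := cimg_open Ac; apply: (smoothM oI _ Sg); apply: (smooth_congr oI _ (cc.1 c Ac)).
by move=> z Iz; rewrite /cutc asboolT.
Qed.

Lemma test_cutc : test (csup c chi) (cutc c chi).
Proof.
have := test_cutcM (smooth_cst (cimg_open Ac) 1); rewrite (_ : (fun y => _) = cutc c chi)//.
by apply/funext => y; rewrite mulr1.
Qed.

Definition loc (v : hd) (j : J) (y : rV) : R := cutc c chi y * co (v c y) j.

Lemma test_loc v j : Cinf X v -> test (csup c chi) (loc v j).
Proof. by move=> Cv; apply: test_cutcM; exact: (Cinf_smooth _ Cv Ac). Qed.

Lemma locE v j y : Cinf X v -> loc v j y = co ((chi (cinv c y))%:K *: v c y) j.
Proof.
move=> Cv; rewrite /loc /cutc coZ; case: asboolP => // nI.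
by rewrite (Cinf_out Cv nI) co0 !mulr0.
Qed.

(** Localised plane waves. The Fourier transform of a localisation of v is an inner product of v
    with them ([cf_loc]), so symmetric operators can be moved from v to the waves. *)
Definition wave (th : R) (xi : rV) (j : J) : hd :=
  ext X c (fun y => cutc c chi y * cos (dot y xi + th)) (ej R j).

Lemma smooth_phase (U : set rV) (xi : rV) th : open U -> smooth_on U (fun y => cos (dot y xi + th)).
Proof.
move=> oU; apply: smooth_cos => //; apply: smoothD => //; last exact: smooth_cst.
apply: smooth_sum => // i _; apply: smoothM => //; [exact: smooth_coord|exact: smooth_cst].
Qed.

Lemma test_wave th xi : test (csup c chi) (fun y => cutc c chi y * cos (dot y xi + th)).
Proof. by apply: test_cutcM; apply: smooth_phase; exact: cimg_open Ac. Qed.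

Lemma Cinf_wave th xi j : Cinf X (wave th xi j).
Proof. exact: (Cinf_ext hM Ac cL LI _ (test_wave th xi)). Qed.

Lemma cf_loc th v j xi : Cinf X v -> cf th (loc v j) xi = rin (wave th xi j) v.
Proof.
move=> Cv; rewrite (rin_ext hM cM Ac cL LI _ (test_wave th xi) Cv).
by apply: eq_intRn => y; rewrite rdot_ej /loc; ring.
Qed.

Lemma wave_le th xi j : nrm (wave th xi j) <= Num.sqrt (intRn (fun y => cutc c chi y * cutc c chi y)).
Proof.
rewrite -[leLHS]ger0_norm ?snorm_ge0// -sqrtr_sqr ler_wsqrtr//.
rewrite (snorm_ext hM cM Ac cL LI _ (test_wave th xi)) rdot_ej co_ej eqxx mul1r.
have Td := test_cutc; have csd := test_cs cL Td; have cst := test_cs cL (test_wave th xi).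
have sq f : cs f -> dec (fun y : rV => f y * f y).
  move=> [cf0 [r hr]]; apply: cs_dec; split; first exact: continuousMT.
  by exists r => x hx; rewrite hr// mul0r.
apply: le_intRn; [exact: sq cst|exact: sq csd|move=> y].
have := cos_max (dot y xi + th); set k := cos _ => hk.
rewrite mulrACA ler_piMr//; first by rewrite -expr2 sqr_ge0.
by rewrite -expr2 -real_normK ?num_real// expr_le1.
Qed.

Definition fvec (xi : rV) (j : J) : hd :=
  if j.2 then wave 0 xi (j.1, true) - wave (- (pi / 2)) xi (j.1, false)
  else wave 0 xi (j.1, false) + wave (- (pi / 2)) xi (j.1, true).

(* real and imaginary parts of the Fourier transform of the localisation of v *)
Definition fh (v : hd) (xi : rV) (j : J) : R := rin (fvec xi j) v.

Lemma Cinf_fvec xi j : Cinf X (fvec xi j).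
Proof.
rewrite /fvec; case: j.2; [apply: (rsB rs)|apply: (rsD rs)]; exact: Cinf_wave.
Qed.

Lemma fh_cf v xi j : Cinf X v -> fh v xi j =
  if j.2 then cf 0 (loc v (j.1, true)) xi - cf (- (pi / 2)) (loc v (j.1, false)) xi
  else cf 0 (loc v (j.1, false)) xi + cf (- (pi / 2)) (loc v (j.1, true)) xi.
Proof.
move=> Cv; rewrite /fh /fvec !cf_loc//; case: j.2.
  by rewrite (siB rs si)//; exact: Cinf_wave.
by rewrite (siD si)//; exact: Cinf_wave.
Qed.

Definition fbound := 2 * Num.sqrt (intRn (fun y => cutc c chi y * cutc c chi y)).

Lemma fbound_ge0 : 0 <= fbound.
Proof. by rewrite mulr_ge0// sqrtr_ge0. Qed.

Lemma fvec_le xi j : nrm (fvec xi j) <= fbound.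
Proof.
have W th k := wave_le th xi k; have CW th k := Cinf_wave th xi k.
rewrite /fvec /fbound; set B := Num.sqrt _ in W *.
case: j.2.
  apply: le_trans (snormB rs si (CW 0 (j.1, true)) (CW (- (pi / 2)) (j.1, false))) _.
  by rewrite mulr_natl mulr2n lerD.
apply: le_trans (snormD rs si (CW 0 (j.1, false)) (CW (- (pi / 2)) (j.1, true))) _.
by rewrite mulr_natl mulr2n lerD.
Qed.

Lemma fh_le v xi j : Cinf X v -> `|fh v xi j| <= fbound * nrm v.
Proof.
move=> Cv; apply: le_trans (si_CS rs si (Cinf_fvec xi j) Cv) _.
by rewrite ler_wpM2r ?snorm_ge0 ?fvec_le.
Qed.

Lemma fh_decay v j N : Cinf X v -> exists B, 0 <= B /\ forall xi, `|fh v xi j| <= B * wt xi ^+ N.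
Proof.
move=> Cv.
have [B1 [B10 H1]] := cf_decay N cL (test_loc (j.1, true) Cv).
have [B2 [B20 H2]] := cf_decay N cL (test_loc (j.1, false) Cv).
exists (B1 + B2); split=> [|xi]; first exact: addr_ge0.
rewrite fh_cf// [leRHS]mulrDl; case: j.2.
  by apply: le_trans (ler_normB _ _) _; rewrite lerD.
by rewrite addrC; apply: le_trans (ler_normD _ _) _; rewrite lerD// addrC.
Qed.

Lemma continuous_fh v j : Cinf X v -> continuous (fun xi => fh v xi j).
Proof.
move=> Cv; have T k := test_dec cL (test_loc k Cv).
have cc0 th k := @continuous_cf R d th _ (T k).
rewrite (_ : (fun xi => _) = fun xi => if j.2 then cf 0 (loc v (j.1, true)) xi - cf (- (pi / 2)) (loc v (j.1, false)) xi
  else cf 0 (loc v (j.1, false)) xi + cf (- (pi / 2)) (loc v (j.1, true)) xi); last by apply/funext => xi; rewrite fh_cf.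
case: j.2 => xi; first exact: (continuousB (cc0 _ _ xi) (cc0 _ _ xi)).
exact: (continuousD (cc0 _ _ xi) (cc0 _ _ xi)).
Qed.

Definition fdot (v w : hd) (xi : rV) : R := \sum_j fh v xi j * fh w xi j.

Lemma dec_wfdot w u v : weight w -> Cinf X u -> Cinf X v -> dec (fun xi => w xi * fdot u v xi).
Proof.
move=> [cw w0 [N [B [B0 HB]]]] Cu Cv.
rewrite (_ : (fun xi => _) = fun xi => \sum_j w xi * (fh u xi j * fh v xi j)); last first.
  by apply/funext => xi; rewrite mulr_sumr.
apply: dec_sum => j _; split.
  by apply: continuousMT => //; apply: continuousMT; exact: continuous_fh.
have [B1 [B10 H1]] := fh_decay j N Cu; have [B2 [B20 H2]] := fh_decay j 1 Cv.
exists (B * (B1 * B2)) => xi; rewrite !normrM (ger0_norm (w0 xi)).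
have p := wt_gt0 xi; have pN : 0 < wt xi ^+ N by rewrite exprn_gt0.
apply: (@le_trans _ _ ((B * (wt xi) ^- N) * ((B1 * wt xi ^+ N) * (B2 * wt xi ^+ 1)))).
  by apply: ler_pM => //; first [apply: ler_pM => //|rewrite mulr_ge0].
rewrite expr1 le_eqVlt; apply/orP; left; apply/eqP.
rewrite (_ : B * wt xi ^- N * (B1 * wt xi ^+ N * (B2 * wt xi)) = B * (B1 * B2) * wt xi * (wt xi ^- N * wt xi ^+ N)); last by ring.
by rewrite mulVf ?mulr1// gt_eqF.
Qed.

Definition hform (w : rV -> R) (u v : hd) : R := intRn (fun xi => w xi * fdot u v xi).

Lemma hform_semi_inner w : weight w -> semi_inner CI (hform w).
Proof.
move=> Hw; split.
- move=> u v _ _; apply: eq_intRn => xi; congr (_ * _); apply: eq_bigr => j _; exact: mulrC.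
- move=> u v z Cu Cv Cz; rewrite /hform -intRnD; [|exact: dec_wfdot..].
  apply: eq_intRn => xi; rewrite -mulrDr; congr (_ * _); rewrite /fdot -big_split.
  by apply: eq_bigr => j _; rewrite /fh (siDr rs si) ?mulrDl//; exact: Cinf_fvec.
- move=> t u v Cu Cv; rewrite /hform -intRnZ; last exact: dec_wfdot.
  apply: eq_intRn => xi; rewrite mulrCA; congr (_ * _); rewrite /fdot mulr_sumr.
  by apply: eq_bigr => j _; rewrite /fh (siZr rs si) ?mulrA//; exact: Cinf_fvec.
- move=> v Cv; apply: intRn_ge0 => xi; have [_ w0 _] := Hw; rewrite mulr_ge0//.
  by apply: sumr_ge0 => j _; rewrite -expr2 sqr_ge0.
Qed.

Lemma fdot_ge0 v xi : 0 <= fdot v v xi.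
Proof. by apply: sumr_ge0 => j _; rewrite -expr2 sqr_ge0. Qed.

Lemma fdot_pw2 v xi : Cinf X v -> fdot v v xi = \sum_i pw2 (loc v (i, false)) (loc v (i, true)) xi.
Proof.
move=> Cv; rewrite /fdot -(pair_bigA _ (fun i b => fh v xi (i, b) * fh v xi (i, b))) /=.
by apply: eq_bigr => i _; rewrite big_bool /= !fh_cf//= /pw2 addrC !expr2.
Qed.

Lemma fourier_fh v xi i : Cinf X v ->
  fourier (fun y => (chi (cinv c y))%:K *: v c y) xi i 0 = (fh v xi (i, false) +i* fh v xi (i, true))%C.
Proof.
move=> Cv; rewrite /fourier /intcV mxE /intC !fh_cf//=.
have da := test_dec cL (test_loc (i, false) Cv); have db := test_dec cL (test_loc (i, true) Cv).
have val y : exists a b : R, [/\ a = loc v (i, false) y, b = loc v (i, true) y &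
   ((chi (cinv c y))%:K *: v c y) i 0 = (a +i* b)%C].
  exists (loc v (i, false) y), (loc v (i, true) y); split => //.
  by rewrite !locE// /co /=; case: (_ i 0).
rewrite {1}/cf -intRnD; [|exact: dec_cosM..].
rewrite {1}/cf -intRnB; [|exact: dec_cosM..].
congr (_ +i* _)%C; apply: eq_intRn => y; rewrite mxE; have [a [b [<- <- ->]]] := val y.
  by rewrite /expi /= cosN sinN addr0 cosB cos_pihalf sin_pihalf; ring.
by rewrite /expi /= cosN sinN addr0 cosB cos_pihalf sin_pihalf; ring.
Qed.

Lemma Hsnorm_hform s v : Cinf X v -> Hsnorm s c chi v = snorm (hform (sobw s)) v.
Proof.
move=> Cv; rewrite /Hsnorm /snorm /hform; congr Num.sqrt; apply: eq_intRn => xi.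
rewrite /fdot -(pair_bigA _ (fun i b => fh v xi (i, b) * fh v xi (i, b))) /=.
congr (_ * _); apply: eq_bigr => i _; rewrite big_bool /= fourier_fh//=.
by move: (fh _ _ _) (fh _ _ _) => p q; rewrite sqr_sqrtr ?addr_ge0 ?sqr_ge0// [RHS]addrC.
Qed.

(** Every Fourier coefficient is an inner product with a vector of norm at most [fbound], and the
    truncated weight is integrable. *)
Lemma truncw_hform_le s k v : Cinf X v ->
  snorm (hform (truncw s k)) v <= Num.sqrt (k%:R * intRn (@wt R d) * (#|{: J}|%:R * fbound ^+ 2)) * nrm v.
Proof.
move=> Cv; rewrite -[X in _ * X]ger0_norm ?snorm_ge0// -sqrtr_sqr -sqrtrM; last first.
  by rewrite !mulr_ge0 ?sqr_ge0// intRn_ge0// => x; exact: ltW (wt_gt0 x).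
rewrite ler_wsqrtr//; set B := _ * fbound ^+ 2.
have dw : dec (@wt R d).
  split; first exact: continuous_wt.
  by exists 1 => x; rewrite mul1r gtr0_norm ?wt_gt0.
have fb xi : fdot v v xi <= B * nrm v ^+ 2.
  rewrite /B -mulrA -exprMn mulr_natl -sumr_const; apply: ler_sum => j _.
  rewrite -expr2 -real_normK ?num_real// lerXn2r ?nnegrE ?mulr_ge0 ?fbound_ge0 ?snorm_ge0//.
  exact: fh_le.
have -> : k%:R * intRn (@wt R d) * B * nrm v ^+ 2 = intRn (fun x : rV => (k%:R * (B * nrm v ^+ 2)) * wt x).
  by rewrite intRnZ//; ring.
apply: le_intRn; [exact: (dec_wfdot (weight_truncw d s k) Cv Cv)|exact: decZ|move=> x].
apply: (@le_trans _ _ ((k%:R * wt x) * (B * nrm v ^+ 2))); last by rewrite mulrAC.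
by apply: ler_pM => //; [exact: truncw_ge0|exact: fdot_ge0|rewrite /truncw ge_min lexx orbT].
Qed.

(** The Plancherel inequality, together with the fact that the Sobolev weight is at least 1 for s >=
    0. *)
Lemma cutv_le : exists K, 0 <= K /\ forall s v, 0 <= s -> Cinf X v ->
  nrm (cutv chi v) <= K * Hsnorm s c chi v.
Proof.
have [K [K0 HK]] := plancherel_le R d; exists (Num.sqrt K); split; first exact: sqrtr_ge0.
move=> s v s0 Cv; rewrite Hsnorm_hform// /snorm -sqrtrM// ler_wsqrtr//.
have Cc := Cinf_cutv cc.1 Cv.
have dw1 := dec_wfdot (weight1 R d) Cv Cv; have dws := dec_wfdot (weight_sobw d s) Cv Cv.
apply: (@le_trans _ _ (K * intRn (fun xi => 1 * fdot v v xi))); last first.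
  rewrite ler_wpM2l//; apply: le_intRn => // xi.
  by rewrite ler_wpM2r ?fdot_ge0// sobw_ge1.
rewrite (rin_cutv hM cM Ac cc Cv Cc).
pose sq i y := loc v (i, false) y * loc v (i, false) y + loc v (i, true) y * loc v (i, true) y.
have dsq i : dec (sq i).
  have sqd f : cs f -> dec (fun y : rV => f y * f y).
    move=> [cf0 [r hr]]; apply: cs_dec; split; first exact: continuousMT.
    by exists r => x hx; rewrite hr// mul0r.
  by apply: decD; apply: sqd; exact: test_cs cL (test_loc _ Cv).
have -> : intRn (fun y => chi (cinv c y) * rdot (v c y) (cutv chi v c y)) = \sum_i intRn (sq i).
  rewrite -intRn_sum//; apply: eq_intRn => y.
  rewrite -rdotZ -/(cutv chi v c y) /rdot.
  rewrite -(pair_bigA _ (fun i b => co (cutv chi v c y) (i, b) * co (cutv chi v c y) (i, b))) /=.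
  by apply: eq_bigr => i _; rewrite big_bool /= /sq !locE// addrC.
have -> : intRn (fun xi => 1 * fdot v v xi) = \sum_i intRn (pw2 (loc v (i, false)) (loc v (i, true))).
  rewrite -intRn_sum; last by move=> i _; apply: (dec_pw2 cL); exact: test_loc.
  by apply: eq_intRn => xi; rewrite mul1r fdot_pw2.
rewrite mulr_sumr; apply: ler_sum => i _; apply: (HK _ _ _ cL); exact: test_loc.
Qed.

(** At each frequency the truncated weight equals the Sobolev weight for all large k; dominated
    convergence does the rest. *)
Lemma Hsnorm_le_trunc s v B : Cinf X v -> 0 <= B ->
  (forall k, snorm (hform (truncw s k)) v <= B) -> Hsnorm s c chi v <= B.
Proof.
move=> Cv B0 H; rewrite Hsnorm_hform// -[leRHS]ger0_norm// -sqrtr_sqr ler_wsqrtr//.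
have dws := dec_wfdot (weight_sobw d s) Cv Cv; have [cs0 [D HD]] := dws.
have lim : hform (truncw s k) v v @[k --> \oo] --> hform (sobw s) v v.
  apply: (@cvg_intRn _ _ _ _ D) => //.
  - by move=> k; have [] := dec_wfdot (weight_truncw d s k) Cv Cv.
  - move=> k x; apply: le_trans (HD x); rewrite !normrM !ger0_norm ?fdot_ge0 ?truncw_ge0 ?sobw_ge0//.
    by rewrite ler_wpM2r ?fdot_ge0// /truncw ge_min lexx.
  move=> x; apply: cvgM; last exact: cvg_cst.
  apply: cvg_near_cst.
  exists (Num.bound (sobw s x / wt x)) => // k /= hk; rewrite /truncw; apply/min_idPl.
  rewrite -ler_pdivrMr ?wt_gt0//; apply: le_trans (ltW (archi_boundP _)) _.
    by rewrite divr_ge0 ?sobw_ge0// ltW// wt_gt0.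
  by rewrite ler_nat.
apply: (cvgr_to_le lim); apply: nearW => k.
rewrite -(sqr_snorm (hform_semi_inner (weight_truncw d s k)))//.
by rewrite lerXn2r ?nnegrE ?snorm_ge0.
Qed.

End Loc.
End Sobolev.

(** * Uniform limits and convergent series of test functions *)

Section UniformLimits.
Variables (R : realType) (n : nat).
Local Notation rV := 'rV[R]_n.

Lemma real_cauchy (u : nat -> R) :
  (forall eps, 0 < eps -> exists N, forall j k, (N <= j)%N -> (N <= k)%N -> `|u j - u k| <= eps) ->
  cvg (u k @[k --> \oo]).
Proof.
move=> H; apply/cauchy_cvgP/cauchy_exP => eps eps0.
have e2 : 0 < eps / 2 by rewrite divr_gt0.
have [N HN] := H _ e2; exists (u N), N => // k Nk.
by have := HN N k (leqnn _) Nk => /= h; rewrite /ball /= /ball_ /=; apply: le_lt_trans h _; lra.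
Qed.

Definition null_seq (e : nat -> R) := forall eps, 0 < eps -> exists N, forall k, (N <= k)%N -> e k <= eps.

Lemma uniform_continuous_limit (F : rV -> R) (S : nat -> rV -> R) e :
  null_seq e -> (forall k, continuous (S k)) -> (forall k x, `|F x - S k x| <= e k) -> continuous F.
Proof.
move=> e0 cS HF x; apply/(@cvgrPdist_le _ _ _ (nbhs x)) => eps eps0.
have e3 : 0 < eps / 3 by rewrite divr_gt0.
have [N HN] := e0 _ e3; have hN := HN N (leqnn _).
have /(@cvgrPdist_le _ _ _ (nbhs x))/(_ _ e3) H := cS N x.
apply: filterS H => z hz.
have := HF N x; have := HF N z; rewrite -(distrC (S N z)) => h1 h2.
have -> : F x - F z = (F x - S N x) + (S N x - S N z) + (S N z - F z) by ring.
have := ler_normD ((F x - S N x) + (S N x - S N z)) (S N z - F z).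
have := ler_normD (F x - S N x) (S N x - S N z); lra.
Qed.

(** The increments of F and of S_k differ by at most |h| e_k, by the mean value theorem for S_p -
    S_k with p large. This uniformity permits the exchange of the limits in k and in h. *)
Lemma uniform_derive_limit (F G : rV -> R) (S : nat -> rV -> R) i e :
  null_seq e -> (forall k x, derivable (S k) x 'e_i) ->
  (forall k x, `|F x - S k x| <= e k) -> (forall k x, `|G x - 'D_('e_i) (S k) x| <= e k) ->
  forall x, is_derive x ('e_i : rV) F (G x).
Proof.
move=> e0 dS HF HG x.
have key k (h : R) : `|(F (x + h *: 'e_i) - F x) - (S k (x + h *: 'e_i) - S k x)| <= `|h| * e k.
  rewrite leNgt; apply/negP => lt; set l := `|_ - _| in lt.
  pose eta := (l - `|h| * e k) / (2 * (2 + `|h|)).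
  have h2 : 0 < 2 + `|h| by rewrite ltr_pwDl.
  have eta0 : 0 < eta by rewrite /eta; apply: divr_gt0; [rewrite subr_gt0|rewrite mulr_gt0].
  have [p Hp] := e0 _ eta0; have ep := Hp p (leqnn _).
  have dB y : derivable (fun z => S p z - S k z) y 'e_i by apply: derivableB.
  have [t _ E] := @MVT_line R n (fun z => S p z - S k z) x 'e_i h (fun t _ => dB _).
  have DE y : 'D_('e_i) (fun z => S p z - S k z) y = 'D_('e_i) (S p) y - 'D_('e_i) (S k) y.
    by rewrite -deriveB.
  rewrite DE in E; set y := x + t *: 'e_i in E.
  have b1 : `|'D_('e_i) (S p) y - 'D_('e_i) (S k) y| <= eta + e k.
    have := HG p y; have := HG k y; rewrite -(distrC ('D_('e_i) (S p) y)) => g1 g2.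
    have := ler_normD ('D_('e_i) (S p) y - G y) (G y - 'D_('e_i) (S k) y); rewrite subrKA; lra.
  have b2 : `|(S p (x + h *: 'e_i) - S p x) - (S k (x + h *: 'e_i) - S k x)| <= `|h| * (eta + e k).
    have -> : (S p (x + h *: 'e_i) - S p x) - (S k (x + h *: 'e_i) - S k x) =
       (S p (x + h *: 'e_i) - S k (x + h *: 'e_i)) - (S p x - S k x) by ring.
    by rewrite E normrM ler_wpM2l.
  have f1 := HF p x; have f2 := HF p (x + h *: 'e_i).
  have b3 : l <= 2 * eta + `|h| * (eta + e k).
    have -> : l = `|((F (x + h *: 'e_i) - S p (x + h *: 'e_i)) - (F x - S p x)) +
       ((S p (x + h *: 'e_i) - S p x) - (S k (x + h *: 'e_i) - S k x))| by rewrite /l; congr `|_|; ring.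
    have := ler_normD ((F (x + h *: 'e_i) - S p (x + h *: 'e_i)) - (F x - S p x))
       ((S p (x + h *: 'e_i) - S p x) - (S k (x + h *: 'e_i) - S k x)).
    have := ler_normB (F (x + h *: 'e_i) - S p (x + h *: 'e_i)) (F x - S p x); lra.
  have : eta * (2 + `|h|) = (l - `|h| * e k) / 2 by rewrite /eta; field; rewrite gt_eqF.
  have -> : eta * (2 + `|h|) = 2 * eta + `|h| * eta by ring.
  move: b3; rewrite mulrDr; lra.
have cv : (h^-1 *: ((F \o shift x) (h *: 'e_i) - F x)) @[h --> 0^'] --> G x.
  apply/cvgrPdist_le => eps eps0; have e3 : 0 < eps / 3 by rewrite divr_gt0.
  have [k Hk] := e0 _ e3; have ek := Hk k (leqnn _).
  have /cvg_ex [l Hl] := dS k x.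
  have lE : 'D_('e_i) (S k) x = l by apply/cvg_lim.
  have /cvgrPdist_le/(_ _ e3) Hq := Hl.
  near=> h; have h0 : h != 0 by near: h; exact: nbhs_dnbhs_neq.
  have q1 : `|l - h^-1 *: ((S k \o shift x) (h *: 'e_i) - S k x)| <= eps / 3 by near: h.
  have g1 := HG k x; rewrite lE in g1.
  have k1 := key k h; rewrite /= ![h *: _ + x]addrC in q1 *.
  have q2 : `|h^-1 *: (S k (x + h *: 'e_i) - S k x) - h^-1 *: (F (x + h *: 'e_i) - F x)| <= e k.
    rewrite -scalerBr normrZ normfV ler_pdivrMl ?normr_gt0// distrC; exact: k1.
  have := ler_normD (G x - l) (l - h^-1 *: (F (x + h *: 'e_i) - F x)); rewrite subrKA.
  have := ler_normD (l - h^-1 *: (S k (x + h *: 'e_i) - S k x))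
    (h^-1 *: (S k (x + h *: 'e_i) - S k x) - h^-1 *: (F (x + h *: 'e_i) - F x)); rewrite subrKA.
  lra.
split; first by apply/cvg_ex; exists (G x).
by apply/cvg_lim.
Unshelve. all: by end_near.
Qed.

Lemma pderiv_lin l t (f g : rV -> R) : smooth_on setT f -> smooth_on setT g ->
  pderiv l (fun y => t * f y + g y) = fun y => t * pderiv l f y + pderiv l g y.
Proof.
move=> Sf Sg; elim: l => //= i l IH; apply/funext => y; rewrite IH.
have df := (Sf l y I).2 i; have dg := (Sg l y I).2 i.
have := is_deriveD (is_deriveZ t (derivableP df)) (derivableP dg).
by move=> /(@derive_val _ _ _ _ _ _ _).
Qed.

Lemma test_pderiv (L : set rV) l f : compact L -> test L f -> test L (pderiv l f).
Proof. by move=> cL Tf; elim: l => //= i l IH; exact: test_derive. Qed.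

Lemma test_lin (L : set rV) t f g : test L f -> test L g -> test L (fun y => t * f y + g y).
Proof.
move=> [Sf f0] [Sg g0]; split; first exact: (smoothD openT (smoothZ openT t Sf) Sg).
by move=> y ny; rewrite f0// g0// mulr0 addr0.
Qed.

Lemma test0 (L : set rV) : test L (fun=> 0).
Proof. by split => //; exact: smooth_cst openT _. Qed.

Lemma testD (L : set rV) f g : test L f -> test L g -> test L (f + g).
Proof.
move=> Tf Tg; have := test_lin 1 Tf Tg; rewrite (_ : (fun y => _) = f + g)//.
by apply/funext => y; rewrite mul1r.
Qed.

(** A basis of neighbourhoods of 0 for test functions; the index k bounds both the order of the
    derivatives and their size, as in the sets [P k] of [hump]. *)
Definition small (L : set rV) (k : nat) : set (rV -> R) := [set f | test L f /\
  forall l y, (size l <= k)%N -> `|pderiv l f y| <= 2^-1 ^+ k].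

Lemma test_series (L : set rV) (v : nat -> rV -> R) : compact L -> (forall k, small L k (v k)) ->
  exists f, test L f /\ forall eps, 0 < eps -> exists N, forall k, (N <= k)%N ->
    forall y, `|f y - (\sum_(i < k) v i) y| <= eps.
Proof.
move=> cL Pv.
pose S (l : seq 'I_n) k y := \sum_(i < k) pderiv l (v i) y.
(* The tail of the geometric series: the sum of 2^-j over all j >= k. *)
pose e k := 2 * 2^-1 ^+ k : R.
have S0E k : (\sum_(i < k) v i) = S [::] k by apply/funext => y; rewrite fct_sumE.
have Cau l k p y : (size l <= k)%N -> `|S l (k + p)%N y - S l k y| <= e k - e (k + p)%N.
  move=> lk; elim: p => [|p IH]; first by rewrite addn0 !subrr normr0.
  rewrite addnS /S big_ord_recr /= -/(S l (k + p)%N y).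
  have h := (Pv (k + p)%N).2 l y (leq_trans lk (leq_addr _ _)).
  have -> : S l (k + p)%N y + pderiv l (v (k + p)%N) y - S l k y = (S l (k + p)%N y - S l k y) + pderiv l (v (k + p)%N) y by ring.
  have := ler_normD (S l (k + p)%N y - S l k y) (pderiv l (v (k + p)%N) y).
  have -> : e (k + p).+1 = e (k + p)%N - 2^-1 ^+ (k + p) by rewrite /e exprS; field.
  by move: IH h; set a := _ ^+ (k + p); lra.
have e_ge0 k : 0 <= e k by rewrite mulr_ge0// exprn_ge0.
have e0 : null_seq e.
  move=> eps eps0.
  have : 2 * 2^-1 ^+ k @[k --> \oo] --> (2 * 0 : R).
    by apply: cvgM; [exact: cvg_cst|apply: cvg_expr; rewrite ger0_norm ?invr_ge0// invf_lt1 ?ltr1n].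
  rewrite mulr0 => /cvgrPdist_le/(_ _ eps0)[N _ HN]; exists N => k Nk.
  by have := HN k Nk; rewrite sub0r normrN ger0_norm ?e_ge0.
have cvS l y : cvg (S l k y @[k --> \oo]).
  apply: real_cauchy => eps eps0; have e2 : 0 < eps / 2 by rewrite divr_gt0.
  have [N HN] := e0 _ e2; exists (maxn N (size l)) => j k; rewrite !geq_max => /andP[j1 j2] /andP[k1 k2].
  have h0 := HN N (leqnn _).
  have B i : (maxn N (size l) <= i)%N -> `|S l i y - S l (maxn N (size l)) y| <= eps / 2.
    move=> hi; have := Cau l (maxn N (size l)) (i - maxn N (size l))%N y (leq_maxr _ _).
    rewrite subnKC// => h; apply: le_trans h _; apply: le_trans (HN _ (leq_maxl N (size l))).
    by rewrite lerBlDr lerDl.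
  have := B j; have := B k; rewrite !geq_max j1 j2 k1 k2 => /(_ isT) b1 /(_ isT) b2.
  have := ler_normB (S l j y - S l (maxn N (size l)) y) (S l k y - S l (maxn N (size l)) y).
  by rewrite opprB addrA subrK; lra.
pose F l (y : rV) : R := lim (S l k y @[k --> \oo]).
have HF l k y : (size l <= k)%N -> `|F l y - S l k y| <= e k.
  move=> lk.
  have c1 : `|S l j y - S l k y| @[j --> \oo] --> `|F l y - S l k y|.
    by apply: cvg_norm; apply: cvgB; [exact: cvS|exact: cvg_cst].
  apply: (cvgr_to_le c1); exists k => // j /= kj.
  have := Cau l k (j - k)%N y lk; rewrite subnKC// => h; apply: le_trans h _.
  by rewrite lerBlDr lerDl.
have TS k : test L (S [::] k).
  elim: k => [|k IH]; first by rewrite (_ : S [::] 0%N = fun=> 0); [exact: test0|apply/funext => y; rewrite /S big_ord0].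
  rewrite (_ : S [::] k.+1 = S [::] k + v k); first by apply: testD => //; exact: (Pv k).1.
  by apply/funext => y; rewrite /S big_ord_recr.
have SE l k : pderiv l (S [::] k) = S l k.
  elim: k => [|k IH].
    have -> : S [::] 0%N = fun y => 0 * 0 + 0 by apply/funext => y; rewrite /S big_ord0 mul0r addr0.
    have [S0 _] := test0 L; rewrite (pderiv_lin l 0 S0 S0).
    have Z : pderiv l (fun _ : rV => 0) = fun=> 0.
      elim: l => //= i l ->; apply/funext => y; exact: derive_cst.
    by rewrite Z; apply/funext => y; rewrite /S big_ord0 mul0r addr0.
  have -> : S [::] k.+1 = fun y => 1 * S [::] k y + v k y.
    by apply/funext => y; rewrite /S big_ord_recr /= mul1r.
  rewrite (pderiv_lin l 1 (TS k).1 (Pv k).1.1) IH; apply/funext => y.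
  by rewrite /S big_ord_recr /= mul1r.
have es (l : seq 'I_n) : null_seq (fun k => e (k + (size l).+1)%N).
  move=> eps /e0[N HN]; exists N => k Nk; apply: HN; exact: leq_trans Nk (leq_addr _ _).
have cF l : continuous (F l).
  have c1 k : continuous (S l (k + (size l).+1)%N).
    by move=> y; rewrite -SE; have [h _] := (TS (k + (size l).+1)%N).1 l y I.
  have c2 k y : `|F l y - S l (k + (size l).+1)%N y| <= e (k + (size l).+1)%N.
    by apply: HF; rewrite (leq_trans (leqnSn _))// leq_addl.
  exact: (uniform_continuous_limit (es l) c1 c2).
have dF l i x : is_derive x ('e_i : rV) (F l) (F (i :: l) x).
  apply: (@uniform_derive_limit (F l) (F (i :: l)) (fun k => S l (k + (size l).+1)%N) i _ (es l)).
  - by move=> k y; rewrite -SE; have [_ h] := (TS (k + (size l).+1)%N).1 l y I.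
  - by move=> k y; apply: HF; rewrite (leq_trans (leqnSn _))// leq_addl.
  - move=> k y; rewrite -SE -[X in _ - X]/(pderiv (i :: l) (S [::] (k + (size l).+1)%N) y) SE.
    by apply: HF; rewrite /= leq_addl.
have FE l : pderiv l (F [::]) = F l.
  elim: l => //= i l IH; apply/funext => y; rewrite IH; exact: (@derive_val _ _ _ _ _ _ _ (dF l i y)).
exists (F [::]); split.
  split=> [l x _|y ny].
    rewrite FE; split; first exact: cF.
    by move=> i; exact: (@ex_derive _ _ _ _ _ _ _ (dF l i x)).
  rewrite /F (_ : (fun k => S [::] k y) = fun=> 0) ?lim_cst//.
  by apply/funext => k; exact: (TS k).2.
move=> eps /e0[N HN]; exists N => k Nk y; rewrite S0E.
by apply: le_trans (HF [::] k y _) _ => //; exact: HN.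
Qed.

End UniformLimits.

(** * Continuity of symmetric operators on smooth columns *)

Section Smoothing.
Variables (R : realType) (d : nat) (M : topologicalType).
Variable X : smooth_structure R d M.
Variable m : nat.
Local Notation chart := (chart R d M).
Local Notation C := R[i].
Local Notation hd := (hdens R d M m).
Local Notation J := ('I_m * bool)%type.
Local Notation rV := 'rV[R]_d.
Local Notation "t %:K" := ((t : R)%:C)%C (at level 1, format "t %:K").
Local Notation CI := [set v : hd | Cinf X v].
Local Notation rin := (@rin R d M X m).
Local Notation nrm := (snorm rin).
Hypotheses (hM : hausdorff_space M) (cM : compact [set: M]) (d0 : (0 < d)%N).

Let rs := Cinf_subspace X m.
Let si : semi_inner CI rin := @rin_semi_inner R d M X m hM cM.

(** This class contains the powers of A without a statement about powers of pseudodifferential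
    operators. *)
Record sym_op (B : op R d M m) : Prop := SymOp {
  so_C : forall v, Cinf X v -> Cinf X (B v);
  so_lin : forall t v w, Cinf X v -> Cinf X w -> B (t%:K *: v + w) = t%:K *: B v + B w;
  so_sym : forall v w, Cinf X v -> Cinf X w -> rin (B v) w = rin v (B w) }.

Lemma so0 B : sym_op B -> B 0 = 0.
Proof.
move=> HB; have C0 := rs0 rs; have := so_lin HB 1 C0 C0.
rewrite (_ : 1%:K = 1)// !scale1r addr0 => /eqP; rewrite -subr_eq0 opprD addrA subrr sub0r oppr_eq0.
by move/eqP.
Qed.

Lemma soZ B t v : sym_op B -> Cinf X v -> B (t%:K *: v) = t%:K *: B v.
Proof. by move=> HB Cv; have := so_lin HB t Cv (rs0 rs); rewrite (so0 HB) !addr0. Qed.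

Lemma soD B v w : sym_op B -> Cinf X v -> Cinf X w -> B (v + w) = B v + B w.
Proof. by move=> HB Cv Cw; have := so_lin HB 1 Cv Cw; rewrite (_ : 1%:K = 1)// !scale1r. Qed.

Section LocalBound.
Variables (c : chart) (L : set rV) (e : 'cV[C]_m) (B : op R d M m).
Hypotheses (Ac : atlas X c) (cL : compact L) (LI : L `<=` cimg c) (HB : sym_op B).

Lemma ext_sup : exists K : R, 0 <= K /\ forall (g : rV -> R) (eta : R), test L g -> (forall y, `|g y| <= eta) ->
  nrm (ext X c g e) <= K * eta.
Proof.
have [r hr] : exists r, forall x, L x -> `|x| <= r.
  have [B0 [_ HB0]] := compact_bounded cL; exists (B0 + 1) => x Lx.
  by apply: (HB0 (B0 + 1)) => //; rewrite ltrDl.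
pose D := (1 + r ^+ 2) ^+ d * pi ^+ d.
have h1 : 0 <= 1 + r ^+ 2 by rewrite addr_ge0// sqr_ge0.
have D0 : 0 <= D.
  by rewrite /D mulr_ge0//; apply: exprn_ge0 => //; exact: pi_ge0.
exists (Num.sqrt (rdot e e * D)); split=> [|g eta Tg ge]; first exact: sqrtr_ge0.
have eta0 : 0 <= eta := le_trans (normr_ge0 _) (ge 0).
rewrite -[leLHS]ger0_norm ?snorm_ge0// -sqrtr_sqr (snorm_ext hM cM Ac cL LI _ Tg).
rewrite -[X in _ <= _ * X]ger0_norm// -[X in _ <= _ * X]sqrtr_sqr -sqrtrM; last by rewrite mulr_ge0// rdot_ge0.
rewrite ler_wsqrtr// -mulrA ler_wpM2l ?rdot_ge0//.
have cg : continuous g by move=> y; exact: (smooth_cont Tg.1 I).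
apply: le_trans (ler_norm _) _.
have -> : D * eta ^+ 2 = (eta ^+ 2 * (1 + r ^+ 2) ^+ d) * pi ^+ d by rewrite /D; ring.
apply: intRn_norm_le; first exact: continuousMT.
apply: cs_bound => x; first by rewrite normrM expr2 ler_pM.
move=> h; rewrite Tg.2 ?mul0r// => /hr h2; move: h; rewrite ltNge h2//.
Qed.

(** A theorem of Hellinger-Toeplitz type. For w of norm at most 1 the functional that pairs [ext f]
    with [B w] is continuous in the sup norm, B w being fixed; for a fixed f all of them are bounded
    by the norm of [B (ext f)], by symmetry. The gliding hump makes the bound uniform in w. *)
Lemma local_bound : exists (k : nat) (T : R), 0 <= T /\ forall (f : rV -> R) (b : R), 0 < b -> test L f ->
  (forall l y, (size l <= k)%N -> `|pderiv l f y| <= b) -> nrm (B (ext X c f e)) <= T * b.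
Proof.
have [K [K0 HK]] := ext_sup.
pose I := {w : hd | Cinf X w /\ nrm w <= 1}.
pose q (w : I) (f : rV -> R) := `|rin (ext X c f e) (B (sval w))|.
have CE f : test L f -> Cinf X (ext X c f e) by exact: Cinf_ext.
have CB (w : I) : Cinf X (B (sval w)) by apply: (so_C HB); exact: (svalP w).1.
have extD f g : ext X c (f + g) e = ext X c f e + ext X c g e.
  have := ext_lin X c 1 f g e; rewrite (_ : 1%:K = 1)// scale1r => <-.
  by congr ext; apply/funext => y; rewrite mul1r.
have extN f : ext X c (- f) e = - ext X c f e.
  have := ext_lin X c (-1) f (fun=> 0) e; rewrite rcN1.
  rewrite (_ : ext X c (fun=> 0) e = 0).
    by rewrite addr0 => <-; congr ext; apply/funext => y; rewrite mulN1r addr0.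
  by apply/funext => c'; apply/funext => y; rewrite /ext mulr0 scale0r if_same.
have qle w f eta : test L f -> (forall y, `|f y| <= eta) -> q w f <= (K * eta) * nrm (B (sval w)).
  move=> Tf fe; apply: le_trans (si_CS rs si (CE _ Tf) (CB w)) _.
  by rewrite ler_wpM2r ?snorm_ge0// HK.
have testN f : test L f -> test L (- f).
  move=> Tf; have := test_lin (-1) Tf (test0 L); rewrite (_ : (fun y => _) = - f)//.
  by apply/funext => y; rewrite mulN1r addr0.
have [] := @hump R (rV -> R) I [set f | test L f] (small L) q.
- exact: test0.
- by move=> u v; exact: testD.
- exact: testN.
- by move=> k f [].
- move=> k l kl f [Tf Hf]; split => // s y sk; apply: le_trans (Hf s y (leq_trans sk kl)) _.
  by rewrite ler_wiXn2l// ?invr_ge0// invf_le1 ?ler1n.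
- move=> k f [Tf Hf]; split; first exact: testN.
  move=> l y lk; have := pderiv_lin l (-1) Tf.1 (test0 L).1.
  rewrite (_ : (fun y => _) = - f); last by apply/funext => z; rewrite mulN1r addr0.
  move=> ->; have -> : pderiv l (fun _ : rV => 0 : R) y = 0.
    suff -> : pderiv l (fun _ : rV => 0 : R) = fun=> 0 by [].
    by elim: l {lk} => //= i l ->; apply/funext => z; exact: derive_cst.
  by rewrite addr0 mulN1r normrN; exact: Hf.
- move=> w u v Tu Tv; rewrite /q extD (siD si) ?ler_normD//; by [exact: CE|exact: CB].
- move=> w v Tv; rewrite /q extN (siN si) ?normrN//; by [exact: CE|exact: CB].
- move=> w v Tv; rewrite /q extD (siD si); [|exact: CE..|exact: CB].
  by rewrite -mulr2n normrMn mulr_natl.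
- move=> w eta eta0; pose b := K * nrm (B (sval w)).
  have b0 : 0 <= b by rewrite mulr_ge0// snorm_ge0.
  have : b * 2^-1 ^+ k @[k --> \oo] --> (b * 0 : R).
    by apply: cvgM; [exact: cvg_cst|apply: cvg_expr; rewrite ger0_norm ?invr_ge0// invf_lt1 ?ltr1n].
  rewrite mulr0 => /cvgrPdist_le/(_ _ eta0)[k _ Hk]; exists k => f [Tf Hf].
  apply: le_trans (qle w f _ Tf (fun y => Hf [::] y isT)) _.
  have := Hk k (leqnn _); rewrite sub0r normrN ger0_norm; last by rewrite mulr_ge0// exprn_ge0// invr_ge0.
  by rewrite /b mulrAC.
- move=> v Pv; have [f [Tf Hf]] := test_series cL Pv.
  exists (nrm (B (ext X c f e)) + 1) => w n0.
  pose bw := K * nrm (B (sval w)) + 1.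
  have bw0 : 0 < bw by rewrite ltr_wpDl// mulr_ge0// snorm_ge0.
  have bwV : 0 < bw^-1 by rewrite invr_gt0.
  have [N HN] := Hf _ bwV.
  exists (maxn n0 N); split; first exact: leq_maxl.
  set S := \sum_(i < _) _.
  have TS : test L S.
    rewrite /S; elim/big_rec: _ => [|i u _]; first exact: test0.
    by apply: testD; have [] := Pv i.
  have TD : test L (S - f) by apply: testD => //; exact: testN.
  have -> : S = f + (S - f) by rewrite addrC subrK.
  rewrite /q extD (siD si); [|exact: CE..|exact: CB].
  apply: le_trans (ler_normD _ _) _; apply: lerD.
    have [Cw w1] := svalP w.
    rewrite -(so_sym HB (CE _ Tf) Cw); apply: le_trans (si_CS rs si (so_C HB (CE _ Tf)) Cw) _.
    by rewrite ler_piMr ?snorm_ge0.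
  apply: le_trans (qle w (S - f) bw^-1 TD _) _.
    by move=> y; have := HN _ (leq_maxr n0 N) y; rewrite distrC.
  by rewrite mulrAC ler_pdivrMr// mul1r /bw lerDl.
move=> k [T HT].
have Z l : pderiv l (fun _ : rV => 0 : R) = fun=> 0.
  by elim: l => //= i l ->; apply/funext => z; exact: derive_cst.
have T0 : 0 <= T.
  have z : Cinf X (0 : hd) /\ nrm 0 <= 1 by split; [exact: (rs0 rs)|rewrite (snorm0 rs si)].
  apply: le_trans (HT (exist _ _ z) (fun=> 0) _); first exact: normr_ge0.
  by split; [exact: test0|move=> l y _; rewrite Z normr0 exprn_ge0// invr_ge0].
have p2 : 0 < (2^-1 : R) ^+ k by rewrite exprn_gt0// invr_gt0.
exists k, (T * (2^-1 ^+ k)^-1); split=> [|f b b0 Tf Hf]; first by rewrite mulr_ge0// invr_ge0 ltW.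
pose t := 2^-1 ^+ k / b; have t0 : 0 < t by rewrite divr_gt0.
pose g y := t * f y + 0.
have Tg : test L g := test_lin t Tf (test0 L).
have Sg : small L k g.
  split => // l y lk; rewrite /g (pderiv_lin l t Tf.1 (test0 L).1) Z addr0 normrM gtr0_norm//.
  by rewrite /t mulrAC ler_pdivrMr// ler_pM2l//; exact: Hf.
have gE : ext X c g e = t%:K *: ext X c f e.
  rewrite /g ext_lin (_ : ext X c (fun=> 0) e = 0) ?addr0//.
  by apply/funext => c'; apply/funext => y; rewrite /ext mulr0 scale0r if_same.
set u := B (ext X c f e); have Cu : Cinf X u := so_C HB (CE _ Tf).
have BgE : B (ext X c g e) = t%:K *: u by rewrite gE soZ//; exact: CE.
have Cv : Cinf X (B (ext X c g e)) := so_C HB (CE _ Tg).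
have uT : nrm (B (ext X c g e)) <= T.
  have [->//|n0] := eqVneq (nrm (B (ext X c g e))) 0.
  have np : 0 < nrm (B (ext X c g e)) by rewrite lt_neqAle eq_sym n0 snorm_ge0.
  (* The normalised column [B (ext g)] is itself an admissible w; it turns the bound on the
     functionals into a bound on the norm. *)
  have Cw := rsZ rs (nrm (B (ext X c g e)))^-1 Cv.
  have w1 : nrm ((nrm (B (ext X c g e)))^-1%:K *: B (ext X c g e)) <= 1.
    by rewrite (snormZ rs si)// gtr0_norm ?invr_gt0// mulVf.
  have := HT (exist _ _ (conj Cw w1)) g Sg; apply: le_trans.
  rewrite /q /= -(so_sym HB (CE _ Tg) Cw) (siZr rs si _ Cv Cv) -(sqr_snorm si Cv) expr2 mulKf//.
  exact: ler_norm.
move: uT; rewrite BgE (snormZ rs si)// gtr0_norm// mulrC -ler_pdivlMr//.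
by rewrite /t invf_div mulrA mulrAC.
Qed.

End LocalBound.

(** Each derivative falls either on g or on the phase, where it produces a component of xi, at most
    1 + |xi|^2. *)
Lemma pderiv_wave_le (L : set rV) (g : rV -> R) k : compact L -> test L g ->
  exists D : R, 0 <= D /\ forall (xi : rV) (th : R) (l : seq 'I_d) (y : rV), (size l <= k)%N ->
    `|pderiv l (fun y => g y * cos (dot y xi + th)) y| <= D * (1 + dot xi xi) ^+ k.
Proof.
move=> cL; elim: k g => [|k IH] g Tg.
  have [D [D0 HD]] := cs_bounded (test_cs cL Tg); exists D; split => // xi th [|//] y _ /=.
  by rewrite expr0 mulr1 normrM -[leRHS]mulr1 ler_pM// cos_max.
have [D0 [D00 H0]] := IH g Tg.
have /choice[E HE] : forall i, exists D : R, 0 <= D /\ forall (xi : rV) (th : R) (l : seq 'I_d) (y : rV), (size l <= k)%N ->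
    `|pderiv l (fun y => 'D_('e_i) g y * cos (dot y xi + th)) y| <= D * (1 + dot xi xi) ^+ k.
  by move=> i; apply: IH; exact: test_derive.
have SE : 0 <= \sum_i E i by apply: sumr_ge0 => i _; have [] := HE i.
exists (D0 + \sum_i E i); split=> [|xi th l y]; first exact: addr_ge0.
have W1 : 1 <= 1 + dot xi xi by rewrite lerDl dot_ge0.
have Wk : 0 <= (1 + dot xi xi) ^+ k by rewrite exprn_ge0// (le_trans _ W1).
rewrite leq_eqVlt => /orP[/eqP lk|]; last first.
  rewrite ltnS => lk; apply: le_trans (H0 xi th l y lk) _; rewrite exprS.
  have : 0 <= (\sum_i E i) * ((1 + dot xi xi) * (1 + dot xi xi) ^+ k).
    by rewrite !mulr_ge0// (le_trans _ W1).
  have : D0 * (1 + dot xi xi) ^+ k <= D0 * ((1 + dot xi xi) * (1 + dot xi xi) ^+ k).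
    by rewrite ler_wpM2l// ler_peMl.
  rewrite mulrDl; lra.
case/lastP: l lk => [//|l i]; rewrite size_rcons => -[lk].
have oT : open [set: rV] by exact: openT.
have S1 : smooth_on setT (fun y => g y * cos (dot y xi + (th + pi / 2))).
  by apply: (smoothM oT Tg.1); exact: smooth_phase.
have S2 : smooth_on setT (fun y => 'D_('e_i) g y * cos (dot y xi + th)).
  by apply: (smoothM oT (test_derive i cL Tg).1); exact: smooth_phase.
rewrite pderiv_rcons.
have -> : 'D_('e_i) (fun y => g y * cos (dot y xi + th)) =
    fun y => xi 0 i * (g y * cos (dot y xi + (th + pi / 2))) + 'D_('e_i) g y * cos (dot y xi + th).
  apply/funext => z; have dg := derivableP ((Tg.1 [::] z I).2 i).
  have /(@derive_val _ _ _ _ _ _ _) -> := is_deriveM dg (is_derive_phase th xi z i).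
  by rewrite /GRing.scale /=; ring.
rewrite (pderiv_lin l _ S1 S2).
have h1 := H0 xi (th + pi / 2) l y; rewrite lk in h1; have {}h1 := h1 (leqnn _).
have [Ei0 hE] := HE i; have h2 := hE xi th l y; rewrite lk in h2; have {}h2 := h2 (leqnn _).
have xiW : `|xi 0 i| <= 1 + dot xi xi.
  have : `|xi 0 i| ^+ 2 <= dot xi xi.
    rewrite real_normK ?num_real// /dot (bigD1 i)//= -expr2 lerDl sumr_ge0// => j _.
    by rewrite -expr2 sqr_ge0.
  have := sqr_ge0 (`|xi 0 i| - 1); rewrite sqrrB expr1n mulr1 => a1 a2.
  have : 0 <= `|xi 0 i| by []. move=> a3; have := dot_ge0 xi; lra.
apply: le_trans (ler_normD _ _) _; rewrite [leRHS]mulrDl; apply: lerD.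
  rewrite normrM exprS mulrCA; apply: ler_pM => //.
apply: le_trans h2 _; apply: ler_pM => //.
  by rewrite (bigD1 i)//= lerDl sumr_ge0// => j _; have [] := HE j.
by rewrite exprS ler_peMl.
Qed.

Section ChartBound.
Variables (c : chart) (psi : M -> R) (B : op R d M m).
Hypotheses (Ac : atlas X c) (cc : cutoff X c psi) (HB : sym_op B).

Let cL : compact (csup c psi) := csup_compact cM Ac cc.
Let LI : csup c psi `<=` cimg c := @csup_cimg _ _ _ _ _ _ cc.

(** Duality: the coefficient pairs [B v] with a wave, hence v with B applied to the wave, and
    [local_bound] estimates the latter by C^k norms, which grow polynomially in xi. *)
Lemma fh_growth : exists (k : nat) (T : R), 0 <= T /\ forall v xi j, Cinf X v ->
  `|fh X c psi (B v) xi j| <= T * (1 + dot xi xi) ^+ k * nrm v.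
Proof.
have /choice[kT H1] : forall j : J, exists kT : nat * R, 0 <= kT.2 /\
    forall (f : rV -> R) (b : R), 0 < b -> test (csup c psi) f ->
    (forall (l : seq 'I_d) (y : rV), (size l <= kT.1)%N -> `|pderiv l f y| <= b) ->
    nrm (B (ext X c f (ej R j))) <= kT.2 * b.
  by move=> j; have [k [T h]] := local_bound (ej R j) Ac cL LI HB; exists (k, T).
pose k := \max_j (kT j).1; pose T := \sum_j (kT j).2.
have T0 : 0 <= T by apply: sumr_ge0 => j _; have [] := H1 j.
have [D [D0 HD]] := pderiv_wave_le k cL (test_cutc cM Ac cc).
have W (xi : rV) : 1 <= 1 + dot xi xi by rewrite lerDl dot_ge0.
have Wk (xi : rV) : 1 <= (1 + dot xi xi) ^+ k by rewrite exprn_ege1.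
have wv th xi j : nrm (B (wave X c psi th xi j)) <= T * ((D + 1) * (1 + dot xi xi) ^+ k).
  have [Tj0 hj] := H1 j.
  have b0 : 0 < (D + 1) * (1 + dot xi xi) ^+ k.
    by rewrite mulr_gt0 ?ltr_wpDl// (lt_le_trans ltr01).
  apply: (@le_trans _ _ ((kT j).2 * ((D + 1) * (1 + dot xi xi) ^+ k))).
    apply: hj => //; first exact: (test_wave cM Ac cc th xi).
    move=> l y lk; apply: le_trans (HD xi th l y _) _.
      by apply: leq_trans lk _; exact: leq_bigmax.
    by rewrite ler_wpM2r ?lerDl// (le_trans _ (Wk xi)).
  rewrite ler_wpM2r ?(ltW b0)// /T (bigD1 j)//= lerDl sumr_ge0// => i _.
  by have [] := H1 i.
have CW (th : R) (xi : rV) (j : J) := Cinf_wave hM cM Ac cc th xi j.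
exists k, (2 * T * (D + 1)); split; first by rewrite !mulr_ge0// addr_ge0.
move=> v xi j Cv.
have CF := Cinf_fvec hM cM Ac cc xi j.
rewrite /fh -(so_sym HB)//; apply: le_trans (si_CS rs si (so_C HB CF) Cv) _.
rewrite ler_wpM2r ?snorm_ge0//.
have -> : 2 * T * (D + 1) * (1 + dot xi xi) ^+ k =
  T * ((D + 1) * (1 + dot xi xi) ^+ k) + T * ((D + 1) * (1 + dot xi xi) ^+ k) by ring.
rewrite /fvec; case: j.2.
  rewrite -rcN1 (soD HB (CW _ _ _) (rsZ rs _ (CW _ _ _))) (soZ _ HB (CW _ _ _)); apply: le_trans (snormD rs si _ _) _; [exact: so_C|apply: (rsZ rs); exact: so_C|].
  by rewrite (snormZ rs si) ?normrN1 ?mul1r ?lerD//; exact: so_C.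
rewrite (soD HB)//; apply: le_trans (snormD rs si _ _) _; [exact: so_C|exact: so_C|].
exact: lerD.
Qed.

Lemma pderiv_slice (H : 'rV[R]_(d + d) -> R) (y : rV) l :
  pderiv l (fun z => H (row_mx y z)) = fun z => pderiv (map (@rshift d d) l) H (row_mx y z).
Proof.
elim: l => //= i l IH; apply/funext => z; rewrite IH /derive; set s := map _ l.
have -> : (fun h : R => h^-1 *: (((fun z0 : rV => pderiv s H (row_mx y z0)) \o shift z) (h *: 'e_i) - pderiv s H (row_mx y z))) =
  (fun h : R => h^-1 *: ((pderiv s H \o shift (row_mx y z)) (h *: 'e_(rshift d i)) - pderiv s H (row_mx y z))); last by [].
apply/funext => h /=; congr (_ *: (pderiv _ _ _ - _)).
have -> : row_mx y (h *: 'e_i + z) = h *: row_mx 0 'e_i + row_mx y z.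
  by rewrite scale_row_mx add_row_mx scaler0 add0r.
congr (_ *: _ + _); apply/rowP => j.
by case: (split_ordP j) => k ->; rewrite ?row_mxEl ?row_mxEr !mxE eqxx /= ?eq_lrshift ?eq_rlshift ?eq_rshift.
Qed.

Lemma continuous_row2 : continuous (fun q : rV * rV => row_mx q.1 q.2).
Proof.
by move=> q; apply: cvg_row_mx; [exact: continuous_fst|exact: continuous_snd].
Qed.

Definition kslice (h : 'rV[R]_(d + d) -> R) (y z : rV) := cutc c psi z * h (row_mx y z).

Lemma open_rsub (U : set rV) : open U -> open [set z : 'rV[R]_(d + d) | U (rsubmx z)].
Proof.
move=> oU; apply: open_comp => // z _; apply: (@cvg_mx R _ (nbhs z)) => i j.
rewrite !mxE; rewrite (_ : (fun x : 'rV[R]_(d + d) => _) = fun x : 'rV[R]_(d + d) => x i (rshift d j)).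
  exact: coord_continuous.
by apply/funext => x; rewrite !mxE.
Qed.

Lemma open_lsub (U : set rV) : open U -> open [set z : 'rV[R]_(d + d) | U (lsubmx z)].
Proof.
move=> oU; apply: open_comp => // z _; apply: (@cvg_mx R _ (nbhs z)) => i j.
rewrite !mxE; rewrite (_ : (fun x : 'rV[R]_(d + d) => _) = fun x : 'rV[R]_(d + d) => x i (lshift d j)).
  exact: coord_continuous.
by apply/funext => x; rewrite !mxE.
Qed.

Lemma smooth_kslice h : smooth_on [set z | cimg c (lsubmx z) /\ cimg c (rsubmx z)] h ->
  smooth_on [set z : 'rV[R]_(d + d) | cimg c (lsubmx z)] (fun w => cutc c psi (rsubmx w) * h w).
Proof.
move=> Sh; have oI := cimg_open Ac.
have oU : open [set z : 'rV[R]_(d + d) | cimg c (lsubmx z) /\ cimg c (rsubmx z)].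
  by apply: openI; [exact: open_lsub|exact: open_rsub].
have cK : closed [set z : 'rV[R]_(d + d) | csup c psi (rsubmx z)].
  rewrite -openC; apply: (@open_rsub (~` csup c psi)); rewrite openC.
  exact: compact_closed (@rV_hausdorff R d) cL.
apply: (@smooth_zero_ext _ _ _ _ _ _ (open_lsub oI) cK _ (smoothM oU _ Sh)).
- by move=> w /= h1 /LI h2; split.
- apply: (@smooth_comp _ _ _ oU _ (cimg c) (@rsubmx R 1 d d) (cutc c psi) oI).
  + by move=> w [].
  + move=> j; apply: (@smooth_congr _ _ _ oU (fun w => w 0 (rshift d j))); last exact: smooth_coord.
    by move=> w _; rewrite mxE.
  + apply: (smooth_congr oI _ (cc.1 c Ac)) => z Iz; by rewrite /cutc asboolT.
- by move=> w _ n; rewrite (cutc_eq0 Ac n) mul0r.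
Qed.

Lemma smooth_slice h y : cimg c y ->
  smooth_on [set z | cimg c (lsubmx z) /\ cimg c (rsubmx z)] h ->
  smooth_on (cimg c) (fun z => h (row_mx y z)).
Proof.
move=> Iy Sh; have oI := cimg_open Ac.
have oU : open [set z : 'rV[R]_(d + d) | cimg c (lsubmx z) /\ cimg c (rsubmx z)].
  by apply: openI; [exact: open_lsub|exact: open_rsub].
have p1 z : cimg c z -> [set z | cimg c (lsubmx z) /\ cimg c (rsubmx z)] (row_mx y z : 'rV[R]_(d + d)).
  by move=> Iz /=; rewrite row_mxKl row_mxKr.
have p2 j : smooth_on (cimg c) (fun z : rV => (row_mx y z : 'rV[R]_(d + d)) 0 j).
  case: (split_ordP j) => k ->.
    apply: (@smooth_congr _ _ _ oI (fun=> y 0 k)); last exact: smooth_cst.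
    by move=> z _; rewrite row_mxEl.
  apply: (@smooth_congr _ _ _ oI (fun z => z 0 k)); last exact: smooth_coord.
  by move=> z _; rewrite row_mxEr.
exact: (smooth_comp oI oU p1 p2 Sh).
Qed.

Lemma test_kslice h y : cimg c y ->
  smooth_on [set z | cimg c (lsubmx z) /\ cimg c (rsubmx z)] h ->
  test (csup c psi) (kslice h y).
Proof. by move=> Iy Sh; apply: (test_cutcM cM Ac cc); exact: smooth_slice. Qed.

(** The duality of [fh_growth] with the slice of the kernel at y as test function. Its derivatives
    are bounded uniformly for y in the compact set L' by joint smoothness of the kernel. *)
Lemma kernel_bound h (L' : set rV) j : compact L' -> L' `<=` cimg c ->
  smooth_on [set z | cimg c (lsubmx z) /\ cimg c (rsubmx z)] h ->
  exists T : R, 0 <= T /\ forall v y, Cinf X v -> L' y ->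
    `|intRn (fun z => cutc c psi z * h (row_mx y z) * co (B v c z) j)| <= T * nrm v.
Proof.
move=> cL' L'I Sh.
have [k [T [T0 HT]]] := local_bound (ej R j) Ac cL LI HB.
pose H w := cutc c psi (rsubmx w) * h w.
have SH := smooth_kslice Sh.
have bd l : exists D : R, 0 <= D /\ forall y z, L' y -> csup c psi z ->
    `|pderiv (map (@rshift d d) l) H (row_mx y z)| <= D.
  have cX := compact_setX cL' cL.
  suff c1 (q : rV * rV) : (L' `*` csup c psi) q ->
      {for q, continuous (fun q : rV * rV => pderiv (map (@rshift d d) l) H (row_mx q.1 q.2))}.
    have [D [D0 HD]] := continuous_bounded_compact cX c1.
    by exists D; split => // y z h1 h2; apply: (HD (y, z)).
  move=> [/L'I q1 _]; apply: (@continuous_comp _ _ _ (fun q : rV * rV => row_mx q.1 q.2)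
     (pderiv (map (@rshift d d) l) H)); first exact: continuous_row2.
  have Hq : [set z : 'rV[R]_(d + d) | cimg c (lsubmx z)] (row_mx q.1 q.2) by rewrite /= row_mxKl.
  by have [] := SH (map (@rshift d d) l) _ Hq.
have bdk : exists D : R, 0 <= D /\ forall l y z, (size l <= k)%N -> L' y -> csup c psi z ->
    `|pderiv (map (@rshift d d) l) H (row_mx y z)| <= D.
  have /choice[F HF] := bd.
  exists (\sum_(i < k.+1) \sum_(l : i.-tuple 'I_d) F l); split.
    by apply: sumr_ge0 => i _; apply: sumr_ge0 => l _; have [] := HF l.
  move=> l y z lk Ly Lz; have [_ h1] := HF l; apply: le_trans (h1 y z Ly Lz) _.
  rewrite (bigD1 (Ordinal (lk : (size l < k.+1)%N)))//= (bigD1 (in_tuple l))//= -addrA lerDl.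
  by rewrite addr_ge0// ?sumr_ge0// => i _; [have [] := HF i|apply: sumr_ge0 => l' _; have [] := HF l'].
have [D [D0 HD]] := bdk.
exists (T * (D + 1)); split; first by rewrite mulr_ge0// addr_ge0.
move=> v y Cv Ly; have Iy := L'I _ Ly; have Tk := test_kslice Iy Sh.
have CE := Cinf_ext hM Ac cL LI (ej R j) Tk.
have -> : intRn (fun z => cutc c psi z * h (row_mx y z) * co (B v c z) j) =
    rin (ext X c (kslice h y) (ej R j)) (B v).
  rewrite (rin_ext hM cM Ac cL LI _ Tk (so_C HB Cv)).
  by apply: eq_intRn => z; rewrite rdot_ej.
rewrite -(so_sym HB)//; apply: le_trans (si_CS rs si (so_C HB CE) Cv) _.
rewrite ler_wpM2r ?snorm_ge0//; apply: HT => //; first by rewrite ltr_wpDl.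
move=> l z lk; have [Lz|nLz] := pselect (csup c psi z); last first.
  by rewrite (test_pderiv l cL Tk).2// normr0 addr_ge0.
have -> : pderiv l (kslice h y) z = pderiv (map (@rshift d d) l) H (row_mx y z).
  rewrite -[RHS](congr1 (fun F => F z) (pderiv_slice H y l)).
  by congr (pderiv l _ z); apply/funext => w; rewrite /H /kslice row_mxKr.
by apply: le_trans (HD l y z lk Ly Lz) _; rewrite lerDl.
Qed.

End ChartBound.
End Smoothing.

(** * Componentwise bounds and continuity for complex functions *)

Section ComplexBounds.
Variable R : realType.
Local Notation C := R[i].

Definition cbd (z : C) (b : R) := `|complex.Re z| <= b /\ `|complex.Im z| <= b.

Definition ccont (T : topologicalType) (f : T -> C) :=
  continuous (fun t => complex.Re (f t)) /\ continuous (fun t => complex.Im (f t)).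

Lemma cbdM z w b b' : cbd z b -> cbd w b' -> cbd (z * w) (2 * b * b').
Proof.
case: z w => [x y] [x' y'] [/= h1 h2] [/= h3 h4].
have b1 : `|x * x'| <= b * b' by rewrite normrM ler_pM.
have b2 : `|y * y'| <= b * b' by rewrite normrM ler_pM.
have b3 : `|x * y'| <= b * b' by rewrite normrM ler_pM.
have b4 : `|y * x'| <= b * b' by rewrite normrM ler_pM.
split=> /=.
  by apply: le_trans (ler_normB _ _) _; lra.
by apply: le_trans (ler_normD _ _) _; lra.
Qed.

Lemma cbd_sum I (s : seq I) (z : I -> C) b : (forall i, cbd (z i) b) ->
  cbd (\sum_(i <- s) z i) ((size s)%:R * b).
Proof.
move=> H; elim: s => [|i s [IH1 IH2]]; first by rewrite big_nil mul0r; split; rewrite /= normr0.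
rewrite big_cons /= -natr1 mulrDl mul1r; case: (H i).
case: (z i) => x y; move: IH1 IH2; case: (\sum_(j <- s) z j) => x' y' /= h1 h2 h3 h4.
by split; rewrite /= addrC; apply: le_trans (ler_normD _ _) _; apply: lerD.
Qed.

Lemma ccontM (T : topologicalType) (f g : T -> C) : ccont f -> ccont g -> ccont (fun t => f t * g t).
Proof.
move=> [f1 f2] [g1 g2]; split.
  rewrite (_ : (fun t => _) = fun t => complex.Re (f t) * complex.Re (g t) + - (complex.Im (f t) * complex.Im (g t))).
    apply: continuousDT; first exact: continuousMT.
    by move=> t; have c := continuousMT f2 g2; exact: (continuousN (c t)).
  by apply/funext => t; case: (f t) => ? ?; case: (g t).
rewrite (_ : (fun t => _) = fun t => complex.Re (f t) * complex.Im (g t) + complex.Im (f t) * complex.Re (g t)).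
  by apply: continuousDT; exact: continuousMT.
by apply/funext => t; case: (f t) => ? ?; case: (g t).
Qed.

Lemma ccont_sum (T : topologicalType) I (s : seq I) (f : I -> T -> C) : (forall i, ccont (f i)) ->
  ccont (fun t => \sum_(i <- s) f i t).
Proof.
move=> H; elim: s => [|i s [IH1 IH2]].
  rewrite (_ : (fun t => _) = fun=> 0); first by split; exact: cst_continuous.
  by apply/funext => t; rewrite big_nil.
rewrite (_ : (fun t => _) = fun t => f i t + \sum_(j <- s) f j t); last first.
  by apply/funext => t; rewrite big_cons.
have [f1 f2] := H i; split.
  rewrite (_ : (fun t => _) = fun t => complex.Re (f i t) + complex.Re (\sum_(j <- s) f j t)).
    exact: continuousDT.
  by apply/funext => t; case: (f i t) => ? ?; case: (\sum_(j <- s) _).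
rewrite (_ : (fun t => _) = fun t => complex.Im (f i t) + complex.Im (\sum_(j <- s) f j t)).
  exact: continuousDT.
by apply/funext => t; case: (f i t) => ? ?; case: (\sum_(j <- s) _).
Qed.

End ComplexBounds.

(** * Smoothing operators composed with symmetric ones, within a chart *)

Section Smoothing2.
Variables (R : realType) (d : nat) (M : topologicalType).
Variable X : smooth_structure R d M.
Variable m : nat.
Local Notation chart := (chart R d M).
Local Notation C := R[i].
Local Notation hd := (hdens R d M m).
Local Notation J := ('I_m * bool)%type.
Local Notation rV := 'rV[R]_d.
Local Notation "t %:K" := ((t : R)%:C)%C (at level 1, format "t %:K").
Local Notation CI := [set v : hd | Cinf X v].
Local Notation rin := (@rin R d M X m).
Local Notation nrm := (snorm rin).
Hypotheses (hM : hausdorff_space M) (cM : compact [set: M]) (d0 : (0 < d)%N).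

Let rs := Cinf_subspace X m.
Let si : semi_inner CI rin := @rin_semi_inner R d M X m hM cM.

Definition smoothing (S : op R d M m) := forall r : R, Psi X r S.

Definition cpart (b : bool) (z : C) : R := if b then complex.Im z else complex.Re z.

Lemma cpart_bound z (B : R) : (forall b, `|cpart b z| <= B) -> cbd z B.
Proof. by move=> H; split; [exact: (H false)|exact: (H true)]. Qed.

(** For large xi this is the symbol estimate without derivatives, for small xi compactness. The even
    order makes the bound an integer power of 1 + |xi|^2. *)
Lemma symbol_bound (U L' : set rV) (a : 'rV[R]_(d + d) -> 'M[C]_m) ak n :
  classical_symbol U (- (2 * n)%:R) a ak -> compact L' -> L' `<=` U ->
  exists B : R, 0 <= B /\ forall x xi, L' x -> forall i k, cbd (a (row_mx x xi) i k) (B * (1 + dot xi xi) ^- n).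
Proof.
move=> [Sa _ _ bd] cL' L'U.
have [c0 H0] := bd 0%N L' [::] cL' L'U.
have Dn (xi : rV) : 0 < (1 + dot xi xi) ^+ n by rewrite exprn_gt0// dot1_gt0.
suff /choice[B HB] : forall ikb : 'I_m * 'I_m * bool, exists B : R, 0 <= B /\ forall x xi, L' x ->
    `|cpart ikb.2 (a (row_mx x xi) ikb.1.1 ikb.1.2)| <= B * (1 + dot xi xi) ^- n.
  have S0 : 0 <= \sum_ikb B ikb by apply: sumr_ge0 => i _; have [] := HB i.
  exists (\sum_ikb B ikb); split => // x xi Lx i k; apply: cpart_bound => b.
  have [_ h] := HB (i, k, b); apply: le_trans (h x xi Lx) _.
  rewrite ler_wpM2r ?invr_ge0 ?(ltW (Dn _))// (bigD1 (i, k, b))//= lerDl.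
  by apply: sumr_ge0 => j _; have [] := HB j.
move=> [ [i k] b] /=.
have cX := compact_setX cL' (@compact_norm_le R d 1).
have c1 (q : rV * rV) : (L' `*` [set x : rV | `|x| <= 1]) q ->
    {for q, continuous (fun q : rV * rV => cpart b (a (row_mx q.1 q.2) i k))}.
  move=> [/L'U q1 _].
  apply: (@continuous_comp _ _ _ (fun q : rV * rV => row_mx q.1 q.2) (fun w => cpart b (a w i k))).
    exact: continuous_row2.
  have Hq : [set z : 'rV[R]_(d + d) | U (lsubmx z)] (row_mx q.1 q.2) by rewrite /= row_mxKl.
  by have [s1 s2] := Sa i k; case: b; [exact: (smooth_cont s2 Hq)|exact: (smooth_cont s1 Hq)].
have [B0 [B00 HB0]] := continuous_bounded_compact cX c1.
exists ((B0 + `|c0|) * 2 ^+ n); split=> [|x xi Lx]; first by rewrite mulr_ge0 ?addr_ge0 ?exprn_ge0.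
have D0 := dot_ge0 xi.
have two_le t : 0 < t -> 1 + dot xi xi <= 2 * t -> t ^- n <= 2 ^+ n * (1 + dot xi xi) ^- n.
  move=> t0 h; rewrite ler_pdivlMr ?Dn// mulrC ler_pdivrMr ?exprn_gt0// -exprMn.
  by rewrite lerXn2r ?nnegrE ?mulr_ge0 ?(ltW (dot1_gt0 _)) ?(ltW t0).
have p2 : 0 <= 2 ^+ n * (1 + dot xi xi) ^- n :> R.
  by rewrite mulr_ge0 ?exprn_ge0// invr_ge0 ltW.
have [big|small] := leP 1 (dot xi xi); last first.
  have n1 : `|xi| <= 1.
    apply: rV_norm_le => // l; rewrite -(@ler_pXn2r _ 2)// ?nnegrE// expr1n real_normK ?num_real//.
    apply: ltW; apply: le_lt_trans small; rewrite /dot (bigD1 l)//= -expr2 lerDl sumr_ge0// => l' _.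
    by rewrite -expr2 sqr_ge0.
  apply: le_trans (HB0 (x, xi) _) _; first by split.
  have := two_le 1 ltr01; rewrite expr1n invr1 mulr1 => h.
  have : 1 <= 2 ^+ n * (1 + dot xi xi) ^- n by apply: h; lra.
  rewrite -mulrA; set t := _ * _ => t1.
  have : 0 <= `|c0| * t by rewrite mulr_ge0.
  have : B0 * 1 <= B0 * t by rewrite ler_wpM2l.
  rewrite mulrDl; lra.
have e1 : 1 <= enorm xi by rewrite /enorm -[leLHS](sqrtr1 R) ler_wsqrtr.
have := H0 x xi Lx e1 i k => /=.
have -> : enorm xi `^ (- (2 * n)%:R - 0%:R - (xi_order (d := d) [::])%:R) = dot xi xi ^- n.
  rewrite /xi_order /= !subr0 powRN powR_mulrn ?sqrtr_ge0// exprM /enorm sqr_sqrtr//.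
rewrite !big_ord0 !subr0.
move=> [h1 h2].
have h : `|cpart b (a (row_mx x xi) i k)| <= c0 * dot xi xi ^- n by case: b {c1 HB0}; [exact: h2|exact: h1].
apply: le_trans h _.
have Dp : 0 < dot xi xi := lt_le_trans ltr01 big.
have tl := two_le _ Dp; have {}tl : dot xi xi ^- n <= 2 ^+ n * (1 + dot xi xi) ^- n by apply: tl; lra.
apply: (@le_trans _ _ (`|c0| * (2 ^+ n * (1 + dot xi xi) ^- n))).
  apply: (@le_trans _ _ (`|c0| * dot xi xi ^- n)).
    by rewrite ler_wpM2r ?ler_norm// invr_ge0 exprn_ge0.
  by rewrite ler_wpM2l.
by rewrite mulrA ler_wpM2r ?invr_ge0 ?(ltW (Dn _))// ler_wpM2r ?exprn_ge0// lerDr.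
Qed.

Section ChartSmooth.
Variables (c : chart) (psi : M -> R) (B : op R d M m) (L' : set rV).
Hypotheses (Ac : atlas X c) (cc : cutoff X c psi) (HB : sym_op X B).
Hypotheses (cL' : compact L') (L'I : L' `<=` cimg c).

Let cL : compact (csup c psi) := csup_compact cM Ac cc.

Lemma Op_bound : exists n : nat, forall a ak, classical_symbol (cimg c) (- (2 * n)%:R) a ak ->
  exists T : R, 0 <= T /\ forall v y j, Cinf X v -> L' y ->
    `|co (Op a (cutv psi (B v) c) y) j| <= T * nrm v.
Proof.
have [k [T [T0 HT]]] := fh_growth hM cM Ac cc HB.
(* The exponent k compensates the growth of the Fourier coefficients of [B v], and (1 + |xi|^2)^-d
   is at most [wt], which is integrable. It is fixed before the symbol is chosen. *)
exists (k + d)%N => a ak Ha; have [D [D0 HD]] := symbol_bound Ha cL' L'I.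
have [Sa _ _ _] := Ha.
pose q : R := ((2 * pi)^-1 ^+ d).
pose K := 2 * 1 * (m%:R * (2 * D * T)).
have q0 : 0 <= q by rewrite /q exprn_ge0// invr_ge0 mulr_ge0// pi_ge0.
have K0 : 0 <= K by rewrite /K !mulr_ge0.
exists (q * (K * pi ^+ d)); split=> [|v y j Cv Ly].
  by rewrite !mulr_ge0// exprn_ge0// pi_ge0.
rewrite /Op coZ normrM ger0_norm// -[leRHS]mulrA ler_wpM2l//.
set F := fun xi : rV => _.
have CB := so_C HB Cv.
have uE i xi : fourier (cutv psi (B v) c) xi i 0 = (fh X c psi (B v) xi (i, false) +i* fh X c psi (B v) xi (i, true))%C.
  exact: (fourier_fh hM cM Ac cc).
have FE i xi : F xi i 0 = expi (dot y xi) * \sum_l a (row_mx y xi) i l * fourier (cutv psi (B v) c) xi l 0.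
  by rewrite /F mxE mxE.
have cfh (j0 : J) : continuous (fun xi : rV => fh X c psi (B v) xi j0).
  by move=> xi; exact: (continuous_fh hM cM Ac cc CB).
have cF i : ccont (fun xi => F xi i 0).
  rewrite (_ : (fun xi => _) = fun xi : rV => expi (dot y xi) * \sum_l a (row_mx y xi) i l * fourier (cutv psi (B v) c) xi l 0); last first.
    by apply/funext => xi; rewrite FE.
  have cd : continuous (fun xi : rV => dot y xi).
    by apply: continuous_dot2; [exact: cst_continuous|exact: continuous_idT].
  apply: ccontM; first by split => /=; [exact: continuous_cosC|exact: (continuousC cd (@continuous_sin R))].
  apply: ccont_sum => l; apply: ccontM; last first.
    split.
      rewrite (_ : (fun xi => _) = fun xi => fh X c psi (B v) xi (l, false)); first exact: cfh.
      by apply/funext => xi; rewrite uE.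
    rewrite (_ : (fun xi => _) = fun xi => fh X c psi (B v) xi (l, true)); first exact: cfh.
    by apply/funext => xi; rewrite uE.
  have cr : continuous (fun xi : rV => row_mx y xi : 'rV[R]_(d + d)).
    by move=> xi; exact: (@cvg_row_mx R d d rV (nbhs xi) _ (fun _ : rV => y) (fun z : rV => z) y xi (@cst_continuous rV _ y xi) (@continuous_idT rV xi)).
  have Hq (xi : rV) : [set z : 'rV[R]_(d + d) | cimg c (lsubmx z)] (row_mx y xi).
    by rewrite /= row_mxKl; exact: L'I.
  have [s1 s2] := Sa i l; split => xi.
    apply: (@continuous_comp _ _ _ (fun xi : rV => row_mx y xi : 'rV[R]_(d + d)) (fun w => complex.Re (a w i l))); first exact: cr.
    exact: (smooth_cont s1 (Hq xi)).
  apply: (@continuous_comp _ _ _ (fun xi : rV => row_mx y xi : 'rV[R]_(d + d)) (fun w => complex.Im (a w i l))); first exact: cr.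
  exact: (smooth_cont s2 (Hq xi)).
have bF i xi : cbd (F xi i 0) (K * nrm v * wt xi).
  have W0 := dot1_gt0 xi; have Wk : 0 < (1 + dot xi xi) ^+ k by rewrite exprn_gt0.
  have e1 : cbd (expi (dot y xi)) 1 by split; [exact: cos_max|exact: sin_max].
  have bt l : cbd (a (row_mx y xi) i l * fourier (cutv psi (B v) c) xi l 0)
      (2 * (D * (1 + dot xi xi) ^- (k + d)) * (T * (1 + dot xi xi) ^+ k * nrm v)).
    by apply: cbdM; [exact: HD|rewrite uE; split; exact: HT].
  have := cbdM e1 (cbd_sum (index_enum 'I_m) bt); rewrite -FE.
  have -> : size (index_enum 'I_m) = m by rewrite -[RHS]card_ord cardT enumT.
  set b1 := (X in cbd _ X) => -[h1 h2].
  suff h : b1 <= K * nrm v * wt xi by split; [exact: le_trans h1 h|exact: le_trans h2 h].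
  rewrite /b1 exprD invfM.
  set x := (1 + dot xi xi) ^- k; set z := (1 + dot xi xi) ^- d.
  have -> : 2 * 1 * (m%:R * (2 * (D * (x * z)) * (T * (1 + dot xi xi) ^+ k * nrm v))) =
     K * nrm v * (z * (x * (1 + dot xi xi) ^+ k)) by rewrite /K; ring.
  rewrite /x mulVf ?mulr1; last by rewrite gt_eqF.
  rewrite ler_wpM2l ?mulr_ge0 ?snorm_ge0// /z -[leRHS]invrK lef_pV2 ?posrE ?invr_gt0 ?wt_gt0 ?exprn_gt0//.
  exact: wt_le_dot1.
case: j => i b; rewrite /co /intcV mxE /intC /=.
rewrite -mulrA (mulrC _ (nrm v)) mulrA; case: b.
  apply: intRn_norm_le; first exact: (cF i).2.
  by move=> xi; exact: (bF i xi).2.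
apply: intRn_norm_le; first exact: (cF i).1.
by move=> xi; exact: (bF i xi).1.
Qed.

Lemma K_bound (K : 'rV[R]_(d + d) -> 'M[C]_m) :
  smooth_mx [set z | cimg c (lsubmx z) /\ cimg c (rsubmx z)] K ->
  exists T : R, 0 <= T /\ forall v y j, Cinf X v -> L' y ->
    `|co (intcV (fun z => K (row_mx y z) *m cutv psi (B v) c z)) j| <= T * nrm v.
Proof.
move=> SK.
have Skb i k b : smooth_on [set z | cimg c (lsubmx z) /\ cimg c (rsubmx z)] (fun z => cpart b (K z i k)).
  by have [s1 s2] := SK i k; case: b; [exact: s2|exact: s1].
have /choice[T HT] : forall z : 'I_m * 'I_m * bool * bool, exists T : R, 0 <= T /\
    forall v y, Cinf X v -> L' y ->
    `|intRn (fun w => cutc c psi w * cpart z.1.2 (K (row_mx y w) z.1.1.1 z.1.1.2) * co (B v c w) (z.1.1.2, z.2))| <= T * nrm v.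
  move=> [ [ [i k] b] b'] /=.
  exact: (kernel_bound hM cM Ac cc HB (k, b') cL' L'I (Skb i k b)).
pose TT := \sum_z T z.
have TT0 : 0 <= TT by apply: sumr_ge0 => z _; have [] := HT z.
have bT z v y : Cinf X v -> L' y -> `|intRn (fun w => cutc c psi w * cpart z.1.2 (K (row_mx y w) z.1.1.1 z.1.1.2) * co (B v c w) (z.1.1.2, z.2))| <= TT * nrm v.
  move=> Cv Ly; have [_ h] := HT z; apply: le_trans (h v y Cv Ly) _.
  by rewrite ler_wpM2r ?snorm_ge0// /TT (bigD1 z)//= lerDl sumr_ge0// => z' _; have [] := HT z'.
exists (m%:R * (TT + TT)); split=> [|v y [i b] Cv Ly]; first by rewrite mulr_ge0// addr_ge0.
have CB := so_C HB Cv; have Iy := L'I Ly; have oI := cimg_open Ac.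
have dk k b1 b2 : dec (fun w => cutc c psi w * cpart b1 (K (row_mx y w) i k) * co (B v c w) (k, b2)).
  have sl := smooth_slice Ac Iy (Skb i k b1).
  have := test_cutcM cM Ac cc (smoothM oI sl (Cinf_smooth (k, b2) CB Ac)).
  move=> /(test_dec cL); rewrite (_ : (fun w => _) = fun w => cutc c psi w * cpart b1 (K (row_mx y w) i k) * co (B v c w) (k, b2))//.
  by apply/funext => w; rewrite mulrA.
have E w : (K (row_mx y w) *m cutv psi (B v) c w) i 0 =
   \sum_k K (row_mx y w) i k * (loc c psi (B v) (k, false) w +i* loc c psi (B v) (k, true) w)%C.
  rewrite mxE; apply: eq_bigr => k _; congr (_ * _).
  have LE k' := @locE R d M X m c psi (B v) k' w CB.
  by rewrite !LE /co /=; case: (_ k 0).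
have bsum (f g : 'I_m -> rV -> R) : (forall k, dec (f k)) -> (forall k, dec (g k)) ->
   (forall k, `|intRn (f k)| <= TT * nrm v) -> (forall k, `|intRn (g k)| <= TT * nrm v) ->
   `|intRn (fun w => \sum_k (f k w + g k w))| <= m%:R * (TT + TT) * nrm v.
  move=> df dg bf bg; rewrite intRn_sum; last by move=> k _; exact: decD.
  apply: le_trans (ler_norm_sum _ _ _) _.
  rewrite -mulrA mulr_natl -[X in _ *+ X]card_ord -sumr_const; apply: ler_sum => k _.
  rewrite intRnD// mulrDl; apply: le_trans (ler_normD _ _) _; exact: lerD.
have Re_sum (z : 'I_m -> C) : complex.Re (\sum_k z k) = \sum_k complex.Re (z k).
  by apply: (big_morph (@complex.Re R) (id1 := 0) (op1 := +%R)) => // -[? ?] [? ?].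
have Im_sum (z : 'I_m -> C) : complex.Im (\sum_k z k) = \sum_k complex.Im (z k).
  by apply: (big_morph (@complex.Im R) (id1 := 0) (op1 := +%R)) => // -[? ?] [? ?].
rewrite /co /intcV mxE /intC /=; case: b.
  rewrite (_ : (fun w => _) = fun w => \sum_k (cutc c psi w * cpart false (K (row_mx y w) i k) * co (B v c w) (k, true) +
     cutc c psi w * cpart true (K (row_mx y w) i k) * co (B v c w) (k, false))).
    apply: bsum => k //; [exact: (bT (i, k, false, true))|exact: (bT (i, k, true, false))].
  apply/funext => w; rewrite E Im_sum; apply: eq_bigr => k _; rewrite /loc.
  by case: (K _ i k) => p q /=; ring.
rewrite (_ : (fun w => _) = fun w => \sum_k (cutc c psi w * cpart false (K (row_mx y w) i k) * co (B v c w) (k, false) +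
   - (cutc c psi w * cpart true (K (row_mx y w) i k) * co (B v c w) (k, true)))).
  apply: bsum => k //; [exact: decN|exact: (bT (i, k, false, false))|].
  by rewrite intRnN// normrN; exact: (bT (i, k, true, true)).
apply/funext => w; rewrite E Re_sum; apply: eq_bigr => k _; rewrite /loc.
by case: (K _ i k) => p q /=; ring.
Qed.

Lemma supp_cutv (v : hd) : Cinf X v -> supp (cutv psi v) `<=` cdom c.
Proof.
move=> Cv; apply: subset_trans cc.2; apply: closureS => x /= [c' Dx nz] p0; apply: nz.
have [Ac'|nA] := pselect (atlas X c'); first by rewrite /cutv (cmapK Ac' Dx) p0 scale0r.
have [_ _ v3] := Cv; by rewrite /cutv v3 ?scaler0// => -[].
Qed.

(** A smoothing operator has symbols of every order; the one of order -2n is taken, with the n that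
    absorbs the growth caused by B. *)
Lemma chart_smooth S : smoothing S -> exists T : R, 0 <= T /\ forall v y j, Cinf X v -> L' y ->
  `|co (S (cutv psi (B v)) c y) j| <= T * nrm v.
Proof.
move=> HS; have [n Hn] := Op_bound.
have [p [S1 S2 S3]] := HS (- (2 * n)%:R).
have [a [ak [K [Ha _ SK SE]]]] := S3 c Ac.
have [T1 [T10 H1]] := Hn a ak Ha; have [T2 [T20 H2]] := K_bound SK.
exists (T1 + T2); split=> [|v y j Cv Ly]; first exact: addr_ge0.
have CB := so_C HB Cv.
rewrite SE; [|exact: (Cinf_cutv cc.1 CB)|exact: supp_cutv|exact: L'I].
by rewrite coD mulrDl; apply: le_trans (ler_normD _ _) _; apply: lerD; [exact: H1|exact: H2].
Qed.

End ChartSmooth.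
End Smoothing2.

(** * Global bounds for smoothing operators *)

Section Smoothing3.
Variables (R : realType) (d : nat) (M : topologicalType).
Variable X : smooth_structure R d M.
Variable m : nat.
Local Notation chart := (chart R d M).
Local Notation C := R[i].
Local Notation hd := (hdens R d M m).
Local Notation J := ('I_m * bool)%type.
Local Notation rV := 'rV[R]_d.
Local Notation "t %:K" := ((t : R)%:C)%C (at level 1, format "t %:K").
Local Notation CI := [set v : hd | Cinf X v].
Local Notation rin := (@rin R d M X m).
Local Notation nrm := (snorm rin).
Hypotheses (hM : hausdorff_space M) (cM : compact [set: M]) (d0 : (0 < d)%N).

Let rs := Cinf_subspace X m.
Let si : semi_inner CI rin := @rin_semi_inner R d M X m hM cM.

(** A chart through x and z exists for every z ([pair_chart]). Each piece of a column is then
    supported in a chart in which its contribution at x can be computed. *)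
Lemma local_partition x : exists n (kappa : 'I_n -> chart) (chi : 'I_n -> M -> R),
  partition_of_unity X kappa chi /\ forall i, cdom (kappa i) x.
Proof.
have [n [f [Hf fpos]]] : exists n (f : 'I_n -> M -> R),
    (forall i, [/\ msmooth X (f i), forall z, 0 <= f i z & exists c, [/\ atlas X c, cdom c x & cutoff X c (f i)]]) /\
    forall z, 0 < \sum_i f i z.
  apply: (finite_bumps cM (P := fun f => exists c, [/\ atlas X c, cdom c x & cutoff X c f])) => z.
  have [c [Ac Dx Dz]] := pair_chart X hM x z d0.
  have [chi [h1 h2 h3 _]] := cutoff_at hM Ac Dz openT I.
  by exists chi; split => //; [exact: h1.1|exists c].
have /choice[kappa Hk] : forall i, exists c, [/\ atlas X c, cdom c x & cutoff X c (f i)].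
  by move=> i; have [] := Hf i.
pose S z := \sum_i f i z.
have SS : msmooth X S by apply: msmooth_sum => i; have [] := Hf i.
have S0 z : S z != 0 by rewrite gt_eqF// fpos.
exists n, kappa, (fun i z => f i z * (S z)^-1); split; last by move=> i; have [] := Hk i.
split=> [i|z]; last by rewrite -mulr_suml (mulfV (S0 z)).
have [Ak _ ck] := Hk i; split; [exact: Ak|apply: cutoffM; [exact: ck|exact: msmooth_inv]].
Qed.

Lemma sumK n (a : 'I_n -> R) : \sum_i (a i)%:K = (\sum_i a i)%:K.
Proof. by rewrite rmorph_sum. Qed.

Lemma cutv_partition n (kappa : 'I_n -> chart) (chi : 'I_n -> M -> R) (v : hd) :
  partition_of_unity X kappa chi -> v = \sum_i cutv (chi i) v.
Proof.
move=> [_ P]; apply/funext => c; apply/funext => y; rewrite !fct_sumE.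
have -> : \sum_i cutv (chi i) v c y = (\sum_i (chi i (cinv c y))%:K) *: v c y by rewrite scaler_suml.
by rewrite sumK P scale1r.
Qed.

Record lin_op (S : op R d M m) : Prop := LinOp {
  lo_C : forall v, Cinf X v -> Cinf X (S v);
  lo_lin : forall (z : C) v w, Cinf X v -> Cinf X w -> S (z *: v + w) = z *: S v + S w }.

Lemma smoothing_lin S : smoothing X S -> lin_op S.
Proof. by move=> /(_ 0)[p [h1 h2 _]]; split. Qed.

Lemma lo0 S : lin_op S -> S 0 = 0.
Proof.
move=> HS; have C0 := rs0 rs; have := lo_lin HS 1 C0 C0.
rewrite !scale1r addr0 => /eqP; rewrite -subr_eq0 opprD addrA subrr sub0r oppr_eq0.
by move/eqP.
Qed.

Lemma loD S v w : lin_op S -> Cinf X v -> Cinf X w -> S (v + w) = S v + S w.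
Proof. by move=> HS Cv Cw; have := lo_lin HS 1 Cv Cw; rewrite !scale1r. Qed.

Lemma loZ S (z : C) v : lin_op S -> Cinf X v -> S (z *: v) = z *: S v.
Proof. by move=> HS Cv; have := lo_lin HS z Cv (rs0 rs); rewrite (lo0 HS) !addr0. Qed.

Lemma lo_sum S I (s : seq I) (F : I -> hd) : lin_op S -> (forall i, Cinf X (F i)) ->
  S (\sum_(i <- s) F i) = \sum_(i <- s) S (F i).
Proof.
move=> HS CF; elim: s => [|i s IH]; first by rewrite !big_nil lo0.
by rewrite !big_cons loD ?IH//; apply: Cinf_sum => k _; exact: CF.
Qed.

Lemma sym_id : sym_op X (id : op R d M m).
Proof. by split. Qed.

Lemma point_bound S x c : smoothing X S -> atlas X c -> cdom c x ->
  exists T : R, 0 <= T /\ forall v j, Cinf X v -> `|co (S v c (cmap c x)) j| <= T * nrm v.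
Proof.
move=> HS Ac Dx; have [n [kappa [chi [P kx]]]] := local_partition x.
have LS := smoothing_lin HS.
have /choice[T HT] : forall i, exists T : R, 0 <= T /\ forall v y j, Cinf X v -> [set cmap (kappa i) x] y ->
    `|co (S (cutv (chi i) (id v)) (kappa i) y) j| <= T * nrm v.
  move=> i; have [Ak ck] := P.1 i.
  have LI1 : [set cmap (kappa i) x] `<=` cimg (kappa i) by move=> _ ->; exact: cimg_cmap.
  exact: (chart_smooth hM cM Ak ck sym_id (@compact_set1 _ _) LI1 HS).
pose h i := hfac c (kappa i) (cmap c x).
have h0 i : 0 <= h i by exact: sqrtr_ge0.
exists (\sum_i h i * T i); split.
  by apply: sumr_ge0 => i _; rewrite mulr_ge0//; have [] := HT i.
move=> v j Cv; rewrite {1}(cutv_partition v P) lo_sum//; last first.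
  by move=> i; have [_ ck] := P.1 i; exact: (Cinf_cutv ck.1 Cv).
rewrite !fct_sumE (big_morph (fun z => co z j) (id1 := 0) (op1 := +%R)); [|by move=> *; exact: coD|exact: co0].
apply: le_trans (ler_norm_sum _ _ _) _; rewrite mulr_suml; apply: ler_sum => i _.
have [Ak ck] := P.1 i.
have CS : Cinf X (S (cutv (chi i) v)) by apply: (lo_C LS); exact: (Cinf_cutv ck.1 Cv).
have o : overlap c (kappa i) (cmap c x).
  by apply/(overlapE _ _ Ac); split; [exact: cimg_cmap|rewrite (cmapK Ac Dx)].
have [_ /(_ c (kappa i) Ac Ak _ o) -> _] := (CinfP X _).1 CS.
rewrite coZ normrM ger0_norm ?h0// -mulrA ler_wpM2l ?h0//.
have [_ hT] := HT i; apply: hT => //.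
by rewrite /transition /= (cmapK Ac Dx).
Qed.

(** Concentrated bumps have a fixed value at the centre and squared L^2 norm proportional to N^-d.
    Together with [point_bound] this distinguishes the identity from smoothing operators. *)
Lemma point_unbounded x c (T : R) (j : J) : atlas X c -> cdom c x ->
  ~ (forall v, Cinf X v -> `|co (v c (cmap c x)) j| <= T * nrm v).
Proof.
move=> Ac Dx H; set a := cmap c x.
have Ia : cimg c a by exact: cimg_cmap.
have /nbhs_ballP[r /= r0 hr] := near_open (cimg_open Ac) Ia.
pose b := @bb R d; pose I2 := intRn (fun u => b u * b u).
have b0 : 0 < b 0 by exact: bumpn_gt0.
have [cb [rb hb]] := cs_bb R d.
have key (N : nat) : r^-1 < N%:R -> (b 0) ^+ 2 * N%:R <= T ^+ 2 * I2.
  move=> rN; have N0 : 0 < N%:R :> R by apply: lt_trans rN; rewrite invr_gt0.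
  pose L := [set y : rV | `|y - a| <= N%:R^-1].
  have cL : compact L.
    have -> : L = (fun z => z + a) @` [set z : rV | `|z| <= N%:R^-1].
      apply/seteqP; split=> [y Ly|_ [z hz <-]]; first by exists (y - a); rewrite ?subrK.
      by rewrite /L /= addrK.
    apply: continuous_compact; last exact: compact_norm_le.
    by apply: continuous_subspaceT; exact: continuous_addr.
  have LI : L `<=` cimg c.
    move=> y Ly; apply: hr; apply/ball_rVP => // i.
    have := rV_coord_le (y - a) i; rewrite !mxE distrC => h; apply: le_lt_trans h _.
    by apply: le_lt_trans Ly _; rewrite invf_plt ?posrE.
  pose f y := b (N%:R *: (y - a)).
  have Tf : test L f.
    split.
      have oT : open [set: rV] by exact: openT.
      apply: (@smooth_comp R d setT oT d setT (fun y : rV => N%:R *: (y - a)) b openT) => //; last exact: (test_bb R d).1.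
      move=> i; apply: (@smooth_congr _ _ _ oT (fun y : rV => N%:R * (y 0 i - a 0 i))).
        by move=> z _; rewrite !mxE.
      by apply: smoothZ => //; apply: smoothB => //; [exact: smooth_coord|exact: smooth_cst].
    move=> y nL; apply: bb_eq0; rewrite normrZ gtr0_norm//; move/negP: nL; rewrite -ltNge => h.
    by rewrite mulrC -ltr_pdivrMr// div1r.
  have CE := Cinf_ext hM Ac cL LI (ej R j) Tf.
  have := H _ CE; rewrite (extE Ac _ _ Ia) coZ co_ej eqxx mulr1 /f subrr scaler0 gtr0_norm// => h.
  have h2 : b 0 ^+ 2 <= (T * nrm (ext X c f (ej R j))) ^+ 2.
    by rewrite lerXn2r ?nnegrE ?(ltW b0)// (le_trans (ltW b0)).
  move: h2; rewrite exprMn (snorm_ext hM cM Ac cL LI _ Tf) rdot_ej co_ej eqxx mul1r => h2.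
  have csf : cs (fun y => f y * f y).
    have [cf0 [r' hr']] := test_cs cL Tf; split; first exact: continuousMT.
    by exists r' => y hy; rewrite hr'// mul0r.
  have E := intRn_rescale a N0 csf.
  have -> : I2 = N%:R ^+ d * intRn (fun y => f y * f y).
    rewrite E; apply: eq_intRn => u; rewrite /f addrK scalerA mulfV ?scale1r// gt_eqF//.
  have i0 : 0 <= intRn (fun y => f y * f y) by apply: intRn_ge0 => y; rewrite -expr2 sqr_ge0.
  have Nd : N%:R <= N%:R ^+ d :> R.
    have N1 : 1 <= N%:R :> R by rewrite ler1n -(ltr0n R).
    by rewrite -[leLHS]expr1 ler_weXn2l.
  rewrite mulrCA mulrA mulrC.
  apply: (@le_trans _ _ (N%:R * (T ^+ 2 * intRn (fun y => f y * f y)))).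
    by rewrite ler_wpM2l// ltW.
  by rewrite -mulrA ler_wpM2r// mulr_ge0 ?sqr_ge0.
have b2 : 0 < b 0 ^+ 2 by rewrite exprn_gt0.
pose Q := `|T ^+ 2 * I2| / b 0 ^+ 2; pose N := ((Num.bound (r^-1)).+1 + (Num.bound Q))%N.
have N1 : r^-1 < N%:R.
  apply: lt_le_trans (archi_boundP _) _; first by rewrite invr_ge0 ltW.
  by rewrite ler_nat /N addSn leqW// leq_addr.
have := key N N1; rewrite leNgt => /negP; apply.
apply: le_lt_trans (ler_norm _) _; rewrite [ltRHS]mulrC -ltr_pdivrMr//.
apply: lt_le_trans (archi_boundP _) _; first by rewrite divr_ge0// ltW.
by rewrite ler_nat /N leq_addl.
Qed.

Lemma cutv_bounded g : msmooth X g -> exists G : R, 0 <= G /\ forall u, Cinf X u -> nrm (cutv g u) <= G * nrm u.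
Proof.
move=> Sg; have cg := msmooth_cont Sg.
have [G [G0 HG]] := continuous_bounded_compact cM (fun x _ => cg x).
exists G; split => // u Cu; have Cg := Cinf_cutv Sg Cu.
have [n [kappa [chi [P chi0]]]] := partition_exists X hM cM.
rewrite -(@ler_pXn2r _ 2)// ?nnegrE ?mulr_ge0 ?snorm_ge0// exprMn !(sqr_snorm si)//.
rewrite !(rinE cM P)// /psum mulr_sumr; apply: ler_sum => i _; have [Ak ck] := P.1 i.
have du := dec_cutoff cM Ak ck (rdensity_rdot Cu Cu); have dg := dec_cutoff cM Ak ck (rdensity_rdot Cg Cg).
rewrite -intRnZ//; apply: le_intRn => //; first exact: decZ.
move=> y; rewrite mulrCA ler_wpM2l// /cutv rdotZ rdotC rdotZ mulrA -expr2 ler_wpM2r ?rdot_ge0//.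
by rewrite -real_normK ?num_real// lerXn2r ?nnegrE//; exact: HG.
Qed.

(** The substitute for a composition theorem: with B = A^i it bounds S A^i on L^2. Pointwise bounds
    near each x are integrated over the support of a cutoff and then patched by compactness. *)
Lemma smoothing_bound S B : smoothing X S -> sym_op X B ->
  exists T : R, 0 <= T /\ forall v, Cinf X v -> nrm (S (B v)) <= T * nrm v.
Proof.
move=> HS HB; have LS := smoothing_lin HS.
have [n [f [Hf fpos]]] : exists n (f : 'I_n -> M -> R),
    (forall i, [/\ msmooth X (f i), forall z, 0 <= f i z & exists T : R, 0 <= T /\
       forall v, Cinf X v -> nrm (cutv (f i) (S (B v))) <= T * nrm v]) /\
    forall z, 0 < \sum_i f i z.
  apply: (finite_bumps cM (P := fun f => exists T : R, 0 <= T /\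
       forall v, Cinf X v -> nrm (cutv f (S (B v))) <= T * nrm v)) => x.
  have [n [kappa [chi [P kx]]]] := local_partition x.
  have [c Ac Dx] := atlas_cover X x.
  (* The finitely many charts of the partition all contain x, hence an open set around x; a cutoff
     supported there puts source and target of each piece into the same chart. *)
  pose O1 := [set z | forall i, cdom (kappa i) z].
  have oO : open O1.
    rewrite openE => z Oz; apply: (@filter_forall _ _ (fun i z => cdom (kappa i) z) (nbhs z)) => i.
    by apply: open_nbhs_nbhs; split; [exact: (cdom_open (P.1 i).1)|exact: Oz].
  have [al [ca al0 alx aO]] := cutoff_at hM Ac Dx oO kx.
  exists al; split => //; first exact: ca.1.
  have cal i : cutoff X (kappa i) al by split; [exact: ca.1|move=> z /aO].
  have /choice[T HT] : forall i, exists T : R, 0 <= T /\ forall v y j, Cinf X v -> csup (kappa i) al y ->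
      `|co (S (cutv (chi i) (B v)) (kappa i) y) j| <= T * nrm v.
    move=> i; have [Ak ck] := P.1 i.
    exact: (chart_smooth hM cM Ak ck HB (csup_compact cM Ak (cal i)) (csup_cimg (cal i)) HS).
  pose q i := Num.sqrt (#|{: J}|%:R * intRn (fun y => cutc (kappa i) al y * cutc (kappa i) al y)).
  exists (\sum_i q i * T i); split.
    by apply: sumr_ge0 => i _; rewrite mulr_ge0 ?sqrtr_ge0//; have [] := HT i.
  move=> v Cv; have CB := so_C HB Cv.
  have CS i : Cinf X (S (cutv (chi i) (B v))).
    by apply: (lo_C LS); have [_ ck] := P.1 i; exact: (Cinf_cutv ck.1 CB).
  rewrite {1}(cutv_partition (B v) P) lo_sum//; last first.
    by move=> i; have [_ ck] := P.1 i; exact: (Cinf_cutv ck.1 CB).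
  have -> : cutv al (\sum_i S (cutv (chi i) (B v))) = \sum_i cutv al (S (cutv (chi i) (B v))).
    by apply/funext => c'; apply/funext => y; rewrite /cutv !fct_sumE scaler_sumr.
  have CA i : Cinf X (cutv al (S (cutv (chi i) (B v)))) by exact: (Cinf_cutv ca.1).
  apply: le_trans (snorm_sum rs si _ CA) _; rewrite mulr_suml; apply: ler_sum => i _.
  have [Ak ck] := P.1 i; have [T0 hT] := HT i.
  have I0 : 0 <= intRn (fun y => cutc (kappa i) al y * cutc (kappa i) al y).
    by apply: intRn_ge0 => y; rewrite -expr2 sqr_ge0.
  suff h2 : nrm (cutv al (S (cutv (chi i) (B v)))) ^+ 2 <= (q i * T i * nrm v) ^+ 2.
    by move: h2; rewrite ler_pXn2r// nnegrE ?snorm_ge0// !mulr_ge0 ?snorm_ge0 ?sqrtr_ge0.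
  rewrite (sqr_snorm si (CA i)) (rin_cutv hM cM Ak (cal i) (CS i) (CA i)) -mulrA exprMn.
  rewrite sqr_sqrtr; last by rewrite mulr_ge0.
  have Tc := test_cutc cM Ak (cal i).
  have dcc : dec (fun y => cutc (kappa i) al y * cutc (kappa i) al y).
    have [cf0 [r' hr']] := test_cs (csup_compact cM Ak (cal i)) Tc.
    apply: cs_dec; split; first exact: continuousMT.
    by exists r' => y hy; rewrite hr'// mul0r.
  have -> : #|{: J}|%:R * intRn (fun y => cutc (kappa i) al y * cutc (kappa i) al y) * (T i * nrm v) ^+ 2 =
     intRn (fun y => (#|{: J}|%:R * (T i * nrm v) ^+ 2) * (cutc (kappa i) al y * cutc (kappa i) al y)).
    by rewrite intRnZ//; ring.
  apply: le_intRn; [exact: (dec_cutoff cM Ak (cal i) (rdensity_rdot (CS i) (CA i)))|exact: decZ|move=> y].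
  set u := S _ (kappa i) y.
  have -> : al (cinv (kappa i) y) * rdot u (cutv al (S (cutv (chi i) (B v))) (kappa i) y) =
     (al (cinv (kappa i) y) * al (cinv (kappa i) y)) * rdot u u.
    by rewrite /cutv rdotC rdotZ; ring.
  have [Ly|nL] := pselect (csup (kappa i) al y); last first.
    rewrite (cutc_eq0 Ak nL) mul0r mulr0.
    have [Iy|nI] := pselect (cimg (kappa i) y); first by rewrite (csup_eq0 Ak Iy nL) !mul0r.
    by rewrite /u (Cinf_out (CS i) nI) rdot0 mulr0.
  have Iy : cimg (kappa i) y := csup_cimg (cal i) Ly.
  rewrite /cutc asboolT// mulrC ler_wpM2r//; first by rewrite -expr2 sqr_ge0.
  rewrite mulr_natl -sumr_const /rdot; apply: ler_sum => j _.
  rewrite -expr2 -real_normK ?num_real// lerXn2r ?nnegrE ?mulr_ge0 ?snorm_ge0//.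
  exact: hT.
pose s z := \sum_i f i z.
have Ss : msmooth X s by apply: msmooth_sum => i; have [] := Hf i.
have s0 z : s z != 0 by rewrite gt_eqF// fpos.
have [G [G0 HG]] := cutv_bounded (msmooth_inv s0 Ss).
have /choice[T HT] : forall i, exists T : R, 0 <= T /\
    forall v, Cinf X v -> nrm (cutv (f i) (S (B v))) <= T * nrm v by move=> i; have [] := Hf i.
exists (\sum_i G * T i); split; first by apply: sumr_ge0 => i _; rewrite mulr_ge0//; have [] := HT i.
move=> v Cv; have CS : Cinf X (S (B v)) := lo_C LS (so_C HB Cv).
have Cf i : Cinf X (cutv (f i) (S (B v))) by apply: Cinf_cutv; [have [] := Hf i|exact: CS].
have -> : S (B v) = \sum_i cutv (fun z => (s z)^-1) (cutv (f i) (S (B v))).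
  apply/funext => c; apply/funext => y; rewrite !fct_sumE /cutv -scaler_sumr -scaler_suml sumK.
  by rewrite scalerA -rmorphM mulVf ?scale1r//; exact: s0.
apply: le_trans (snorm_sum rs si _ _) _.
  by move=> i; apply: Cinf_cutv; [exact: msmooth_inv|exact: Cf].
rewrite mulr_suml; apply: ler_sum => i _; apply: le_trans (HG _ (Cf i)) _.
by rewrite -mulrA ler_wpM2l//; have [_ h] := HT i; exact: h.
Qed.

End Smoothing3.

(** * Resolvents and spectra of symmetric operators *)

Section Spectral.
Variables (R : realType) (d : nat) (M : topologicalType).
Variable X : smooth_structure R d M.
Variable m : nat.
Local Notation chart := (chart R d M).
Local Notation C := R[i].
Local Notation hd := (hdens R d M m).
Local Notation J := ('I_m * bool)%type.
Local Notation rV := 'rV[R]_d.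
Local Notation "t %:K" := ((t : R)%:C)%C (at level 1, format "t %:K").
Local Notation CI := [set v : hd | Cinf X v].
Local Notation rin := (@rin R d M X m).
Local Notation nrm := (snorm rin).
Hypotheses (hM : hausdorff_space M) (cM : compact [set: M]) (d0 : (0 < d)%N).

Let rs := Cinf_subspace X m.
Let si : semi_inner CI rin := @rin_semi_inner R d M X m hM cM.

Lemma fin_max n (P : 'I_n -> nat -> Prop) :
  (forall i, exists N, forall k, (N <= k)%N -> P i k) -> exists N, forall k, (N <= k)%N -> forall i, P i k.
Proof.
move=> /choice[F HF]; exists (\max_i F i) => k hk i; apply: HF; apply: leq_trans hk.
exact: leq_bigmax.
Qed.

Lemma le_eps (a b c : R) : 0 <= c -> (forall eta, 0 < eta -> a <= b + c * eta) -> a <= b.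
Proof.
move=> c0 H; rewrite leNgt; apply/negP => ba.
have c1 : 0 < 2 * (c + 1) by rewrite mulr_gt0// ltr_wpDl.
pose eta := (a - b) / (2 * (c + 1)).
have e0 : 0 < eta by rewrite divr_gt0// subr_gt0.
have := H _ e0; have : (c + 1) * eta = (a - b) / 2 by rewrite /eta; field; rewrite gt_eqF// ltr_wpDl.
rewrite mulrDl mul1r; lra.
Qed.

Lemma half_null (K e : R) : 0 <= K -> 0 < e -> exists k, forall j, (k <= j)%N -> K * 2^-1 ^+ j <= e.
Proof.
move=> K0 e0.
have : K * 2^-1 ^+ k @[k --> \oo] --> (K * 0 : R).
  by apply: cvgM; [exact: cvg_cst|apply: cvg_expr; rewrite ger0_norm ?invr_ge0// invf_lt1 ?ltr1n].
rewrite mulr0 => /cvgrPdist_le/(_ _ e0)[k _ Hk]; exists k => j kj.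
by have := Hk j kj; rewrite sub0r normrN ger0_norm ?mulr_ge0// exprn_ge0// invr_ge0.
Qed.

Definition nul (u : nat -> hd) := forall e : R, 0 < e -> exists N, forall n, (N <= n)%N -> nrm (u n) <= e.

Definition cau (u : nat -> hd) := (forall n, Cinf X (u n)) /\
  forall e : R, 0 < e -> exists N, forall n k, (N <= n)%N -> (N <= k)%N -> nrm (u n - u k) <= e.

Lemma L2nullP u : L2null X u -> nul u.
Proof.
move=> H e e0; have /cvgrPdist_le/(_ _ e0)[N _ HN] := H; exists N => n Nn.
by have := HN n Nn; rewrite sub0r normrN ger0_norm ?sqrtr_ge0.
Qed.

Lemma Hs_cau s u : 0 <= s -> Hs X s u -> cau u.
Proof.
move=> s0 [Cu Hu]; split => // e e0.
have [n [kappa [chi [P _]]]] := partition_exists X hM cM.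
have /choice[K HK] : forall i, exists K : R, 0 <= K /\ forall (s : R) v, 0 <= s -> Cinf X v ->
    nrm (cutv (chi i) v) <= K * Hsnorm s (kappa i) (chi i) v.
  by move=> i; have [Ak ck] := P.1 i; exact: (cutv_le m hM cM Ak ck).
pose S := \sum_i K i.
have S0 : 0 <= S by apply: sumr_ge0 => i _; have [] := HK i.
pose e1 := e / (S + 1); have e10 : 0 < e1 by rewrite divr_gt0// ltr_wpDl.
have [N HN] : exists N, forall k, (N <= k)%N -> forall i, forall j, (k <= j)%N ->
    forall j', (k <= j')%N -> Hsnorm s (kappa i) (chi i) (u j - u j') < e1.
  apply: (@fin_max n (fun i k => forall j, (k <= j)%N -> forall j', (k <= j')%N -> Hsnorm s (kappa i) (chi i) (u j - u j') < e1)) => i.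
  have [Ak ck] := P.1 i; have [N HN] := Hu _ _ Ak ck _ e10.
  exists N => k Nk j kj j' kj'; apply: HN; exact: leq_trans Nk _.
exists N => j j' Nj Nj'; have Cd : Cinf X (u j - u j') := rsB rs (Cu j) (Cu j').
rewrite (cutv_partition (u j - u j') P).
apply: le_trans (snorm_sum rs si _ _) _.
  by move=> i; have [_ ck] := P.1 i; exact: (Cinf_cutv ck.1 Cd).
apply: (@le_trans _ _ (\sum_i K i * e1)).
  apply: ler_sum => i _; have [Ki0 hK] := HK i; apply: le_trans (hK s _ s0 Cd) _.
  by rewrite ler_wpM2l//; apply: ltW; exact: (HN N (leqnn _)).
by rewrite -mulr_suml -/S /e1 mulrCA ler_piMr ?(ltW e0)// ler_pdivrMr ?ltr_wpDl// mul1r lerDl.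
Qed.

Lemma cau_bounded u : cau u -> exists (T : R) N, 0 <= T /\ forall n, (N <= n)%N -> nrm (u n) <= T.
Proof.
move=> [Cu Hu]; have [N HN] := Hu 1 ltr01.
exists (1 + nrm (u N)), N; split=> [|n Nn]; first by rewrite addr_ge0// snorm_ge0.
apply: le_trans (snorm_le_dist rs si (Cu n) (Cu N)) _; rewrite lerD2r; exact: HN.
Qed.

Lemma geom_cauchy (v : nat -> hd) : (forall k, Cinf X (v k)) -> (forall k, nrm (v k) <= 2^-1 ^+ k) ->
  L2 X (fun n => \sum_(i < n) v i).
Proof.
move=> Cv Hv; have CS n : Cinf X (\sum_(i < n) v i) by apply: Cinf_sum => i _; exact: Cv.
split => // e e0; have e4 : 0 < e / 8 by rewrite divr_gt0.
have [k0 Hk0] := half_null ler01 e4.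
have key p : nrm (\sum_(i < k0 + p) v i - \sum_(i < k0) v i) <= 2 * (2^-1 ^+ k0 - 2^-1 ^+ (k0 + p)).
  elim: p => [|p IH]; first by rewrite addn0 !subrr (snorm0 rs si) mulr0.
  rewrite addnS big_ord_recr /= addrAC.
  apply: le_trans (snormD rs si (rsB rs (CS _) (CS _)) (Cv _)) _.
  have := Hv (k0 + p)%N; have -> : (2^-1 : R) ^+ (k0 + p).+1 = 2^-1 * 2^-1 ^+ (k0 + p) by rewrite exprS.
  by move: IH; set a := _ ^+ (k0 + p); lra.
have bd j : (k0 <= j)%N -> nrm (\sum_(i < j) v i - \sum_(i < k0) v i) <= e / 4.
  move=> kj; have := key (j - k0)%N; rewrite subnKC// => h; apply: le_trans h _.
  have := Hk0 k0 (leqnn _); rewrite mul1r; have : 0 <= (2^-1 : R) ^+ j by rewrite exprn_ge0.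
  lra.
exists k0 => j j' kj kj'.
rewrite -[L2norm _ _]/(nrm _).
have -> : \sum_(i < j) v i - \sum_(i < j') v i =
  (\sum_(i < j) v i - \sum_(i < k0) v i) - (\sum_(i < j') v i - \sum_(i < k0) v i).
  by rewrite opprB addrA subrK.
apply: le_lt_trans (snormB rs si (rsB rs (CS _) (CS _)) (rsB rs (CS _) (CS _))) _.
by move: (bd j kj) (bd j' kj'); move: (nrm _) (nrm _) => a b; lra.
Qed.

Section Operator.
Variables (s : R) (D : op R d M m).
Hypotheses (s0 : 0 <= s) (HD : sym_op X D).

(** The first half of [resolvent] at the point 0. For symmetric operators the estimates below are
    drawn from it alone. *)
Definition surj := forall f : nat -> hd, L2 X f -> exists2 u, Hs X s u & L2null X (fun n => D (u n) - f n).

Definition below := exists T : R, 0 <= T /\ forall v, Cinf X v -> nrm v <= T * nrm (D v).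

Definition asurj := forall v eta, Cinf X v -> 0 < eta -> exists z, Cinf X z /\ nrm (D z - v) <= eta.

Lemma surj_asurj : surj -> asurj.
Proof.
move=> HS v eta Cv eta0; have [|u [Cu _] /L2nullP] := HS (fun=> v).
  split => // e e0; exists 0%N => n k _ _; rewrite -[L2norm _ _]/(nrm _) subrr (snorm0 rs si)//.
by move=> /(_ _ eta0)[N HN]; exists (u N); split => //; exact: HN.
Qed.

Definition Pk (k : nat) : set hd := [set v | Cinf X v /\ nrm (D v) <= 2^-1 ^+ k].

Lemma D_sum n (v : nat -> hd) : (forall k, Cinf X (v k)) -> D (\sum_(i < n) v i) = \sum_(i < n) D (v i).
Proof.
move=> Cv; elim: n => [|n IH]; first by rewrite !big_ord0 (so0 HD).
by rewrite !big_ord_recr /= (soD HD) ?IH//; apply: Cinf_sum => i _; exact: Cv.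
Qed.

Lemma DN v : Cinf X v -> D (- v) = - D v.
Proof. by move=> Cv; rewrite -!rcN1 (soZ _ HD). Qed.

Lemma DB v w : Cinf X v -> Cinf X w -> D (v - w) = D v - D w.
Proof. by move=> Cv Cw; rewrite (soD HD) ?DN//; exact: (rsN rs). Qed.

(** Banach-Steinhaus with respect to the seminorm |D v|. The hypothesis on partial sums stands in
    for completeness; it is verified by solving D u = sum of D v_i, a series that converges in
    L^2. *)
Lemma hump_op (I : Type) (q : I -> hd -> R) :
  (forall r u v, Cinf X u -> Cinf X v -> q r (u + v) <= q r u + q r v) ->
  (forall r t v, Cinf X v -> q r (t%:K *: v) = `|t| * q r v) ->
  (forall r, exists K : R, 0 <= K /\ forall v, Cinf X v -> q r v <= K * nrm (D v)) ->
  (forall v : nat -> hd, (forall k, Pk k (v k)) ->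
     exists T, forall r n0, exists n, (n0 <= n)%N /\ q r (\sum_(i < n) v i) <= T) ->
  exists T : R, 0 <= T /\ forall r v, Cinf X v -> q r v <= T * nrm (D v).
Proof.
move=> qD qZ qK lim.
have qN r v : Cinf X v -> q r (- v) = q r v by move=> Cv; rewrite -rcN1 qZ// normrN1 mul1r.
have [] := @hump R hd I CI Pk q (rs0 rs) (rsD rs) (rsN rs) _ _ _ qD qN _ _ lim.
- by move=> k v [].
- move=> k l kl v [Cv h]; split => //; apply: le_trans h _.
  by rewrite ler_wiXn2l// ?invr_ge0// invf_le1 ?ler1n.
- move=> k v [Cv h]; split; first exact: (rsN rs).
  by rewrite DN// (snormN rs si)//; exact: (so_C HD).
- move=> r v Cv; have -> : v + v = 2%:K *: v.
    rewrite (_ : 2%:K = 1 + 1) ?scalerDl ?scale1r//.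
    by apply/eqP; rewrite eq_complex /= addr0 !eqxx.
  by rewrite qZ// ger0_norm.
- move=> r e e0; have [K [K0 HK]] := qK r; have [k Hk] := half_null K0 e0.
  exists k => v [Cv h]; apply: le_trans (HK v Cv) _; apply: le_trans (Hk k (leqnn _)).
  by rewrite ler_wpM2l.
move=> k [T HT].
have p2 : 0 < (2^-1 : R) ^+ k by rewrite exprn_gt0// invr_gt0.
have T0 : 0 <= `|T| / 2^-1 ^+ k by rewrite divr_ge0// ltW.
exists (`|T| / 2^-1 ^+ k); split => // r v Cv; apply: (le_eps T0) => eta eta0.
have n0 : 0 < nrm (D v) + eta by rewrite ltr_wpDl// snorm_ge0.
(* The vector is normalised by |D v| + eta since D v may have norm zero; [le_eps] removes eta. *)
pose t := 2^-1 ^+ k / (nrm (D v) + eta); have t0 : 0 < t by rewrite divr_gt0.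
have := HT r (t%:K *: v); rewrite qZ// gtr0_norm// => h.
have {}h : t * q r v <= T.
  apply: h; split; first exact: (rsZ rs).
  rewrite (soZ _ HD)// (snormZ rs si) ?gtr0_norm//; last exact: (so_C HD).
  by rewrite /t mulrAC ler_pdivrMr// ler_pM2l// lerDl ltW.
rewrite -mulrDr -(@ler_pM2l _ t)//; apply: le_trans h _; apply: le_trans (ler_norm _) _.
rewrite /t le_eqVlt; apply/orP; left; apply/eqP; field.
by rewrite !gt_eqF.
Qed.

(** In the role of the open mapping theorem. The functionals pair v with D z, where |D z| <= 1; by
    symmetry each is bounded by |z| |D v|. A solution u of D u = sum of D v_i differs little from
    the partial sums when paired with D z, which makes the bound uniform in z. *)
Lemma surj_below : surj -> below.
Proof.
move=> HS; pose I := {z : hd | Cinf X z /\ nrm (D z) <= 1}.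
pose q (z : I) (v : hd) := `|rin v (D (sval z))|.
have CD (z : I) : Cinf X (D (sval z)) by apply: (so_C HD); exact: (svalP z).1.
have [] := @hump_op I q.
- by move=> z u v Cu Cv; rewrite /q (siD si Cu Cv (CD z)) ler_normD.
- by move=> z t v Cv; rewrite /q (siZ si _ Cv (CD z)) normrM.
- move=> z; exists (nrm (sval z)); split; first exact: snorm_ge0.
  move=> v Cv; have [Cz _] := svalP z; rewrite /q -(so_sym HD)// mulrC.
  by apply: (si_CS rs si) => //; exact: (so_C HD).
- move=> v Pv; have Cv k : Cinf X (v k) by have [] := Pv k.
  have [|u Hu /L2nullP un] := HS (fun n => \sum_(i < n) D (v i)).
    by apply: (@geom_cauchy (fun k => D (v k))) => k; [exact: (so_C HD)|have [] := Pv k].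
  have Cu := Hu.1; have [T [N [T0 HT]]] := cau_bounded (Hs_cau s0 Hu).
  exists (T + 1) => z n0; have [Cz z1] := svalP z.
  have e0 : 0 < (nrm (sval z) + 1)^-1 by rewrite invr_gt0 ltr_wpDl// snorm_ge0.
  have [N' HN'] := un _ e0; exists (maxn n0 (maxn N N')); split; first exact: leq_maxl.
  set n := maxn _ _.
  have nN : (N <= n)%N by rewrite leq_max leq_max leqnn orbT.
  have nN' : (N' <= n)%N by rewrite leq_max leq_max leqnn !orbT.
  have CS : Cinf X (\sum_(i < n) v i) by apply: Cinf_sum => i _; exact: Cv.
  have CDu := so_C HD (Cu n).
  rewrite /q -(so_sym HD)// D_sum//.
  have CSD : Cinf X (\sum_(i < n) D (v i)) by apply: Cinf_sum => i _; apply: (so_C HD); exact: Cv.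
  have -> : \sum_(i < n) D (v i) = D (u n) - (D (u n) - \sum_(i < n) D (v i)).
    by rewrite opprB addrC subrK.
  have CDB : Cinf X (D (u n) - \sum_(i < n) D (v i)) by exact: (rsB rs).
  rewrite (siB rs si)//; apply: le_trans (ler_normB _ _) _; apply: lerD.
    rewrite (so_sym HD)//; apply: le_trans (si_CS rs si (Cu n) (CD z)) _.
    by apply: le_trans (HT n nN); rewrite ler_piMr ?snorm_ge0.
  apply: le_trans (si_CS rs si CDB Cz) _.
  apply: (@le_trans _ _ ((nrm (sval z) + 1)^-1 * nrm (sval z))).
    by rewrite ler_wpM2r ?snorm_ge0//; exact: HN'.
  by rewrite mulrC ler_pdivrMr ?mul1r ?lerDl// ltr_wpDl// snorm_ge0.
move=> T [T0 HT]; exists T; split => // v Cv.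
have HA := surj_asurj HS.
have [->|vn] := eqVneq (nrm v) 0; first by rewrite mulr_ge0// snorm_ge0.
have vp : 0 < nrm v by rewrite lt_neqAle eq_sym vn snorm_ge0.
rewrite -(ler_pM2r vp); apply: (@le_eps _ _ (nrm v + T * nrm (D v))).
  by rewrite addr_ge0 ?mulr_ge0 ?snorm_ge0.
move=> eta eta0; have [z [Cz hz]] := HA v eta Cv eta0.
have CDz := so_C HD Cz; have CB : Cinf X (D z - v) := rsB rs CDz Cv.
have n0 : 0 < nrm v + eta by rewrite ltr_wpDl// snorm_ge0.
have nz : nrm (D z) <= nrm v + eta.
  by apply: le_trans (snorm_le_dist rs si CDz Cv) _; rewrite addrC lerD2l.
have Cw := rsZ rs (nrm v + eta)^-1 Cz.
have w1 : nrm (D ((nrm v + eta)^-1%:K *: z)) <= 1.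
  by rewrite (soZ _ HD)// (snormZ rs si)// gtr0_norm ?invr_gt0// mulrC ler_pdivrMr// mul1r.
have := HT (exist _ _ (conj Cw w1)) v Cv.
rewrite /q /= (soZ _ HD)// (siZr rs si)// normrM gtr0_norm ?invr_gt0// mulrC ler_pdivrMr// => h1.
have h2 : nrm v ^+ 2 - eta * nrm v <= rin v (D z).
  have -> : rin v (D z) = nrm v ^+ 2 + rin v (D z - v).
    by rewrite (siBr rs si)// (sqr_snorm si)// addrC subrK.
  rewrite lerD2l lerNl; apply: le_trans (ler_norm _) _; rewrite normrN.
  by apply: le_trans (si_CS rs si Cv CB) _; rewrite mulrC ler_wpM2r// snorm_ge0.
have h3 := le_trans (ler_norm _) h1; rewrite expr2 in h2.
move: h2 h3; move: (rin _ _) (nrm v) (nrm (D v)) => p a b h2 h3.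
have -> : T * b * a + (a + T * b) * eta = T * b * (a + eta) + eta * a by ring.
by rewrite -lerBlDr; exact: le_trans h2 h3.
Qed.

Lemma trunc_le_Hs c chi k (v : hd) : atlas X c -> cutoff X c chi -> Cinf X v ->
  snorm (hform X c chi (truncw s k)) v <= Hsnorm s c chi v.
Proof.
move=> Ac cc Cv; rewrite (Hsnorm_hform hM cM Ac cc)// ler_wsqrtr//.
apply: le_intRn; [exact: (dec_wfdot hM cM Ac cc (weight_truncw d s k))|exact: (dec_wfdot hM cM Ac cc (weight_sobw d s))|].
by move=> x; rewrite ler_wpM2r ?fdot_ge0// /truncw ge_min lexx.
Qed.

(** Each truncated Sobolev norm is bounded by the L^2 norm, hence by |D v|. The H^s Cauchy property
    of a solution of D u = sum of D v_i makes this uniform in the truncation. *)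
Lemma Hs_est c chi : atlas X c -> cutoff X c chi -> surj -> below ->
  exists T : R, 0 <= T /\ forall v, Cinf X v -> Hsnorm s c chi v <= T * nrm (D v).
Proof.
move=> Ac cc HS [Tb [Tb0 HTb]].
have sf k := hform_semi_inner m hM cM Ac cc (weight_truncw d s k).
have sh := hform_semi_inner m hM cM Ac cc (weight_sobw d s).
pose K k := Num.sqrt (k%:R * intRn (@wt R d) * (#|{: J}|%:R * fbound c chi ^+ 2)).
have HK k v : Cinf X v -> snorm (hform X c chi (truncw s k)) v <= K k * nrm v.
  exact: (truncw_hform_le hM cM Ac cc).
have K0 k : 0 <= K k by exact: sqrtr_ge0.
have [] := @hump_op nat (fun k v => snorm (hform X c chi (truncw s k)) v).
- by move=> k u v Cu Cv; exact: (snormD rs (sf k)).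
- by move=> k t v Cv; exact: (snormZ rs (sf k)).
- move=> k; exists (K k * Tb); split=> [|v Cv]; first by rewrite mulr_ge0.
  by apply: le_trans (HK k v Cv) _; rewrite -mulrA ler_wpM2l//; exact: HTb.
- move=> v Pv; have Cv k : Cinf X (v k) by have [] := Pv k.
  have [|u Hu /L2nullP un] := HS (fun n => \sum_(i < n) D (v i)).
    by apply: (@geom_cauchy (fun k => D (v k))) => k; [exact: (so_C HD)|have [] := Pv k].
  have [Cu Cau] := Hu; have [N HN] := Cau c chi Ac cc 1 ltr01.
  exists (1 + Hsnorm s c chi (u N) + 1) => k n0.
  have KT0 : 0 < (K k * Tb + 1)^-1 by rewrite invr_gt0 ltr_wpDl// mulr_ge0.
  have [N' HN'] := un _ KT0; exists (maxn n0 (maxn N N')); split; first exact: leq_maxl.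
  set n := maxn _ _.
  have nN : (N <= n)%N by rewrite leq_max leq_max leqnn orbT.
  have nN' : (N' <= n)%N by rewrite leq_max leq_max leqnn !orbT.
  have CS : Cinf X (\sum_(i < n) v i) by apply: Cinf_sum => i _; exact: Cv.
  have CB : Cinf X (u n - \sum_(i < n) v i) := rsB rs (Cu n) CS.
  have -> : \sum_(i < n) v i = u n - (u n - \sum_(i < n) v i) by rewrite opprB addrC subrK.
  apply: le_trans (snormB rs (sf k) (Cu n) CB) _; apply: lerD.
    apply: le_trans (trunc_le_Hs k Ac cc (Cu n)) _.
    rewrite !(Hsnorm_hform hM cM Ac cc)//.
    apply: le_trans (snorm_le_dist rs sh (Cu n) (Cu N)) _; rewrite lerD2r.
    by rewrite -(Hsnorm_hform hM cM Ac cc) ?ltW//; [exact: HN|exact: (rsB rs (Cu n) (Cu N))].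
  apply: le_trans (HK k _ CB) _.
  apply: (@le_trans _ _ (K k * (Tb * (K k * Tb + 1)^-1))).
    rewrite ler_wpM2l//; apply: le_trans (HTb _ CB) _; rewrite ler_wpM2l//.
    by rewrite DB// D_sum//; exact: HN'.
  by rewrite mulrA ler_pdivrMr ?mul1r ?lerDl// -invr_gt0.
move=> T [T0 HT]; exists T; split => // v Cv.
apply: (Hsnorm_le_trunc hM cM Ac cc) => //; first by rewrite mulr_ge0// snorm_ge0.
by move=> k; exact: HT.
Qed.

End Operator.

Definition shift_op (D : op R d M m) (t : R) : op R d M m := fun v => D v - t%:K *: v.

Lemma sym_shift D t : sym_op X D -> sym_op X (shift_op D t).
Proof.
move=> HD; split.
- by move=> v Cv; apply: (rsB rs); [exact: (so_C HD)|exact: (rsZ rs)].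
- move=> a v w Cv Cw; rewrite /shift_op (so_lin HD)// scalerBr !scalerDr opprD !scalerA.
  by rewrite (mulrC t%:K) addrACA.
- move=> v w Cv Cw; have CDv := so_C HD Cv; have CDw := so_C HD Cw.
  have Ctv := rsZ rs t Cv; have Ctw := rsZ rs t Cw.
  by rewrite /shift_op (siB rs si)// (siBr rs si)// (siZ si)// (siZr rs si)// (so_sym HD).
Qed.

Lemma gap_arith (k e a : R) : 0 <= k -> 0 < e -> a <= k * e -> e * (2 * (k + 1)) = a -> False.
Proof.
move=> k0 e0 h E; move: h; rewrite -E; have -> : e * (2 * (k + 1)) = 2 * (k * e) + 2 * e by ring.
have : 0 <= k * e by rewrite mulr_ge0// ltW.
by move: (k * e) => x; lra.
Qed.

(* If t is the infimum of |D v| / |v|, then t or -t is an approximate eigenvalue of D: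
   choose u with |D u| = 1 and |u| close to 1/t, and z with D z close to u; then z is close to
   t^-2 D u, hence z + u / t and z - u / t nearly solve (D - t) y = 0 and (D + t) y = 0. *)
Lemma gap D eps : sym_op X D -> 0 < eps -> (forall t, `|t| < eps -> below (shift_op D t)) ->
  asurj D -> forall v, Cinf X v -> eps * nrm v <= nrm (D v).
Proof.
move=> HD eps0 Hb HA v0 Cv0; rewrite leNgt; apply/negP => lt0.
have v00 : 0 < nrm v0.
  rewrite lt_neqAle snorm_ge0 andbT; apply/negP => /eqP z; move: lt0; rewrite -z mulr0.
  by rewrite ltNge snorm_ge0.
have sh0 v : shift_op D 0 v = D v by rewrite /shift_op (_ : 0%:K = 0)// scale0r subr0.
have [T [T0 HT]] : below D.
  have h00 : `|0 : R| < eps by rewrite normr0.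
  have [T [T0 HT]] := Hb 0 h00.
  by exists T; split => // v Cv; have := HT v Cv; rewrite sh0.
pose E := [set r | exists2 v, Cinf X v /\ nrm v = 1 & r = nrm (D v)].
have nz v : Cinf X v -> 0 < nrm v -> E (nrm (D v) / nrm v).
  move=> Cv vp; exists ((nrm v)^-1%:K *: v).
    by split; [exact: (rsZ rs)|rewrite (snormZ rs si)// gtr0_norm ?invr_gt0// mulVf// gt_eqF].
  rewrite (soZ _ HD)// (snormZ rs si) ?gtr0_norm ?invr_gt0// 1?mulrC//; exact: (so_C HD).
have E0 : E !=set0 by exists (nrm (D v0) / nrm v0); exact: nz.
have Tp : 0 < T.
  rewrite lt_neqAle T0 andbT; apply/eqP => z; have := HT _ Cv0; rewrite -z mul0r.
  by rewrite leNgt v00.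
have lb : lbound E T^-1.
  move=> _ [v [Cv v1] ->]; have := HT v Cv; rewrite v1 => h.
  by rewrite -[leLHS]mul1r ler_pdivrMr// mulrC.
have hE : has_inf E by split => //; exists T^-1.
pose t := inf E.
have tp : 0 < t by apply: lt_le_trans (lb_le_inf E0 lb); rewrite invr_gt0.
have tlt : t < eps.
  apply: le_lt_trans (ge_inf (ex_intro _ _ lb) (nz _ Cv0 v00)) _.
  by rewrite ltr_pdivrMr.
have tD v : Cinf X v -> t * nrm v <= nrm (D v).
  move=> Cv; have [->|vn] := eqVneq (nrm v) 0; first by rewrite mulr0 snorm_ge0.
  have vp : 0 < nrm v by rewrite lt_neqAle eq_sym vn snorm_ge0.
  by rewrite -ler_pdivlMr//; apply: ge_inf; [exists T^-1|exact: nz].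
have [C1 [C10 H1]] : below (shift_op D t) by apply: Hb; rewrite gtr0_norm.
have [C2 [C20 H2]] : below (shift_op D (- t)) by apply: Hb; rewrite normrN gtr0_norm.
pose al := t^-1; have al0 : 0 < al by rewrite invr_gt0.
(* The lower bounds at t and at -t will give al^2 <= (C1 + C2) (1 + t) eta with al = 1/t; eta is
   chosen to contradict this. *)
pose K := (C1 + C2) * (1 + t) + 1; have K0 : 0 < K.
  by rewrite /K ltr_wpDl// mulr_ge0 ?addr_ge0// ltW.
pose eta := al ^+ 2 / (2 * K); have eta0 : 0 < eta by rewrite divr_gt0 ?exprn_gt0 ?mulr_gt0.
have etaE : eta * (2 * K) = al ^+ 2.
  by rewrite /eta divfK// gt_eqF//; apply: mulr_gt0.
(* The coefficients of the error terms in the expansion of |w|^2, which turns out to be at most de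
   Q. *)
pose Q := 4 * al ^+ 3 + al ^+ 2 + 4 * al ^+ 4.
have Q0 : 0 < Q by rewrite /Q !addr_gt0// ?mulr_gt0 ?exprn_gt0.
pose de := Num.min 1 (Num.min eta (eta ^+ 2 / Q)).
have de0 : 0 < de by rewrite !lt_min ltr01 eta0 divr_gt0// exprn_gt0.
have de1 : de <= 1 by rewrite ge_min lexx.
have de2 : de <= eta by rewrite !ge_min lexx orbT.
have de3 : de * Q <= eta ^+ 2.
  by rewrite -ler_pdivlMr// !ge_min lexx !orbT.
clearbody de eta.
have [_ [v [Cv v1] ->] hv] := inf_adherent (mulr_gt0 tp de0) hE.
rewrite -/t in hv.
have CDv := so_C HD Cv.
have Dvp : 0 < nrm (D v) by apply: lt_le_trans (tD v Cv); rewrite v1 mulr1.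
pose u := (nrm (D v))^-1%:K *: v; have Cu : Cinf X u := rsZ rs _ Cv.
have Du1 : nrm (D u) = 1.
  by rewrite /u (soZ _ HD)// (snormZ rs si)// gtr0_norm ?invr_gt0// mulVf// gt_eqF.
have uE : nrm u = (nrm (D v))^-1 by rewrite /u (snormZ rs si)// gtr0_norm ?invr_gt0// v1 mulr1.
have u_le : nrm u <= al by rewrite uE /al lef_pV2 ?posrE//; have := tD v Cv; rewrite v1 mulr1.
have u_ge : al <= nrm u * (1 + de).
  rewrite uE -(ler_pM2l Dvp) mulrA divff ?gt_eqF// mul1r /al -ler_pdivlMr ?invr_gt0// invrK.
  by apply: ltW; have -> : (1 + de) * t = t + t * de by ring.
have [z [Cz hz]] := HA u de Cu de0.
have CDz := so_C HD Cz; have CDu := so_C HD Cu.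
have CB : Cinf X (D z - u) := rsB rs CDz Cu.
have z_le : nrm z <= al * (al + de).
  have := tD z Cz; rewrite mulrC -ler_pdivlMr// => h; apply: le_trans h _.
  rewrite mulrC ler_wpM2l ?(ltW al0)//; apply: le_trans (snorm_le_dist rs si CDz Cu) _.
  by rewrite addrC lerD.
pose w := z - (al ^+ 2)%:K *: D u; have Caw := rsZ rs (al ^+ 2) CDu.
have Cw : Cinf X w := rsB rs Cz Caw.
have zw : rin z (D u) >= nrm u ^+ 2 - de * al.
  have -> : rin z (D u) = nrm u ^+ 2 + rin (D z - u) u.
    by rewrite (siB rs si)// (sqr_snorm si)// (so_sym HD)// addrC subrK.
  rewrite lerD2l lerNl; apply: le_trans (ler_norm _) _; rewrite normrN.
  by apply: le_trans (si_CS rs si CB Cu) _; apply: ler_pM => //; exact: snorm_ge0.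
have w2 : nrm w ^+ 2 <= eta ^+ 2.
  apply: le_trans de3.
  have E1 : nrm w ^+ 2 = nrm z ^+ 2 - 2 * al ^+ 2 * rin z (D u) + al ^+ 4.
    rewrite !(sqr_snorm si)// /w (siB rs si)// !(siBr rs si)// !(siZ si)// !(siZr rs si)//.
    rewrite (siC si CDu Cz) -(sqr_snorm si CDu) Du1; ring.
  have u2 : al ^+ 2 * (1 - 2 * de) <= nrm u ^+ 2.
    have a2 : al ^+ 2 <= (nrm u * (1 + de)) ^+ 2.
      by rewrite lerXn2r ?nnegrE ?(ltW al0)// mulr_ge0 ?snorm_ge0// addr_ge0// ltW.
    have d2 : (1 - 2 * de) * (1 + de) ^+ 2 <= 1.
      have -> : (1 - 2 * de) * (1 + de) ^+ 2 = 1 - (3 * de ^+ 2 + 2 * de ^+ 3) by ring.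
      by rewrite lerBlDr lerDl addr_ge0// mulr_ge0// exprn_ge0// ltW.
    have [h|h] := leP 0 (1 - 2 * de).
      apply: (@le_trans _ _ ((nrm u * (1 + de)) ^+ 2 * (1 - 2 * de))); first by rewrite ler_wpM2r.
      by rewrite exprMn -mulrA ler_piMr ?sqr_ge0// mulrC.
    apply: le_trans (sqr_ge0 _); rewrite mulr_ge0_le0 ?sqr_ge0// ltW//.
  have z2 : nrm z ^+ 2 <= (al * (al + de)) ^+ 2.
    by rewrite lerXn2r ?nnegrE ?snorm_ge0// (le_trans (snorm_ge0 _ _) z_le).
  have a20 : 0 <= al ^+ 2 by exact: sqr_ge0.
  have m1 : al ^+ 2 * (al ^+ 2 * (1 - 2 * de) - de * al) <= al ^+ 2 * rin z (D u).
    by rewrite ler_wpM2l//; apply: le_trans zw; rewrite lerD2r.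
  have dd : al ^+ 2 * de ^+ 2 <= al ^+ 2 * de.
    by rewrite ler_wpM2l// expr2 ler_piMr// ltW.
  rewrite E1 /Q; apply: (@le_trans _ _ ((al * (al + de)) ^+ 2 - 2 * (al ^+ 2 * (al ^+ 2 * (1 - 2 * de) - de * al)) + al ^+ 4)).
    by rewrite lerD2r; apply: lerB => //; rewrite -mulrA ler_pM2l.
  have -> : (al * (al + de)) ^+ 2 - 2 * (al ^+ 2 * (al ^+ 2 * (1 - 2 * de) - de * al)) + al ^+ 4 =
     4 * al ^+ 3 * de + al ^+ 2 * de ^+ 2 + 4 * al ^+ 4 * de by ring.
  have -> : de * (4 * al ^+ 3 + al ^+ 2 + 4 * al ^+ 4) = 4 * al ^+ 3 * de + al ^+ 2 * de + 4 * al ^+ 4 * de by ring.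
  by rewrite lerD2r lerD2l.
have w1 : nrm w <= eta by move: w2; rewrite ler_pXn2r// nnegrE ?snorm_ge0// ltW.
have Cau := rsZ rs al Cu.
pose yp := z + al%:K *: u; pose ym := z - al%:K *: u.
have Cyp : Cinf X yp := rsD rs Cz Cau; have Cym : Cinf X ym := rsB rs Cz Cau.
have Ctw := rsZ rs t Cw.
have aux : t%:K * al%:K = 1 by rewrite -rmorphM /al divff ?gt_eqF.
have aux2 : t%:K * (al ^+ 2)%:K = al%:K by rewrite -rmorphM /al; congr (_%:K); field; rewrite gt_eqF.
have twE : t%:K *: w = t%:K *: z - al%:K *: D u by rewrite /w scalerBr scalerA aux2.
have v1E (a b c e : hd) : (a + b) - (c + e) = (a - e) - (c - b).
  by rewrite opprD opprB [RHS]addrACA [(- c) + (- e)]addrC.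
have v2E (a b c e : hd) : (a - b) + (c - e) = (a - e) + (c - b).
  by rewrite addrACA [RHS]addrACA [(- b) + (- e)]addrC.
have DaE : D (al%:K *: u) = al%:K *: D u := soZ _ HD Cu.
have tauE : t%:K *: (al%:K *: u) = u by rewrite scalerA aux scale1r.
have Ep : shift_op D t yp = (D z - u) - t%:K *: w.
  by rewrite twE -v1E -DaE -{2}tauE -scalerDr -(soD HD Cz Cau).
have Em : shift_op D (- t) ym = (D z - u) + t%:K *: w.
  rewrite twE -v2E -DaE -[X in _ + (_ - X)]tauE -scalerBr -(DB HD Cz Cau).
  by rewrite /shift_op rmorphN scaleNr opprK.
have b1 : nrm yp <= C1 * (eta + t * eta).
  apply: le_trans (H1 _ Cyp) _; rewrite Ep; apply: (ler_wpM2l C10).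
  apply: le_trans (snormB rs si CB Ctw) _; apply: lerD; first exact: le_trans hz de2.
  rewrite (snormZ rs si t Cw) (gtr0_norm tp) (ler_pM2l tp); exact: w1.
have b2 : nrm ym <= C2 * (eta + t * eta).
  apply: le_trans (H2 _ Cym) _; rewrite Em; apply: (ler_wpM2l C20).
  apply: le_trans (snormD rs si CB Ctw) _; apply: lerD; first exact: le_trans hz de2.
  rewrite (snormZ rs si t Cw) (gtr0_norm tp) (ler_pM2l tp); exact: w1.
have := snormB rs si Cyp Cym.
have -> : yp - ym = (2 * al)%:K *: u.
  rewrite /yp /ym opprB addrC addrA subrK -scalerDl; congr (_ *: _).
  by rewrite -rmorphD; congr (_%:K); ring.
rewrite (snormZ rs si (2 * al) Cu) gtr0_norm; last by apply: mulr_gt0.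
move=> b3.
have u3 : al <= 2 * nrm u.
  apply: le_trans u_ge _; rewrite mulrC; apply: ler_wpM2r; first exact: snorm_ge0.
  by rewrite -[leRHS]/(1 + 1) lerD2l; exact: de1.
have b4 : al ^+ 2 <= (C1 + C2) * (1 + t) * eta.
  apply: (@le_trans _ _ (2 * al * nrm u)).
    by rewrite expr2 -mulrA mulrCA ler_wpM2l ?(ltW al0).
  apply: le_trans b3 _; apply: le_trans (lerD b1 b2) _.
  by rewrite le_eqVlt; apply/orP; left; apply/eqP; ring.
have k0 : 0 <= (C1 + C2) * (1 + t).
  apply: mulr_ge0; first exact: addr_ge0.
  by apply: addr_ge0; [exact: ler01|exact: ltW].
exact: (gap_arith k0 eta0 b4 etaE).
Qed.

Lemma resolvent_surj s D x : resolvent X s D x%:K -> surj s (shift_op D x).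
Proof. by move=> [h _]. Qed.

(** If no point of sigma^+ lies within eps of lam, then D - lam - t is surjective for |t| < eps and
    [gap] applies to D - lam. The condition eps <= lam keeps the interval in the positive half-line,
    where absence from sigma^+ means membership in the resolvent set. *)
Lemma spectrum_near s D lam eps v : 0 <= s -> sym_op X D -> 0 < eps -> eps <= lam -> Cinf X v ->
  nrm (D v - lam%:K *: v) < eps * nrm v -> exists x, spectrum_pos X s D x /\ `|lam - x| < eps.
Proof.
move=> s0 HD eps0 el Cv; apply: contraPP => H; apply/negP; rewrite -leNgt.
have res x : `|lam - x| < eps -> resolvent X s D x%:K.
  move=> hx; apply: contrapT => nr; apply: H; exists x; split => //; split => //.
  by move: hx; rewrite ltr_distlC; lra.
apply: (gap (D := shift_op D lam)) => //; first exact: sym_shift.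
  move=> t ht; have HDx := sym_shift (lam + t) HD.
  have [|T [T0 HT]] := surj_below s0 HDx (resolvent_surj (res _ _)).
    by rewrite opprD addrA subrr sub0r normrN.
  exists T; split; first exact: T0.
  move=> w Cw; have := HT w Cw.
  have -> : shift_op D (lam + t) w = shift_op (shift_op D lam) t w.
    by rewrite /shift_op rmorphD scalerDl opprD addrA.
  exact.
apply: (surj_asurj (s := s)); apply: resolvent_surj; apply: res.
by rewrite subrr normr0.
Qed.

End Spectral.

(** * Almost orthonormal smooth approximate eigenvectors of A *)

Section EigenSequences.
Variables (R : realType) (d : nat) (M : topologicalType).
Variable X : smooth_structure R d M.
Variable m : nat.
Local Notation chart := (chart R d M).
Local Notation C := R[i].
Local Notation hd := (hdens R d M m).
Local Notation J := ('I_m * bool)%type.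
Local Notation rV := 'rV[R]_d.
Local Notation "t %:K" := ((t : R)%:C)%C (at level 1, format "t %:K").
Local Notation CI := [set v : hd | Cinf X v].
Local Notation rin := (@rin R d M X m).
Local Notation nrm := (snorm rin).
Hypotheses (hM : hausdorff_space M) (cM : compact [set: M]) (d0 : (0 < d)%N).

Let rs := Cinf_subspace X m.
Let si : semi_inner CI rin := @rin_semi_inner R d M X m hM cM.
Local Notation cau := (@cau R d M X m).
Local Notation nul := (@nul R d M X m).

(** The real inner product of the elements of L^2(M) that two Cauchy sequences represent. *)
Definition glim (U V : nat -> hd) : R := limn (fun n => rin (U n) (V n)).

Lemma cvg_glim U V : cau U -> cau V -> rin (U n) (V n) @[n --> \oo] --> glim U V.
Proof.
move=> hU hV; have [CU HU] := hU; have [CV HV] := hV.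
have [TU [NU [TU0 HTU]]] := cau_bounded hM cM hU.
have [TV [NV [TV0 HTV]]] := cau_bounded hM cM hV.
apply: real_cauchy => e e0; pose de := e / (TU + TV + 1).
have p : 0 < TU + TV + 1 by rewrite ltr_wpDl// addr_ge0.
have de0 : 0 < de by rewrite divr_gt0.
have [N1 H1] := HU de de0; have [N2 H2] := HV de de0.
exists (maxn (maxn NU NV) (maxn N1 N2)) => j k.
rewrite !geq_max => /andP[/andP[j1 j2] /andP[j3 j4]] /andP[/andP[k1 k2] /andP[k3 k4]].
have -> : rin (U j) (V j) - rin (U k) (V k) = rin (U j - U k) (V j) + rin (U k) (V j - V k).
  rewrite (siB rs si (CU j) (CU k) (CV j)) (siBr rs si (CV j) (CV k) (CU k)).
  by move: (rin _ _) (rin _ _) (rin _ _) => a b c; ring.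
apply: le_trans (ler_normD _ _) _.
have b1 := si_CS rs si (rsB rs (CU j) (CU k)) (CV j).
have b2 := si_CS rs si (CU k) (rsB rs (CV j) (CV k)).
have c1 : nrm (U j - U k) * nrm (V j) <= de * TV.
  by apply: ler_pM; rewrite ?snorm_ge0//; [exact: H1|exact: HTV].
have c2 : nrm (U k) * nrm (V j - V k) <= TU * de.
  by apply: ler_pM; rewrite ?snorm_ge0//; [exact: HTU|exact: H2].
apply: (@le_trans _ _ (de * TV + TU * de)).
  by apply: lerD; [exact: le_trans b1 c1|exact: le_trans b2 c2].
have -> : e = de * (TU + TV + 1) by rewrite /de divfK// gt_eqF.
by rewrite mulrDr mulr1 mulrDr (mulrC TU) [de * TV + _]addrC lerDl ltW.
Qed.

Lemma cau_subspace : real_subspace [set U : nat -> hd | cau U].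
Proof.
split.
- split=> [n|e e0]; first exact: (rs0 rs).
  by exists 0%N => n k _ _; rewrite subrr (snorm0 rs si) ltW.
- move=> U V [CU HU] [CV HV]; split=> [n|e e0]; first exact: (rsD rs (CU n) (CV n)).
  have e2 : 0 < e / 2 by rewrite divr_gt0.
  have [N1 H1] := HU _ e2; have [N2 H2] := HV _ e2; exists (maxn N1 N2) => n k.
  rewrite !geq_max => /andP[n1 n2] /andP[k1 k2].
  have -> : (U + V) n - (U + V) k = (U n - U k) + (V n - V k) by rewrite opprD addrACA.
  apply: le_trans (snormD rs si (rsB rs (CU n) (CU k)) (rsB rs (CV n) (CV k))) _.
  by rewrite [leRHS]splitr; apply: lerD; [exact: H1|exact: H2].
- move=> t U [CU HU]; split=> [n|e e0]; first exact: (rsZ rs t (CU n)).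
  have p : 0 < `|t| + 1 by rewrite ltr_wpDl.
  have e2 : 0 < e / (`|t| + 1) by rewrite divr_gt0.
  have [N1 H1] := HU _ e2; exists N1 => n k n1 k1.
  have -> : (t%:K *: U) n - (t%:K *: U) k = t%:K *: (U n - U k) by rewrite scalerBr.
  rewrite (snormZ rs si t (rsB rs (CU n) (CU k))).
  apply: le_trans (ler_wpM2l (normr_ge0 t) (H1 n k n1 k1)) _.
  by rewrite mulrA ler_pdivrMr// mulrC ler_wpM2l ?lerDl// ltW.
Qed.

Lemma glim_semi_inner : semi_inner [set U : nat -> hd | cau U] glim.
Proof.
have g U V : cau U -> cau V -> rin (U n) (V n) @[n --> \oo] --> glim U V by exact: cvg_glim.
split.
- move=> U V [CU _] [CV _]; rewrite /glim.
  have -> : (fun n => rin (U n) (V n)) = (fun n => rin (V n) (U n)) by apply/funext => n; rewrite (siC si (CU n) (CV n)).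
  by [].
- move=> U V W hU hV hW; have [CU _] := hU; have [CV _] := hV; have [CW _] := hW.
  have h := cvgD (g _ _ hU hW) (g _ _ hV hW).
  have E : (fun n => rin ((U + V) n) (W n)) = (fun n => rin (U n) (W n) + rin (V n) (W n)).
    by apply/funext => n; rewrite -(siD si (CU n) (CV n) (CW n)).
  by rewrite {1}/glim E; apply/cvg_lim; [exact: Rhausdorff|exact: h].
- move=> t U V hU hV; have [CU _] := hU; have [CV _] := hV.
  have h := cvgM (@cvg_cst _ t _ \oo _) (g _ _ hU hV).
  have E : (fun n => rin ((t%:K *: U) n) (V n)) = (fun n => t * rin (U n) (V n)).
    by apply/funext => n; rewrite -(siZ si t (CU n) (CV n)).
  by rewrite {1}/glim E; apply/cvg_lim; [exact: Rhausdorff|exact: h].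
- move=> U hU; have [CU _] := hU.
  have h := g _ _ hU hU; apply: (limr_ge (cvgP _ h)); near=> n.
  exact: (si_ge0 si (CU n)).
Unshelve. all: by end_near. Qed.

Lemma glim_near U V e : cau U -> cau V -> 0 < e ->
  exists N, forall n, (N <= n)%N -> `|rin (U n) (V n) - glim U V| <= e.
Proof.
move=> hU hV e0; have /cvgrPdist_le /(_ e e0) [N _ HN] := cvg_glim hU hV.
by exists N => n Nn; rewrite distrC; exact: HN.
Qed.

Section Eigen.
Variables (s : R) (A : op R d M m).
Hypotheses (s0 : 0 <= s) (HA : sym_op X A).
Hypothesis W : forall c chi, atlas X c -> cutoff X c chi ->
  exists T : R, 0 <= T /\ forall v, Cinf X v -> Hsnorm s c chi v <= T * (nrm (A v) + nrm v).

Definition eigs (x : R) : set (nat -> hd) := [set u | Hs X s u /\ nul (fun n => A (u n) - x%:K *: u n)].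

Lemma eigs_cau x u : eigs x u -> cau u.
Proof. by move=> [/(Hs_cau hM cM s0)]. Qed.

Lemma Hs_lin I (t : I -> R) (u : I -> nat -> hd) (r : seq I) : (forall i, Hs X s (u i)) ->
  Hs X s (fun n => \sum_(i <- r) (t i)%:K *: u i n).
Proof.
move=> Hu; have Cu i n : Cinf X (u i n) by have [] := Hu i.
have CS n : Cinf X (\sum_(i <- r) (t i)%:K *: u i n) by apply: Cinf_sum => i _; exact: (rsZ rs (t i) (Cu i n)).
split => // c chi Ac cc e e0; have sh := hform_semi_inner m hM cM Ac cc (weight_sobw d s).
elim: r e e0 {CS} => [|i r IH] e e0.
  exists 0%N => n k _ _; rewrite !big_nil subrr (Hsnorm_hform hM cM Ac cc) ?(snorm0 rs sh)//.
  exact: (rs0 rs).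
have e2 : 0 < e / 2 by rewrite divr_gt0.
have p : 0 < `|t i| + 1 by rewrite ltr_wpDl.
have e3 : 0 < e / 2 / (`|t i| + 1) by rewrite divr_gt0.
have [N1 H1] := IH _ e2; have [_ Hi] := Hu i; have [N2 H2] := Hi c chi Ac cc _ e3.
exists (maxn N1 N2) => n k; rewrite !geq_max => /andP[n1 n2] /andP[k1 k2].
rewrite !big_cons.
have CS n' : Cinf X (\sum_(i <- r) (t i)%:K *: u i n') by apply: Cinf_sum => j _; exact: (rsZ rs (t j) (Cu j n')).
have C1 : Cinf X (u i n - u i k) := rsB rs (Cu i n) (Cu i k).
have C2 := rsB rs (CS n) (CS k).
rewrite opprD addrACA -scalerBr (Hsnorm_hform hM cM Ac cc); last exact: (rsD rs (rsZ rs _ C1) C2).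
apply: le_lt_trans (snormD rs sh (rsZ rs _ C1) C2) _.
rewrite (snormZ rs sh _ C1) -!(Hsnorm_hform hM cM Ac cc)//.
rewrite [ltRHS]splitr; apply: ler_ltD; last exact: H1.
apply: (@le_trans _ _ (`|t i| * (e / 2 / (`|t i| + 1)))).
  by rewrite ler_wpM2l//; apply: ltW; exact: H2.
by rewrite mulrA ler_pdivrMr// mulrC ler_wpM2l ?lerDl// ltW.
Qed.

Lemma nul_lin I (t : I -> R) (u : I -> nat -> hd) (r : seq I) : (forall i n, Cinf X (u i n)) ->
  (forall i, nul (u i)) -> nul (fun n => \sum_(i <- r) (t i)%:K *: u i n).
Proof.
move=> Cu Hu; elim: r => [|i r IH] e e0.
  by exists 0%N => n _; rewrite big_nil (snorm0 rs si) ltW.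
have e2 : 0 < e / 2 by rewrite divr_gt0.
have p : 0 < `|t i| + 1 by rewrite ltr_wpDl.
have e3 : 0 < e / 2 / (`|t i| + 1) by rewrite divr_gt0.
have [N1 H1] := IH _ e2; have [N2 H2] := Hu i _ e3.
exists (maxn N1 N2) => n; rewrite !geq_max => /andP[n1 n2]; rewrite big_cons.
have CS : Cinf X (\sum_(i <- r) (t i)%:K *: u i n) by apply: Cinf_sum => j _; exact: (rsZ rs (t j) (Cu j n)).
apply: le_trans (snormD rs si (rsZ rs _ (Cu i n)) CS) _.
rewrite (snormZ rs si _ (Cu i n)) [leRHS]splitr; apply: lerD; last exact: H1.
apply: (@le_trans _ _ (`|t i| * (e / 2 / (`|t i| + 1)))).
  by rewrite ler_wpM2l//; exact: H2.
by rewrite mulrA ler_pdivrMr// mulrC ler_wpM2l ?lerDl// ltW.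
Qed.

Lemma sym_sum I (t : I -> R) (u : I -> hd) (r : seq I) : (forall i, Cinf X (u i)) ->
  A (\sum_(i <- r) (t i)%:K *: u i) = \sum_(i <- r) (t i)%:K *: A (u i).
Proof.
move=> Cu; elim: r => [|i r IH]; first by rewrite !big_nil (so0 HA).
by rewrite !big_cons (so_lin HA) ?IH//; apply: Cinf_sum => j _; exact: (rsZ rs (t j) (Cu j)).
Qed.

Lemma eigs_lin x I (t : I -> R) (u : I -> nat -> hd) (r : seq I) : (forall i, eigs x (u i)) ->
  eigs x (fun n => \sum_(i <- r) (t i)%:K *: u i n).
Proof.
move=> Hu; have Cu i n : Cinf X (u i n) by have [[]] := Hu i.
split; first by apply: Hs_lin => i; have [] := Hu i.
rewrite (_ : (fun n => _) = fun n => \sum_(i <- r) (t i)%:K *: (A (u i n) - x%:K *: u i n)).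
  apply: nul_lin => [i n|i]; last by have [] := Hu i.
  exact: (rsB rs (so_C HA (Cu i n)) (rsZ rs _ (Cu i n))).
apply/funext => n; rewrite sym_sum// scaler_sumr -sumrB; apply: eq_bigr => i _.
by rewrite scalerBr !scalerA mulrC.
Qed.

Lemma eigs_orth x y u v : eigs x u -> eigs y v -> x != y -> glim u v = 0.
Proof.
move=> Hu Hv xy; have hu := eigs_cau Hu; have hv := eigs_cau Hv.
have [[Cu _] nu] := Hu; have [[Cv _] nv] := Hv.
have [TU [NU [TU0 HTU]]] := cau_bounded hM cM hu.
have [TV [NV [TV0 HTV]]] := cau_bounded hM cM hv.
suff h : `|(x - y) * glim u v| <= 0.
  by move: h; rewrite normr_le0 mulf_eq0 subr_eq0 (negbTE xy) => /eqP.
apply: (@le_eps _ _ _ (`|x - y| + TU + TV)); first by rewrite !addr_ge0.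
move=> e e0; rewrite add0r.
have [N1 H1] := glim_near hu hv e0; have [N2 H2] := nu e e0; have [N3 H3] := nv e e0.
pose n := maxn (maxn NU NV) (maxn N1 (maxn N2 N3)).
have /and5P[n1 n2 n3 n4 n5] : [&& NU <= n, NV <= n, N1 <= n, N2 <= n & N3 <= n]%N.
  by rewrite /n !leq_max !leqnn !orbT.
have E : (x - y) * rin (u n) (v n) = rin (u n) (A (v n) - y%:K *: v n) - rin (A (u n) - x%:K *: u n) (v n).
  rewrite (siBr rs si (so_C HA (Cv n)) (rsZ rs y (Cv n)) (Cu n)) (siB rs si (so_C HA (Cu n)) (rsZ rs x (Cu n)) (Cv n)).
  rewrite (siZr rs si y (Cv n) (Cu n)) (siZ si x (Cu n) (Cv n)) (so_sym HA (Cu n) (Cv n)).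
  by move: (rin _ _) (rin _ _) => a b; ring.
have C1 := rsB rs (so_C HA (Cv n)) (rsZ rs y (Cv n)).
have C2 := rsB rs (so_C HA (Cu n)) (rsZ rs x (Cu n)).
have b1 : `|rin (u n) (A (v n) - y%:K *: v n)| <= TU * e.
  apply: le_trans (si_CS rs si (Cu n) C1) _.
  by apply: ler_pM; rewrite ?snorm_ge0//; [exact: HTU|exact: H3].
have b2 : `|rin (A (u n) - x%:K *: u n) (v n)| <= e * TV.
  apply: le_trans (si_CS rs si C2 (Cv n)) _.
  by apply: ler_pM; rewrite ?snorm_ge0//; [exact: H2|exact: HTV].
have -> : (x - y) * glim u v = (x - y) * rin (u n) (v n) - (x - y) * (rin (u n) (v n) - glim u v).
  by move: (rin _ _) (glim _ _) => a b; ring.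
apply: le_trans (ler_normB _ _) _; rewrite E normrM.
have b3 : `|x - y| * `|rin (u n) (v n) - glim u v| <= `|x - y| * e.
  by rewrite ler_wpM2l//; exact: H1.
have b4 := ler_normB (rin (u n) (A (v n) - y%:K *: v n)) (rin (A (u n) - x%:K *: u n) (v n)).
rewrite !mulrDl -addrA addrC; apply: lerD b3.
by apply: le_trans b4 _; rewrite [TV * e]mulrC; exact: lerD.
Qed.

(** [multiplicity_ge] expresses independence modulo null sequences of H^s, while orthogonalisation
    detects only null sequences of L^2. The estimate [W] bridges the two, because A u is close to x
    u. *)
Lemma eigs_null x u : eigs x u -> glim u u = 0 -> Hsnull X s u.
Proof.
move=> Hu g0; have hu := eigs_cau Hu; have [[Cu _] nu] := Hu.
have nw : nul u.
  move=> e e0; have [N HN] := glim_near hu hu (exprn_gt0 2 e0).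
  exists N => n Nn; have := HN n Nn; rewrite g0 subr0 -(sqr_snorm si (Cu n)) ger0_norm ?sqr_ge0//.
  by rewrite ler_pXn2r// ?nnegrE ?snorm_ge0// ltW.
move=> c chi Ac cc; have [T [T0 HT]] := W Ac cc.
apply/cvgrPdist_le => e e0.
have p : 0 < T * (`|x| + 2) + 1 by rewrite ltr_wpDl// mulr_ge0// addr_ge0.
pose de := e / (T * (`|x| + 2) + 1); have de0 : 0 < de by rewrite divr_gt0.
have [N1 H1] := nu _ de0; have [N2 H2] := nw _ de0.
exists (maxn N1 N2) => // n /=; rewrite geq_max => /andP[n1 n2].
rewrite sub0r normrN ger0_norm ?sqrtr_ge0//; apply: le_trans (HT _ (Cu n)) _.
have b1 : nrm (A (u n)) <= de + `|x| * de.
  apply: le_trans (snorm_le_dist rs si (so_C HA (Cu n)) (rsZ rs x (Cu n))) _.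
  apply: lerD; first exact: H1.
  by rewrite (snormZ rs si x (Cu n)) ler_wpM2l//; exact: H2.
have b2 := H2 n n2.
apply: (@le_trans _ _ (T * (de + `|x| * de + de))).
  by rewrite ler_wpM2l//; exact: lerD.
have -> : T * (de + `|x| * de + de) = de * (T * (`|x| + 2)) by ring.
have -> : e = de * (T * (`|x| + 2) + 1) by rewrite /de divfK// gt_eqF.
by rewrite (ler_wpM2l (ltW de0))// lerDl.
Qed.

Variable lam : nat -> R.
Hypothesis Hlam : positive_eigenvalues X s A lam.

Let orth n (e : nat -> nat -> hd) := (forall i, (i < n)%N -> eigs (lam i) (e i)) /\
  forall i j, (i < n)%N -> (j < n)%N -> glim (e i) (e j) = (i == j)%:R.

(* One Gram-Schmidt step: the eigenspace of [lam n] has dimension larger than the number of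
   earlier vectors in it, and the other earlier vectors are automatically orthogonal to it. *)
Lemma eigen_step n e : orth n e -> exists w, eigs (lam n) w /\ glim w w = 1 /\
  forall i, (i < n)%N -> glim w (e i) = 0.
Proof.
have grs := cau_subspace; have gsi := glim_semi_inner.
move=> [He Oe]; have [lp lh lm] := Hlam; set x := lam n.
have ex : exists p, lam p == x by exists n.
case: (ex_minnP ex) => p /eqP px pmin.
have pn : (p <= n)%N by apply: pmin.
(* With p the first index at which the value x occurs, the indices from p to n all carry it, which
   gives n - p + 1 independent eigenvectors. *)
have [u [Hu Iu]] : multiplicity_ge X s A x (n - p).+1.
  apply/lm; first exact: lp.
  exists (fun a : 'I_(n - p).+1 => (p + a)%N); first by move=> a b /addnI /val_inj.
  move=> a; have an : (p + a <= n)%N by rewrite -leq_subRL// -ltnS.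
  by apply/le_anti; rewrite {1}/x lh//= -px lh// leq_addr.
have Eu a : eigs x (u a) by have [h1 /L2nullP h2] := Hu a; split.
(* One row more than columns, hence a nonzero left kernel: a real combination of the u_a orthogonal
   to the earlier vectors of the same eigenspace. *)
pose G : 'M[R]_((n - p).+1, n - p) := \matrix_(a, b) glim (u a) (e (p + b)%N).
have /rowV0Pn[z /sub_kermxP zG z0] : kermx G != 0.
  by rewrite -mxrank_eq0 mxrank_ker -lt0n subn_gt0 ltnS rank_leq_col.
pose w : nat -> hd := fun k => \sum_a (z 0 a)%:K *: u a k.
have Ew : eigs x w by exact: eigs_lin.
have hw := eigs_cau Ew.
have wE : w = \sum_a (z 0 a)%:K *: u a.
  by apply/funext => k; rewrite fct_sumE.
have cu a : cau (u a) := eigs_cau (Eu a).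
have ow i : (i < n)%N -> glim w (e i) = 0.
  move=> lin; have ce := eigs_cau (He i lin).
  have [ip|pi] := ltnP i p.
    apply: (eigs_orth Ew (He i lin)); apply/negP => /eqP xi.
    by have := pmin i; rewrite -xi eqxx => /(_ isT); rewrite leqNgt ip.
  have ib : (i - p < n - p)%N by rewrite ltn_sub2r// (leq_ltn_trans pi).
  have := congr1 (fun K : 'rV_(n - p) => K 0 (Ordinal ib)) zG; rewrite !mxE => zi.
  rewrite wE (si_suml grs gsi _ (fun a => rsZ grs (z 0 a) (cu a)) ce).
  rewrite -[RHS]zi; apply: eq_bigr => a _; rewrite (siZ gsi _ (cu a) ce) mxE /= subnKC//.
have gw : 0 < glim w w.
  rewrite lt_neqAle (si_ge0 gsi hw) andbT; apply/negP => /eqP gw0.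
  have := Iu (fun a => (z 0 a)%:K) (eigs_null Ew (esym gw0)) => zz.
  move/negP: z0; apply; apply/eqP/rowP => a; rewrite mxE.
  by have [] := zz a.
pose t := (Num.sqrt (glim w w))^-1.
have E2 : eigs x (fun k => \sum_(i : 'I_1) t%:K *: w k) by exact: (@eigs_lin x 'I_1 (fun=> t) (fun=> w)).
have E2' : (fun k => \sum_(i : 'I_1) t%:K *: w k) = t%:K *: w by apply/funext => k; rewrite big_ord1.
rewrite E2' in E2.
exists (t%:K *: w); split; [exact: E2|split].
  rewrite (siZ gsi _ hw (rsZ grs t hw)) (siZr grs gsi t hw hw) mulrA -expr2 exprVn sqr_sqrtr ?ltW// mulVf// gt_eqF//.
by move=> i lin; rewrite (siZ gsi _ hw (eigs_cau (He i lin))) ow// mulr0.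
Qed.

Lemma eigen_basis n : exists e, orth n e.
Proof.
elim: n => [|n [e He]]; first by exists (fun _ _ => 0).
have [w [Ew [gw ow]]] := eigen_step He; have [He1 He2] := He.
have gsi := glim_semi_inner.
exists (fun i => if (i < n)%N then e i else w).
split=> [i|i j]; rewrite ltnS leq_eqVlt.
  by case/orP => [/eqP->|lin]; [rewrite ltnn; exact: Ew|rewrite lin; exact: (He1 i lin)].
rewrite [(j < _)%N]ltnS [(j <= _)%N]leq_eqVlt => /orP[/eqP->|li] /orP[/eqP->|lj].
- by rewrite ltnn eqxx gw.
- by rewrite ltnn lj (ow j lj) gtn_eqF.
- by rewrite ltnn li (siC gsi (eigs_cau (He1 _ li)) (eigs_cau Ew)) (ow i li) ltn_eqF.
- by rewrite li lj (He2 i j li lj).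
Qed.

(** The orthonormal eigenvectors are sequences of smooth columns; a far common index gives columns
    with the same properties up to eps. *)
Lemma eigen_approx n eps : 0 < eps -> exists e : 'I_n -> hd, (forall i, Cinf X (e i)) /\
  (forall i j, `|rin (e i) (e j) - (i == j)%:R| <= eps) /\
  forall i, nrm (A (e i) - (lam i)%:K *: e i) <= eps.
Proof.
move=> eps0; have [e [He Oe]] := eigen_basis n.
have [|N1 H1] := @fin_max n (fun i k => nrm (A (e i k) - (lam i)%:K *: e i k) <= eps).
  by move=> i; have [_ /(_ eps eps0)] := He i (ltn_ord i).
have [|N2 H2] := @fin_max n (fun i k => forall j : 'I_n, `|rin (e i k) (e j k) - (i == j)%:R| <= eps).
  move=> i; apply: (@fin_max n (fun j k => `|rin (e i k) (e j k) - (i == j)%:R| <= eps)) => j.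
  have [N HN] := glim_near (eigs_cau (He i (ltn_ord i))) (eigs_cau (He j (ltn_ord j))) eps0.
  by exists N => k Nk; have := HN k Nk; rewrite (Oe i j (ltn_ord i) (ltn_ord j)).
exists (fun i => e i (maxn N1 N2)); split=> [i|]; first by have [[]] := He i (ltn_ord i).
split=> [i j|i]; first by apply: H2; exact: leq_maxr.
by apply: H1; exact: leq_maxl.
Qed.

End Eigen.
End EigenSequences.

(** * A crude Weyl bound *)

Section Weyl.
Variables (R : realType) (d : nat) (M : topologicalType).
Variable X : smooth_structure R d M.
Variable m : nat.
Local Notation chart := (chart R d M).
Local Notation C := R[i].
Local Notation hd := (hdens R d M m).
Local Notation J := ('I_m * bool)%type.
Local Notation rV := 'rV[R]_d.
Local Notation "t %:K" := ((t : R)%:C)%C (at level 1, format "t %:K").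
Local Notation CI := [set v : hd | Cinf X v].
Local Notation rin := (@rin R d M X m).
Local Notation nrm := (snorm rin).
Hypotheses (hM : hausdorff_space M) (cM : compact [set: M]) (d0 : (0 < d)%N).

Let rs := Cinf_subspace X m.
Let si : semi_inner CI rin := @rin_semi_inner R d M X m hM cM.

Lemma sqr_sum_le n (x : 'I_n -> R) : (\sum_i x i) ^+ 2 <= n%:R * \sum_i x i ^+ 2.
Proof.
rewrite expr2 mulr_suml.
apply: (@le_trans _ _ (\sum_i \sum_j (x i ^+ 2 / 2 + x j ^+ 2 / 2))).
  apply: ler_sum => i _; rewrite mulr_sumr; apply: ler_sum => j _.
  by have := sqr_ge0 (x i - x j); move: (x i) (x j) => a b; nra.
have -> : \sum_i \sum_j (x i ^+ 2 / 2 + x j ^+ 2 / 2) = \sum_i (n%:R * (x i ^+ 2 / 2) + (\sum_j x j ^+ 2) / 2).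
  by apply: eq_bigr => i _; rewrite big_split /= sumr_const card_ord mulr_suml [n%:R * _]mulr_natl.
rewrite big_split /= sumr_const card_ord -mulr_sumr -mulr_suml -(mulr_natl (_ / 2)).
by rewrite -mulrDr -splitr.
Qed.

Lemma sum_delta n (a : 'I_n -> R) : \sum_i \sum_j a i * a j * (i == j)%:R = \sum_i a i ^+ 2.
Proof.
apply: eq_bigr => i _; rewrite (bigD1 i)//= eqxx mulr1 -expr2 big1 ?addr0// => j ji.
by rewrite eq_sym (negbTE ji) mulr0.
Qed.

(** The tolerance 1 / (2n) keeps the off-diagonal part of the Gram form below half of its diagonal
    part, by Cauchy-Schwarz over n terms; this costs the factor 2. *)
Lemma bessel n (e : 'I_n -> hd) f : (forall i, Cinf X (e i)) -> Cinf X f ->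
  (forall i j, `|rin (e i) (e j) - (i == j)%:R| <= (2 * n%:R)^-1) ->
  \sum_i rin f (e i) ^+ 2 <= 2 * nrm f ^+ 2.
Proof.
have aux (x y z : R) : 0 <= y - z - (z - x) -> x <= z + z / 2 -> z <= 2 * y by lra.
move=> Ce Cf He; pose a i := rin f (e i); rewrite -/a.
set S := \sum_i _; have CZ i : Cinf X ((a i)%:K *: e i) := rsZ rs (a i) (Ce i).
pose w : hd := \sum_i (a i)%:K *: e i.
have Cw : Cinf X w by apply: Cinf_sum => i _; exact: CZ.
have fw : rin f w = S.
  rewrite (si_sumr rs si _ CZ Cf); apply: eq_bigr => i _.
  by rewrite (siZr rs si _ (Ce i) Cf) -/(a i) expr2.
have ww : rin w w = \sum_i \sum_j a i * a j * rin (e i) (e j).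
  rewrite {1}/w (si_suml rs si _ CZ Cw); apply: eq_bigr => i _.
  rewrite (siZ si _ (Ce i) Cw) (si_sumr rs si _ CZ (Ce i)) mulr_sumr; apply: eq_bigr => j _.
  by rewrite (siZr rs si _ (Ce j) (Ce i)) mulrA.
have wS : rin w w <= S + S / 2.
  rewrite ww.
  apply: (@le_trans _ _ (\sum_i \sum_j (a i * a j * (i == j)%:R + `|a i| * `|a j| * (2 * n%:R)^-1))).
    apply: ler_sum => i _; apply: ler_sum => j _.
    rewrite -lerBlDl -mulrBr; apply: le_trans (ler_norm _) _; rewrite !normrM.
    by rewrite ler_wpM2l ?mulr_ge0.
  under eq_bigr do rewrite big_split /=.
  rewrite big_split /= sum_delta lerD2l.
  under eq_bigr do rewrite -mulr_suml -mulr_sumr.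
  rewrite -mulr_suml -mulr_suml -expr2.
  have [n0|n0] := posnP n.
    have -> : (2 * n%:R)^-1 = 0 :> R by rewrite n0 mulr0 invr0.
    by rewrite mulr0 mulr_ge0 ?invr_ge0//; apply: sumr_ge0 => i _; exact: sqr_ge0.
  have np : 0 < n%:R :> R by rewrite ltr0n.
  rewrite (_ : S / 2 = n%:R * S * (2 * n%:R)^-1); last by field; rewrite gt_eqF.
  rewrite ler_wpM2r ?invr_ge0 ?mulr_ge0 ?(ltW np)//; apply: le_trans (sqr_sum_le _) _.
  rewrite ler_wpM2l ?(ltW np)//; by apply: ler_sum => i _; rewrite real_normK ?num_real.
have := si_ge0 si (rsB rs Cf Cw).
rewrite (siB rs si Cf Cw (rsB rs Cf Cw)) (siBr rs si Cf Cw Cf) (siBr rs si Cf Cw Cw).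
rewrite (siC si Cw Cf) fw (sqr_snorm si Cf).
by move=> h; exact: aux h wS.
Qed.

(** The exponent q is at least d/s. Where the Sobolev weight is below rho, 1 / [wt] is at most (1 +
    |x|^2)^d and hence at most rho^q; elsewhere the second term is at least 1. *)
Lemma weight_split (s : R) : 0 < s -> exists q : nat, forall (rho : R) (x : rV), 1 <= rho ->
  1 <= rho ^+ q * wt x + rho^-1 * sobw s x.
Proof.
move=> s0; pose q := Num.bound (d%:R / s); exists q => rho x r1.
have rp : 0 < rho := lt_le_trans ltr01 r1.
have hq : d%:R <= s * q%:R.
  by rewrite mulrC -ler_pdivrMr// ltW// archi_boundP// divr_ge0// ltW.
have w0 : 0 <= sobw s x := sobw_ge0 s x.
have wx := wt_gt0 x.
have [h|h] := leP rho (sobw s x).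
  rewrite -[leLHS]add0r; apply: lerD; first by rewrite mulr_ge0 ?exprn_ge0 ?ltW.
  by rewrite ler_pdivlMl// mulr1.
rewrite -[leLHS]addr0; apply: lerD; last by rewrite mulr_ge0// invr_ge0 ltW.
rewrite -ler_pdivrMr// mul1r; apply: le_trans (wt_le_dot1 x) _.
have y0 := dot1_gt0 x; have y1 : 1 <= 1 + dot x x by rewrite lerDl dot_ge0.
rewrite -powR_mulrn ?(ltW y0)//; apply: le_trans (ler_powR y1 hq) _.
rewrite powRrM powR_mulrn ?powR_ge0//; by apply: lerXn2r; rewrite ?nnegrE ?(ltW rp) ?(ltW h) ?powR_ge0.
Qed.

Lemma weight_wt : weight (@wt R d).
Proof.
split; [exact: continuous_wt|by move=> x; exact: ltW (wt_gt0 x)|exists 0%N, 1; split => // x].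
by rewrite expr0 invr1 mul1r; exact: wt_le1.
Qed.

(** At a fixed frequency the sum over i is bounded independently of n, by Bessel's inequality for
    the wave [fvec]; the weight [wt] makes this bound integrable over the frequencies. *)
Lemma local_weyl (s : R) c chi : 0 < s -> atlas X c -> cutoff X c chi ->
  exists (q : nat) (K : R), 0 <= K /\ forall (rho : R) n (e : 'I_n -> hd), 1 <= rho ->
  (forall i, Cinf X (e i)) ->
  (forall i j, `|rin (e i) (e j) - (i == j)%:R| <= (2 * n%:R)^-1) ->
  \sum_i Hsnorm 0 c chi (e i) ^+ 2 <= rho ^+ q * K + rho^-1 * \sum_i Hsnorm s c chi (e i) ^+ 2.
Proof.
move=> s0 Ac cc; have [q Hq] := weight_split s0.
have dw : dec (@wt R d) by split; [exact: continuous_wt|exists 1 => x; rewrite mul1r ger0_norm// ltW// wt_gt0].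
pose b := #|{: J}|%:R * (2 * fbound c chi ^+ 2) : R.
have b0 : 0 <= b by rewrite !mulr_ge0// sqr_ge0.
exists q, (intRn (fun x : rV => b * wt x)); split.
  by apply: intRn_ge0 => x; rewrite mulr_ge0// ltW// wt_gt0.
move=> rho n e r1 Ce He; have rp : 0 < rho := lt_le_trans ltr01 r1.
have H w : weight w -> forall i, dec (fun x => w x * fdot X c chi (e i) (e i) x).
  by move=> Hw i; exact: (dec_wfdot hM cM Ac cc Hw (Ce i) (Ce i)).
have sq w i : weight w -> snorm (hform X c chi w) (e i) ^+ 2 = intRn (fun x => w x * fdot X c chi (e i) (e i) x).
  by move=> Hw; rewrite (sqr_snorm (hform_semi_inner m hM cM Ac cc Hw) (Ce i)).
apply: (@le_trans _ _ (\sum_i (rho ^+ q * intRn (fun x => wt x * fdot X c chi (e i) (e i) x) + rho^-1 * Hsnorm s c chi (e i) ^+ 2))).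
  apply: ler_sum => i _; rewrite !(Hsnorm_hform hM cM Ac cc _ (Ce i)) !sq; [|exact: weight_sobw..].
  have D1 := H _ weight_wt i; have D2 := H _ (weight_sobw d s) i.
  rewrite -(intRnZ _ D1) -(intRnZ _ D2) -(intRnD (decZ _ D1) (decZ _ D2)).
  apply: le_intRn; [exact: (H _ (weight_sobw d 0) i)|exact: (decD (decZ _ D1) (decZ _ D2))|].
  move=> x; rewrite /sobw powRr0 !mulrA -mulrDl ler_wpM2r ?fdot_ge0//; exact: Hq.
rewrite big_split /= -!mulr_sumr lerD2r ler_wpM2l ?exprn_ge0 ?(ltW rp)//.
rewrite -intRn_sum; last by move=> i _; exact: H _ weight_wt i.
apply: le_intRn; [by apply: dec_sum => i _; exact: H _ weight_wt i|exact: decZ|].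
move=> x; rewrite -mulr_sumr mulrC ler_wpM2r ?(ltW (wt_gt0 x))//.
rewrite exchange_big /=.
apply: (@le_trans _ _ (\sum_(j : J) (2 * fbound c chi ^+ 2))).
  apply: ler_sum => j _; have CF := Cinf_fvec hM cM Ac cc x j.
  apply: le_trans (bessel Ce CF He) _; rewrite ler_wpM2l//.
  by rewrite ler_pXn2r ?nnegrE ?snorm_ge0 ?fbound_ge0//; exact: (fvec_le hM cM Ac cc x j).
by rewrite sumr_const /b (mulr_natl (2 * _)) lexx.
Qed.

(* Bessel's inequality bounds the low frequencies of an almost orthonormal family and the
   Sobolev norm bounds the high ones; rho balances the two. *)
Lemma weyl_bound (s : R) (A : op R d M m) : 0 < s ->
  (forall c chi, atlas X c -> cutoff X c chi ->
    exists T : R, 0 <= T /\ forall v, Cinf X v -> Hsnorm s c chi v <= T * (nrm (A v) + nrm v)) ->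
  exists (K : R) (q : nat), 0 <= K /\ forall (L : R) n (e : 'I_n -> hd), 0 <= L ->
  (forall i, Cinf X (e i)) ->
  (forall i j, `|rin (e i) (e j) - (i == j)%:R| <= (2 * n%:R)^-1) ->
  (forall i, nrm (A (e i)) <= L) -> n%:R <= K * (L + 2) ^+ q.
Proof.
move=> s0 W; have [nb [kappa [chi [PU _]]]] := partition_exists X hM cM.
have [Hkc _] := PU.
have aux1 (z : R) : 0 <= z -> 1 <= 4 * (z + 1) by lra.
have aux2 (z x y : R) : z / 2 <= x + y -> y <= z / 4 -> z <= 4 * x by lra.
have aux3 (z : R) : 0 <= z -> 1 <= z + 2 by lra.
have /choice[F HF] : forall b, exists t : nat * R * (R * R), [/\ 0 <= t.1.2, 0 <= t.2.1, 0 <= t.2.2,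
    (forall v, Cinf X v -> nrm (cutv (chi b) v) <= t.2.1 * Hsnorm 0 (kappa b) (chi b) v) /\
    (forall v, Cinf X v -> Hsnorm s (kappa b) (chi b) v <= t.2.2 * (nrm (A v) + nrm v)) &
    forall (rho : R) n (e : 'I_n -> hd), 1 <= rho -> (forall i, Cinf X (e i)) ->
  (forall i j, `|rin (e i) (e j) - (i == j)%:R| <= (2 * n%:R)^-1) ->
  \sum_i Hsnorm 0 (kappa b) (chi b) (e i) ^+ 2 <= rho ^+ t.1.1 * t.1.2 + rho^-1 * \sum_i Hsnorm s (kappa b) (chi b) (e i) ^+ 2].
  move=> b; have [Ak ck] := Hkc b.
  have [K1 [K10 HK1]] := cutv_le m hM cM Ak ck.
  have [T [T0 HT]] := W _ _ Ak ck.
  have [q [K [K0 HK]]] := local_weyl s0 Ak ck.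
  by exists ((q, K), (K1, T)); split => //; split => // v Cv; exact: HK1.
pose Q := (\sum_b (F b).1.1)%N.
pose g b := nb%:R * (F b).2.1 ^+ 2 : R.
pose G := \sum_b g b * ((F b).1.2 + (F b).2.2 ^+ 2).
have g0 b : 0 <= g b by rewrite mulr_ge0// sqr_ge0.
have G0 : 0 <= G by apply: sumr_ge0 => b _; have [h1 _ _ _ _] := HF b; rewrite mulr_ge0// addr_ge0// sqr_ge0.
exists (4 * G * (4 * (G + 1)) ^+ Q), (2 * Q)%N; split.
  by rewrite !mulr_ge0// exprn_ge0// mulr_ge0// addr_ge0.
(* With this rho the high frequency contribution is at most n/4, while the sum of the squared norms
   is at least n/2. *)
move=> L n e L0 Ce He HA; pose rho := 4 * (G + 1) * (L + 2) ^+ 2.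
have l2 : 1 <= (L + 2) ^+ 2 by rewrite expr_ge1 ?addr_ge0//; exact: aux3.
have r1 : 1 <= rho.
  by rewrite /rho -[leLHS]mulr1; apply: ler_pM; [exact: ler01|exact: ler01|exact: aux1|exact: l2].
have rp : 0 < rho := lt_le_trans ltr01 r1.
have [n0|n0] := posnP n.
  have G1 : 0 <= 4 * (G + 1) by rewrite mulr_ge0// addr_ge0.
  have L2 : 0 <= L + 2 by rewrite addr_ge0.
  by rewrite n0 mulr_ge0 ?exprn_ge0// mulr_ge0 ?exprn_ge0// mulr_ge0.
have np : 0 < n%:R :> R by rewrite ltr0n.
have n1 : (2 * n%:R)^-1 <= 2^-1 :> R.
  by rewrite lef_pV2 ?posrE ?mulr_gt0// -[leLHS]mulr1 ler_pM2l// ler1n.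
have hh i : 2^-1 <= nrm (e i) ^+ 2 <= 4.
  have := le_trans (He i i) n1; rewrite eqxx (sqr_snorm si (Ce i)).
  by rewrite mulr1n ler_distl => /andP[]; move: (rin _ _) => z z1 z2; apply/andP; split; lra.
have n2 i : nrm (e i) <= 2.
  have /andP[_] := hh i; rewrite (_ : 4 = 2 ^+ 2); last by rewrite -natrX.
  by rewrite ler_pXn2r ?nnegrE ?snorm_ge0.
have up : n%:R / 2 <= \sum_i nrm (e i) ^+ 2.
  rewrite -[n in n%:R]card_ord mulr_natl -sumr_const; apply: ler_sum => i _.
  by have /andP[] := hh i.
have lo : \sum_i nrm (e i) ^+ 2 <= \sum_b g b * \sum_i Hsnorm 0 (kappa b) (chi b) (e i) ^+ 2.
  under [leRHS]eq_bigr do rewrite mulr_sumr.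
  rewrite exchange_big /=; apply: ler_sum => i _.
  have h : nrm (e i) <= \sum_b (F b).2.1 * Hsnorm 0 (kappa b) (chi b) (e i).
    have CC b : Cinf X (cutv (chi b) (e i)).
      by apply: (Cinf_cutv _ (Ce i)); have [_ []] := Hkc b.
    rewrite {1}(cutv_partition (e i) PU); apply: le_trans (snorm_sum rs si _ CC) _.
    (* The factor [nb] contained in g comes next, from Cauchy-Schwarz over the charts of the
       partition. *)
    by apply: ler_sum => b _; have [_ _ _ [h _] _] := HF b; exact: h.
  apply: (@le_trans _ _ ((\sum_b (F b).2.1 * Hsnorm 0 (kappa b) (chi b) (e i)) ^+ 2)).
    rewrite ler_pXn2r ?nnegrE ?snorm_ge0//; exact: le_trans (snorm_ge0 _ _) h.
  apply: le_trans (sqr_sum_le _) _; rewrite mulr_sumr; apply: ler_sum => b _.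
  by rewrite /g exprMn mulrA.
have b1 b : g b * \sum_i Hsnorm 0 (kappa b) (chi b) (e i) ^+ 2 <=
    (rho ^+ Q + rho^-1 * (n%:R * (L + 2) ^+ 2)) * (g b * ((F b).1.2 + (F b).2.2 ^+ 2)).
  have [k0 _ t0 [_ HT] HS] := HF b.
  rewrite [leRHS]mulrCA ler_wpM2l//; apply: le_trans (HS rho n e r1 Ce He) _.
  have h1 : rho ^+ (F b).1.1 <= rho ^+ Q by rewrite ler_weXn2l// /Q (bigD1 b)//= leq_addr.
  have h2 : \sum_i Hsnorm s (kappa b) (chi b) (e i) ^+ 2 <= n%:R * (L + 2) ^+ 2 * (F b).2.2 ^+ 2.
    rewrite -mulrA -exprMn -[n in n%:R]card_ord mulr_natl -sumr_const; apply: ler_sum => i _.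
    have h3 : Hsnorm s (kappa b) (chi b) (e i) <= (L + 2) * (F b).2.2.
      apply: le_trans (HT _ (Ce i)) _; rewrite mulrC ler_wpM2r//; exact: lerD (HA i) (n2 i).
    by rewrite ler_pXn2r ?nnegrE ?sqrtr_ge0// mulr_ge0// addr_ge0.
  have ri : 0 <= rho^-1 by rewrite invr_ge0 ltW.
  have a1 : rho ^+ (F b).1.1 * (F b).1.2 <= rho ^+ Q * (F b).1.2 by rewrite ler_wpM2r.
  have a2 := ler_wpM2l ri h2.
  have a3 : 0 <= rho^-1 * (n%:R * (L + 2) ^+ 2) * (F b).1.2.
    by rewrite mulr_ge0// mulr_ge0// mulr_ge0// sqr_ge0.
  have a4 : 0 <= rho ^+ Q * (F b).2.2 ^+ 2 by rewrite mulr_ge0 ?exprn_ge0 ?sqr_ge0// ltW.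
  rewrite mulrDl !mulrDr; apply: lerD.
    by apply: le_trans a1 _; rewrite lerDl.
  by rewrite -!mulrA in a2 a3 *; apply: le_trans a2 _; rewrite lerDr.
have key : n%:R / 2 <= (rho ^+ Q + rho^-1 * (n%:R * (L + 2) ^+ 2)) * G.
  apply: le_trans up (le_trans lo _); rewrite /G mulr_sumr; apply: ler_sum => b _; exact: b1.
have fin : rho^-1 * (n%:R * (L + 2) ^+ 2) * G <= n%:R / 4.
  rewrite -mulrA ler_pdivrMl// /rho.
  have -> : 4 * (G + 1) * (L + 2) ^+ 2 * (n%:R / 4) = n%:R * (L + 2) ^+ 2 * (G + 1) by field.
  by rewrite ler_wpM2l ?lerDl// mulr_ge0// sqr_ge0.
have -> : 4 * G * (4 * (G + 1)) ^+ Q * (L + 2) ^+ (2 * Q) = 4 * (rho ^+ Q * G).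
  by rewrite /rho [X in _ = 4 * (X * _)]exprMn -exprM; move: (_ ^+ Q) (_ ^+ (2 * Q)) => a b; ring.
by rewrite mulrDl in key; exact: (aux2 _ _ _ key fin).
Qed.

End Weyl.

(** * Bounded operators and operators that stay bounded after powers of A *)

Section Operators.
Variables (R : realType) (d : nat) (M : topologicalType).
Variable X : smooth_structure R d M.
Variable m : nat.
Local Notation chart := (chart R d M).
Local Notation C := R[i].
Local Notation hd := (hdens R d M m).
Local Notation J := ('I_m * bool)%type.
Local Notation rV := 'rV[R]_d.
Local Notation "t %:K" := ((t : R)%:C)%C (at level 1, format "t %:K").
Local Notation CI := [set v : hd | Cinf X v].
Local Notation rin := (@rin R d M X m).
Local Notation nrm := (snorm rin).
Hypotheses (hM : hausdorff_space M) (cM : compact [set: M]) (d0 : (0 < d)%N).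

Let rs := Cinf_subspace X m.
Let si : semi_inner CI rin := @rin_semi_inner R d M X m hM cM.
Local Notation lin_op := (@lin_op R d M X m).

Lemma loB S v w : lin_op S -> Cinf X v -> Cinf X w -> S (v - w) = S v - S w.
Proof. by move=> HS Cv Cw; rewrite addrC -scaleN1r (lo_lin HS)// scaleN1r addrC. Qed.

Lemma lin_id : lin_op (id : op R d M m). Proof. by split. Qed.

Lemma lin_comp U V : lin_op U -> lin_op V -> lin_op (fun v => U (V v)).
Proof.
move=> HU HV; split=> [v Cv|z v w Cv Cw]; first exact: (lo_C HU (lo_C HV Cv)).
by rewrite (lo_lin HV)// (lo_lin HU)//; exact: (lo_C HV).
Qed.

Lemma linB U V : lin_op U -> lin_op V -> lin_op (fun v => U v - V v).
Proof.
move=> HU HV; split=> [v Cv|z v w Cv Cw]; first exact: (rsB rs (lo_C HU Cv) (lo_C HV Cv)).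
by rewrite (lo_lin HV)// (lo_lin HU)// scalerBr opprD addrACA.
Qed.

Lemma linD U V : lin_op U -> lin_op V -> lin_op (fun v => U v + V v).
Proof.
move=> HU HV; split=> [v Cv|z v w Cv Cw]; first exact: (rsD rs (lo_C HU Cv) (lo_C HV Cv)).
by rewrite (lo_lin HV)// (lo_lin HU)// scalerDr addrACA.
Qed.

Lemma lin_sum (I : finType) (Q : pred I) (V : I -> op R d M m) : (forall i, Q i -> lin_op (V i)) ->
  lin_op (fun v => \sum_(i | Q i) V i v).
Proof.
move=> HV; split=> [v Cv|z v w Cv Cw]; first by apply: Cinf_sum => i Qi; exact: (lo_C (HV i Qi) Cv).
by rewrite scaler_sumr -big_split; apply: eq_bigr => i Qi; rewrite (lo_lin (HV i Qi)).
Qed.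

Definition bd (F : op R d M m) := exists T : R, 0 <= T /\ forall v, Cinf X v -> nrm (F v) <= T * nrm v.

Lemma bd_id : bd id.
Proof. by exists 1; split => // v _; rewrite mul1r. Qed.

Lemma bdD F G : (forall v, Cinf X v -> Cinf X (F v)) -> (forall v, Cinf X v -> Cinf X (G v)) ->
  bd F -> bd G -> bd (fun v => F v + G v).
Proof.
move=> CF CG [T [T0 HT]] [T' [T0' HT']]; exists (T + T'); split=> [|v Cv]; first exact: addr_ge0.
apply: le_trans (snormD rs si (CF v Cv) (CG v Cv)) _; rewrite mulrDl.
by apply: lerD; [exact: HT|exact: HT'].
Qed.

Lemma bdB F G : (forall v, Cinf X v -> Cinf X (F v)) -> (forall v, Cinf X v -> Cinf X (G v)) ->
  bd F -> bd G -> bd (fun v => F v - G v).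
Proof.
move=> CF CG bF [T [T0 HT]]; apply: bdD => // [v Cv|]; first exact: (rsN rs (CG v Cv)).
by exists T; split => // v Cv; rewrite (snormN rs si (CG v Cv)); exact: HT.
Qed.

Lemma bd_sum (I : finType) (Q : pred I) (F : I -> op R d M m) :
  (forall i, Q i -> forall v, Cinf X v -> Cinf X (F i v)) ->
  (forall i, Q i -> bd (F i)) -> bd (fun v => \sum_(i | Q i) F i v).
Proof.
move=> CF bF; pose G i v := if Q i then F i v else 0.
have -> : (fun v => \sum_(i | Q i) F i v) = fun v => \sum_i G i v.
  by apply/funext => v; rewrite big_mkcond.
have CG i v : Cinf X v -> Cinf X (G i v).
  by rewrite /G; case E: (Q i) => Cv; [exact: CF|exact: (rs0 rs)].
have /choice[T HT] : forall i, exists T : R, 0 <= T /\ forall v, Cinf X v -> nrm (G i v) <= T * nrm v.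
  move=> i; rewrite /G; case E: (Q i); first exact: bF.
  by exists 0; split => // v _; rewrite (snorm0 rs si) mul0r.
exists (\sum_i T i); split=> [|v Cv]; first by apply: sumr_ge0 => i _; have [] := HT i.
apply: le_trans (snorm_sum rs si _ (fun i => CG i v Cv)) _.
by rewrite mulr_suml; apply: ler_sum => i _; have [_] := HT i; exact.
Qed.

Lemma bd_comp F G : (forall v, Cinf X v -> Cinf X (G v)) -> bd F -> bd G -> bd (fun v => F (G v)).
Proof.
move=> CG [T [T0 HT]] [T' [T0' HT']]; exists (T * T'); split=> [|v Cv]; first exact: mulr_ge0.
by apply: le_trans (HT _ (CG v Cv)) _; rewrite -mulrA ler_wpM2l//; exact: HT'.
Qed.

Definition bnd U := lin_op U /\ bd U.

Lemma bnd_id : bnd id. Proof. by split; [exact: lin_id|exact: bd_id]. Qed.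

Lemma bnd_comp U V : bnd U -> bnd V -> bnd (fun v => U (V v)).
Proof. by move=> [LU bU] [LV bV]; split; [exact: lin_comp|apply: bd_comp => //; exact: (lo_C LV)]. Qed.

Lemma bndB U V : bnd U -> bnd V -> bnd (fun v => U v - V v).
Proof. by move=> [LU bU] [LV bV]; split; [exact: linB|apply: bdB => //; [exact: (lo_C LU)|exact: (lo_C LV)]]. Qed.

Lemma bndD U V : bnd U -> bnd V -> bnd (fun v => U v + V v).
Proof. by move=> [LU bU] [LV bV]; split; [exact: linD|apply: bdD => //; [exact: (lo_C LU)|exact: (lo_C LV)]]. Qed.

Lemma bnd_sum (I : finType) (Q : pred I) (V : I -> op R d M m) : (forall i, Q i -> bnd (V i)) ->
  bnd (fun v => \sum_(i | Q i) V i v).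
Proof.
move=> HV; split; first by apply: lin_sum => i /HV[].
by apply: bd_sum => i /HV[LV bV]; [exact: (lo_C LV)|exact: bV].
Qed.

Lemma symD (U V : op R d M m) : sym_op X U -> sym_op X V -> sym_op X (fun v => U v + V v).
Proof.
move=> HU HV; split=> [v Cv|t v w Cv Cw|v w Cv Cw].
- exact: (rsD rs (so_C HU Cv) (so_C HV Cv)).
- by rewrite (so_lin HU)// (so_lin HV)// scalerDr addrACA.
rewrite (siD si (so_C HU Cv) (so_C HV Cv) Cw) (siDr rs si (so_C HU Cw) (so_C HV Cw) Cv).
by rewrite (so_sym HU Cv Cw) (so_sym HV Cv Cw).
Qed.

Lemma symB (U V : op R d M m) : sym_op X U -> sym_op X V -> sym_op X (fun v => U v - V v).
Proof.
move=> HU HV; split=> [v Cv|t v w Cv Cw|v w Cv Cw].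
- exact: (rsB rs (so_C HU Cv) (so_C HV Cv)).
- by rewrite (so_lin HU)// (so_lin HV)// scalerBr opprD addrACA.
rewrite (siB rs si (so_C HU Cv) (so_C HV Cv) Cw) (siBr rs si (so_C HU Cw) (so_C HV Cw) Cv).
by rewrite (so_sym HU Cv Cw) (so_sym HV Cv Cw).
Qed.

Lemma sym_sumP (I : finType) (Q : pred I) (V : I -> op R d M m) : (forall i, Q i -> sym_op X (V i)) ->
  sym_op X (fun v => \sum_(i | Q i) V i v).
Proof.
move=> HV; pose G i : op R d M m := fun v => if Q i then V i v else 0.
have E v : \sum_(i | Q i) V i v = \sum_i G i v by rewrite big_mkcond.
have HG i : sym_op X (G i).
  rewrite /G; case Qi: (Q i); first exact: HV.
  split=> [v _|t v w _ _|v w Cv Cw]; first exact: (rs0 rs).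
    by rewrite scaler0 addr0.
  by rewrite (si0 rs si Cw) (siC si Cv (rs0 rs)) (si0 rs si Cv).
split=> [v Cv|t v w Cv Cw|v w Cv Cw]; rewrite ?E.
- by apply: Cinf_sum => i _; exact: (so_C (HG i) Cv).
- by rewrite scaler_sumr -big_split; apply: eq_bigr => i _; exact: (so_lin (HG i)).
rewrite (si_suml rs si _ (fun i => so_C (HG i) Cv) Cw) (si_sumr rs si _ (fun i => so_C (HG i) Cw) Cv).
by apply: eq_bigr => i _; exact: (so_sym (HG i)).
Qed.

Section Powers.
Variable A : op R d M m.
Hypotheses (LA : lin_op A) (HA : sym_op X A).

Lemma sym_iter i : sym_op X (iter i A).
Proof.
elim: i => [|i IH]; first exact: (sym_id X m).
split=> [v Cv|t v w Cv Cw|v w Cv Cw] /=; first exact: (so_C HA (so_C IH Cv)).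
  by rewrite (so_lin IH)// (so_lin HA)//; exact: (so_C IH).
rewrite (so_sym HA (so_C IH Cv) Cw) (so_sym IH Cv (so_C HA Cw)); congr (rin v _).
by rewrite -iterS -iterSr.
Qed.

Let Ci i v : Cinf X v -> Cinf X (iter i A v) := @so_C _ _ _ _ _ _ (sym_iter i) v.

(** The part of being smoothing that the argument consumes. Unlike smoothing itself it is easily
    seen to be stable under the compositions that occur, by [smoL], [smoA] and [smoR]. *)
Definition smo U := lin_op U /\ forall i, bd (fun v => U (iter i A v)).

Lemma smo_bnd U : smo U -> bnd U.
Proof. by move=> [LU HU]; split => //; exact: (HU 0%N). Qed.

Lemma smo_smoothing S : smoothing X S -> smo S.
Proof.
move=> HS; split=> [|i]; first exact: smoothing_lin.
exact: (smoothing_bound hM cM d0 HS (sym_iter i)).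
Qed.

Lemma smo_eq U V : smo U -> lin_op V -> (forall v, Cinf X v -> V v = U v) -> smo V.
Proof.
move=> [LU HU] LV E; split => // i; have [T [T0 HT]] := HU i.
by exists T; split => // v Cv; rewrite (E _ (Ci i Cv)); exact: HT.
Qed.

Lemma smoA U : smo U -> smo (fun v => U (A v)).
Proof. by move=> [LU HU]; split=> [|i]; [exact: lin_comp|exact: (HU i.+1)]. Qed.

Lemma smoL B U : bnd B -> smo U -> smo (fun v => B (U v)).
Proof.
move=> [LB bB] [LU HU]; split=> [|i]; first exact: lin_comp.
by apply: bd_comp => // v Cv; exact: (lo_C LU (Ci i Cv)).
Qed.

Lemma smoB U V : smo U -> smo V -> smo (fun v => U v - V v).
Proof.
move=> [LU HU] [LV HV]; split=> [|i]; first exact: linB.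
by apply: (bdB (F := fun v => U (iter i A v)) (G := fun v => V (iter i A v))) => // v Cv;
  [exact: (lo_C LU (Ci i Cv))|exact: (lo_C LV (Ci i Cv))].
Qed.

Lemma smoD U V : smo U -> smo V -> smo (fun v => U v + V v).
Proof.
move=> [LU HU] [LV HV]; split=> [|i]; first exact: linD.
by apply: (bdD (F := fun v => U (iter i A v)) (G := fun v => V (iter i A v))) => // v Cv;
  [exact: (lo_C LU (Ci i Cv))|exact: (lo_C LV (Ci i Cv))].
Qed.

Lemma smo_sum (I : finType) (Q : pred I) (V : I -> op R d M m) : (forall i, Q i -> smo (V i)) ->
  smo (fun v => \sum_(i | Q i) V i v).
Proof.
move=> HV; split=> [|k]; first by apply: lin_sum => i /HV[].
apply: (bd_sum (F := fun i v => V i (iter k A v))) => i Qi; have [LV bV] := HV i Qi; last exact: bV.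
by move=> v Cv; exact: (lo_C LV (Ci k Cv)).
Qed.

(** One A is moved across B at a time: U B A^(i+1) = (U A) B A^i - U S A^i, where U A and S are in
    the class and U is bounded. *)
Lemma smoR B S U : bnd B -> smo S -> (forall v, Cinf X v -> B (A v) = A (B v) - S v) ->
  smo U -> smo (fun v => U (B v)).
Proof.
move=> [LB bB] HS E HU; split; first by have [LU _] := HU; exact: lin_comp.
move=> i; elim: i U HU => [|i IH] U HU; have [LU bU] := HU.
  by apply: bd_comp (bU 0%N) bB => v Cv; exact: (lo_C LB Cv).
have [LS bS] := HS.
have b1 := IH _ (smoA HU); have b2 := (smoL (smo_bnd HU) HS).2 i.
have [|v Cv|T [T0 HT]] := bdB _ _ b1 b2.
- by move=> v Cv; exact: (lo_C LU (lo_C LA (lo_C LB (Ci i Cv)))).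
- exact: (lo_C LU (lo_C LS (Ci i Cv))).
exists T; split => // v Cv; have := HT v Cv.
by rewrite -(loB LU (lo_C LA (lo_C LB (Ci i Cv))) (lo_C LS (Ci i Cv))) -(E _ (Ci i Cv)).
Qed.

Let small_arith (k l T T0 a b c : R) : 0 <= k -> 1 <= l -> 0 <= T -> 0 <= T0 -> 0 <= b -> 0 <= c ->
  k * a <= T * (b + k * c) -> k * a + k * (T0 * c) <= (T + T0) * (b + k * l * c).
Proof.
move=> k0 l1 t0 t1 b0 c0 h.
have kc : k * c <= k * l * c by rewrite ler_wpM2r// -[leLHS]mulr1 ler_wpM2l.
apply: le_trans (lerD h (lexx _)) _; rewrite [leRHS]mulrDl; apply: lerD.
  by rewrite ler_wpM2l// lerD2l.
by rewrite mulrCA ler_wpM2l//; apply: le_trans kc _; rewrite lerDr.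
Qed.

(** Each factor l is traded for a factor A: l U w equals U A w minus U applied to the defect, and U
    A is again in the class. *)
Lemma smo_small U : smo U -> forall i, exists T : R, 0 <= T /\ forall (l : R) w, 1 <= l -> Cinf X w ->
  l ^+ i * nrm (U w) <= T * (nrm w + l ^+ i * nrm (A w - l%:K *: w)).
Proof.
move=> HU i; elim: i U HU => [|i IH] U HU; have [LU bU] := HU; have [T0 [T00 HT0]] := bU 0%N.
  exists T0; split => // l w l1 Cw; rewrite expr0 !mul1r mulrDr -[leLHS]addr0; apply: lerD; first exact: HT0.
  by rewrite mulr_ge0// snorm_ge0.
have [T [T1 HT]] := IH _ (smoA HU); exists (T + T0); split=> [|l w l1 Cw]; first exact: addr_ge0.
have l0 : 0 <= l := le_trans ler01 l1.
have CA := lo_C LA Cw; have Cr : Cinf X (A w - l%:K *: w) := rsB rs CA (rsZ rs l Cw).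
have E : l%:K *: U w = U (A w) - U (A w - l%:K *: w).
  by rewrite (loB LU CA (rsZ rs l Cw)) (loZ _ LU Cw) opprB addrC subrK.
have h : l * nrm (U w) <= nrm (U (A w)) + T0 * nrm (A w - l%:K *: w).
  rewrite -{1}(ger0_norm l0) -(snormZ rs si l (lo_C LU Cw)) E.
  apply: le_trans (snormB rs si (lo_C LU CA) (lo_C LU Cr)) _; rewrite lerD2l; exact: HT0.
have h2 := HT l w l1 Cw.
have li : 0 <= l ^+ i by exact: exprn_ge0.
rewrite exprSr -mulrA; apply: le_trans (ler_wpM2l li h) _.
rewrite mulrDr.
exact: (small_arith li l1 T1 T00 (snorm_ge0 rin w) (snorm_ge0 rin _) h2).
Qed.

End Powers.

(** An almost self-adjoint almost idempotent is bounded: |B v|^2 pairs v with B' B v = B v + S' v -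
    S B v, and this is at most |v| times a combination of |B v| and |v|. No symbol estimate
    enters. *)
Lemma bnd_of_adj B B' S S' : lin_op B -> bd S -> bd S' -> is_adjoint X B B' ->
  (forall v, Cinf X v -> B' v = B v - S v) -> (forall v, Cinf X v -> B (B v) = B v + S' v) ->
  (forall v, Cinf X v -> Cinf X (S v)) -> (forall v, Cinf X v -> Cinf X (S' v)) -> bd B.
Proof.
move=> LB [T [T0 HT]] [T' [T0' HT']] HB E E2 CS CS'.
exists (1 + T + T'); split=> [|v Cv]; first by rewrite !addr_ge0.
have Cb := lo_C LB Cv.
have h : nrm (B v) ^+ 2 <= nrm v * (nrm (B v) + T' * nrm v + T * nrm (B v)).
  rewrite (sqr_snorm si Cb) (rin_adjoint HB Cv Cb) (E _ Cb) (E2 _ Cv).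
  have C1 := rsD rs Cb (CS' v Cv); have C2 := CS _ Cb.
  apply: le_trans (ler_norm _) _; apply: le_trans (si_CS rs si Cv (rsB rs C1 C2)) _.
  rewrite ler_wpM2l ?snorm_ge0//; apply: le_trans (snormB rs si C1 C2) _.
  apply: lerD; last exact: HT.
  by apply: le_trans (snormD rs si Cb (CS' v Cv)) _; rewrite lerD2l; exact: HT'.
move: h (snorm_ge0 rin (B v)) (snorm_ge0 rin v).
move: (nrm (B v)) (nrm v) => a b h a0 b0; rewrite leNgt; apply/negP => lt.
have ba : b <= a.
  by apply: le_trans (ltW lt); rewrite -addrA mulrDl mul1r lerDl mulr_ge0// addr_ge0.
have ap : 0 < a by apply: le_lt_trans lt; rewrite mulr_ge0// !addr_ge0.
have h1 : (1 + T + T') * b * a < a * a by rewrite ltr_pM2r.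
have h2 : T' * (b * b) <= T' * (b * a) by rewrite ler_wpM2l// ler_wpM2l.
by move: h; rewrite expr2; nra.
Qed.

(** The hypothesis is (1 + S1)(1 + S2) = S3 solved for v. Values at x of smoothing operators are
    bounded by the L^2 norm, those of the identity are not. *)
Lemma not_smoothing_id (x : M) (S1 S2 S3 : op R d M m) (l : 'I_m) :
  smoothing X S1 -> smoothing X S2 -> smoothing X S3 ->
  (forall v, Cinf X v -> v = S3 v - S2 v - S1 v - S1 (S2 v)) -> False.
Proof.
move=> H1 H2 H3 E; have [c Ac Dx] := atlas_cover X x.
have [T1 [T10 B1]] := point_bound hM cM d0 H1 Ac Dx.
have [T2 [T20 B2]] := point_bound hM cM d0 H2 Ac Dx.
have [T3 [T30 B3]] := point_bound hM cM d0 H3 Ac Dx.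
have [T4 [T40 B4]] := smoothing_bound hM cM d0 H2 (sym_id X m).
apply: (point_unbounded hM cM d0 (T := T3 + T2 + T1 + T1 * T4) (j := (l, false)) Ac Dx) => v Cv.
have Cs := lo_C (smoothing_lin H2) Cv.
have b4 := B1 _ (l, false) Cs; have b5 := ler_wpM2l T10 (B4 v Cv).
have b1 := B1 v (l, false) Cv; have b2 := B2 v (l, false) Cv; have b3 := B3 v (l, false) Cv.
have -> : co (v c (cmap c x)) (l, false) = co (S3 v c (cmap c x)) (l, false) - co (S2 v c (cmap c x)) (l, false)
   - co (S1 v c (cmap c x)) (l, false) - co (S1 (S2 v) c (cmap c x)) (l, false).
  by rewrite {1}(E v Cv) !coD !coN.
move: b1 b2 b3 b4 b5; rewrite /= !ler_norml mulrA !mulrDl.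
move: (co _ _) (co _ _) (co _ _) (co _ _) (T1 * nrm v) (T2 * _) (T3 * _) (T1 * _ * _) (T1 * _).
by move=> a b e f t1 t2 t3 t4 t5 /andP[? ?] /andP[? ?] /andP[? ?] /andP[? ?] ?; apply/andP; split; lra.
Qed.

End Operators.

(** * The pseudodifferential projections and the operators A_j *)

Section Projections.
Variables (R : realType) (d : nat) (M : topologicalType).
Variable X : smooth_structure R d M.
Variables (mneg mpos : nat).
Local Notation m := (mneg + mpos)%N.
Local Notation chart := (chart R d M).
Local Notation C := R[i].
Local Notation hd := (hdens R d M m).
Local Notation "t %:K" := ((t : R)%:C)%C (at level 1, format "t %:K").
Local Notation CI := [set v : hd | Cinf X v].
Local Notation rin := (@rin R d M X m).
Local Notation nrm := (snorm rin).
Hypotheses (hM : hausdorff_space M) (cM : compact [set: M]) (d0 : (0 < d)%N).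

Let rs := Cinf_subspace X m.
Let si : semi_inner CI rin := @rin_semi_inner R d M X m hM cM.

Variables (s : R) (A : op R d M m) (p : symb R d M m)
  (h : 'I_m -> chart -> 'rV[R]_d -> 'rV[R]_d -> R) (P : 'I_m -> op R d M m).
Hypotheses (psA : psido_prin X s A p) (saA : self_adjoint X A) (HP : psido_projections X A p h P).
Local Notation smo := (smo X A).
Local Notation bnd := (bnd X).
Local Notation adj := (adj X).
Local Notation pos := (@rshift mneg mpos).

Lemma LA : lin_op X A. Proof. by have [h1 h2 _] := psA; split. Qed.

Lemma SA : sym_op X A.
Proof.
split; first exact: (lo_C LA); first by move=> t v w; exact: (lo_lin LA).
by move=> v w; exact: (rin_adjoint saA).
Qed.

Lemma LP l : lin_op X (P l).
Proof. by have [h1 _ _ _ _] := HP; have [Q [h2 h3 _] _] := h1 l; split. Qed.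

(** The congruences modulo smoothing operators are kept as exact identities with the error operators
    [S1] to [S4]. *)
Definition S1 l : op R d M m := fun v => P l v - adj (P l) v.
Definition S2 j l : op R d M m := fun v => (P j \o P l) v - (if j == l then P j else fun=> 0) v.
Definition S3 : op R d M m := fun v => \sum_j P j v - v.
Definition S4 j : op R d M m := fun v => (A \o P j) v - (P j \o A) v.

Lemma sm1 l : smoothing X (S1 l). Proof. by have [_ h1 _ _ _] := HP; exact: (h1 l). Qed.
Lemma sm2 j l : smoothing X (S2 j l). Proof. by have [_ _ h1 _ _] := HP; exact: (h1 j l). Qed.
Lemma sm3 : smoothing X S3. Proof. by have [_ _ _ h1 _] := HP; exact: h1. Qed.
Lemma sm4 j : smoothing X (S4 j). Proof. by have [_ _ _ _ h1] := HP; exact: (h1 j). Qed.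

Let so S : smoothing X S -> smo S := smo_smoothing hM cM d0 SA (S := S).
Let bo S : smoothing X S -> bnd S := fun HS => smo_bnd (so HS).

Definition has_adj l := is_adjoint X (P l) (adj (P l)).

(** [adj] is chosen by [xget] with default [id], so the absence of an adjoint on C^oo(M) is a case
    to be treated, not an error. *)
Lemma adj_cases l : has_adj l \/ adj (P l) = id.
Proof.
have [ex|nex] := pselect (exists B, is_adjoint X (P l) B).
  have ex' : exists B, [set B | is_adjoint X (P l) B] B by case: ex => B HB; exists B.
  by left; exact: (xgetPex (id : op R d M m) ex').
by right; apply: xgetPN => B HB; apply: nex; exists B.
Qed.

Lemma adjE l : adj (P l) = fun v => P l v - S1 l v.
Proof. by apply/funext => v; rewrite /S1 opprB addrC subrK. Qed.

Lemma S2E v j l : j != l -> P j (P l v) = S2 j l v.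
Proof. by move=> /negbTE jl; rewrite /S2 jl subr0. Qed.

Lemma S4E j v : A (P j v) = P j (A v) + S4 j v.
Proof. by rewrite /S4 /= addrC subrK. Qed.

(** With an adjoint, P l is an almost self-adjoint almost idempotent and [bnd_of_adj] applies;
    without one, P l is the identity plus a smoothing operator. *)
Lemma bndP l : bnd (P l).
Proof.
have [_ b1] := bo (sm1 l).
have [ha|aid] := adj_cases l.
  split; first exact: LP.
  apply: (bnd_of_adj hM cM (LP l) b1 (bo (sm2 l l)).2 ha).
  - by move=> v Cv; rewrite adjE.
  - by move=> v Cv; rewrite /S2 eqxx /= addrC subrK.
  - exact: (lo_C (smoothing_lin (sm1 l))).
  - exact: (lo_C (smoothing_lin (sm2 l l))).
have -> : P l = fun v => v + S1 l v by apply/funext => v; rewrite /S1 aid addrC subrK.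
exact: (bndD hM cM (bnd_id X m) (bo (sm1 l))).
Qed.

Lemma bnd_adj l : bnd (adj (P l)).
Proof. by rewrite adjE; exact: (bndB hM cM (bndP l) (bo (sm1 l))). Qed.

(* [adj (P l)] is the identity when P l has no adjoint on C^oo(M); then P l is the identity
   up to a smoothing operator, which excludes a second such index because P l (P l') is
   smoothing and the identity is not. *)
Lemma missing_unique l l' : [set: M] !=set0 -> l != l' -> ~ has_adj l -> has_adj l'.
Proof.
move=> [x _] ll' nl; have [ha|e'] := adj_cases l'; first exact: ha.
have [ha|e] := adj_cases l; first by case: (nl ha).
exfalso; apply: (not_smoothing_id hM cM d0 x l (sm1 l) (sm1 l') (sm2 l l')) => v Cv.
have E1 w : P l w = w + S1 l w by rewrite /S1 e addrC subrK.
have E2 w : P l' w = w + S1 l' w by rewrite /S1 e' addrC subrK.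
have L1 := smoothing_lin (sm1 l); have C2 := lo_C (smoothing_lin (sm1 l')) Cv.
rewrite -(S2E v ll') E2 E1 (loD L1 Cv C2).
set a := S1 l' v; set b := S1 l v; set c := S1 l a.
by rewrite (addrAC v a) -[v + _ + a - a - b - c]/(v + (b + c) + a - a - b - c) addrK (addrA v) addrAC addrK addrK.
Qed.

Definition comp_op r : op R d M m := fun v => adj (P (pos r)) (A (P (pos r) v)).

Lemma AjE J : Aj X A P J = fun v => A v - (\sum_(r | r != J) comp_op r v + \sum_(r | r != J) comp_op r v).
Proof. by apply/funext => v; rewrite /Aj scaler_nat mulr2n. Qed.

Lemma sym_comp r : has_adj (pos r) -> sym_op X (comp_op r).
Proof.
move=> ha; have [La _] := bnd_adj (pos r); have L := LP (pos r).
split=> [v Cv|t v w Cv Cw|v w Cv Cw].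
- exact: (lo_C La (lo_C LA (lo_C L Cv))).
- by rewrite /comp_op (lo_lin L)// (lo_lin LA) ?(lo_lin La)//; [exact: (lo_C LA (lo_C L Cv))|exact: (lo_C LA (lo_C L Cw))|exact: (lo_C L)..].
have CPv := lo_C L Cv; have CPw := lo_C L Cw.
rewrite /comp_op (siC si (lo_C La (lo_C LA CPv)) Cw) -(rin_adjoint ha Cw (lo_C LA CPv)).
by rewrite (siC si CPw (lo_C LA CPv)) (so_sym SA CPv CPw) (rin_adjoint ha Cv (lo_C LA CPw)).
Qed.

Definition good J := forall r, r != J -> has_adj (pos r).

Lemma sym_Aj J : good J -> sym_op X (Aj X A P J).
Proof.
move=> gJ; rewrite AjE; have H := sym_sumP hM cM (fun r rJ => sym_comp (gJ r rJ)).
exact: (symB hM cM SA (symD hM cM H H)).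
Qed.

(** Commuting A with the P_r writes A_J v as a bounded operator applied to A v plus one applied to
    v. This carries an estimate from A_J over to A in [Hs_dichotomy]. *)
Lemma Aj_bound J : exists T : R, 0 <= T /\ forall v, Cinf X v -> nrm (Aj X A P J v) <= T * (nrm (A v) + nrm v).
Proof.
pose B1 : op R d M m := fun u => u - (\sum_(r | r != J) adj (P (pos r)) (P (pos r) u) + \sum_(r | r != J) adj (P (pos r)) (P (pos r) u)).
pose B2 : op R d M m := fun u => \sum_(r | r != J) adj (P (pos r)) (S4 (pos r) u) + \sum_(r | r != J) adj (P (pos r)) (S4 (pos r) u).
have b1 : bnd B1.
  have H : bnd (fun u => \sum_(r | r != J) adj (P (pos r)) (P (pos r) u)).
    by apply: (bnd_sum hM cM) => r _; exact: (bnd_comp (bnd_adj (pos r)) (bndP (pos r))).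
  exact: (bndB hM cM (bnd_id X m) (bndD hM cM H H)).
have b2 : bnd B2.
  have H : bnd (fun u => \sum_(r | r != J) adj (P (pos r)) (S4 (pos r) u)).
    by apply: (bnd_sum hM cM) => r _; exact: (bnd_comp (bnd_adj (pos r)) (bo (sm4 (pos r)))).
  exact: (bndD hM cM H H).
have [L1 [T1 [T10 H1]]] := b1; have [L2 [T2 [T20 H2]]] := b2.
exists (T1 + T2); split=> [|v Cv]; first exact: addr_ge0.
have CAv := lo_C LA Cv.
have -> : Aj X A P J v = B1 (A v) - B2 v.
  have E : \sum_(r | r != J) comp_op r v = \sum_(r | r != J) adj (P (pos r)) (P (pos r) (A v)) + \sum_(r | r != J) adj (P (pos r)) (S4 (pos r) v).
    rewrite -big_split; apply: eq_bigr => r _; rewrite /comp_op S4E.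
    by have [La _] := bnd_adj (pos r); rewrite (loD La (lo_C (LP _) CAv) (lo_C (smoothing_lin (sm4 _)) Cv)).
  by rewrite AjE E /B1 /B2 addrACA opprD addrA.
apply: le_trans (snormB rs si (lo_C L1 CAv) (lo_C L2 Cv)) _.
have h1 := H1 _ CAv; have h2 := H2 _ Cv; rewrite mulrDl; apply: lerD.
  by apply: le_trans h1 _; rewrite ler_wpM2l// lerDl snorm_ge0.
by apply: le_trans h2 _; rewrite ler_wpM2l// lerDr snorm_ge0.
Qed.

(** The common part of the two cases that follow: the summands of A_J with r <> J contribute
    [adj (P_r)] applied to A P_r T, which stays in the class as soon as A P_r T is in it. *)
Lemma Aj_smo J (V : 'I_mpos -> op R d M m) T S : bnd T -> smo S ->
  (forall v, Cinf X v -> A (T v) = T (A v) + S v) ->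
  (forall r, r != J -> smo (V r)) ->
  (forall r v, r != J -> Cinf X v -> A (P (pos r) (T v)) = V r v) ->
  exists U, smo U /\ forall v, Cinf X v -> Aj X A P J (T v) = T (A v) + U v.
Proof.
move=> bT HS E HV EV.
exists (fun v => S v - (\sum_(r | r != J) adj (P (pos r)) (V r v) + \sum_(r | r != J) adj (P (pos r)) (V r v))); split.
  have H : smo (fun v => \sum_(r | r != J) adj (P (pos r)) (V r v)).
    by apply: (smo_sum hM cM SA) => r rJ; exact: (smoL SA (bnd_adj _) (HV r rJ)).
  exact: (smoB hM cM SA HS (smoD hM cM SA H H)).
move=> v Cv; rewrite AjE E// -addrA; congr (_ + (_ - _)).
have H : \sum_(r | r != J) comp_op r (T v) = \sum_(r | r != J) adj (P (pos r)) (V r v).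
  by apply: eq_bigr => r rJ; rewrite /comp_op EV.
by rewrite H.
Qed.

(** The removed summands all have an index r different from l, and P_r P_l is smoothing; commuting A
    with the projections leaves only errors of the class. *)
Lemma Aj_proj J l : (forall r, r != J -> pos r != l) ->
  exists U, smo U /\ forall v, Cinf X v -> Aj X A P J (P l v) = P l (A v) + U v.
Proof.
move=> nl; have CP := lo_C (LP l); have CS := lo_C (smoothing_lin (sm4 l)).
have sP S : smo S -> smo (fun v => S (P l v)).
  by apply: (smoR hM cM LA SA (bndP l) (so (sm4 l))) => v Cv; rewrite S4E addrK.
apply: (@Aj_smo J (fun r v => S2 (pos r) l (A v) + P (pos r) (S4 l v) + S4 (pos r) (P l v))).
- exact: bndP.
- exact: (so (sm4 l)).
- by move=> v Cv; rewrite S4E.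
- move=> r rJ; apply: (smoD hM cM SA); last exact: (sP _ (so (sm4 (pos r)))).
  apply: (smoD hM cM SA); first exact: (smoA LA (so (sm2 (pos r) l))).
  exact: (smoL SA (bndP (pos r)) (so (sm4 l))).
move=> r v rJ Cv; rewrite S4E S4E (loD (LP (pos r)) (CP _ (lo_C LA Cv)) (CS _ Cv)) S2E//; exact: nl.
Qed.

(** Here P_J is the identity plus a smoothing operator, so every other P_r equals P_r P_J up to an
    error and belongs to the class; nothing but errors is subtracted from A. *)
Lemma Aj_missing J : ~ has_adj (pos J) ->
  exists U, smo U /\ forall v, Cinf X v -> Aj X A P J v = A v + U v.
Proof.
move=> nJ; have [ha|aid] := adj_cases (pos J); first by case: (nJ ha).
have E w : P (pos J) w = w + S1 (pos J) w by rewrite /S1 aid addrC subrK.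
have sP r : r != J -> smo (P (pos r)).
  move=> rJ; have rJ' : pos r != pos J by rewrite (inj_eq (@rshift_inj _ _)).
  apply: (smo_eq SA (smoB hM cM SA (so (sm2 (pos r) (pos J))) (smoL SA (bndP (pos r)) (so (sm1 (pos J))))) (LP (pos r))).
  by move=> v Cv; rewrite -(S2E v rJ') E (loD (LP _) Cv (lo_C (smoothing_lin (sm1 _)) Cv)) addrK.
have zs : smo (fun v => S3 v - S3 v) := smoB hM cM SA (so sm3) (so sm3).
apply: (@Aj_smo J (fun r v => P (pos r) (A v) + S4 (pos r) v) id _ (bnd_id X m) zs).
- by move=> v Cv; rewrite subrr addr0.
- by move=> r rJ; apply: (smoD hM cM SA); [exact: (smoA LA (sP r rJ))|exact: (so (sm4 (pos r)))].
by move=> r v rJ Cv; rewrite S4E.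
Qed.

(* In general the T k are the projections; if some P l with l > 0 has no adjoint, then all the
   others are smoothing, and T is the identity. *)
Lemma Aj_family : [set: M] !=set0 -> (0 < mpos)%N ->
  exists (n : nat) (J : 'I_n.+1 -> 'I_mpos) (T U : 'I_n.+1 -> op R d M m) (U' : op R d M m),
  [/\ forall k, good (J k), forall k, bnd (T k), forall k, smo (U k), smo U' &
    (forall k v, Cinf X v -> Aj X A P (J k) (T k v) = T k (A v) + U k v) /\
    forall v, Cinf X v -> v = \sum_k T k v - U' v].
Proof.
move=> M0 mp; have [[J nJ]|all] := pselect (exists J, ~ has_adj (pos J)).
  have [U [HU EU]] := Aj_missing nJ.
  (* A family with a single member, T = id; the difference [S3 v - S3 v] is the zero operator. *)
  exists 0%N, (fun=> J), (fun=> id), (fun=> U), (fun v => S3 v - S3 v); split.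
  - move=> _ r rJ; apply: (missing_unique M0 _ nJ).
    by rewrite eq_sym (inj_eq (@rshift_inj _ _)).
  - by move=> _; exact: bnd_id.
  - by move=> _.
  - exact: (smoB hM cM SA (so sm3) (so sm3)).
  - by split=> [_|v Cv]; [exact: EU|rewrite big_ord1 subrr subr0].
have ha r : has_adj (pos r) by apply: contrapT => nr; apply: all; exists r.
pose r0 := Ordinal mp.
(* For l > 0 the operator A_l belongs to P_l; for l < 0 any index will do, and [r0] is taken. *)
have /choice[J HJ] : forall l : 'I_m, exists J, forall r, r != J -> pos r != l.
  move=> l; have [[J <-]|nl] := pselect (exists J, pos J = l).
    by exists J => r rJ; rewrite (inj_eq (@rshift_inj _ _)).
  by exists r0 => r _; apply/eqP => e; apply: nl; exists r.
have /choice[U HU] : forall l, exists U, smo U /\ forall v, Cinf X v -> Aj X A P (J l) (P l v) = P l (A v) + U v.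
  by move=> l; exact: (Aj_proj (HJ l)).
have m1 : m = m.-1.+1 by rewrite prednK// addn_gt0 mp orbT.
exists m.-1, (J \o cast_ord (esym m1)), (P \o cast_ord (esym m1)), (U \o cast_ord (esym m1)), S3; split.
- by move=> k r _; exact: ha.
- by move=> k; exact: bndP.
- by move=> k; have [] := HU (cast_ord (esym m1) k).
- exact: (so sm3).
- split=> [k|v Cv]; first by have [] := HU (cast_ord (esym m1) k).
  have -> : \sum_k (P \o cast_ord (esym m1)) k v = \sum_l P l v.
    by rewrite (reindex (cast_ord (esym m1)))//; exists (cast_ord m1) => k _; rewrite ?cast_ordK ?cast_ordKV.
  by rewrite /S3 opprB addrC subrK.
Qed.

End Projections.

(** * Spectrum of some A_j near each large eigenvalue of A *)

Section Distance.
Variables (R : realType) (d : nat) (M : topologicalType).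
Variable X : smooth_structure R d M.
Variables (mneg mpos : nat).
Local Notation m := (mneg + mpos)%N.
Local Notation chart := (chart R d M).
Local Notation C := R[i].
Local Notation hd := (hdens R d M m).
Local Notation "t %:K" := ((t : R)%:C)%C (at level 1, format "t %:K").
Local Notation CI := [set v : hd | Cinf X v].
Local Notation rin := (@rin R d M X m).
Local Notation nrm := (snorm rin).
Hypotheses (hM : hausdorff_space M) (cM : compact [set: M]) (d0 : (0 < d)%N).

Let rs := Cinf_subspace X m.
Let si : semi_inner CI rin := @rin_semi_inner R d M X m hM cM.

Variables (s : R) (A : op R d M m) (p : symb R d M m)
  (h : 'I_m -> chart -> 'rV[R]_d -> 'rV[R]_d -> R) (P : 'I_m -> op R d M m).
Hypotheses (s0 : 0 <= s) (psA : psido_prin X s A p) (saA : self_adjoint X A)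
  (HP : psido_projections X A p h P).
Hypotheses (M0 : [set: M] !=set0) (mp : (0 < mpos)%N).

Let LA := LA psA.
Let SA := SA psA saA.

Lemma Hs_dichotomy :
  (exists J, forall x : R, 0 < x -> spectrum_pos X s (Aj X A P J) x) \/
  forall c chi, atlas X c -> cutoff X c chi ->
    exists T : R, 0 <= T /\ forall v, Cinf X v -> Hsnorm s c chi v <= T * (nrm (A v) + nrm v).
Proof.
(* From the family only one index is extracted here, such that A_J is symmetric. *)
have [n [J [_ [_ [_ [gJ _ _ _ _]]]]]] := Aj_family hM cM d0 psA saA HP M0 mp.
have HD := sym_Aj hM cM d0 psA saA HP (gJ ord0); set D := Aj _ _ _ _ in HD.
have [[x [x0 rx]]|nr] := pselect (exists x : R, 0 < x /\ resolvent X s D x%:K); last first.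
  by left; exists (J ord0) => x x0; split => // rx; apply: nr; exists x.
right => c chi Ac cc; have HS := sym_shift hM cM x HD.
have sj := resolvent_surj rx; have [Tb HTb] := surj_below hM cM s0 HS sj.
have [T [T0 HT]] := Hs_est hM cM HS Ac cc sj (ex_intro _ Tb HTb).
have [T' [T'0 HT']] := Aj_bound hM cM d0 psA saA HP (J ord0).
exists (T * (T' + x)); split=> [|v Cv]; first by rewrite mulr_ge0// addr_ge0// ltW.
apply: le_trans (HT v Cv) _; rewrite -mulrA ler_wpM2l//.
apply: le_trans (snormB rs si (so_C HD Cv) (rsZ rs x Cv)) _; rewrite mulrDl; apply: lerD.
  exact: HT'.
by rewrite (snormZ rs si x Cv) gtr0_norm// ler_wpM2l ?(ltW x0)// lerDr snorm_ge0.
Qed.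

(** The power i is fixed beforehand because the errors are only known to be O(l^-i) with a constant
    depending on i. The vector w is allowed to depend on the tolerance, since eigenvectors are
    limits of smooth columns. *)
Lemma spectrum_approx i : exists T L : R, [/\ 0 < T, 1 <= L & forall l, L <= l ->
  (forall de, 0 < de -> exists w, [/\ Cinf X w, 2^-1 <= nrm w, nrm w <= 2 & nrm (A w - l%:K *: w) <= de]) ->
  exists J x, spectrum_pos X s (Aj X A P J) x /\ `|l - x| < T * l ^- i].
Proof.
have [n [J [B [U [U' [gJ bB sU sU' [EU EB]]]]]]] := Aj_family hM cM d0 psA saA HP M0 mp.
have /choice[b Hb] : forall k, exists t : R, 0 <= t /\ forall v, Cinf X v -> nrm (B k v) <= t * nrm v.
  by move=> k; have [_] := bB k.
have /choice[c Hc] : forall k, exists t : R, 0 <= t /\ forall (l : R) w, 1 <= l -> Cinf X w ->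
    l ^+ i * nrm (U k w) <= t * (nrm w + l ^+ i * nrm (A w - l%:K *: w)).
  by move=> k; exact: (smo_small hM cM LA (sU k) i).
have [c' [c'0 Hc']] := smo_small hM cM LA sU' 1.
pose G := \sum_k (b k + 3 * c k).
have b0 k : 0 <= b k by have [] := Hb k.
have c0 k : 0 <= c k by have [] := Hc k.
have G0 : 0 <= G by apply: sumr_ge0 => k _; rewrite addr_ge0// mulr_ge0.
have Gk k : b k + 3 * c k <= G.
  rewrite /G (bigD1 k)//= lerDl; apply: sumr_ge0 => j _; by rewrite addr_ge0// mulr_ge0.
pose N : R := n.+1%:R; have N0 : 0 < N by rewrite ltr0n.
(* As w has norm at least 1/2 and U' w at most 1/4, one of the N components exceeds 1 / (8 N): hence
   the factor 8 N. The threshold below ensures 12 c' <= l, used for U', and T <= l, which keeps the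
   interval positive. *)
pose T := 8 * N * (G + 1).
have T0 : 0 < T by rewrite !mulr_gt0// ltr_wpDl.
have e3 : 3 = 2 + 1 :> R by lra.
have aux1 (x y : R) : 0 <= x -> 0 <= y -> 1 <= 1 + 12 * x + y by lra.
have aux2 (x y z : R) : 0 <= x -> 0 <= y -> 1 + 12 * x + y <= z -> 12 * x <= z /\ y <= z by move=> *; split; lra.
exists T, (1 + 12 * c' + T); split => //; first exact: (aux1 _ _ c'0 (ltW T0)).
move=> l Ll Hw; have l1 : 1 <= l := le_trans (aux1 _ _ c'0 (ltW T0)) Ll.
have [lc lT] := aux2 _ _ _ c'0 (ltW T0) Ll.
have l0 : 0 < l := lt_le_trans ltr01 l1.
have li0 j : 0 < l ^+ j by exact: exprn_gt0.
have li1 j : 1 <= l ^+ j by exact: exprn_ege1.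
(* This tolerance makes both l^i and l times the defect at most 1. *)
have [w [Cw w1 w2 wd]] := Hw (l ^- i.+1) (ltac:(by rewrite invr_gt0)).
have di : l ^+ i * nrm (A w - l%:K *: w) <= 1.
  apply: le_trans (ler_wpM2l (ltW (li0 i)) wd) _.
  by rewrite ler_pdivrMr// mul1r exprS ler_peMl// ltW.
have d1 : l * nrm (A w - l%:K *: w) <= 1.
  apply: le_trans (ler_wpM2l (ltW l0) wd) _.
  by rewrite ler_pdivrMr// mul1r exprS ler_peMr// ltW.
have CA := lo_C LA Cw; have Cr : Cinf X (A w - l%:K *: w) := rsB rs CA (rsZ rs l Cw).
have CB k v : Cinf X v -> Cinf X (B k v) by have [LB _] := bB k; exact: (lo_C LB).
have CU k v : Cinf X v -> Cinf X (U k v) by have [LU _] := sU k; exact: (lo_C LU).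
have small' : nrm (U' w) <= 4^-1.
  have h3 : l * nrm (U' w) <= c' * 3.
    have := Hc' l w l1 Cw; rewrite !expr1 => /le_trans; apply; rewrite ler_wpM2l// e3; exact: (lerD w2 d1).
  have h4 : l * nrm (U' w) <= l * 4^-1.
    by apply: le_trans h3 _; rewrite ler_pdivlMr// (_ : c' * 3 * 4 = 12 * c')//; ring.
  by move: h4; rewrite ler_pM2l.
have big : 4^-1 <= \sum_k nrm (B k w).
  have h5 : nrm w <= \sum_k nrm (B k w) + nrm (U' w).
    have CS : Cinf X (\sum_k B k w) by apply: Cinf_sum => k _; exact: CB.
    have CU' : Cinf X (U' w) by have [LU _] := sU'; exact: (lo_C LU).
    rewrite {1}(EB w Cw); apply: le_trans (snormB rs si CS CU') _; rewrite lerD2r.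
    exact: (snorm_sum rs si _ (fun k => CB k w Cw)).
  have aux (x y z : R) : 2^-1 <= x -> x <= y + z -> z <= 4^-1 -> 4^-1 <= y by lra.
  exact: aux w1 h5 small'.
have [[k hk]|nk] := pselect (exists k, (8 * N)^-1 < nrm (B k w)); last first.
  exfalso; have h6 : \sum_k nrm (B k w) <= \sum_(k < n.+1) (8 * N)^-1.
    by apply: ler_sum => k _; rewrite leNgt; apply/negP => hk; apply: nk; exists k.
  have e8 : \sum_(k < n.+1) (8 * N)^-1 = 8^-1.
    by rewrite sumr_const card_ord -(mulr_natl (_^-1)) -/N invfM mulrCA divff ?mulr1// gt_eqF.
  by have := le_trans big h6; rewrite e8 lef_pV2 ?posrE// ler_nat.
exists (J k); apply: (spectrum_near hM cM s0 (sym_Aj hM cM d0 psA saA HP (gJ k)) _ _ (CB k w Cw)).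
- by rewrite mulr_gt0// invr_gt0.
- by apply: le_trans _ lT; rewrite ler_piMr ?(ltW T0)// invf_le1.
rewrite (EU k w Cw).
have -> : B k (A w) + U k w - l%:K *: B k w = B k (A w - l%:K *: w) + U k w.
  by have [LB _] := bB k; rewrite (loB LB CA (rsZ rs l Cw)) (loZ _ LB Cw) addrAC.
apply: le_lt_trans (snormD rs si (CB k _ Cr) (CU k w Cw)) _.
apply: (@le_lt_trans _ _ (G * l ^- i)).
  rewrite ler_pdivlMr// mulrDl; apply: le_trans _ (Gk k); apply: lerD.
    have [_ Hk] := Hb k; rewrite mulrC; apply: le_trans (ler_wpM2l (ltW (li0 i)) (Hk _ Cr)) _.
    by rewrite mulrCA -[leRHS]mulr1 ler_wpM2l.
  have [_ Hk] := Hc k; rewrite mulrC; apply: le_trans (Hk l w l1 Cw) _; rewrite [3 * _]mulrC ler_wpM2l// e3; exact: (lerD w2 di).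
apply: (@lt_le_trans _ _ ((G + 1) * l ^- i)); first by rewrite ltr_pM2r ?invr_gt0// ltrDl.
have -> : T * l ^- i * nrm (B k w) = (G + 1) * l ^- i * (8 * N * nrm (B k w)).
  by rewrite /T; move: (l ^- i) (nrm _) => x y; ring.
rewrite ler_peMr//; first by rewrite mulr_ge0 ?invr_ge0 ?(ltW (li0 i))// addr_ge0.
by rewrite -ler_pdivrMl ?mulr_gt0// mulr1 ltW.
Qed.

Lemma norm_near1 w e : Cinf X w -> `|rin w w - 1| <= e -> e <= 2^-1 -> 2^-1 <= nrm w /\ nrm w <= 2.
Proof.
move=> Cw h1 h2; have := le_trans h1 h2; rewrite -(sqr_snorm si Cw) ler_distl => /andP[].
move: (snorm_ge0 rin w); move: (nrm w) => x x0 h3 h4; split; rewrite leNgt; apply/negP => h5; nra.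
Qed.

End Distance.

(** * The distance estimate *)

Lemma edist_inf_le (R : realType) (S : set R) (x y e : R) : S y -> 0 < e -> `|x - y| < e ->
  (edist_inf S x <= e%:E)%E.
Proof.
move=> Sy e0 xy; apply: ge_ereal_inf; exists (edist (x, y)); first by exists y.
by apply: edist_fin => //; exact: xy.
Qed.

(* lam k is the eigenvalue lambda_(k+1) *)
Theorem theorem2p2 (R : realType) (d : nat) (M : topologicalType)
    (X : smooth_structure R d M) (mneg mpos : nat) (s : R)
    (A : op R d M (mneg + mpos)) (p : symb R d M (mneg + mpos))
    (h : 'I_(mneg + mpos) -> chart R d M -> 'rV[R]_d -> 'rV[R]_d -> R)
    (P : 'I_(mneg + mpos) -> op R d M (mneg + mpos)) (lam : nat -> R) :
  closed_connected M -> (2 <= d)%N -> 0 < s ->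
  psido_prin X s A p -> elliptic X p -> self_adjoint X A ->
  simple_eigenvalues X p h -> (2 <= mpos)%N ->
  psido_projections X A p h P ->
  positive_eigenvalues X s A lam ->
  forall N : nat, exists c : R, \forall k \near \oo,
    (edist_inf (\bigcup_(j in [set: 'I_mpos]) spectrum_pos X s (Aj X A P j))
       (lam k) <= (c * k.+1%:R ^- N)%:E)%E.
Proof.
move=> [M0 hM cM _] d2 s0 psA _ saA _ mp2 HP Hlam N.
have d0 : (0 < d)%N := ltnW d2; have mp : (0 < mpos)%N := ltnW mp2.
have [lp lh _] := Hlam.
have SAA := SA psA saA.
have rs := Cinf_subspace X (mneg + mpos); have si := @rin_semi_inner R d M X (mneg + mpos) hM cM.
have [[J HJ]|W] := Hs_dichotomy hM cM d0 (ltW s0) psA saA HP M0 mp.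
  exists 0; near=> k; rewrite mul0r; apply: ge_ereal_inf.
  exists (edist (lam k, lam k)); last by rewrite edist_refl.
  by exists (lam k) => //; exists J => //; exact: HJ.
have [K [q [K0 HK]]] := weyl_bound hM cM s0 W.
(* The Weyl bound gives k + 1 <= K1 lam_k^q, so the power q N of 1/lam_k yields the power N of 1/(k
   + 1). *)
have [T [L [T0 L1 HT]]] := spectrum_approx hM cM d0 (ltW s0) psA saA HP M0 mp (q * N).
(* The k + 1 vectors belong to [lam 0], ..., [lam k], the last one, at [ord_max], to [lam k]. The
   tolerance 1 / (2 (k + 1)) is the one that Bessel's inequality requires. *)
have app k de : 0 < de -> exists e : 'I_k.+1 -> hdens R d M (mneg + mpos), [/\ forall i, Cinf X (e i),
    forall i j, `|rin X (e i) (e j) - (i == j)%:R| <= (2 * k.+1%:R)^-1,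
    forall i, 2^-1 <= snorm (@rin R d M X (mneg + mpos)) (e i) /\ snorm (@rin R d M X (mneg + mpos)) (e i) <= 2 &
    forall i, snorm (@rin R d M X (mneg + mpos)) (A (e i) - ((lam i)%:C)%C *: e i) <= de].
  move=> de0; pose ep := Num.min de (2 * k.+1%:R)^-1.
  have k2 : 0 < (2 * k.+1%:R)^-1 :> R by rewrite invr_gt0 mulr_gt0.
  have e0 : 0 < ep by rewrite lt_min de0 k2.
  have [e [Ce [He Ae]]] := eigen_approx hM cM (ltW s0) SAA W Hlam k.+1 e0.
  have epk : ep <= (2 * k.+1%:R)^-1 by rewrite ge_min lexx orbT.
  have ep2 : ep <= 2^-1.
    apply: le_trans epk _; rewrite lef_pV2 ?posrE ?mulr_gt0//.
    by rewrite ler_peMr// ler1n.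
  exists e; split => // [i j|i|i]; first exact: le_trans (He i j) epk.
    by apply: (norm_near1 hM cM (Ce i) _ ep2); have := He i i; rewrite eqxx.
  by apply: le_trans (Ae i) _; rewrite ge_min lexx.
(* The vectors have norm at most 2 and defect at most 1, so that A e_i has norm at most 2 lam_k + 1
   for all i <= k. *)
have weyl k : k.+1%:R <= K * (2 * lam k + 3) ^+ q.
  have [e [Ce He Ne Ae]] := app k 1 ltr01.
  have -> : 2 * lam k + 3 = (2 * lam k + 1) + 2 :> R by ring.
  apply: (HK _ _ e) => //; first by rewrite addr_ge0// mulr_ge0// ltW.
  move=> i; have CA := so_C SAA (Ce i); have CZ := rsZ rs (lam i) (Ce i).
  apply: le_trans (snorm_le_dist rs si CA CZ) _; rewrite addrC; apply: lerD; last exact: Ae.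
  rewrite (snormZ rs si (lam i) (Ce i)) gtr0_norm// mulrC.
  have [_ n2] := Ne i; apply: ler_pM; rewrite ?snorm_ge0 ?(ltW (lp _))//.
  by apply: lh; rewrite -ltnS.
pose K1 := K * 5 ^+ q + 1.
have K10 : 0 < K1 by rewrite ltr_wpDl// mulr_ge0// exprn_ge0.
(* Beyond this index the Weyl bound forces [lam k] to be at least L. *)
exists (T * K1 ^+ N); exists (Num.bound (K * (2 * L + 3) ^+ q)) => // k /= hk.
have L0 : 0 <= L := le_trans ler01 L1.
have Lk : L <= lam k.
  rewrite leNgt; apply/negP => lt.
  have b0 : 0 <= K * (2 * L + 3) ^+ q by rewrite mulr_ge0// exprn_ge0// addr_ge0// mulr_ge0.
  have h1 : K * (2 * L + 3) ^+ q < k.+1%:R.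
    by apply: lt_le_trans (archi_boundP b0) _; rewrite ler_nat ltnW.
  have := lt_le_trans h1 (weyl k); rewrite ltNge => /negP; apply.
  rewrite ler_wpM2l//; apply: lerXn2r; rewrite ?nnegrE ?addr_ge0 ?mulr_ge0 ?(ltW (lp k))//.
  by rewrite lerD2r ler_wpM2l// ltW.
have l1 : 1 <= lam k := le_trans L1 Lk.
have [J [x [Sx hx]]] : exists J x, spectrum_pos X s (Aj X A P J) x /\ `|lam k - x| < T * lam k ^- (q * N).
  apply: HT => // de de0; have [e [Ce He Ne Ae]] := app k de de0.
  have [n1 n2] := Ne ord_max.
  by exists (e ord_max); split => //; exact: (Ae ord_max).
have lq : k.+1%:R <= K1 * lam k ^+ q.
  apply: le_trans (weyl k) _.
  apply: (@le_trans _ _ (K * (5 * lam k) ^+ q)).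
    rewrite ler_wpM2l//; apply: lerXn2r; rewrite ?nnegrE ?addr_ge0 ?mulr_ge0 ?(ltW (lp k))//.
    by move: l1; move: (lam k) => z; lra.
  by rewrite exprMn mulrA ler_wpM2r ?exprn_ge0 ?(ltW (lp k))// /K1 lerDl.
have kN : k.+1%:R ^+ N <= K1 ^+ N * lam k ^+ (q * N).
  rewrite exprM -exprMn; apply: lerXn2r; rewrite ?nnegrE// mulr_ge0 ?exprn_ge0 ?(ltW K10) ?(ltW (lp k))//.
have k0 : 0 < k.+1%:R :> R by rewrite ltr0n.
apply: (@edist_inf_le _ _ _ x); first by exists J.
  by rewrite !mulr_gt0 ?invr_gt0 ?exprn_gt0.
apply: lt_le_trans hx _; rewrite -mulrA ler_wpM2l ?(ltW T0)//.
by rewrite ler_pdivlMr ?exprn_gt0// mulrC ler_pdivrMr ?exprn_gt0// mulrC.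
Unshelve. all: by end_near. Qed.
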